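(* Let $n\ge1$, $\alpha\in(\frac{n-1}{n},1]$, $C_\alpha\ge0$, $\delta>0$, and let $N\ge1$ be an integer. There is a constant $C_N$, depending only on $n$, $\delta$, $\alpha$, $C_\alpha$ and $N$, such that the following holds. Let $\Omega\subset\mathbb{R}^n$ be a bounded domain, $a:\Omega\to(0,+\infty)$ a Borel function, and let $G:\mathcal{F}_w(\Omega)\to\mathbb{R}$ satisfy $$|G(\mathbf{W})-G(\mathbf{W}')|\le C_\alpha\,\mathrm{dist}(\mathbf{W},\mathbf{W}')^\alpha\quad\text{for }\mathbf{W},\mathbf{W}'\in\mathcal{F}_w(\Omega).$$ If $\Omega'\subset\Omega$ is open, $\delta\le a(x)\le1$ for $x\in\Omega'$, and $\mathbf{W}=(W_1,\dots,W_N)\in\mathcal{F}_w(\Omega)$ minimizes $J_w=F_w+G$ in the class $\mathcal{F}_w(\Omega)$, then for $1\le i\le N$, every $x\in\Omega'\cap\partial^*W_i$ and every $r$ with $0<r\le\min(1,\mathrm{dist}(x,\partial\Omega'))$, $$C_N^{-1}r^{n-1}\le\mathcal{H}^{n-1}(\partial^*W_i\cap B(x,r)).$$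
   Context: Throughout, $|A|$ is Lebesgue measure on $\mathbb{R}^n$, $\mathcal{H}^{n-1}$ is $(n-1)$-dimensional Hausdorff measure, and $B(x,r)$ is the open ball. A Borel set $W\subset\Omega$ has locally finite perimeter in $\Omega$ if the distributional gradient $\nabla\mathbf{1}_W$ of its characteristic function is a locally finite vector-valued measure on $\Omega$; its total variation measure is denoted $\mu_W=|D\mathbf{1}_W|$. The (De Giorgi) reduced boundary of $W$ in $\Omega$ is denoted $\partial^*W\subset\Omega$ (nothing on $\partial\Omega$ is counted). $\mathcal{F}_w=\mathcal{F}_w(\Omega)$ is the set of $N$-tuples $\mathbf{W}=(W_1,\dots,W_N)$ of Borel subsets of $\Omega$ of locally finite perimeter in $\Omega$ such that $\sum_{i=1}^N\mathbf{1}_{W_i}=\mathbf{1}_\Omega$ almost everywhere; two $N$-tuples are identified if their components agree up to Lebesgue-null sets. Some $W_i$ may be empty. $\mathrm{dist}(\mathbf{W},\mathbf{W}')=\sum_{i=1}^N|W_i\triangle W_i'|$, where $A\triangle B=(A\setminus B)\cup(B\setminus A)$. $F_w(\mathbf{W})=\sum_{i=1}^N\int_\Omega a(x)\,d\mu_{W_i}(x)\in[0,+\infty]$, and $J_w(\mathbf{W})=F_w(\mathbf{W})+G(\mathbf{W})$. ''$\mathbf{W}$ minimizes $J_w$ in $\mathcal{F}_w(\Omega)$'' means $J_w(\mathbf{W})\le J_w(\mathbf{W}')$ for all $\mathbf{W}'\in\mathcal{F}_w(\Omega)$. *)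

(* Defs.v *)
From HB Require Import structures.
From mathcomp Require Import all_boot all_order all_algebra.
From mathcomp Require Import all_classical all_reals all_analysis.
From mathcomp Require Import measurable_realfun.
Set Implicit Arguments.
Unset Strict Implicit.
Unset Printing Implicit Defensive.
Import Order.TTheory GRing.Theory Num.Theory.
Import numFieldNormedType.Exports.
Local Open Scope classical_set_scope.
Local Open Scope ring_scope.

HB.instance Definition _ (R : realType) m n :=
  @isMeasurable.Build (sigma_display (@open 'M[R]_(m, n))) 'M[R]_(m, n)
    <<s @open 'M[R]_(m, n) >> (@sigma_algebra0 _ setT _)
    (@sigma_algebraC _ _) (@sigma_algebra_bigcup _ setT _).

Section lebesgue_measure_rV.
Variable R : realType.

Lemma open_measurable_rV n (U : set 'rV[R]_n) : open U -> measurable U.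
Proof. by move=> oU; apply: sub_sigma_algebra. Qed.

Definition cons_rV n (p : (measurableTypeR R * 'rV[R]_n)%type) : 'rV[R]_n.+1 :=
  row_mx (p.1%:M : 'M[R]_1) p.2.

Definition tail_rV n (v : 'rV[R]_n.+1) : 'rV[R]_n := rsubmx (v : 'rV[R]_(1 + n)).

Lemma dense_rat_ball (x e : R) : 0 < e -> exists q : rat, ball x e (ratr q).
Proof.
move=> e0.
have [|y [xy [q _ qy]]] := dense_rat _ (ball_open x e).
  by exists x; exact: ballxx e0.
by exists q; rewrite qy.
Qed.

Lemma ball_cons n (p q : (measurableTypeR R * 'rV[R]_n)%type) (e : R) :
  ball (p.1 : R) e q.1 -> ball p.2 e q.2 -> ball (cons_rV p) e (cons_rV q).
Proof.
move=> h1 [e0 h2]; split=> // i j.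
rewrite /cons_rV !mxE; case: splitP => k _; rewrite ?mxE ?ord1 //=.
Qed.

Lemma measurable_cons_rV n : measurable_fun [set: _] (@cons_rV n).
Proof.
apply: measurability => [|_ [U oU <-]]; first by [].
rewrite setTI.
pose box (t : rat * 'rV[rat]_n * rat) : set (measurableTypeR R * 'rV[R]_n)%type :=
  ball (ratr t.1.1 : R) (ratr t.2) `*` ball (map_mx ratr t.1.2 : 'rV[R]_n) (ratr t.2).
have mbox t : measurable (box t).
  apply: measurableX; first by apply: open_measurable; exact: ball_open.
  by apply: open_measurable_rV; exact: ball_open.
suff -> : @cons_rV n @^-1` U =
    \bigcup_(t in [set t | box t `<=` @cons_rV n @^-1` U]) box t.
  rewrite bigcup_mkcond; apply: countable_bigcupT_measurable => // t.
  by case: ifP.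
apply/seteqP; split => [p Up|p [t + ?]]; last exact.
have /nbhs_ballP[e /= e0 eU] := open_nbhs_nbhs (conj oU Up : open_nbhs _ _).
have [r /itvP re] : exists r : rat, (ratr r : R) \in `]0, e / 2[.
  by have [r rP] := rat_in_itvoo (divr_gt0 e0 (ltr0n R 2)); exists r.
have r0 : 0 < ratr r :> R by rewrite re.
have rre : ratr r + ratr r <= e :> R by rewrite [leRHS]splitr lerD// ltW// re.
have [q xq] := dense_rat_ball (p.1 : R) r0.
have [w pw] : exists w : 'rV[rat]_n, ball p.2 (ratr r) (map_mx ratr w).
  have /choice[f fP] := fun j => dense_rat_ball (p.2 ord0 j) r0.
  by exists (\row_j f j); split => // i j; rewrite !mxE ord1; exact: fP.
exists (q, w, r); last by split; exact: ball_sym.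
move=> p' [/= h1 h2]; apply: eU; apply: ball_cons.
  by apply: le_ball rre _ _; exact: ball_triangle xq h1.
by apply: le_ball rre _ _; exact: ball_triangle pw h2.
Qed.

Lemma measurable_coord_rV n (i : 'I_n) :
  measurable_fun [set: 'rV[R]_n] (fun v => v ord0 i : measurableTypeR R).
Proof.
apply: (measurability _ (RGenOpens.measurableE R)) => // _ [_ [a [b ->] <-]].
rewrite setTI; apply: open_measurable_rV; apply: open_comp; last first.
  exact: interval_open.
by move=> x _; exact: coord_continuous.
Qed.

Lemma measurable_tail_rV n : measurable_fun [set: 'rV[R]_n.+1] (@tail_rV n).
Proof.
apply: measurability => [|_ [U oU <-]]; first by [].
rewrite setTI; apply: open_measurable_rV.
move: U oU; apply/continuousP => x U /nbhs_ballP[e e0 eU].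
apply/nbhs_ballP; exists e => // y [_ xy]; apply: eU; split => // i j.
by rewrite !mxE; exact: xy.
Qed.

Definition leb_cons n (mu : {sigma_finite_measure set 'rV[R]_n -> \bar R})
    : set 'rV[R]_n.+1 -> \bar R :=
  pushforward (lebesgue_measure \x mu)%E (@cons_rV n).

Section leb_cons.
Variables (n : nat) (mu : {sigma_finite_measure set 'rV[R]_n -> \bar R}).

Let leb_cons0 : leb_cons mu set0 = 0%E.
Proof. by rewrite /leb_cons /pushforward preimage_set0 measure0. Qed.

Let leb_cons_ge0 A : (0 <= leb_cons mu A)%E.
Proof. by rewrite /leb_cons /pushforward measure_ge0. Qed.

Let leb_cons_sigma_additive : semi_sigma_additive (leb_cons mu).
Proof.
rewrite /leb_cons; apply: measure_semi_sigma_additive.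
exact: measurable_cons_rV.
Qed.

HB.instance Definition _ := isMeasure.Build _ _ _ (leb_cons mu)
  leb_cons0 leb_cons_ge0 leb_cons_sigma_additive.

Let leb_cons_sigma_finite : sigma_finite setT (leb_cons mu).
Proof.
have /sigma_finiteP[F [TF ndF Foo]] := sigma_finiteT (@lebesgue_measure R).
have /sigma_finiteP[G [TG ndG Goo]] := sigma_finiteT mu.
exists (fun k => [set v : 'rV[R]_n.+1 | F k (v ord0 ord0) /\ G k (tail_rV v)]).
  rewrite predeqE => v; split=> // _.
  have [i _ Fi] : (\bigcup_i F i) (v ord0 ord0) by rewrite -TF.
  have [j _ Gj] : (\bigcup_i G i) (tail_rV v) by rewrite -TG.
  exists (maxn i j) => //; split.
  - by move: Fi; exact/subsetPset/ndF/leq_maxl.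
  - by move: Gj; exact/subsetPset/ndG/leq_maxr.
move=> k; have [mF Fk] := Foo k; have [mG Gk] := Goo k; split.
  apply: measurableI.
    by rewrite -[X in measurable X]setTI; exact: measurable_coord_rV.
  by rewrite -[X in measurable X]setTI; exact: measurable_tail_rV.
rewrite /leb_cons /pushforward.
rewrite (_ : _ @^-1` _ = F k `*` G k); last first.
  apply/seteqP; split=> -[x v] /=; rewrite /tail_rV /cons_rV row_mxKr !mxE;
    by case: splitP => // j _; rewrite mxE (ord1 j).
by rewrite product_measure1E// lte_mul_pinfty// ge0_fin_numE.
Qed.

HB.instance Definition _ := Measure_isSigmaFinite.Build _ _ _ (leb_cons mu)
  leb_cons_sigma_finite.

End leb_cons.

(* n-dimensional Lebesgue measure on the Borel sets, as an iterated product of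
   the one-dimensional one; on R^0 it is the unit mass at the only point. *)
Fixpoint leb n : {sigma_finite_measure set 'rV[R]_n -> \bar R} :=
  match n with
  | 0 => \d_(0 : 'rV[R]_0)
  | k.+1 => leb_cons (leb k)
  end.

Lemma cons_rV0 n (p : (measurableTypeR R * 'rV[R]_n)%type) :
  cons_rV p ord0 ord0 = p.1.
Proof. by rewrite mxE; case: splitP => // j _; rewrite mxE (ord1 j). Qed.

Lemma cons_rVS n (p : (measurableTypeR R * 'rV[R]_n)%type) (i : 'I_n) :
  cons_rV p ord0 (lift ord0 i) = p.2 ord0 i.
Proof.
rewrite mxE; case: splitP => j /=; first by rewrite (ord1 j).
by rewrite /bump /= !add1n => -[] /val_inj ->.
Qed.

Lemma tail_rVE n (v : 'rV[R]_n.+1) (i : 'I_n) :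
  tail_rV v ord0 i = v ord0 (lift ord0 i).
Proof. by rewrite mxE; congr (v _ _); exact/val_inj. Qed.

Lemma lebS n (A : set 'rV[R]_n.+1) :
  leb n.+1 A = (lebesgue_measure \x leb n)%E (@cons_rV n @^-1` A).
Proof. by []. Qed.

Lemma leb_box n (a b : 'rV[R]_n) : (forall i, a ord0 i <= b ord0 i) ->
  leb n [set v : 'rV[R]_n | forall i, a ord0 i <= v ord0 i <= b ord0 i] =
  (\prod_(i < n) (b ord0 i - a ord0 i))%:E.
Proof.
elim: n => [|n IHn] in a b *; move=> ab.
  rewrite big_ord0 /= diracE mem_set//; by case.
pose I : set (measurableTypeR R) := `[a ord0 ord0, b ord0 ord0]%classic.
pose B := [set v : 'rV[R]_n | forall i, tail_rV a ord0 i <= v ord0 i <= tail_rV b ord0 i].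
rewrite lebS (_ : _ @^-1` _ = I `*` B); last first.
  apply/seteqP; split=> -[x v]; rewrite /I /B /= in_itv /=.
    move=> abv; split; first by have := abv ord0; rewrite cons_rV0.
    by move=> i; have := abv (lift ord0 i); rewrite cons_rVS !tail_rVE.
  move=> [xab vab] i; have [j ->|->] := unliftP ord0 i.
    by rewrite cons_rVS -!tail_rVE.
  by rewrite cons_rV0.
have mB : measurable B.
  rewrite (_ : B = \bigcap_(i in [set: 'I_n])
    (fun v : 'rV[R]_n => v ord0 i : measurableTypeR R) @^-1`
    `[tail_rV a ord0 i, tail_rV b ord0 i]%classic).
    apply: fin_bigcap_measurable => // i _.
    by rewrite -[X in measurable X]setTI; exact: measurable_coord_rV.
  apply/seteqP; split=> v /= vB i; have := vB i; rewrite /= in_itv//=; exact.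
rewrite product_measure1E//; last exact: measurable_itv.
rewrite /B IHn; last by move=> i; rewrite !tail_rVE.
rewrite [X in (X * _)%E]lebesgue_measure_itv /= lte_fin.
rewrite big_ord_recl EFinM; congr (_ * _)%E.
  case: ltP => // ba; rewrite (_ : b _ _ = a ord0 ord0) ?subrr//.
  by apply/eqP; rewrite eq_le ba ab.
by under eq_bigr do rewrite !tail_rVE.
Qed.
End lebesgue_measure_rV.

Section euclidean.
Variables (R : realType) (n : nat).
Implicit Types (x y : 'rV[R]_n) (A : set 'rV[R]_n).

(* The library norm and balls on 'rV[R]_n are those of the sup norm. *)
Definition enorm x : R := Num.sqrt (\sum_i x ord0 i ^+ 2).

Definition eball x (r : R) : set 'rV[R]_n := [set y | enorm (y - x) < r].

Definition edist_to x A : \bar R := ereal_inf [set (enorm (x - y))%:E | y in A].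

Definition ediam A : \bar R :=
  ereal_sup [set (enorm (p.1 - p.2))%:E | p in A `*` A].

Definition boundary A : set 'rV[R]_n := closure A `\` interior A.

End euclidean.

Section hausdorff_measure.
Variables (R : realType) (n m : nat).
Implicit Types A C : set 'rV[R]_n.
Local Open Scope ereal_scope.

(* omega_m (diam C / 2)^m, where omega_m is the volume of the unit ball of R^m;
   since x ^+ 0 = 1, the empty set has to be treated apart. *)
Definition hausdorff_gauge C : \bar R :=
  if `[< C = set0 >] then 0
  else leb R m (eball 0%R 1%R) * (ediam C * 2^-1%:E) ^+ m.

Definition hausdorff_size (eps : R) A : \bar R :=
  ereal_inf [set \sum_(k <oo) hausdorff_gauge (C k) | C in
    [set C : (set 'rV[R]_n)^nat |
      A `<=` \bigcup_k C k /\ forall k, ediam (C k) <= eps%:E]].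

Definition hausdorff A : \bar R :=
  ereal_sup [set hausdorff_size eps A | eps in [set eps : R | (0 < eps)%R]].

End hausdorff_measure.

Section perimeter.
Variables (R : realType) (n : nat).
Local Notation E := 'rV[R]_n.
Implicit Types (Omega W A : set E).

Definition partial (i : 'I_n) (phi : E -> R) : E -> R :=
  fun x => 'D_(delta_mx ord0 i) phi x.

Definition smooth (phi : E -> R) :=
  forall (s : seq 'I_n) (x : E), differentiable (foldr partial phi s) x.

Definition test_function Omega (phi : E -> R) := smooth phi /\
  exists K, [/\ compact K, K `<=` Omega & forall x, ~ K x -> phi x = 0].

(* A locally finite vector-valued measure on an open set Omega: its i-th
   component is the difference (D i).1 - (D i).2 of two measures that are finite
   on the compact subsets of Omega, so that the difference makes sense on
   relatively compact Borel subsets of Omega. *)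
Definition vmeasure :=
  ('I_n -> {measure set E -> \bar R} * {measure set E -> \bar R})%type.

Implicit Types D : vmeasure.

Definition locally_finite Omega D := forall i K, compact K -> K `<=` Omega ->
  ((D i).1 K < +oo /\ (D i).2 K < +oo)%E.

Definition vvalue D A : E := \row_i (fine ((D i).1 A) - fine ((D i).2 A)).

Definition vintegral Omega D (i : 'I_n) (phi : E -> R) : \bar R :=
  (\int[(D i).1]_(x in Omega) (phi x)%:E -
   \int[(D i).2]_(x in Omega) (phi x)%:E)%E.

Definition relatively_compact Omega A :=
  exists K, [/\ compact K, K `<=` Omega & A `<=` K].

(* Disjoint subfamilies give the same supremum as countable partitions of the
   part of A inside Omega, and keep the value nonnegative on every set. *)
Definition total_variation Omega D A : \bar R :=
  ereal_sup [set (\sum_(k <oo) (enorm (vvalue D (B k)))%:E)%E | B in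
    [set B : (set E)^nat | [/\ forall k, measurable (B k),
       forall k, relatively_compact Omega (B k),
       trivIset setT B & \bigcup_k B k `<=` A]]].

(* D is the distributional gradient of the characteristic function of W. *)
Definition is_gradient Omega W D := locally_finite Omega D /\
  forall i phi, test_function Omega phi ->
    (\int[leb R n]_(x in W) (partial i phi x)%:E = - vintegral Omega D i phi)%E.

Definition locally_finite_perimeter Omega W := exists D, is_gradient Omega W D.

(* The gradient measure is unique on relatively compact Borel subsets of Omega,
   so the choice below is immaterial; it is 0 if there is none. *)
Definition gradient Omega W : vmeasure :=
  match pselect (locally_finite_perimeter Omega W) with
  | left h => projT1 (cid h)
  | right _ => fun=> (mzero : {measure set E -> \bar R},
                      mzero : {measure set E -> \bar R})
  end.

Definition perimeter Omega W : set E -> \bar R :=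
  total_variation Omega (gradient Omega W).

Definition reduced_boundary Omega W : set E :=
  [set x | [/\ Omega x,
    forall r : R, 0 < r -> (0 < perimeter Omega W (eball x r))%E &
    exists2 nu : E, enorm nu = 1 &
      (fun r : R => (fine (perimeter Omega W (eball x r)))^-1 *:
        vvalue (gradient Omega W) (eball x r)) @ 0^'+ --> nu]].

End perimeter.

Section functional.
Variables (R : realType) (n N : nat).
Local Notation E := 'rV[R]_n.
Implicit Types (Omega : set E) (W : 'I_N -> set E).

Definition Fw Omega W := (forall i, [/\ measurable (W i), W i `<=` Omega &
    locally_finite_perimeter Omega (W i)]) /\
  {ae leb R n, forall x, \sum_i \1_(W i) x = \1_Omega x :> R}.

Definition distw W W' : \bar R := (\sum_i leb R n (W i `+` W' i))%E.

Definition energy Omega (a : E -> R) W : \bar R :=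
  (\sum_i \int[perimeter Omega (W i)]_(x in Omega) (a x)%:E)%E.

Definition Jw Omega a (G : ('I_N -> set E) -> R) W : \bar R :=
  (energy Omega a W + (G W)%:E)%E.

Definition minimizes_Jw Omega a G W := Fw Omega W /\
  forall W', Fw Omega W' -> (Jw Omega a G W <= Jw Omega a G W')%E.

End functional.

(* Main.v *)
(* The regularity comes from comparison only. Cutting all phases along the faces
   of a cube q of half side s at which they have Lebesgue slices, one may give
   W_i inside q to another phase j, or give everything inside q to W_i. The cut
   creates perimeter at most the area t(s) of the slices on the faces, and G
   changes by at most C m(s)^alpha, where m(s) is the transferred volume. Since the
   gradients of the phases add up to 0, at each point some other phase has a
   gradient partly opposite to that of W_i; summing over j the first competitors
   bound the perimeter of W_i in q by C (t(s) + m(s)^alpha), and the second one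
   gives the same bound with the complement of W_i, hence also the upper bound
   C s^(n-1).

   As t(s) is controlled by m'(s) and the perimeter in q controls m(s) by the
   Poincare inequality on small tiles of q, a small density m(rho) / rho^n forces,
   thanks to alpha > (n-1)/n, m to vanish near the center. So on the support of the
   perimeter both W_i and its complement have positive density in every small
   cube, and the perimeter measure is comparable to s^(n-1) there. With this
   doubling property a Vitali covering argument shows that almost every point for
   the perimeter measure is a Lebesgue point of its direction, hence belongs to the
   reduced boundary, and the upper bound gives the Hausdorff estimate by the mass
   distribution principle. *)

From HB Require Import structures.
Require Import Defs.
From mathcomp Require Import all_boot all_order all_algebra.
From mathcomp Require Import all_classical all_reals all_analysis.
From mathcomp Require Import measurable_realfun.
From mathcomp Require Import ring lra.
Import Order.TTheory GRing.Theory Num.Theory.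
Import numFieldNormedType.Exports.
Local Open Scope classical_set_scope.
Local Open Scope ring_scope.
Set Implicit Arguments.
Unset Strict Implicit.
Unset Printing Implicit Defensive.

(** * Measures and boxes *)

(** The data are weak: a set is known only through a gradient made of pairs of measures finite on
    compact sets, and the perimeter is a supremum over partitions. Two devices make this tractable.
    Faces are put at heights that are one-sided Lebesgue points for the slices over the countably
    many rational boxes; such heights then serve every box and every test function, so the gradient
    of a set cut by a cube is explicit. And all gradients receive densities with respect to one
    common measure, so that the relation between the phases becomes an inequality between $N$
    vectors of sum 0 at a point, which can be multiplied by the weight [a] and integrated. Cubes
    replace balls because their faces are coordinate slices; the Poincare inequality on them comes
    from Fubini and the divergence identity on slabs. The exponent enters by scaling: at scale $z$
    the penalty of $G$ is $z^{n\alpha}=z^{n-1}z^{\beta}$ with $\beta=n\alpha-(n-1)>0$, which is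
    small against the perimeter scale $z^{n-1}$. All constants are fixed before any set is
    introduced, hence the uniformity in $\Omega$, $a$ and $G$. *)

Section measure_of.
Context d (T : measurableType d) (R : realType).
Variable mu : set T -> \bar R.

(* The phantom arguments let HB attach a measure structure to a bare set
   function. *)
Definition measure_of (mu0 : mu set0 = 0%E) (mu_ge0 : forall A, (0 <= mu A)%E)
  (mu_add : semi_sigma_additive mu) := mu.

Variables (mu0 : mu set0 = 0%E) (mu_ge0 : forall A, (0 <= mu A)%E)
  (mu_add : semi_sigma_additive mu).

HB.instance Definition _ := isMeasure.Build _ _ _
  (measure_of mu0 mu_ge0 mu_add) mu0 mu_ge0 mu_add.

End measure_of.

Section push_measure.
Context d d' (T : measurableType d) (T' : measurableType d') (R : realType).
Variables (m : {measure set T -> \bar R}) (f : T -> T').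
Hypothesis mf : measurable_fun [set: T] f.

Let push0 : pushforward m f set0 = 0%E.
Proof. by rewrite /pushforward preimage_set0 measure0. Qed.

Let push_ge0 A : (0 <= pushforward m f A)%E.
Proof. by rewrite /pushforward measure_ge0. Qed.

Let push_add : semi_sigma_additive (pushforward m f).
Proof.
move=> F mF tF mUF; rewrite /pushforward preimage_bigcup.
apply: measure_semi_sigma_additive.
- by move=> n; rewrite -[X in measurable X]setTI; exact: mf.
- apply/trivIsetP => /= i j _ _ ij; rewrite -preimage_setI.
  by move/trivIsetP : tF => /(_ _ _ _ _ ij) ->//; rewrite preimage_set0.
- by rewrite -preimage_bigcup -[X in measurable X]setTI; exact: mf.
Qed.

Definition push_measure : {measure set T' -> \bar R} :=
  measure_of push0 push_ge0 push_add.

Lemma push_measureE A : push_measure A = m (f @^-1` A).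
Proof. by []. Qed.

End push_measure.

Section boxes.
Variable R : realType.

(** Half-open, so that boxes tile, intersect in boxes, and share no face. *)
Definition hbox n (a b : 'rV[R]_n) : set 'rV[R]_n :=
  [set v | forall i, a ord0 i < v ord0 i <= b ord0 i].

(** Countably many of them generate the Borel sets, so that an almost-everywhere statement about
    each one holds for all of them at once. *)
Definition qbox n (p : 'rV[rat]_n * 'rV[rat]_n) : set 'rV[R]_n :=
  hbox (map_mx ratr p.1) (map_mx ratr p.2).

Lemma measurable_hbox n (a b : 'rV[R]_n) : measurable (hbox a b).
Proof.
rewrite (_ : hbox a b = \bigcap_(i in [set: 'I_n])
  (fun v : 'rV[R]_n => v ord0 i : measurableTypeR R) @^-1`
  `]a ord0 i, b ord0 i]%classic).
  apply: fin_bigcap_measurable => // i _.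
  by rewrite -[X in measurable X]setTI; exact: measurable_coord_rV.
by apply/seteqP; split=> v /= vB i; have := vB i; rewrite /= in_itv//=; exact.
Qed.

Lemma hboxI n (a b c d : 'rV[R]_n) : hbox a b `&` hbox c d =
  hbox (\row_i Num.max (a ord0 i) (c ord0 i))
       (\row_i Num.min (b ord0 i) (d ord0 i)).
Proof.
apply/seteqP; split => v /=.
  move=> [h1 h2] i; rewrite !mxE gt_max le_min.
  by case/andP: (h1 i) => h11 h12; case/andP: (h2 i) => h21 h22; rewrite h11 h12 h21 h22.
by move=> h; split => i; have := h i; rewrite !mxE gt_max le_min;
  case/andP => /andP[h1 h2] /andP[h3 h4]; apply/andP.
Qed.

Lemma qboxI n : setI_closed (range (@qbox n)).
Proof.
move=> _ _ [p _ <-] [q _ <-]; rewrite /qbox hboxI.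
exists (\row_i Num.max (p.1 ord0 i) (q.1 ord0 i),
        \row_i Num.min (p.2 ord0 i) (q.2 ord0 i)) => //.
congr hbox; apply/rowP => i; rewrite !mxE.
  by rewrite !maxEle ler_rat; case: ifP.
by rewrite !minEle ler_rat; case: ifP.
Qed.

Lemma qbox_in_ball n (y : 'rV[R]_n) (e : R) : 0 < e ->
  exists2 p : 'rV[rat]_n * 'rV[rat]_n, @qbox n p y & @qbox n p `<=` ball y e.
Proof.
move=> e0.
have /choice[f fP] (i : 'I_n) : exists q : rat, (ratr q : R) \in `]y ord0 i - e, y ord0 i[.
  by have [q qP] := @rat_in_itvoo R (y ord0 i - e) (y ord0 i) ltac:(lra); exists q.
have /choice[g gP] (i : 'I_n) : exists q : rat, (ratr q : R) \in `]y ord0 i, y ord0 i + e[.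
  by have [q qP] := @rat_in_itvoo R (y ord0 i) (y ord0 i + e) ltac:(lra); exists q.
exists (\row_i f i, \row_i g i).
  move=> i /=; rewrite !mxE.
  by move: (fP i) (gP i); rewrite !in_itv /= => /andP[_ ->] /andP[/ltW -> _].
move=> v vq; split => // i j; rewrite (ord1 i) /ball /=.
have := vq j; rewrite /= !mxE => /andP[h1 h2].
move: (fP j) (gP j); rewrite !in_itv /= => /andP[h3 h4] /andP[h5 h6].
by rewrite ltr_distlC; apply/andP; split; lra.
Qed.

Lemma open_qbox n (U : set 'rV[R]_n) : open U ->
  U = \bigcup_(p in [set p | @qbox n p `<=` U]) @qbox n p.
Proof.
move=> oU; apply/seteqP; split => [y Uy|y [p]]; last by move=> /[apply].
have /nbhs_ballP[e /= e0 eU] := open_nbhs_nbhs (conj oU Uy : open_nbhs _ _).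
have [p py pe] := qbox_in_ball y e0.
by exists p => //=; apply: subset_trans eU.
Qed.

Lemma measurable_rVE n : @measurable _ 'rV[R]_n = <<s range (@qbox n) >>.
Proof.
apply/seteqP; split; last first.
  apply: smallest_sub; first exact: sigma_algebra_measurable.
  by move=> _ [p _ <-]; exact: measurable_hbox.
apply: smallest_sub; first exact: smallest_sigma_algebra.
move=> U oU; rewrite (open_qbox oU) bigcup_mkcond.
apply: (@countable_bigcupT_measurable _ (g_sigma_algebraType (range (@qbox n)))) => // p.
case: ifPn => _; last exact: measurable0.
by apply: sub_sigma_algebra; exists p.
Qed.

(** The rational boxes are stable under intersection, and those with corners $\pm k$ exhaust the
    space. *)
Lemma rV_measure_unique n (m1 m2 : {measure set 'rV[R]_n -> \bar R}) :
  (forall p, m1 (@qbox n p) = m2 (@qbox n p)) ->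
  (forall p, (m1 (@qbox n p) < +oo)%E) ->
  forall A, measurable A -> m1 A = m2 A.
Proof.
move=> m12 m1oo.
apply: (@measure_unique _ _ _ (range (@qbox n))
  (fun k => @qbox n (const_mx (- k%:R), const_mx k%:R))).
- exact: measurable_rVE.
- exact: qboxI.
- by move=> k; exists (const_mx (- k%:R), const_mx k%:R).
- apply/seteqP; split => // v _.
  exists (Num.truncn (\sum_i `|v ord0 i|)).+1 => // i /=; rewrite !mxE.
  rewrite rmorphN /= ratr_nat.
  have vi : `|v ord0 i| < (Num.truncn (\sum_i `|v ord0 i|)).+1%:R.
    apply: le_lt_trans (truncnS_gt _).
    by rewrite (bigD1 i)//= lerDl sumr_ge0.
  by move: vi; rewrite ltr_norml => /andP[-> /ltW ->].
- by move=> _ [p _ <-]; exact: m12.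
- by move=> k; exact: m1oo.
Qed.

Lemma measurable_fun_rV d (T : measurableType d) n (f : T -> 'rV[R]_n) :
  (forall i, measurable_fun setT (fun x => f x ord0 i : measurableTypeR R)) ->
  measurable_fun setT f.
Proof.
move=> mf; apply: (measurability (range (@qbox n))) => [|_ [_ [p _ <-] <-]].
  exact: measurable_rVE.
rewrite setTI (_ : _ @^-1` _ = \bigcap_(i in [set: 'I_n])
  (fun x => f x ord0 i : measurableTypeR R) @^-1`
  `](map_mx ratr p.1 : 'rV[R]__) ord0 i, (map_mx ratr p.2 : 'rV[R]__) ord0 i]%classic).
  apply: fin_bigcap_measurable => // i _.
  by rewrite -[X in measurable X]setTI; exact: mf.
by apply/seteqP; split=> v /= vB i; have := vB i; rewrite /= in_itv//=; exact.
Qed.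

Lemma lebesgue_measure_oc (a b : R) : a <= b ->
  lebesgue_measure `]a, b]%classic = (b - a)%:E.
Proof.
move=> ab; rewrite lebesgue_measure_itv /= lte_fin.
by case: ltP => // ba; congr (_%:E); apply/eqP; rewrite eq_sym subr_eq0 eq_le ab ba.
Qed.

Lemma leb_hbox n (a b : 'rV[R]_n) : (forall i, a ord0 i <= b ord0 i) ->
  leb R n (hbox a b) = (\prod_(i < n) (b ord0 i - a ord0 i))%:E.
Proof.
elim: n => [|n IHn] in a b *; move=> ab.
  rewrite big_ord0 /= diracE mem_set//; by case.
rewrite lebS (_ : _ @^-1` _ =
    `]a ord0 ord0, b ord0 ord0]%classic `*` hbox (tail_rV a) (tail_rV b)); last first.
  apply/seteqP; split=> -[x v]; rewrite /= in_itv /=.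
    move=> abv; split; first by have := abv ord0; rewrite cons_rV0.
    by move=> i; have := abv (lift ord0 i); rewrite cons_rVS !tail_rVE.
  move=> [xab vab] i; have [j ->|->] := unliftP ord0 i.
    by rewrite cons_rVS -!tail_rVE.
  by rewrite cons_rV0.
rewrite product_measure1E//; last exact: measurable_hbox.
rewrite IHn; last by move=> i; rewrite !tail_rVE.
rewrite [X in (X * _)%E]lebesgue_measure_oc// big_ord_recl EFinM; congr (_ * _)%E.
by under eq_bigr do rewrite !tail_rVE.
Qed.

Lemma hbox_empty n (a b : 'rV[R]_n) i : b ord0 i <= a ord0 i -> hbox a b = set0.
Proof.
by move=> ba; apply/seteqP; split => // v /(_ i) /andP[h1 h2]; lra.
Qed.

Lemma leb_hbox_lty n (a b : 'rV[R]_n) : (leb R n (hbox a b) < +oo)%E.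
Proof.
have [ab|] := pselect (forall i, a ord0 i <= b ord0 i).
  by rewrite leb_hbox// ltry.
move=> /existsNP[i /negP]; rewrite -ltNge => /ltW /hbox_empty ->.
by rewrite measure0 ltry.
Qed.

(** [leb] splits off coordinate 0, whereas the cuts single out an arbitrary coordinate [j];
    [leb_ins] makes the two points of view agree. *)
Definition insert n (j : 'I_n.+1) (p : (measurableTypeR R * 'rV[R]_n)%type) : 'rV[R]_n.+1 :=
  \row_k oapp (fun l => p.2 ord0 l) p.1 (unlift j k).

Lemma ins_id n (j : 'I_n.+1) p : insert j p ord0 j = p.1.
Proof. by rewrite mxE unlift_none. Qed.

Lemma ins_lift n (j : 'I_n.+1) p l : insert j p ord0 (lift j l) = p.2 ord0 l.
Proof. by rewrite mxE liftK. Qed.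

Definition delete n (j : 'I_n.+1) (v : 'rV[R]_n.+1) : 'rV[R]_n := \row_l v ord0 (lift j l).

Lemma del_ins n (j : 'I_n.+1) p : delete j (insert j p) = p.2.
Proof. by apply/rowP => l; rewrite mxE ins_lift. Qed.

Lemma ins_del n (j : 'I_n.+1) (v : 'rV[R]_n.+1) : insert j (v ord0 j, delete j v) = v.
Proof.
apply/rowP => l; have [k ->|->] := unliftP j l; last by rewrite ins_id.
by rewrite ins_lift mxE.
Qed.

Lemma measurable_ins n (j : 'I_n.+1) : measurable_fun [set: _] (@insert n j).
Proof.
apply: measurable_fun_rV => i.
have [l ->|->] := unliftP j i.
  rewrite (_ : (fun _ => _) = (fun v : 'rV[R]_n => v ord0 l : measurableTypeR R) \o snd); last first.
    by apply/funext => p; rewrite ins_lift.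
  by apply: measurableT_comp => //; exact: measurable_coord_rV.
rewrite (_ : (fun _ => _) = fst); first exact: measurable_fst.
by apply/funext => p; rewrite ins_id.
Qed.

Lemma measurable_del n (j : 'I_n.+1) : measurable_fun [set: _] (@delete n j).
Proof.
apply: measurable_fun_rV => i.
under eq_fun do rewrite mxE; exact: measurable_coord_rV.
Qed.

Lemma in_hbox_ins n (j : 'I_n.+1) (a b : 'rV[R]_n.+1) t w :
  hbox a b (insert j (t, w)) <->
  (a ord0 j < t <= b ord0 j) /\ hbox (delete j a) (delete j b) w.
Proof.
split=> [h|[h1 h2] i].
  split; first by have := h j; rewrite ins_id.
  by move=> i; rewrite !mxE; have := h (lift j i); rewrite ins_lift.
have [l ->|->] := unliftP j i; last by rewrite ins_id.
by rewrite ins_lift; have := h2 l; rewrite !mxE.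
Qed.

(* [s] is [true] for the orientation-reversing change of variable. *)
Definition affine (s : bool) (c t : R) : measurableTypeR R := c + (-1) ^+ s * t.

Lemma measurable_affine s c : measurable_fun [set: measurableTypeR R] (affine s c).
Proof.
by apply: measurable_funD => //; apply: measurable_funM => //.
Qed.

Lemma preimage_affine_oc s (c a b : R) : a <= b ->
  lebesgue_measure (affine s c @^-1` `]a, b]%classic) = (b - a)%:E.
Proof.
move=> ab; case: s; rewrite /affine.
  rewrite (_ : _ @^-1` _ = `[c - b, c - a[%classic); last first.
    apply/seteqP; split => x /=; rewrite !in_itv /= expr1 mulN1r => /andP[h1 h2];
    apply/andP; split; lra.
  rewrite lebesgue_measure_itv /= lte_fin; case: ltP => h; first by rewrite -EFinD; congr (_%:E); lra.
  congr (_%:E); lra.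
rewrite (_ : _ @^-1` _ = `]a - c, b - c]%classic); last first.
  apply/seteqP; split => x /=; rewrite !in_itv /= expr0 mul1r => /andP[h1 h2];
  apply/andP; split; lra.
rewrite lebesgue_measure_oc; last lra.
by congr (_%:E); lra.
Qed.

Definition affins n (j : 'I_n.+1) (s : bool) (c : R)
  (p : (measurableTypeR R * 'rV[R]_n)%type) := insert j (affine s c p.1, p.2).

Lemma measurable_affins n (j : 'I_n.+1) s c : measurable_fun [set: _] (@affins n j s c).
Proof.
apply: (measurableT_comp (measurable_ins j)).
apply: measurable_fun_pair => /=; last exact: measurable_snd.
apply: (measurableT_comp (measurable_affine s c)); exact: measurable_fst.
Qed.

(** Both sides are measures that agree on rational boxes. Measuring coordinate [j] from a centre
    [c], in either direction, lets the two faces of a growing cube be parametrized by its half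
    side. *)
Lemma leb_affins n (j : 'I_n.+1) s c (A : set 'rV[R]_n.+1) : measurable A ->
  leb R n.+1 A = (lebesgue_measure \x leb R n)%E (affins j s c @^-1` A).
Proof.
move=> mA.
apply: (@rV_measure_unique _ _ (push_measure _ (measurable_affins j s c))) => // p;
  last exact: leb_hbox_lty.
rewrite [RHS]push_measureE; pose a : 'rV[R]_n.+1 := map_mx ratr p.1; pose b : 'rV[R]_n.+1 := map_mx ratr p.2; rewrite -[qbox p]/(hbox a b).
have [ab|] := pselect (forall i, a ord0 i <= b ord0 i); last first.
  move=> /existsNP[i /negP]; rewrite -ltNge => /ltW /hbox_empty ->.
  by rewrite preimage_set0 !measure0.
rewrite [LHS](leb_hbox ab)// (_ : _ @^-1` _ =
  (affine s c @^-1` `]a ord0 j, b ord0 j]%classic) `*` hbox (delete j a) (delete j b)); last first.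
  by apply/seteqP; split => -[t w] /=; rewrite /affins in_hbox_ins /= in_itv.
rewrite [RHS]product_measure1E; first last.
- exact: measurable_hbox.
- by rewrite -[X in measurable X]setTI; apply: measurable_affine.
rewrite [X in (X * _)%E]preimage_affine_oc// leb_hbox => [|i]; last by rewrite [leLHS]mxE [leRHS]mxE; exact: ab.
rewrite -EFinM (bigD1_ord j)//=; congr (_ * _)%:E.
by apply: eq_bigr => i _; rewrite [X in _ = X - _]mxE [X in _ = _ - X]mxE.
Qed.

Lemma leb_ins n (j : 'I_n.+1) (A : set 'rV[R]_n.+1) : measurable A ->
  leb R n.+1 A = (lebesgue_measure \x leb R n)%E (@insert n j @^-1` A).
Proof.
move=> mA; rewrite (leb_affins j false 0)//; congr (_ _).
by apply/seteqP; split => -[t w]; rewrite /preimage /affins /= /affine expr0 mul1r add0r.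
Qed.

End boxes.

(** * Smooth cutoff functions *)

Section smooth1.
Variable R : realType.
Implicit Types (f g : R -> R) (P : {poly R}).

(** Order by order, with the derivative as a witness, so that stability under the operations is an
    induction on [k]. *)
Fixpoint smooth1 k f := match k with
  | 0 => True
  | k'.+1 => exists2 f' : R -> R, (forall x : R, is_derive x (1 : R) f (f' x)) & smooth1 k' f'
  end.

Lemma smooth1W k f : smooth1 k.+1 f -> smooth1 k f.
Proof.
elim: k f => //= k IH f [f' df [f'' df' s]].
by exists f' => //; apply: IH; exists f''.
Qed.

Lemma smooth1_cst k (c : R) : smooth1 k (fun=> c).
Proof.
elim: k c => //= k IH c; exists (fun=> 0); last exact: IH.
by move=> x; exact: is_derive_cst.
Qed.

Lemma smooth1D k f g : smooth1 k f -> smooth1 k g ->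
  smooth1 k (fun x => f x + g x).
Proof.
elim: k f g => //= k IH f g [f' df sf] [g' dg sg].
exists (fun x => f' x + g' x); last exact: IH.
by move=> x; exact: is_deriveD.
Qed.

Lemma smooth1M k f g : smooth1 k f -> smooth1 k g ->
  smooth1 k (fun x => f x * g x).
Proof.
elim: k f g => //= k IH f g [f' df sf] [g' dg sg].
exists (fun x => f x * g' x + g x * f' x).
  by move=> x; exact: is_deriveM.
by apply: smooth1D; apply: IH => //; apply: smooth1W; [exists f'|exists g'].
Qed.

Lemma smooth1V k f : (forall x, f x != 0) -> smooth1 k f ->
  smooth1 k (fun x => (f x)^-1).
Proof.
move=> f0; elim: k => //= k IH [f' df sf].
have sV : smooth1 k (fun x => (f x)^-1) by apply: IH; apply: smooth1W; exists f'.
exists (fun x => (-1) * ((f x)^-1 * (f x)^-1) * f' x).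
  move=> x; apply: (is_derive_eq (is_deriveV (f0 x) (df x))).
  by rewrite /GRing.scale /= mulN1r -invfM -expr2.
by do 2! apply: smooth1M => //; [exact: smooth1_cst|exact: smooth1M].
Qed.

Lemma smooth1_affine k f (a b : R) : smooth1 k f ->
  smooth1 k (fun x => f (a * x + b)).
Proof.
elim: k f => //= k IH f [f' df sf].
exists (fun x => f' (a * x + b) * a).
  move=> x; rewrite -[fun x => _]/(f \o (fun x => a * x + b)).
  apply: is_derive1_comp.
  apply: (is_derive_eq (is_deriveD (is_deriveM (is_derive_cst a x 1)
    (is_derive_id x (1 : R))) (is_derive_cst b x 1))).
  by rewrite /GRing.scale /= mulr0 !addr0 mulr1.
by apply: smooth1M; [exact: IH|exact: smooth1_cst].
Qed.

(* This family, which contains [flat 1], is stable under differentiation. *)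
Definition flat P x : R := if 0 < x then P.[x^-1] * expR (- x^-1) else 0.

Lemma poly_bound P : exists2 C : R, 0 <= C &
  forall y, 1 <= y -> `|P.[y]| <= C * y ^+ size P.
Proof.
exists (\sum_(i < size P) `|P`_i|); first exact: sumr_ge0.
move=> y y1; rewrite horner_coef mulr_suml; apply: le_trans (ler_norm_sum _ _ _) _.
apply: ler_sum => i _; rewrite normrM ler_wpM2l// ger0_norm ?exprn_ge0//.
  by rewrite ler_weXn2l// ltnW.
exact: le_trans y1.
Qed.

(** Quadratic decay at the origin yields a zero derivative there. It follows from $e^y\ge
    y^{d+2}/(d+2)!$ at $y=1/h$, with $d$ the exponent in [poly_bound]. *)
Lemma flat_bound P : exists2 C : R, 0 <= C &
  forall h, h <= 1 -> `|flat P h| <= C * h ^+ 2.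
Proof.
have [C C0 CP] := poly_bound P.
exists (C * ((size P).+2)`!%:R); first by rewrite mulr_ge0.
move=> h h1; rewrite /flat; case: ifPn => h0; last first.
  by rewrite normr0 mulr_ge0 ?sqr_ge0// mulr_ge0.
have y1 : 1 <= h^-1 by rewrite invf_ge1.
have y0 : 0 < h^-1 by rewrite invr_gt0.
rewrite normrM [X in _ * X <= _]ger0_norm ?expR_ge0//.
apply: (@le_trans _ _ (C * h^-1 ^+ size P * expR (- h^-1))).
  by rewrite ler_wpM2r ?expR_ge0// CP.
rewrite -!mulrA ler_wpM2l// expRN ler_pdivrMr ?expR_gt0//.
have := @expR_ge1Dxn R h^-1 (size P).+1 (ltW y0).
set F := _`!%:R => H.
have F0 : 0 < F by rewrite ltr0n fact_gt0.
have {}H : h^-1 ^+ (size P).+2 <= F * expR h^-1.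
  by rewrite mulrC -ler_pdivrMr//; apply: le_trans H; rewrite lerDr.
rewrite mulrAC -ler_pdivrMr ?exprn_gt0// -exprVn -exprD addn2.
exact: H.
Qed.

(** The derivative of $P(1/x)e^{-1/x}$ is $x^{-2}(P-P')(1/x)e^{-1/x}$, which is again in the family;
    at 0 the bound [flat_bound] takes over. *)
Lemma is_derive_flat P (x : R) :
  is_derive x (1 : R) (flat P) (flat ('X^2 * (P - P^`())) x).
Proof.
have [x0|x0|->] := ltgtP x 0.
- have -> : flat ('X^2 * (P - P^`())) x = 0 by rewrite /flat ltNge (ltW x0).
  apply: (@near_eq_is_derive _ _ _ (cst (0 : R))).
  near=> y; rewrite /flat ltNge /= (_ : y <= 0)//.
  near: y; exact: lt_le_nbhsl.
- have -> : flat ('X^2 * (P - P^`())) x =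
    ('X^2 * (P - P^`())).[x^-1] * expR (- x^-1) by rewrite /flat x0.
  apply: (@near_eq_is_derive R _ _ (fun y : R => P.[y^-1] * expR (- y^-1) : R)).
    near=> y; rewrite /flat (_ : 0 < y)//.
    by near: y; exact: lt_nbhsr.
  have dV : is_derive x 1 (fun y : R => y^-1) (- x ^- 2 *: 1).
    by apply: (@is_deriveV _ id); rewrite gt_eqF.
  have dP : is_derive x 1 (fun y : R => P.[y^-1]) (P^`().[x^-1] * (- x ^- 2 *: 1)).
    exact: (@is_derive1_comp _ (horner P)).
  have dE : is_derive x 1 (fun y : R => expR (- y^-1)) (expR (- x^-1) * (- (- x ^- 2 *: 1))).
    apply: (@is_derive1_comp _ expR (fun y => - y^-1)); exact: is_deriveN.
  apply: (is_derive_eq (is_deriveM dP dE)).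
  rewrite /GRing.scale /= !hornerE /=.
  by rewrite exprVn; ring.
- have -> : flat ('X^2 * (P - P^`())) 0 = 0 by rewrite /flat ltxx.
  have [C C0 CP] := flat_bound P.
  have lim0 : h^-1 *: ((flat P \o shift 0) (h *: (1 : R)) - flat P 0) @[h --> 0^'] --> (0 : R).
    apply/cvgrPdist_le => e e0; near=> h.
    have hn0 : h != 0 by near: h; exact: nbhs_dnbhs_neq.
    have h1 : h <= 1.
      by near: h; apply: nbhs_dnbhs; exact: lt_le_nbhsl.
    rewrite sub0r normrN /= addr0 /GRing.scale /= mulr1 {2}/flat ltxx subr0 normrM.
    have {}CP := CP _ h1.
    have hp : 0 < `|h| by rewrite normr_gt0.
    rewrite normfV ler_pdivrMl//; apply: le_trans CP _.
    rewrite -[h ^+ 2]ger0_norm ?sqr_ge0// normrX expr2 mulrCA ler_wpM2l//.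
    have hC : `|h| <= e / (C + 1).
      near: h; apply: dnbhs0_le.
      by rewrite divr_gt0// ltr_wpDl.
    apply: (@le_trans _ _ (C * (e / (C + 1)))); first by rewrite ler_wpM2l.
    rewrite mulrCA ger_pMr// ler_pdivrMr ?ltr_wpDl// mul1r lerDl//.
  apply: DeriveDef; first by apply/cvg_ex; exists 0.
  by apply/cvg_lim.
Unshelve. all: by end_near.
Qed.

Lemma smooth1_flat k P : smooth1 k (flat P).
Proof.
elim: k P => //= k IH P; exists (flat ('X^2 * (P - P^`()))) => //.
by move=> x; exact: is_derive_flat.
Qed.

Lemma flat1_le0 x : x <= 0 -> flat 1 x = 0.
Proof. by rewrite /flat ltNge => ->. Qed.

Lemma flat1_gt0 x : 0 < x -> 0 < flat 1 x.
Proof. by rewrite /flat => ->; rewrite hornerE mul1r expR_gt0. Qed.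

Lemma flat1_ge0 x : 0 <= flat 1 x.
Proof.
have [/flat1_le0 ->//|x0] := leP x 0; exact/ltW/flat1_gt0.
Qed.

(** The usual smooth transition between 0 and 1 on the unit interval; [1 - x] is written so as to
    match [smooth1_affine]. *)
Definition step (x : R) : R := flat 1 x * (flat 1 x + flat 1 ((-1) * x + 1))^-1.

Let den_gt0 x : 0 < flat 1 x + flat 1 ((-1) * x + 1).
Proof.
have [x0|x0] := ltP 0 x; first by rewrite ltr_pwDl ?flat1_gt0 ?flat1_ge0.
by rewrite ltr_wpDl ?flat1_ge0// flat1_gt0//; lra.
Qed.

Lemma smooth1_step k : smooth1 k step.
Proof.
apply: smooth1M; first exact: smooth1_flat.
apply: smooth1V; first by move=> x; rewrite gt_eqF.
apply: smooth1D; first exact: smooth1_flat.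
by apply: smooth1_affine; exact: smooth1_flat.
Qed.

Lemma step_le0 x : x <= 0 -> step x = 0.
Proof. by move=> x0; rewrite /step flat1_le0// mul0r. Qed.

Lemma step_ge1 x : 1 <= x -> step x = 1.
Proof.
move=> x1; rewrite /step [X in _ + X]flat1_le0; last lra.
by rewrite addr0 divff// gt_eqF// flat1_gt0//; lra.
Qed.

Lemma step_ge0 x : 0 <= step x.
Proof. by rewrite mulr_ge0 ?flat1_ge0// invr_ge0 ltW. Qed.

Lemma step_le1 x : step x <= 1.
Proof. by rewrite ler_pdivrMr// mul1r lerDl flat1_ge0. Qed.

Lemma is_derive_step x : is_derive x (1 : R) step ((derive1 step) x).
Proof.
have [f' df _] := smooth1_step 1.
by rewrite derive1E; apply: DeriveDef => //; case: (df x).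
Qed.

Lemma continuous_dstep : continuous (derive1 step).
Proof.
have [f' df [f'' df' _]] := smooth1_step 2.
suff -> : (derive1 step) = f'.
  move=> x; apply: differentiable_continuous; apply/derivable1_diffP.
  by case: (df' x).
by apply/funext => x; rewrite derive1E; case: (df x).
Qed.

Lemma dstep_lt0 x : x < 0 -> (derive1 step) x = 0.
Proof.
move=> x0; rewrite derive1E.
suff [] : is_derive x (1 : R) step 0 by [].
apply: (@near_eq_is_derive R _ _ (cst (0 : R))).
by near=> y; rewrite step_le0//; near: y; exact: lt_le_nbhsl.
Unshelve. all: by end_near. Qed.

Lemma dstep_gt1 x : 1 < x -> (derive1 step) x = 0.
Proof.
move=> x0; rewrite derive1E.
suff [] : is_derive x (1 : R) step 0 by [].
apply: (@near_eq_is_derive R _ _ (cst (1 : R))).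
by near=> y; rewrite step_ge1//; near: y; exact: lt_le_nbhsr.
Unshelve. all: by end_near. Qed.

Lemma dstep_bound : exists2 M : R, 0 < M & forall x, `|(derive1 step) x| <= M.
Proof.
have [c _ cM] := @EVT_max R (fun x => `|(derive1 step) x|) 0 1 ler01
  (continuous_subspaceT (fun x => continuous_comp (@continuous_dstep x) (@norm_continuous _ _ _))).
exists (`|(derive1 step) c| + 1); first by rewrite ltr_wpDl.
move=> x; have [x0|x0] := ltP x 0; first by rewrite dstep_lt0// normr0 addr_ge0.
have [x1|x1] := ltP 1 x; first by rewrite dstep_gt1// normr0 addr_ge0.
by apply: le_trans (cM x _) _; rewrite ?lerDl// in_itv /= x0 x1.
Qed.

(* Tends pointwise to the indicator of the half-open interval ]a, b]. *)
Definition ramp (a b : R) (N : nat) (t : R) : R :=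
  step (N.+1%:R * t + - (N.+1%:R * a)) - step (N.+1%:R * t + - (N.+1%:R * b)).

Definition dramp (a b : R) (N : nat) (t : R) : R :=
  (derive1 step) (N.+1%:R * t + - (N.+1%:R * a)) * N.+1%:R -
  (derive1 step) (N.+1%:R * t + - (N.+1%:R * b)) * N.+1%:R.

Lemma smooth1_ramp k a b N : smooth1 k (ramp a b N).
Proof.
rewrite (_ : ramp a b N = fun t => step (N.+1%:R * t + - (N.+1%:R * a)) +
   (-1) * step (N.+1%:R * t + - (N.+1%:R * b))); last first.
  by apply/funext => t; rewrite mulN1r.
apply: smooth1D; first by apply: smooth1_affine; exact: smooth1_step.
apply: smooth1M; first exact: smooth1_cst.
by apply: smooth1_affine; exact: smooth1_step.
Qed.

Lemma is_derive_step_affine (N a x : R) :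
  is_derive x (1 : R) (fun t => step (N * t + a)) ((derive1 step) (N * x + a) * N).
Proof.
rewrite -[fun t => _]/(step \o (fun t => N * t + a)).
apply: is_derive1_comp; first exact: is_derive_step.
apply: (is_derive_eq (is_deriveD (is_deriveM (is_derive_cst N x 1)
  (is_derive_id x (1 : R))) (is_derive_cst a x 1))).
by rewrite /GRing.scale /= mulr0 !addr0 mulr1.
Qed.

Lemma is_derive_ramp a b N x :
  is_derive x (1 : R) (ramp a b N) (dramp a b N x).
Proof. by apply: is_deriveB; exact: is_derive_step_affine. Qed.

Lemma ramp_le1 a b N t : `|ramp a b N t| <= 1.
Proof.
rewrite ler_norml /ramp; set s1 := step _; set s2 := step _.
have [? ? ? ?] : [/\ 0 <= s1, s1 <= 1, 0 <= s2 & s2 <= 1].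
  by split; rewrite ?step_ge0 ?step_le1.
by apply/andP; split; lra.
Qed.

Lemma ramp_left a b N t : a <= b -> t <= a -> ramp a b N t = 0.
Proof.
move=> ab ta; rewrite /ramp !step_le0 ?subr0//.
  by rewrite subr_le0 ler_wpM2l// (le_trans ta).
by rewrite subr_le0 ler_wpM2l.
Qed.

Let Ninv N (t c : R) : c + N.+1%:R^-1 <= t -> 1 <= N.+1%:R * t + - (N.+1%:R * c).
Proof.
by move=> h; rewrite -mulrBr -ler_pdivrMl// mulr1 lerBrDl.
Qed.

Lemma ramp_right a b N t : a <= b -> b + N.+1%:R^-1 <= t -> ramp a b N t = 0.
Proof.
move=> ab bt; rewrite /ramp !step_ge1 ?subrr//; apply: Ninv => //.
by apply: le_trans bt; rewrite lerD2r.
Qed.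

Lemma ramp_out a b N t : a <= b -> ~ (a <= t <= b + N.+1%:R^-1) -> ramp a b N t = 0.
Proof.
move=> ab /negP; rewrite negb_and -!ltNge => /orP[] /ltW h.
  exact: ramp_left.
exact: ramp_right.
Qed.

Lemma step_cvg (a t : R) :
  step (N.+1%:R * t + - (N.+1%:R * a)) @[N --> \oo] --> (\1_(`]a, +oo[%classic) t : R).
Proof.
rewrite indicE; have [ta|ta] := leP t a.
  rewrite memNset /=; last by rewrite in_itv /= andbT ltNge ta.
  rewrite (_ : (fun _ => _) = cst 0); first exact: cvg_cst.
  by apply/funext => N; rewrite step_le0// subr_le0 ler_wpM2l.
rewrite mem_set /=; last by rewrite in_itv /= andbT.
have ta0 : 0 < t - a by rewrite subr_gt0.
apply: cvg_near_cst; near=> N; rewrite step_ge1//; apply: Ninv.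
rewrite -lerBrDl ltW//.
by near: N; exact: (near_infty_natSinv_lt (PosNum ta0)).
Unshelve. all: by end_near. Qed.

Lemma ramp_cvg (a b t : R) : a <= b ->
  ramp a b N t @[N --> \oo] --> (\1_(`]a, b]%classic) t : R).
Proof.
move=> ab; rewrite (_ : \1_(_) t = \1_(`]a, +oo[%classic) t - \1_(`]b, +oo[%classic) t :> R).
  by apply: cvgB; exact: step_cvg.
have memE (P : bool) (S : set R) : (S t <-> P) -> (t \in S) = P.
  by case: P => h; [apply/mem_set/h|apply/memNset => /h].
rewrite !indicE (memE (a < t <= b)) ?(memE (a < t) `]a, +oo[%classic) ?(memE (b < t) `]b, +oo[%classic);
  rewrite /= ?in_itv /= ?andbT//.
by have [bt|tb] := ltP b t; [rewrite andbF (le_lt_trans ab bt) subrr|rewrite andbT subr0].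
Qed.

End smooth1.

Section smooth.
Variables (R : realType) (n : nat).
Local Notation E := 'rV[R]_n.
Implicit Types f g : E -> R.

Fixpoint smoothk k f := match k with
  | 0 => True
  | k'.+1 => (forall x, differentiable f x) /\ forall i, smoothk k' (partial i f)
  end.

Lemma smoothP f : smooth f <-> forall k, smoothk k f.
Proof.
split=> [sf k|sf s].
  elim: k f sf => //= k IH f sf; split => [x|i]; first exact: (sf [::]).
  by apply: IH => s x; rewrite -foldr_rcons; exact: sf.
have := sf (size s).+1; elim/last_ind: s f {sf} => [|s i IH] f; first by case.
by rewrite size_rcons foldr_rcons => -[_ /(_ i)]; exact: IH.
Qed.

Lemma smoothkW k f : smoothk k.+1 f -> smoothk k f.
Proof. by elim: k f => //= k IH f [df sf]; split => // i; exact: IH. Qed.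

Lemma partialD i f g : (forall x, differentiable f x) ->
  (forall x, differentiable g x) ->
  partial i (fun x => f x + g x) = fun x => partial i f x + partial i g x.
Proof.
by move=> df dg; apply/funext => x; rewrite /partial deriveD//; exact: diff_derivable.
Qed.

Lemma partialM i f g : (forall x, differentiable f x) ->
  (forall x, differentiable g x) ->
  partial i (fun x => f x * g x) = fun x => f x * partial i g x + g x * partial i f x.
Proof.
by move=> df dg; apply/funext => x; rewrite /partial deriveM//; exact: diff_derivable.
Qed.

Lemma smoothkD k f g : smoothk k f -> smoothk k g -> smoothk k (fun x => f x + g x).
Proof.
elim: k f g => //= k IH f g [df sf] [dg sg]; split=> [x|i].
  exact: differentiableD.
by rewrite partialD//; exact: IH.
Qed.

Lemma smoothkM k f g : smoothk k f -> smoothk k g -> smoothk k (fun x => f x * g x).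
Proof.
elim: k f g => //= k IH f g [df sf] [dg sg]; split=> [x|i].
  exact: differentiableM.
by rewrite partialM//; apply: smoothkD; apply: IH => //; apply: smoothkW.
Qed.

Lemma partial_cst i c : partial i (fun=> c : R) = (fun=> 0 : R) :> (E -> R).
Proof. by apply/funext => x; rewrite /partial derive_cst. Qed.

Lemma smoothk_cst k c : smoothk k (fun=> c).
Proof.
elim: k c => //= k IH c; split=> [x|i]; first exact: differentiable_cst.
by rewrite partial_cst.
Qed.

Lemma partial_coord i j (f f' : R -> R) : (forall t, is_derive t (1 : R) f (f' t)) ->
  partial i (fun x : E => f (x ord0 j)) = fun x => if i == j then f' (x ord0 j) else 0.
Proof.
move=> df; apply/funext => x; rewrite /partial /derive.
case: eqVneq => [->|ij].
  transitivity ('D_1 f (x ord0 j)); last by case: (df (x ord0 j)).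
  rewrite /derive; set d := (fun _ : R => _); set d' := (fun _ : R => _).
  suff -> : d = d' by []; apply/funext => h; rewrite /d /d' /=.
  by rewrite !mxE !eqxx.
set d := (fun _ : R => _); suff -> : d = fun=> 0 by apply: cvg_lim => //; exact: cvg_cst.
apply/funext => h; rewrite /d /= !mxE eqxx eq_sym (negbTE ij) /=.
by rewrite /GRing.scale /= mulr0 add0r subrr mulr0.
Qed.

Lemma smoothk_coord k j (f : R -> R) : smooth1 k f -> smoothk k (fun x : E => f (x ord0 j)).
Proof.
elim: k f => //= k IH f [f' df sf]; split=> [x|i].
  apply: (@differentiable_comp _ _ _ _ (fun x : E => x ord0 j)).
    exact: differentiable_coord.
  by apply/derivable1_diffP; case: (df (x ord0 j)).
rewrite (partial_coord _ _ df); case: eqVneq => _; first exact: IH.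
exact: smoothk_cst.
Qed.

(** One sharpness [N i] per coordinate: the limit in the coordinate that is differentiated has to be
    taken last. *)
Definition cutoff (a b : E) (N : 'I_n -> nat) (x : E) : R :=
  \prod_i ramp (a ord0 i) (b ord0 i) (N i) (x ord0 i).

Lemma smoothk_prod k (I : Type) (r : seq I) (P : pred I) (F : I -> E -> R) :
  (forall i, smoothk k (F i)) -> smoothk k (fun x => \prod_(i <- r | P i) F i x).
Proof.
move=> sF; elim: r => [|i r IH].
  rewrite (_ : (fun _ => _) = fun=> 1); first exact: smoothk_cst.
  by apply/funext => x; rewrite big_nil.
case/boolP : (P i) => Pi.
  rewrite (_ : (fun _ => _) = fun x => F i x * \prod_(i <- r | P i) F i x).
    exact: smoothkM.
  by apply/funext => x; rewrite big_cons Pi.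
rewrite (_ : (fun _ => _) = fun x => \prod_(i <- r | P i) F i x)//.
by apply/funext => x; rewrite big_cons (negbTE Pi).
Qed.

Lemma smooth_cutoff a b N : smooth (cutoff a b N).
Proof.
apply/smoothP => k; apply: smoothk_prod => i.
by apply: smoothk_coord; exact: smooth1_ramp.
Qed.

Lemma smoothM f g : smooth f -> smooth g -> smooth (fun x => f x * g x).
Proof. by move=> /smoothP sf /smoothP sg; apply/smoothP => k; exact: smoothkM. Qed.

Lemma smooth_cst c : smooth (fun _ : E => c).
Proof. by apply/smoothP => k; exact: smoothk_cst. Qed.

Lemma smooth_differentiable f x : smooth f -> differentiable f x.
Proof. by move=> /(_ [::] x). Qed.

Lemma smooth_continuous f : smooth f -> continuous f.
Proof. by move=> sf x; apply: differentiable_continuous; exact: smooth_differentiable. Qed.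

Lemma smooth_partial f i : smooth f -> smooth (partial i f).
Proof. by move=> sf s x; rewrite -foldr_rcons; exact: sf. Qed.

Definition prod_but (a b : E) (N : 'I_n -> nat) (j : 'I_n) (x : E) : R :=
  \prod_(i | i != j) ramp (a ord0 i) (b ord0 i) (N i) (x ord0 i).

Lemma cutoffE a b N j x :
  cutoff a b N x = ramp (a ord0 j) (b ord0 j) (N j) (x ord0 j) * prod_but a b N j x.
Proof. by rewrite /cutoff (bigD1 j). Qed.

Lemma partial_prod_but a b N j x : partial j (prod_but a b N j) x = 0.
Proof.
rewrite /prod_but; elim: (index_enum _) => [|i r IH].
  rewrite (_ : (fun _ => _) = fun=> 1); first by rewrite partial_cst.
  by apply/funext => y; rewrite big_nil.
case/boolP : (i != j) => ij; last first.
  rewrite (_ : (fun _ => _) = fun x : E => \prod_(i <- r | i != j) ramp (a ord0 i) (b ord0 i) (N i) (x ord0 i))//.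
  by apply/funext => y; rewrite big_cons (negbTE ij).
rewrite (_ : (fun _ => _) = fun x : E => ramp (a ord0 i) (b ord0 i) (N i) (x ord0 i) *
    \prod_(i <- r | i != j) ramp (a ord0 i) (b ord0 i) (N i) (x ord0 i)); last first.
  by apply/funext => y; rewrite big_cons ij.
have s1 : smoothk 1 (fun x : E => ramp (a ord0 i) (b ord0 i) (N i) (x ord0 i)).
  by apply: smoothk_coord; exact: smooth1_ramp.
have s2 : smoothk 1 (fun x : E => \prod_(i <- r | i != j) ramp (a ord0 i) (b ord0 i) (N i) (x ord0 i)).
  by apply: smoothk_prod => l; apply: smoothk_coord; exact: smooth1_ramp.
rewrite partialM ?IH; [|by case: s1|by case: s2].
rewrite (partial_coord _ _ (is_derive_ramp _ _ _)) eq_sym (negbTE ij).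
by rewrite !mulr0 addr0.
Qed.

Lemma partial_cutoff f a b N j x : smooth f ->
  partial j (fun x => f x * cutoff a b N x) x =
  partial j f x * cutoff a b N x +
  f x * dramp (a ord0 j) (b ord0 j) (N j) (x ord0 j) * prod_but a b N j x.
Proof.
move=> sf.
have s1 : smoothk 1 (fun x : E => ramp (a ord0 j) (b ord0 j) (N j) (x ord0 j)).
  by apply: smoothk_coord; exact: smooth1_ramp.
have s2 : smoothk 1 (prod_but a b N j).
  by apply: smoothk_prod => l; apply: smoothk_coord; exact: smooth1_ramp.
rewrite partialM; [|by move=> y; exact: smooth_differentiable|
  by move=> y; apply: smooth_differentiable; exact: smooth_cutoff].
rewrite (_ : cutoff a b N = fun x : E => ramp (a ord0 j) (b ord0 j) (N j) (x ord0 j) *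
   prod_but a b N j x); last by apply/funext => y; rewrite (cutoffE _ _ _ j).
rewrite partialM; [|by case: s1|by case: s2].
rewrite partial_prod_but (partial_coord _ _ (is_derive_ramp _ _ _)) eqxx.
by rewrite mulr0 add0r; ring.
Qed.

Definition cbox (a b : E) : set E := [set v | forall i, a ord0 i <= v ord0 i <= b ord0 i].

Lemma compact_cbox a b : compact (cbox a b).
Proof.
rewrite (_ : cbox a b = [set v : E | forall i, `[a ord0 i, b ord0 i]%classic (v ord0 i)]).
  apply: (@rV_compact R n (fun i => `[a ord0 i, b ord0 i]%classic)) => i.
  exact: segment_compact.
by apply/seteqP; split => v /= vab i; have := vab i; rewrite /= in_itv.
Qed.

Lemma cutoff_out (a b : E) N x : (forall i, a ord0 i <= b ord0 i) ->
  ~ cbox a (\row_i (b ord0 i + (N i).+1%:R^-1)) x -> cutoff a b N x = 0.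
Proof.
move=> ab /existsNP[i]; rewrite mxE => xi.
by rewrite (cutoffE _ _ _ i) ramp_out// mul0r.
Qed.

Lemma cutoff_le1 a b N x : `|cutoff a b N x| <= 1.
Proof.
rewrite normr_prod; suff /andP[] : 0 <= \prod_(i < n) `|ramp (a ord0 i) (b ord0 i) (N i) (x ord0 i)| <= 1 by [].
apply: (big_ind (fun y => 0 <= y <= 1)) => /= [|y z|i _].
- by rewrite ler01 lexx.
- move=> /andP[y0 y1] /andP[z0 z1]; rewrite mulr_ge0//= mulr_ile1//.
- by rewrite normr_ge0 ramp_le1.
Qed.

End smooth.

(** * Cutting a set along a box *)

Section bsupp.
Context d (T : measurableType d) (R : realType).
Implicit Types (mu : {measure set T -> \bar R}) (K D : set T) (g : T -> R).

(** A bound together with a support of finite measure is what dominated convergence needs when the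
    measures are only locally finite; [C] and [K] are explicit because they must be uniform along
    sequences. *)
Definition bsupp K (C : R) g := [/\ 0 <= C, measurable_fun setT g,
  forall x, `|g x| <= C & forall x, ~ K x -> g x = 0].

Lemma bsupp_integrable mu K C g D : measurable K -> (mu K < +oo)%E ->
  measurable D -> bsupp K C g -> mu.-integrable D (EFin \o g).
Proof.
move=> mK Koo mD [C0 mg gC g0].
apply: (@integrableS _ _ _ _ setT) => //.
rewrite (_ : EFin \o g = (EFin \o g) \_ K); last first.
  apply/funext => x; rewrite patchE; case: ifPn => // /negP xK.
  by rewrite /= g0// => /mem_set.
apply/(integrable_mkcond _ mK); apply: (measurable_bounded_integrable mK Koo).
  exact: measurable_funS mg.
exists C; split; first exact: num_real.
by move=> M CM x _; apply: le_trans (gC x) (ltW CM).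
Qed.

Lemma bsupp_dct mu K C D (g_ : nat -> T -> R) g : measurable K -> (mu K < +oo)%E ->
  measurable D -> (forall k, bsupp K C (g_ k)) ->
  (forall x, g_ k x @[k --> \oo] --> g x) ->
  bsupp K C g /\ \int[mu]_(x in D) g_ k x @[k --> \oo] --> \int[mu]_(x in D) g x.
Proof.
move=> mK Koo mD bg gg.
have C0 : 0 <= C by case: (bg 0).
have bsg : bsupp K C g.
  split=> //.
  - by apply: (measurable_fun_cvg (h := g_)) => // k; case: (bg k).
  - move=> x; have h : `|g_ k x| @[k --> \oo] --> `|g x| by apply: cvg_norm; exact: gg.
    rewrite -(cvg_lim _ h)//.
    by apply: limr_le; [apply/cvg_ex; eexists; exact: h|near=> k; case: (bg k)].
  - move=> x xK; apply/esym; have := gg x.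
    rewrite (_ : (fun k => _) = cst 0); first by move/cvg_lim => <- //; rewrite lim_cst.
    by apply/funext => k; case: (bg k) => _ _ _ ->.
split=> //.
apply: fine_cvg; rewrite fineK; last first.
  by apply: integrable_fin_num => //; exact: bsupp_integrable bsg.
apply: (@dominated_cvg _ _ _ _ _ mD _ _ (EFin \o (fun x => C * \1_K x))) => //.
- by move=> k; apply/measurable_EFinP; case: (bg k) => _ mg _ _; exact: measurable_funS mg.
- by move=> x _; apply: cvg_EFin; [exact: nearW|exact: gg].
- apply: (bsupp_integrable (K := K) (C := C)) => //; split=> //.
  + by apply: measurable_funM => //; exact: measurable_indic.
  + move=> x; rewrite normrM indicE; case: (_ \in _); rewrite ?normr1 ?mulr1 ?normr0 ?mulr0 ?ger0_norm//.
  + by move=> x xK; rewrite /= indicE memNset// mulr0.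
- move=> k x _; rewrite lee_fin /= indicE; have [_ mg gC g0] := bg k.
  case: (boolP (x \in K)) => [_|/negP xK]; first by rewrite mulr1.
  by rewrite g0 ?mulr0 ?normr0// => /mem_set.
Unshelve. all: by end_near. Qed.

End bsupp.

Section gradient_calculus.
Variables (R : realType) (n : nat).
Local Notation E := 'rV[R]_n.
Implicit Types (f g phi : E -> R) (Omega A K : set E).

Lemma continuous_measurable_rV f : continuous f -> measurable_fun [set: E] f.
Proof.
move=> cf; apply: (measurability _ (RGenOpens.measurableE R)) => // _ [_ [a [b ->] <-]].
rewrite setTI; apply: open_measurable_rV; apply: open_comp; last exact: interval_open.
by move=> x _; exact: cf.
Qed.

Lemma compact_sub_cbox K : compact K -> exists2 c : R, 0 < c & K `<=` cbox (const_mx (- c)) (const_mx c).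
Proof.
move=> /compact_bounded [M [_ MK]].
exists (`|M| + 1); first by rewrite ltr_wpDl.
move=> x Kx i; rewrite !mxE -ler_norml.
apply: (le_trans _ (MK (`|M| + 1) _ x Kx)); last by rewrite (le_lt_trans (ler_norm _))// ltrDl.
rewrite /Num.norm /= mx_normrE.
by apply: (le_bigmax _ (fun ij : 'I_1 * 'I_n => `|x ij.1 ij.2|) (ord0, i)).
Qed.

Lemma compact_measurable K : compact K -> measurable K.
Proof.
move=> cK; have cl : closed K by apply: compact_closed => //; exact: norm_hausdorff.
by rewrite -(setCK K); apply: measurableC; apply: open_measurable_rV; exact: closed_openC.
Qed.

Lemma cbox_sub_hbox (a b : E) : cbox a b `<=` hbox (\row_i (a ord0 i - 1)) b.
Proof.
by move=> x xab i; rewrite mxE; have /andP[h1 ->] := xab i; rewrite andbT; lra.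
Qed.

Lemma leb_compact_lty K : compact K -> (leb R n K < +oo)%E.
Proof.
move=> cK; have [c c0 Kc] := compact_sub_cbox cK.
apply: le_lt_trans (leb_hbox_lty _ _).
apply: le_measure; last exact: subset_trans Kc (@cbox_sub_hbox _ _).
  by rewrite inE; exact: compact_measurable.
by rewrite inE; exact: measurable_hbox.
Qed.

Definition cpt_supp K f := compact K /\ forall x, ~ K x -> f x = 0.

Lemma cpt_supp_bsupp K f : cpt_supp K f -> continuous f -> exists C, bsupp K C f.
Proof.
move=> [cK f0] cf.
have : compact (f @` K) by apply: continuous_compact => //; exact: continuous_subspaceT.
move=> /compact_bounded [M [_ MK]].
exists (`|M| + 1); split.
- by rewrite addr_ge0.
- exact: continuous_measurable_rV.
- move=> x; have [Kx|nKx] := pselect (K x).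
    by apply: MK; [rewrite (le_lt_trans (ler_norm _))// ltrDl|exists x].
  by rewrite f0// normr0 addr_ge0.
- exact: f0.
Qed.

Lemma cpt_supp_partial K f i : cpt_supp K f -> cpt_supp K (partial i f).
Proof.
move=> [cK f0]; split=> // x Kx.
have oKC : open (~` K) by apply: closed_openC; apply: compact_closed => //; exact: norm_hausdorff.
rewrite /partial (@near_eq_derive _ _ _ _ (cst 0 : E -> R)) ?derive_cst//.
by near=> y; rewrite f0//; near: y; exact: open_nbhs_nbhs.
Unshelve. all: by end_near. Qed.

Lemma Rint_fin (m : {measure set E -> \bar R}) K C D g : measurable K -> (m K < +oo)%E ->
  measurable D -> bsupp K C g ->
  (\int[m]_(x in D) (g x)%:E)%E = (\int[m]_(x in D) g x)%:E.
Proof.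
move=> mK Koo mD bg; rewrite /Rintegral fineK//.
by apply: integrable_fin_num => //; exact: bsupp_integrable bg.
Qed.

Lemma is_gradient_test Omega A (D : vmeasure R n) phi i : open Omega -> measurable A ->
  is_gradient Omega A D -> test_function Omega phi ->
  \int[leb R n]_(x in A) partial i phi x =
  - (\int[(D i).1]_(x in Omega) phi x - \int[(D i).2]_(x in Omega) phi x).
Proof.
move=> oO mA [lf gr] tphi; have := gr i phi tphi.
case: tphi => sphi [K [cK KO phi0]].
have mO : measurable Omega by exact: open_measurable_rV.
have mK := compact_measurable cK.
have [D1 D2] := lf i K cK KO.
have [C bC] := cpt_supp_bsupp (conj cK phi0) (smooth_continuous sphi).
have [C' bC'] := cpt_supp_bsupp (cpt_supp_partial i (conj cK phi0))
  (smooth_continuous (smooth_partial i sphi)).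
rewrite /vintegral (Rint_fin mK (leb_compact_lty cK) mA bC').
by rewrite (Rint_fin mK D1 mO bC) (Rint_fin mK D2 mO bC) -EFinB -EFinN => -[].
Qed.

End gradient_calculus.

Section fubini.
Variables (R : realType) (m : nat).
Local Notation E := 'rV[R]_m.+1.
Implicit Types (f g : E -> R) (K : set E).

Lemma bsupp_comp d d' (T : measurableType d) (T' : measurableType d') (h : T -> T')
    (K : set T') C (g : T' -> R) : measurable_fun setT h ->
  bsupp K C g -> bsupp (h @^-1` K) C (g \o h).
Proof.
move=> mh [C0 mg gC g0]; split => //.
- exact: measurableT_comp.
- by move=> x; exact: gC.
- by move=> x; exact: g0.
Qed.

Lemma leb_int_ins (j : 'I_m.+1) K C g : measurable K -> (leb R m.+1 K < +oo)%E ->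
  bsupp K C g ->
  (lebesgue_measure \x leb R m)%E.-integrable setT (EFin \o g \o insert j) /\
  (\int[leb R m.+1]_x (g x)%:E =
   \int[lebesgue_measure \x leb R m]_p (g (insert j p))%:E)%E.
Proof.
move=> mK Koo bg.
have mi := @measurable_ins R m j.
have bgi := bsupp_comp mi bg.
have mK' : measurable (@insert R m j @^-1` K) by rewrite -[X in measurable X]setTI; exact: mi.
have ig : (lebesgue_measure \x leb R m)%E.-integrable setT (EFin \o g \o insert j).
  apply: (bsupp_integrable mK' _ _ bgi) => //.
  by move: (Koo); rewrite (leb_ins j mK).
split=> //.
rewrite (@eq_measure_integral _ _ _ _ (push_measure (lebesgue_measure \x leb R m)%E mi)); last first.
  by move=> A mA _; exact: leb_ins.
rewrite (integral_pushforward mi)//.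
by apply/measurable_EFinP; case: bg.
Qed.

Lemma is_derive_ins j f t w : differentiable f (insert j (t, w)) ->
  is_derive t (1 : R) (fun s : R => f (insert j (s, w))) (partial j f (insert j (t, w))).
Proof.
move=> df.
have eqd : (fun h : R => h^-1 *: (f (insert j (h *: (1 : R) + t, w)) - f (insert j (t, w)))) =
    (fun h : R => h^-1 *: (f (h *: delta_mx ord0 j + insert j (t, w)) - f (insert j (t, w)))).
  apply/funext => h; congr (_ *: (f _ - _)); apply/rowP => l.
  have [k ->|->] := unliftP j l; rewrite [RHS]mxE [X in _ = X + _]mxE [delta_mx _ _ _ _]mxE.
    by rewrite !ins_lift /= eq_sym (negbTE (neq_lift _ _)) mulr0 add0r.
  by rewrite !ins_id /= eqxx mulr1 /GRing.scale /= mulr1.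
apply: DeriveDef; last first.
  transitivity (lim ((fun h : R => h^-1 *: (f (insert j (h *: (1 : R) + t, w)) -
    f (insert j (t, w)))) h @[h --> 0^'])); first by [].
  by rewrite eqd.
have := diff_derivable (v := delta_mx ord0 j) df.
by rewrite /derivable /= eqd.
Qed.

(** Integrate first along coordinate [j], over a segment reaching one unit past the support on both
    sides: the fundamental theorem of calculus gives 0. *)
Lemma int_partial0 j f K : smooth f -> cpt_supp K f ->
  \int[leb R m.+1]_x partial j f x = 0.
Proof.
move=> sf fK; have [cK f0] := fK.
have [_ pf0] := cpt_supp_partial j fK.
have cpf := smooth_continuous (smooth_partial j sf).
have [C bC] := cpt_supp_bsupp (cpt_supp_partial j fK) cpf.
rewrite /Rintegral; have [ip ->] := leb_int_ins j (compact_measurable cK) (leb_compact_lty cK) bC.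
rewrite -integral21_prod_meas1//.
rewrite integral0_eq// => w _; rewrite /fubini_G /=.
have [c c0 Kc] := compact_sub_cbox cK.
have out t : ~ (- c <= t <= c) -> ~ K (insert j (t, w)).
  by move=> tc /Kc /(_ j); rewrite ins_id !mxE.
have cc : - (c + 1) < c + 1 by lra.
have cont_ins h t : smooth h -> {for t, continuous (fun s => h (insert j (s, w)) : R)}.
  move=> sh; apply: differentiable_continuous; apply/derivable1_diffP.
  by case: (is_derive_ins (smooth_differentiable (insert j (t, w)) sh)).
transitivity (\int[lebesgue_measure]_(t in `[(- (c + 1))%R, (c + 1)%R]) (partial j f (insert j (t, w)))%:E)%E.
  rewrite [RHS]integral_mkcond; apply: eq_integral => t _; rewrite patchE.
  case: ifPn => //; rewrite notin_setE /= in_itv /= => /negP tc; rewrite pf0//; apply: out.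
  by move=> /andP[h1 h2]; move: tc; apply/negP; rewrite negbK; apply/andP; split; lra.
rewrite (@continuous_FTC2 _ _ (fun t => f (insert j (t, w))))//.
- by rewrite !f0 ?sube0//; apply: out => /andP[h1 h2]; lra.
- by apply: continuous_subspaceT => t; apply: cont_ins; exact: smooth_partial.
- split.
  + by move=> t _; case: (is_derive_ins (smooth_differentiable (insert j (t, w)) sf)).
  + by apply: cvg_at_right_filter; exact: cont_ins.
  + by apply: cvg_at_left_filter; exact: cont_ins.
- move=> t _; rewrite derive1E.
  by case: (is_derive_ins (smooth_differentiable (insert j (t, w)) sf)).
Qed.

End fubini.

(** * Recovering face values from smooth cutoffs *)

Section kernel.
Variable R : realType.
Implicit Types (H : R -> R).

(** One-sided, because the ramps rise and fall to the right of the faces. *)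
Definition right_lebesgue_pt H (p : R) :=
  (fun k => k.+1%:R * \int[lebesgue_measure]_(t in `[p, p + k.+1%:R^-1]) `|H t - H p|) @ \oo --> (0 : R).

(* An approximate identity on the right of [p]. *)
Definition kernel (p : R) k t : R := derive1 (@step R) (k.+1%:R * t + - (k.+1%:R * p)) * k.+1%:R.

Lemma kernel_out p k t : ~ (p <= t <= p + k.+1%:R^-1) -> kernel p k t = 0.
Proof.
move=> /negP; rewrite negb_and -!ltNge /kernel -mulrBr => /orP[tp|pt].
  by rewrite dstep_lt0 ?mul0r// nmulr_llt0 ?subr_lt0 // subr_lt0.
by rewrite dstep_gt1 ?mul0r// -ltr_pdivrMl// mulr1 ltrBrDl.
Qed.

Lemma continuous_kernel p k : continuous (kernel p k).
Proof.
move=> t; apply: cvgM; last exact: cvg_cst.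
apply: (@continuous_comp _ _ _ (fun t : R => k.+1%:R * t + - (k.+1%:R * p)) (derive1 (@step R))); last exact: continuous_dstep.
apply: cvgD; last exact: cvg_cst.
by apply: cvgM; [exact: cvg_cst|exact: cvg_id].
Qed.

Lemma int_kernel p k : (\int[lebesgue_measure]_(t in `[p, (p + k.+1%:R^-1)%R]) (kernel p k t)%:E = 1)%E.
Proof.
have h : 0 < (k.+1%:R^-1 : R) by rewrite invr_gt0.
have pp : p < p + k.+1%:R^-1 by rewrite ltrDl.
rewrite (@continuous_FTC2 _ _ (fun t => step (k.+1%:R * t + - (k.+1%:R * p))))//.
- rewrite -mulrBr [p + _]addrC addrK divff// step_ge1// step_le0 ?sube0// subrr//.
- by apply: continuous_subspaceT; exact: continuous_kernel.
- have dstepN (t : R) : derivable (fun t : R => step (k.+1%:R * t + - (k.+1%:R * p))) t (1 : R).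
    by case: (is_derive_step_affine k.+1%:R (- (k.+1%:R * p)) t).
  have cs (t : R) : {for t, continuous (fun t : R => step (k.+1%:R * t + - (k.+1%:R * p)))}.
    by apply: differentiable_continuous; apply/derivable1_diffP; exact: dstepN.
  split => //; [exact/cvg_at_right_filter/cs|exact/cvg_at_left_filter/cs].
- move=> t _; rewrite derive1E.
  by case: (is_derive_step_affine k.+1%:R (- (k.+1%:R * p)) t).
Qed.

Lemma measurable_kernel p k D : measurable_fun D (kernel p k).
Proof. by apply: measurable_funTS; apply: continuous_measurable_fun; exact: continuous_kernel. Qed.

Lemma kernel_bound : exists2 M : R, 0 < M & forall p k t, `|kernel p k t| <= M * k.+1%:R.
Proof.
have [M M0 HM] := @dstep_bound R; exists M => // p k t.
by rewrite normrM [X in _ * X]ger0_norm// ler_wpM2r.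
Qed.

Lemma bounded_integrable (a b C : R) (g : R -> R) : measurable_fun setT g ->
  (forall t, `|g t| <= C) ->
  lebesgue_measure.-integrable `[a, b] (EFin \o g).
Proof.
move=> mg gC.
have loo : (lebesgue_measure `[a, b]%classic < +oo)%E.
  by rewrite lebesgue_measure_itv/=; case: ifP => _; rewrite ?ltry// -EFinB ltry.
apply: (measurable_bounded_integrable _ loo) => //.
- exact: measurable_funTS.
- exists C; split; first exact: num_real.
  by move=> M CM x _; apply: le_trans (gC x) (ltW CM).
Qed.

(** The kernel has integral 1 and is at most [M * k.+1%:R] on a segment of length [k.+1%:R^-1], so
    the error is at most [M] times the mean oscillation of [H] there, which tends to 0 at a right
    Lebesgue point. *)
Lemma kernel_cvg H p C : measurable_fun setT H -> (forall t, `|H t| <= C) ->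
  right_lebesgue_pt H p ->
  \int[lebesgue_measure]_t (kernel p k t * H t) @[k --> \oo] --> H p.
Proof.
move=> mH HC; have [M M0 HM] := kernel_bound.
move=> rl; apply/cvgrPdist_le => e e0.
have : (fun k => M * (k.+1%:R * \int[lebesgue_measure]_(t in `[p, p + k.+1%:R^-1]) `|H t - H p|)) @ \oo --> (0 : R).
  by rewrite -(mulr0 M); apply: cvgM; [exact: cvg_cst|exact: rl].
move/cvgrPdist_le => /(_ _ e0); apply: filterS => k.
rewrite sub0r normrN; apply: le_trans.
set I := `[p, p + k.+1%:R^-1]%classic.
have mI : measurable (I : set (measurableTypeR R)) by exact: measurable_itv.
have ikH : lebesgue_measure.-integrable I (EFin \o (fun t => kernel p k t * H t)).
  apply: (@bounded_integrable _ _ (M * k.+1%:R * C)).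
    by apply: measurable_funM => //; exact: measurable_kernel.
  by move=> t; rewrite normrM ler_pM.
have ik : lebesgue_measure.-integrable I (EFin \o kernel p k).
  by apply: (@bounded_integrable _ _ (M * k.+1%:R)) => //; exact: measurable_kernel.
have iH : lebesgue_measure.-integrable I (EFin \o (fun t => H t - H p)).
  apply: (@bounded_integrable _ _ (C + C)); first exact: measurable_funB.
  by move=> t; apply: le_trans (ler_normB _ _) _; rewrite lerD.
have ikHp : lebesgue_measure.-integrable I (EFin \o (fun t => kernel p k t * (H t - H p))).
  apply: (@bounded_integrable _ _ (M * k.+1%:R * (C + C))).
    by apply: measurable_funM; [exact: measurable_kernel|exact: measurable_funB].
  by move=> t; rewrite normrM ler_pM//; apply: le_trans (ler_normB _ _) _; rewrite lerD.
have -> : \int[lebesgue_measure]_t (kernel p k t * H t) = \int[lebesgue_measure]_(t in I) (kernel p k t * H t).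
  rewrite [RHS]Rintegral_mkcond; apply: eq_Rintegral => t _; rewrite patchE; case: ifPn => //.
  by rewrite notin_setE /I /= in_itv /= => tI; rewrite kernel_out// mul0r.
have int1 : \int[lebesgue_measure]_(t in I) kernel p k t = 1.
  by rewrite /Rintegral int_kernel.
have Hp : H p = \int[lebesgue_measure]_(t in I) (kernel p k t * H p).
  apply/esym; transitivity ((\int[lebesgue_measure]_(t in I) kernel p k t) * H p).
    apply: (@RintegralZr _ _ _ lebesgue_measure I (kernel p k) (H p)); [exact: measurable_itv|exact: ik].
  by transitivity (1 * H p); [congr (_ * _); exact: int1|exact: mul1r].
have -> : H p - \int[lebesgue_measure]_(t in I) (kernel p k t * H t) =
  - \int[lebesgue_measure]_(t in I) (kernel p k t * (H t - H p)).
  have ikc : lebesgue_measure.-integrable I (EFin \o (fun t => kernel p k t * H p)).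
    apply: (@bounded_integrable _ _ (M * k.+1%:R * C)).
      by apply: measurable_funM => //; exact: measurable_kernel.
    by move=> t; rewrite normrM ler_pM.
  rewrite [X in X - _]Hp -RintegralB//.
  rewrite -mulN1r -RintegralZl; [|exact: measurable_itv|exact: ikHp].
  by apply: eq_Rintegral => t _ /=; rewrite mulN1r mulrBr opprB.
rewrite normrN; apply: le_trans (le_normr_Rintegral _ ikHp) _ => //.
rewrite ger0_norm; last first.
  by apply: mulr_ge0; [exact: ltW|apply: mulr_ge0 => //; apply: Rintegral_ge0].
rewrite mulrA -RintegralZl//; last exact: integrable_norm.
apply: le_Rintegral => //; first exact: (integrable_norm ikHp).
  apply: (@bounded_integrable _ _ (M * k.+1%:R * (C + C))).
    apply: measurable_funM => //; apply: measurableT_comp => //; exact: measurable_funB.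
  have Mk : 0 <= M * k.+1%:R by apply: mulr_ge0; [exact: ltW|].
  move=> t; rewrite normrM normr_id [X in X * _]ger0_norm//.
  by apply: ler_wpM2l => //; apply: le_trans (ler_normB _ _) _; rewrite lerD.
by move=> t _; rewrite normrM ler_wpM2r.
Qed.

End kernel.

Section cut_prelim.
Variables (R : realType).

Lemma compact_open_ball (V : normedModType R) (K Omega : set V) : compact K -> open Omega -> K `<=` Omega ->
  exists2 e : R, 0 < e & forall x, K x -> ball x e `<=` Omega.
Proof.
move=> /compact_near_coveringP cK oO KO.
have [|/= e e0 He] := cK R (0 : R)^'+ (fun (e : R) x => ball x e `<=` Omega) _.
  move=> x Kx.
  have /nbhs_ballP[d /= d0 dO] := open_nbhs_nbhs (conj oO (KO _ Kx) : open_nbhs _ _).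
  near=> y e => z yz; apply: dO.
  have xy : ball x (d / 2) y by near: y; apply: nbhsx_ballx; rewrite divr_gt0.
  have ed : e <= d / 2 by near: e; apply: nbhs_right_le; rewrite divr_gt0.
  rewrite [d]splitr; apply: ball_triangle xy _; exact: le_ball yz.
exists (e / 2); first by rewrite divr_gt0.
move=> x Kx; apply: (He (e / 2)) => //=.
  by rewrite sub0r normrN gtr0_norm ?divr_gt0// ltr_pdivrMr// ltr_pMr// ltr1n.
by rewrite divr_gt0.
Unshelve. all: by end_near. Qed.

(** Cutoffs overshoot the box on the right by the inverse of their sharpness; from this sharpness
    on, their supports stay in [Omega]. *)
Lemma cbox_enlarge n (a b : 'rV[R]_n) (Omega : set 'rV[R]_n) : open Omega ->
  (forall i, a ord0 i <= b ord0 i) -> cbox a b `<=` Omega ->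
  exists N : nat, cbox a (\row_i (b ord0 i + N.+1%:R^-1)) `<=` Omega.
Proof.
move=> oO ab abO.
have [e e0 eO] := compact_open_ball (@compact_cbox _ _ a b) oO abO.
have [N _ HN] := near_infty_natSinv_lt (PosNum e0).
exists N => v vab.
(* The nearest point of the box: [v] overshoots it on the right only. *)
apply: (eO (\row_i Num.min (v ord0 i) (b ord0 i))).
  by move=> i; rewrite !mxE le_min ge_min lexx orbT ab andbT; have := vab i; rewrite mxE => /andP[->].
split=> // i k; rewrite (ord1 i) /ball /= !mxE.
have := HN N (leqnn N); rewrite /= => Ne.
have := vab k; rewrite mxE => /andP[h1 h2].
have [vb|bv] := leP (v ord0 k) (b ord0 k); first by rewrite subrr normr0.
change (`|b ord0 k - v ord0 k| < e).
by rewrite ltr0_norm ?subr_lt0// opprB ltrBlDl (le_lt_trans h2)// ltrD2l.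
Qed.

Lemma cvg_bigprod (I : Type) (r : seq I) (P : pred I) (F : I -> nat -> R) (l : I -> R) :
  (forall i, P i -> F i k @[k --> \oo] --> l i) ->
  \prod_(i <- r | P i) F i k @[k --> \oo] --> \prod_(i <- r | P i) l i.
Proof.
move=> Fl; elim: r => [|i r IH].
  rewrite big_nil (_ : (fun _ => _) = fun=> 1); first exact: cvg_cst.
  by apply/funext => k; rewrite big_nil.
rewrite big_cons; case: ifPn => Pi.
  rewrite (_ : (fun _ => _) = fun k => F i k * \prod_(i <- r | P i) F i k).
    by apply: cvgM => //; exact: Fl.
  by apply/funext => k; rewrite big_cons Pi.
rewrite (_ : (fun _ => _) = fun k => \prod_(i <- r | P i) F i k)//.
by apply/funext => k; rewrite big_cons (negbTE Pi).
Qed.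

Lemma indicP (T : Type) (S : set T) x (P : bool) : (S x <-> P) -> \1_S x = P%:R :> R.
Proof.
by rewrite indicE => h; congr (_%:R); congr nat_of_bool;
  case: P h => h; [apply/mem_set/h|apply/memNset => /h].
Qed.

Lemma indic1 (T : Type) (S : set T) x : S x -> \1_S x = 1 :> R.
Proof. by move=> Sx; rewrite indicE mem_set. Qed.

Lemma indic0 (T : Type) (S : set T) x : ~ S x -> \1_S x = 0 :> R.
Proof. by move=> Sx; rewrite indicE memNset. Qed.

Lemma indic_le1 (T : Type) (S : set T) x : `|\1_S x| <= 1 :> R.
Proof. by rewrite indicE; case: (_ \in _); rewrite ?normr1 ?normr0. Qed.

Lemma prod_indic n (a b x : 'rV[R]_n.+1) j :
  \prod_(i | i != j) \1_(`]a ord0 i, b ord0 i]%classic) (x ord0 i) =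
  \1_(hbox (delete j a) (delete j b)) (delete j x) :> R.
Proof.
have [h|h] := pselect (hbox (delete j a) (delete j b) (delete j x)).
  rewrite indic1// big1// => i ij.
  have [k ki|ji] := unliftP j i; last by rewrite ji eqxx in ij.
  by rewrite indic1//= in_itv /=; have := h k; rewrite !mxE -ki.
rewrite (indic0 h); move/existsNP : h => [k hk].
rewrite (bigD1 (lift j k)) ?neq_lift 1?eq_sym ?neq_lift//= indic0 ?mul0r//= in_itv /=.
by move=> h; apply: hk; rewrite !mxE.
Qed.

Lemma indic_hbox n (a b x : 'rV[R]_n.+1) j : \1_(hbox a b) x =
  \1_(`]a ord0 j, b ord0 j]%classic) (x ord0 j) *
  \1_(hbox (delete j a) (delete j b)) (delete j x) :> R.
Proof.
have := in_hbox_ins j a b (x ord0 j) (delete j x); rewrite ins_del => h.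
have [h1|h1] := pselect (hbox (delete j a) (delete j b) (delete j x)); last first.
  by rewrite [in RHS](indic0 h1) mulr0 indic0// => /h [].
rewrite [in RHS](indic1 h1) mulr1; apply: indicP.
by split; [move=> /h[h2 _]; apply/mem_set; rewrite /= in_itv|
  move=> h2; apply/h; split => //; move: h2 => /set_mem; rewrite /= in_itv].
Qed.

Lemma dramp_bound : exists2 M : R, 0 < M & forall a b k t, `|dramp a b k t| <= M * k.+1%:R.
Proof.
have [M M0 HM] := kernel_bound R.
exists (M + M); first by rewrite addr_gt0.
move=> a b k t; rewrite /dramp mulrDl; apply: le_trans (ler_normB _ _) _.
by rewrite lerD//; exact: HM.
Qed.

Lemma prod_but_le1 n (a b : 'rV[R]_n) N j x : `|prod_but a b N j x| <= 1.
Proof.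
rewrite normr_prod; suff /andP[] : 0 <= \prod_(i < n | i != j) `|ramp (a ord0 i) (b ord0 i) (N i) (x ord0 i)| <= 1 by [].
apply: (big_ind (fun y => 0 <= y <= 1)) => /= [|y z|i _].
- by rewrite ler01 lexx.
- move=> /andP[y0 y1] /andP[z0 z1]; rewrite mulr_ge0//= mulr_ile1//.
- by rewrite normr_ge0 ramp_le1.
Qed.

End cut_prelim.

Section cut.
Variables (R : realType) (m : nat).
Local Notation E := 'rV[R]_m.+1.
Variables (Omega A : set E) (D : vmeasure R m.+1).
Hypotheses (oO : open Omega) (mA : measurable A) (gD : is_gradient Omega A D).
Variables (j : 'I_m.+1) (a b : E) (f : E -> R) (C1 C2 : R) (N0 : nat).
Hypotheses (sf : smooth f) (fC1 : forall x, `|f x| <= C1)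
  (fC2 : forall x, `|partial j f x| <= C2) (ab : forall i, a ord0 i <= b ord0 i).
Let K := cbox a (\row_i (b ord0 i + N0.+1%:R^-1)).
Hypothesis (KO : K `<=` Omega).

Let chi (x : E) : R := \1_(hbox (delete j a) (delete j b)) (delete j x).
Let ran k (x : E) : R := ramp (a ord0 j) (b ord0 j) k (x ord0 j).
Let dra k (x : E) : R := dramp (a ord0 j) (b ord0 j) k (x ord0 j).

(** Direction [j] keeps its sharpness while the others tend to infinity; the shift by [N0] keeps
    every support inside [K]. *)
Let NN Nj k (i : 'I_m.+1) := if i == j then Nj else (k + N0)%N.

Let prodbut_cvg Nj x : prod_but a b (NN Nj k) j x @[k --> \oo] --> chi x.
Proof.
rewrite /chi -prod_indic; apply: cvg_bigprod => i ij.
rewrite /NN (negbTE ij).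
by rewrite (cvg_shiftn N0 (fun k => ramp (a ord0 i) (b ord0 i) k (x ord0 i))); exact: ramp_cvg.
Qed.

Let C10 : 0 <= C1. Proof. exact: le_trans (normr_ge0 _) (fC1 0). Qed.
Let C20 : 0 <= C2. Proof. exact: le_trans (normr_ge0 _) (fC2 0). Qed.
Let cK : compact K. Proof. exact: compact_cbox. Qed.
Let mK : measurable K. Proof. exact: compact_measurable. Qed.
Let mO : measurable Omega. Proof. exact: open_measurable_rV. Qed.
Let Koo : (leb R m.+1 K < +oo)%E. Proof. exact: leb_compact_lty. Qed.
Let D1oo : ((D j).1 K < +oo)%E. Proof. by case: gD => /(_ j K cK KO)[]. Qed.
Let D2oo : ((D j).2 K < +oo)%E. Proof. by case: gD => /(_ j K cK KO)[]. Qed.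

Let subK N : (forall i, (N0 <= N i)%N) -> cbox a (\row_i (b ord0 i + (N i).+1%:R^-1)) `<=` K.
Proof.
move=> NN0 x xN i; have := xN i; rewrite !mxE => /andP[-> h] /=.
by apply: le_trans h _; rewrite lerD2l lef_pV2 ?posrE// ler_nat ltnS.
Qed.

Let cutK N : (forall i, (N0 <= N i)%N) -> cpt_supp K (fun x => f x * cutoff a b N x).
Proof.
move=> NN0; split=> // x xK; rewrite cutoff_out ?mulr0//.
by move=> /(subK NN0).
Qed.

(** The gradient identity for [f] times a cutoff, in the limit of all directions but [j]. The
    factors of these directions are not differentiated, so the bound [C] is uniform along the limit;
    it does depend on [Nj]. *)
Lemma cut_smooth Nj : (N0 <= Nj)%N -> exists C,
  [/\ bsupp K C (fun x => partial j f x * (ran Nj x * chi x) + f x * dra Nj x * chi x),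
     bsupp K C1 (fun x => f x * (ran Nj x * chi x)) &
  \int[leb R m.+1]_(x in A) (partial j f x * (ran Nj x * chi x) + f x * dra Nj x * chi x) =
   - (\int[(D j).1]_(x in Omega) (f x * (ran Nj x * chi x)) -
      \int[(D j).2]_(x in Omega) (f x * (ran Nj x * chi x)))].
Proof.
move=> NjN0; have [M M0 HM] := dramp_bound R.
pose C := C2 + C1 * (M * Nj.+1%:R).
pose u k x := f x * cutoff a b (NN Nj k) x.
have NNN0 k i : (N0 <= NN Nj k i)%N by rewrite /NN; case: ifP => // _; rewrite leq_addl.
have su k : smooth (u k) by apply: smoothM => //; exact: smooth_cutoff.
have bu k : bsupp K C1 (u k).
  split=> //.
  - by apply: continuous_measurable_rV; exact: smooth_continuous.
  - by move=> x; rewrite normrM -[leRHS]mulr1 ler_pM// cutoff_le1.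
  - by have [] := cutK (NNN0 k).
have pu k x : partial j (u k) x = partial j f x * cutoff a b (NN Nj k) x +
    f x * dra Nj x * prod_but a b (NN Nj k) j x.
  by rewrite partial_cutoff// /NN eqxx.
have bpu k : bsupp K C (partial j (u k)).
  split.
  - by rewrite addr_ge0// mulr_ge0// mulr_ge0// ltW.
  - by apply: continuous_measurable_rV; apply: smooth_continuous; exact: smooth_partial.
  - move=> x; rewrite pu; apply: le_trans (ler_normD _ _) _; apply: lerD.
      by rewrite normrM -[leRHS]mulr1 ler_pM// cutoff_le1.
    rewrite normrM -[leRHS]mulr1 ler_pM// ?prod_but_le1//.
    by rewrite normrM ler_pM//; exact: HM.
  - by have [] := cpt_supp_partial j (cutK (NNN0 k)).
have cutcvg x : cutoff a b (NN Nj k) x @[k --> \oo] --> ran Nj x * chi x.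
  under eq_fun do rewrite (cutoffE _ _ _ j) {1}/NN eqxx.
  by apply: cvgM; [exact: cvg_cst|exact: prodbut_cvg].
have ucvg x : u k x @[k --> \oo] --> f x * (ran Nj x * chi x).
  by apply: cvgM; [exact: cvg_cst|exact: cutcvg].
have pucvg x : partial j (u k) x @[k --> \oo] -->
    partial j f x * (ran Nj x * chi x) + f x * dra Nj x * chi x.
  under eq_fun do rewrite pu.
  apply: cvgD; apply: cvgM; [exact: cvg_cst|exact: cutcvg|exact: cvg_cst|exact: prodbut_cvg].
have [bg lg] := bsupp_dct mK Koo mA bpu pucvg.
have [bf l1] := bsupp_dct mK D1oo mO bu ucvg.
have [_ l2] := bsupp_dct mK D2oo mO bu ucvg.
exists C; split=> //.
apply: (cvg_unique (@Rhausdorff R) lg).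
rewrite (_ : (fun k => _) = fun k => - (\int[(D j).1]_(x in Omega) u k x - \int[(D j).2]_(x in Omega) u k x)).
  by apply: cvgN; apply: cvgB.
have tu k : test_function Omega (u k).
  by split; [exact: su|exists K; split=> //; case: (cutK (NNN0 k))].
by apply/funext => k; exact: (is_gradient_test j oO mA gD (tu k)).
Qed.

Let bchi x : `|chi x| <= 1. Proof. exact: indic_le1. Qed.

Let ranchi_cvg x : ran (k + N0)%N x * chi x @[k --> \oo] --> (\1_(hbox a b) x : R).
Proof.
rewrite (indic_hbox _ _ _ j); apply: cvgM; last exact: cvg_cst.
by rewrite (cvg_shiftn N0 (fun k => ramp (a ord0 j) (b ord0 j) k (x ord0 j))); exact: ramp_cvg.
Qed.

Let ranchi_out k x : (N0 <= k)%N -> ~ K x -> ran k x * chi x = 0.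
Proof.
move=> kN0 Kx.
have [h1|h1] := pselect (hbox (delete j a) (delete j b) (delete j x)); last by rewrite /chi (indic0 _ h1) mulr0.
rewrite /ran ramp_out ?mul0r// => h2; apply: Kx => i; rewrite mxE.
have [l ->|->] := unliftP j i.
  have := h1 l; rewrite !mxE => /andP[/ltW -> h] /=.
  by apply: le_trans h _; rewrite lerDl invr_ge0.
by move: h2 => /andP[-> h] /=; apply: le_trans h _; rewrite lerD2l lef_pV2 ?posrE// ler_nat ltnS.
Qed.

Let bsupp_ranchi (g : E -> R) C k : continuous g -> (forall x, `|g x| <= C) -> (N0 <= k)%N ->
  bsupp K C (fun x => g x * (ran k x * chi x)).
Proof.
move=> cg gC kN0; split.
- exact: le_trans (normr_ge0 _) (gC 0).
- apply: measurable_funM; first exact: continuous_measurable_rV.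
  apply: measurable_funM.
    apply: continuous_measurable_rV => x.
    have s1 : smoothk 1 (ran k) by apply: smoothk_coord; exact: smooth1_ramp.
    by apply: differentiable_continuous; case: s1.
  have mi : measurable_fun setT (\1_(hbox (delete j a) (delete j b)) : 'rV[R]_m -> R).
    by apply: measurable_indic; exact: measurable_hbox.
  exact: (measurableT_comp mi (measurable_del j)).
- by move=> x; rewrite normrM -[leRHS]mulr1 ler_pM// normrM mulr_ile1// ramp_le1.
- by move=> x xK; rewrite ranchi_out ?mulr0.
Qed.

Lemma bsupp_dchi k : (N0 <= k)%N -> exists C, bsupp K C (fun x => f x * dra k x * chi x).
Proof.
move=> kN0; have [C [[C0 mg gC g0] _ _]] := cut_smooth kN0.
have [_ m2 b2 o2] := bsupp_ranchi (smooth_continuous (smooth_partial j sf)) fC2 kN0.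
have e x : f x * dra k x * chi x = (partial j f x * (ran k x * chi x) + f x * dra k x * chi x) -
  partial j f x * (ran k x * chi x) by rewrite addrAC subrr add0r.
exists (C + C2); split.
- by rewrite addr_ge0.
- by under eq_fun do rewrite e; exact: measurable_funB.
- by move=> x; rewrite e; apply: le_trans (ler_normB _ _) _; rewrite lerD.
- by move=> x xK; rewrite e g0// o2// subrr.
Qed.

Let Rintegral_indic (mu : {measure set E -> \bar R}) S B g :
  \int[mu]_(x in S) (g x * \1_B x) = \int[mu]_(x in S `&` B) g x.
Proof.
rewrite Rintegral_mkcond [RHS]Rintegral_mkcond; apply: eq_Rintegral => x _.
rewrite !patchE in_setI indicE.
by case: (x \in S); case: (x \in B); rewrite ?mulr1 ?mulr0.
Qed.

Let hboxO : Omega `&` hbox a b = hbox a b.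
Proof.
apply/setIidr => x xab; apply: KO => i; rewrite mxE.
have /andP[/ltW -> h] := xab i; rewrite /=; apply: le_trans h _.
by rewrite lerDl invr_ge0.
Qed.

(** When direction [j] is sharpened too, the term with the derivative of the ramp has no uniform
    bound; its limit is deduced from those of the other terms, where dominated convergence
    applies. *)
Lemma cut_limit :
  \int[leb R m.+1]_(x in A) (f x * dra k x * chi x) @[k --> \oo] -->
  - (\int[(D j).1]_(x in hbox a b) f x - \int[(D j).2]_(x in hbox a b) f x) -
  \int[leb R m.+1]_(x in A `&` hbox a b) partial j f x.
Proof.
rewrite -(cvg_shiftn N0 (fun k => \int[leb R m.+1]_(x in A) (f x * dra k x * chi x))).
have kN0 k : (N0 <= k + N0)%N by rewrite leq_addl.
have cpf := smooth_continuous (smooth_partial j sf).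
have [_ l1] := bsupp_dct mK D1oo mO (fun k => bsupp_ranchi (smooth_continuous sf) fC1 (kN0 k))
  (fun x => cvgM (cvg_cst (f x)) (@ranchi_cvg x)).
have [_ l2] := bsupp_dct mK D2oo mO (fun k => bsupp_ranchi (smooth_continuous sf) fC1 (kN0 k))
  (fun x => cvgM (cvg_cst (f x)) (@ranchi_cvg x)).
have [_ l3] := bsupp_dct mK Koo mA (fun k => bsupp_ranchi cpf fC2 (kN0 k))
  (fun x => cvgM (cvg_cst (partial j f x)) (@ranchi_cvg x)).
rewrite !Rintegral_indic hboxO in l1 l2 l3.
rewrite (_ : (fun k => _) = fun k =>
   - (\int[(D j).1]_(x in Omega) (f x * (ran (k + N0)%N x * chi x)) -
      \int[(D j).2]_(x in Omega) (f x * (ran (k + N0)%N x * chi x))) -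
   \int[leb R m.+1]_(x in A) (partial j f x * (ran (k + N0)%N x * chi x))).
  by apply: cvgB; [apply: cvgN; apply: cvgB|].
apply/funext => k.
have [C [_ _ <-]] := cut_smooth (kN0 k).
have [C' bd] := bsupp_dchi (kN0 k).
have bp := bsupp_ranchi cpf fC2 (kN0 k).
rewrite RintegralD//; [|exact: bsupp_integrable bp|exact: bsupp_integrable bd].
by rewrite addrAC subrr add0r.
Qed.

Definition slice_int (g : E -> R) (S : set E) t : R :=
  \int[leb R m]_(w in hbox (delete j a) (delete j b)) (g (insert j (t, w)) * \1_S (insert j (t, w))).

(** The box is widened by 1 in direction [j] only: this makes [H] a bounded measurable function on
    the whole line that still coincides with the slice integral wherever the ramps vary, as
    [k.+1%:R^-1 <= 1]. *)
Let a1 : E := insert j (a ord0 j - 1, delete j a).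
Let b1 : E := insert j (b ord0 j + 1, delete j b).
Let G x : R := f x * \1_A x * \1_(hbox a1 b1) x.
Let H t := \int[leb R m]_w G (insert j (t, w)).

Let H_slice t : a ord0 j - 1 < t <= b ord0 j + 1 -> H t = slice_int f A t.
Proof.
move=> tab; rewrite /H /slice_int [RHS]Rintegral_mkcond; apply: eq_Rintegral => w _.
rewrite patchE /G; have := in_hbox_ins j a1 b1 t w.
rewrite !ins_id !del_ins /= => h.
case: ifPn => [/set_mem wq|/negP wq].
  by rewrite [X in _ * X]indic1 ?mulr1//; apply/h.
by rewrite [X in _ * X]indic0 ?mulr0// => /h [_ /mem_set].
Qed.

Let K1 := cbox a1 b1.
Let bG : bsupp K1 C1 G.
Proof.
split=> //.
- apply: measurable_funM; last by apply: measurable_indic; exact: measurable_hbox.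
  apply: measurable_funM; last exact: measurable_indic.
  by apply: continuous_measurable_rV; exact: smooth_continuous.
- move=> x; rewrite normrM -[leRHS]mulr1 ler_pM ?indic_le1//.
  by rewrite normrM -[leRHS]mulr1 ler_pM ?indic_le1.
- move=> x xK; rewrite /G [X in _ * X]indic0 ?mulr0// => h; apply: xK => i.
  by have /andP[/ltW -> ->] := h i.
Qed.

Let mH : measurable_fun setT H.
Proof.
have [ig _] := leb_int_ins j (compact_measurable (@compact_cbox _ _ a1 b1)) (leb_compact_lty (@compact_cbox _ _ a1 b1)) bG.
by apply: measurableT_comp => //; exact: (measurable_fubini_F ig).
Qed.

Let bH t : `|H t| <= C1 * fine (leb R m (hbox (delete j a) (delete j b))).
Proof.
pose q := hbox (delete j a) (delete j b).
have mq : measurable q by exact: measurable_hbox.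
have qoo : (leb R m q < +oo)%E by exact: leb_hbox_lty.
have bGt : bsupp q C1 (fun w => G (insert j (t, w))).
  split=> //.
  - case: bG => _ mG _ _; apply: (measurableT_comp mG).
    apply: (measurableT_comp (measurable_ins j)); exact: measurable_pair1.
  - by case: bG => _ _ + _ w; apply.
  - move=> w wq; rewrite /G [X in _ * X]indic0 ?mulr0// => /in_hbox_ins [_].
    by rewrite !del_ins.
have iG := bsupp_integrable mq qoo (measurableT) bGt.
apply: le_trans (le_normr_Rintegral _ iG) _ => //.
rewrite -Rintegral_cst// [leRHS]Rintegral_mkcond; apply: le_Rintegral => //.
- exact: integrable_norm.
- have : bsupp q C1 (patch (cst 0) q (cst C1)).
    split=> //.
    + by apply/(measurable_restrictT _ mq)=> //.
    + by move=> w; rewrite patchE; case: ifP => _; rewrite /= ?normr0// ger0_norm.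
    + by move=> w wq; rewrite patchE memNset.
  by move=> h; exact: bsupp_integrable h.
- case: bGt => _ _ h1 h2 w _; rewrite patchE; case: ifPn => [_|/negP wq]; first exact: h1.
  by rewrite h2 ?normr0// => /mem_set.
Qed.

Let rlH p : p = a ord0 j \/ p = b ord0 j ->
  right_lebesgue_pt (slice_int f A) p -> right_lebesgue_pt H p.
Proof.
move=> hp; rewrite /right_lebesgue_pt.
set u := (fun k : nat => _); set v := (fun k : nat => _); suff -> : u = v by [].
apply/funext => k; congr (_ * _); apply: eq_Rintegral => t.
rewrite inE /= in_itv /= => /andP[h1 h2].
have k1 : k.+1%:R^-1 <= 1 :> R by rewrite invf_le1// ler1n.
have := ab j => abj.
move: (k.+1%:R^-1) h2 k1 => z h2 z1.
have pab : a ord0 j <= p <= b ord0 j by case: hp => ->; rewrite lexx ab.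
by rewrite !H_slice//; apply/andP; split; lra.
Qed.

Lemma int_slice k : (N0 <= k)%N -> \int[leb R m.+1]_(x in A) (f x * dra k x * chi x) =
  \int[lebesgue_measure]_t (dramp (a ord0 j) (b ord0 j) k t * H t).
Proof.
move=> kN0; have [C [C0 mg gC g0]] := bsupp_dchi kN0.
have e x : (f x * dra k x * chi x) * \1_A x = dra k x * G x.
  have [[/andP[h1 h2]]|h] := pselect (a ord0 j <= x ord0 j <= b ord0 j + k.+1%:R^-1); last first.
    rewrite /dra [dramp _ _ _ _](_ : _ = 0); first by rewrite mulr0 !mul0r.
    rewrite /dramp -!/(kernel _ _ _) !kernel_out ?subrr//.
      by move=> /andP[h1 h2]; apply: h; rewrite h2 andbT; exact: le_trans (ab j) h1.
    move=> /andP[h1 h2]; apply: h; rewrite h1 /=; apply: le_trans h2 _.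
    by rewrite lerD2r.
  have k1 : k.+1%:R^-1 <= 1 :> R by rewrite invf_le1// ler1n.
  rewrite /G (indic_hbox _ _ _ j) !ins_id !del_ins [X in _ = _ * (_ * (X * _))]indic1 ?mul1r.
    by rewrite -/(chi x); ring.
  rewrite /= in_itv /=; move: (k.+1%:R^-1) h2 k1 => z h2 z1.
  by apply/andP; split; lra.
have bv : bsupp K C (fun x => dra k x * G x).
  split => //.
  - under eq_fun do rewrite -e; apply: measurable_funM => //; exact: measurable_indic.
  - by move=> x; rewrite -e normrM -[leRHS]mulr1 ler_pM// indic_le1.
  - by move=> x xK; rewrite -e g0// mul0r.
have -> : \int[leb R m.+1]_(x in A) (f x * dra k x * chi x) = \int[leb R m.+1]_x (dra k x * G x).
  rewrite -[in LHS](setTI A) -Rintegral_indic; apply: eq_Rintegral => x _; exact: e.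
rewrite /Rintegral; have [ig ->] := leb_int_ins j mK Koo bv.
rewrite -integral12_prod_meas1//; congr fine; apply: eq_integral => t _.
rewrite /fubini_F.
have [ig' _] := leb_int_ins j (compact_measurable (@compact_cbox _ _ a1 b1)) (leb_compact_lty (@compact_cbox _ _ a1 b1)) bG.
rewrite /H EFinM /Rintegral.
under eq_integral do rewrite /dra ins_id EFinM /=.
have bGt : bsupp (hbox (delete j a) (delete j b)) C1 (fun w => G (insert j (t, w))).
  split=> //.
  - case: bG => _ mG _ _; apply: (measurableT_comp mG).
    apply: (measurableT_comp (measurable_ins j)); exact: measurable_pair1.
  - by case: bG => _ _ + _ w; apply.
  - move=> w wq; rewrite /G [X in _ * X]indic0 ?mulr0// => /in_hbox_ins [_].
    by rewrite !del_ins.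
have iG := bsupp_integrable (measurable_hbox _ _) (leb_hbox_lty _ _) (measurableT) bGt.
by rewrite integralZl// fineK//; exact: integrable_fin_num.
Qed.

(** The limit of [cut_limit] is computed a second time: by Fubini the sequence is the integral of
    [dramp] against the slice integrals, that is, a kernel at the lower face minus one at the upper
    face, and [kernel_cvg] applies to both. *)
Lemma cut_formula : right_lebesgue_pt (slice_int f A) (a ord0 j) ->
  right_lebesgue_pt (slice_int f A) (b ord0 j) ->
  \int[leb R m.+1]_(x in A `&` hbox a b) partial j f x =
  - (\int[(D j).1]_(x in hbox a b) f x - \int[(D j).2]_(x in hbox a b) f x) +
  (slice_int f A (b ord0 j) - slice_int f A (a ord0 j)).
Proof.
move=> rla rlb.
have abj := ab j.
have la := kernel_cvg mH bH (rlH (or_introl erefl) rla).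
have lb := kernel_cvg mH bH (rlH (or_intror erefl) rlb).
rewrite !H_slice in la lb; [|by apply/andP; split; lra..].
have l2 : \int[leb R m.+1]_(x in A) (f x * dra k x * chi x) @[k --> \oo] -->
    slice_int f A (a ord0 j) - slice_int f A (b ord0 j).
  apply: cvg_trans (cvgB la lb); apply: near_eq_cvg.
  near=> k; rewrite int_slice; last by near: k; exact: nbhs_infty_ge.
  have ik p : lebesgue_measure.-integrable setT (EFin \o (fun t => kernel p k t * H t)).
    have [M M0 HM] := kernel_bound R.
    have loo : (lebesgue_measure `[p, (p + k.+1%:R^-1)%R]%classic < +oo)%E.
      by rewrite lebesgue_measure_itv/=; case: ifP => _; rewrite ?ltry// -EFinB ltry.
    have bs : bsupp (`[p, p + k.+1%:R^-1]%classic : set (measurableTypeR R))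
       (M * k.+1%:R * (C1 * fine (leb R m (hbox (delete j a) (delete j b)))))
       (fun t => kernel p k t * H t).
      split.
      - by rewrite mulr_ge0// ?mulr_ge0 ?fine_ge0// ltW.
      - by apply: measurable_funM => //; exact: measurable_kernel.
      - by move=> t; rewrite normrM ler_pM.
      - by move=> t; rewrite /= in_itv /= => tp; rewrite kernel_out// mul0r.
    by apply: (bsupp_integrable _ loo _ bs) => //; exact: measurable_itv.
  transitivity (\int[lebesgue_measure]_t (kernel (a ord0 j) k t * H t) -
    \int[lebesgue_measure]_t (kernel (b ord0 j) k t * H t)); first by [].
  rewrite -RintegralB//; apply: eq_Rintegral => t _.
  by rewrite /dramp mulrBl.
have /(_ _) := cvg_unique (@Rhausdorff R) l2 cut_limit.
set I := \int[_]_(x in A `&` _) _; set sa := slice_int _ _ _; set sb := slice_int _ _ _.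
by move=> h; lra.
Unshelve. all: by end_near. Qed.

End cut.

(** * Uniqueness of the gradient, and slices *)

Section measure_tools.
Context d (T : measurableType d) (R : realType).
Implicit Types (mu : {measure set T -> \bar R}).

(** Made disjoint, the pieces of the cover cut [B] into sets on which the measures agree. *)
Lemma measure_eq_cover (m1 m2 : {measure set T -> \bar R}) (F : nat -> set T) :
  (forall k, measurable (F k)) ->
  (forall k X, measurable X -> m1 (X `&` F k) = m2 (X `&` F k)) ->
  forall B, measurable B -> B `<=` \bigcup_k F k -> m1 B = m2 B.
Proof.
move=> mF h B mB BF.
have mS := seqDU_measurable mF.
have -> : B = \bigcup_k (B `&` seqDU F k).
  by rewrite -setI_bigcupr -seqDU_bigcup_eq; apply/esym/setIidl.
have tB : trivIset setT (fun k => B `&` seqDU F k).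
  by apply: trivIset_setIl; exact: trivIset_seqDU.
rewrite !measure_bigcup// => [|k _|k _]; try exact: measurableI.
apply: eq_eseriesr => k _.
have -> : B `&` seqDU F k = (B `&` seqDU F k) `&` F k.
  by apply/esym/setIidl => x [_ h1]; exact: subset_seqDU h1.
by apply: h; exact: measurableI.
Qed.

Lemma Rintegral_indic mu S B (g : T -> R) :
  \int[mu]_(x in S) (g x * \1_B x) = \int[mu]_(x in S `&` B) g x.
Proof.
rewrite Rintegral_mkcond [RHS]Rintegral_mkcond; apply: eq_Rintegral => x _.
rewrite !patchE in_setI indicE.
by case: (x \in S); case: (x \in B); rewrite ?mulr1 ?mulr0.
Qed.

End measure_tools.

Section covering.
Variables (R : realType) (n : nat).
Local Notation E := 'rV[R]_n.

Lemma qcbox_in_ball (y : E) (e : R) : 0 < e ->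
  exists p : 'rV[rat]_n * 'rV[rat]_n, [/\ @qbox R n p y,
    forall i, (map_mx ratr p.1 : E) ord0 i <= (map_mx ratr p.2 : E) ord0 i &
    cbox (map_mx ratr p.1) (map_mx ratr p.2) `<=` ball y e].
Proof.
move=> e0.
have /choice[f fP] (i : 'I_n) : exists q : rat, (ratr q : R) \in `]y ord0 i - e, y ord0 i[.
  by have [q qP] := @rat_in_itvoo R (y ord0 i - e) (y ord0 i) ltac:(lra); exists q.
have /choice[g gP] (i : 'I_n) : exists q : rat, (ratr q : R) \in `]y ord0 i, y ord0 i + e[.
  by have [q qP] := @rat_in_itvoo R (y ord0 i) (y ord0 i + e) ltac:(lra); exists q.
have fi i : y ord0 i - e < ratr (f i) < y ord0 i by have := fP i; rewrite in_itv.
have gi i : y ord0 i < ratr (g i) < y ord0 i + e by have := gP i; rewrite in_itv.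
exists (\row_i f i, \row_i g i); split.
- by move=> i /=; rewrite !mxE; have /andP[_ ->] := fi i; have /andP[/ltW -> _] := gi i.
- move=> i; rewrite !mxE; have /andP[_ h1] := fi i; have /andP[h2 _] := gi i.
  exact/ltW/(lt_trans h1).
- move=> v vq; split => // i j; rewrite (ord1 i) /ball /=.
  have := vq j; rewrite /= !mxE => /andP[h1 h2].
  have /andP[h3 h4] := fi j; have /andP[h5 h6] := gi j.
  by rewrite ltr_distlC; apply/andP; split; [exact: lt_le_trans h1|exact: le_lt_trans h6].
Qed.

(** Requiring the closed box to lie in [Omega] makes every member relatively compact, hence of
    finite measure; indices that encode no such box give the empty set. *)
Definition qcover (Omega : set E) (k : nat) : set E :=
  if unpickle k is Some p then
    (if `[< cbox (map_mx ratr p.1) (map_mx ratr p.2) `<=` Omega >] then @qbox R n p else set0)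
  else set0.

Lemma measurable_qcover Omega k : measurable (qcover Omega k).
Proof.
rewrite /qcover; case: unpickle => [p|]//; case: ifP => _ //.
exact: measurable_hbox.
Qed.

Lemma qcoverP Omega : open Omega -> Omega = \bigcup_k qcover Omega k.
Proof.
move=> oO; apply/seteqP; split=> [y Oy|y [k _]].
  have /nbhs_ballP[e /= e0 eO] := open_nbhs_nbhs (conj oO Oy : open_nbhs _ _).
  have [p [py pab pe]] := qcbox_in_ball y e0.
  exists (pickle p) => //; rewrite /qcover pickleK.
  by rewrite asboolT//; apply: subset_trans eO.
rewrite /qcover; case: unpickle => // p; case: asboolP => // pO h; apply: pO => i.
by have /andP[/ltW -> ->] := h i.
Qed.

End covering.

Section gradient_unique.
Variables (R : realType) (m : nat).
Local Notation E := 'rV[R]_m.+1.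
Implicit Types (Omega A : set E) (D : vmeasure R m.+1).

(** For [f = 1] the sequence in [cut_limit] involves [A] but not [D], so its limit does not depend
    on the choice of the gradient. *)
Lemma gradient_box Omega A D D' j (a b : E) : open Omega -> measurable A ->
  is_gradient Omega A D -> is_gradient Omega A D' ->
  (forall i, a ord0 i <= b ord0 i) -> cbox a b `<=` Omega ->
  fine ((D j).1 (hbox a b)) - fine ((D j).2 (hbox a b)) =
  fine ((D' j).1 (hbox a b)) - fine ((D' j).2 (hbox a b)).
Proof.
move=> oO mA gD gD' ab abO.
have [N0 HN] := cbox_enlarge oO ab abO.
have sf : smooth (fun _ : E => 1 : R) by exact: smooth_cst.
have f1 (x : E) : `|(fun=> 1) x : R| <= 1 by rewrite normr1.
have f2 (x : E) : `|partial j (fun=> 1) x : R| <= 0 by rewrite partial_cst normr0.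
have /(_ _) h := cvg_unique (@Rhausdorff R) (cut_limit oO mA gD sf f1 f2 ab HN)
  (cut_limit oO mA gD' sf f1 f2 ab HN).
rewrite !Rintegral_cst ?mul1r// in h; try exact: measurable_hbox.
by have /addIr/oppr_inj := h.
Qed.

(** The components are differences of measures, so the comparison is made between the cross sums
    [(D j).1 + (D' j).2] and [(D' j).1 + (D j).2], on rational boxes inside one closed box of
    [Omega] and then over a countable cover. *)
Lemma gradient_unique Omega A D D' j B : open Omega -> measurable A ->
  is_gradient Omega A D -> is_gradient Omega A D' ->
  measurable B -> relatively_compact Omega B ->
  fine ((D j).1 B) - fine ((D j).2 B) = fine ((D' j).1 B) - fine ((D' j).2 B).
Proof.
move=> oO mA gD gD' mB [K [cK KO BK]].
have fin (D0 : vmeasure R m.+1) X : is_gradient Omega A D0 -> measurable X ->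
    (exists K, [/\ compact K, K `<=` Omega & X `<=` K]) ->
    (D0 j).1 X \is a fin_num /\ (D0 j).2 X \is a fin_num.
  move=> [lf _] mX [K' [cK' KO' XK']]; have [h1 h2] := lf j K' cK' KO'.
  by rewrite !ge0_fin_numE//; split; [apply: le_lt_trans h1|apply: le_lt_trans h2];
    apply: le_measure => //; rewrite inE//; exact: compact_measurable.
pose m1 := [the {measure set E -> \bar R} of measure_add (D j).1 (D' j).2].
pose m2 := [the {measure set E -> \bar R} of measure_add (D' j).1 (D j).2].
have m1E X : m1 X = ((D j).1 X + (D' j).2 X)%E by exact: measure_addE.
have m2E X : m2 X = ((D' j).1 X + (D j).2 X)%E by exact: measure_addE.
suff : m1 B = m2 B.
  rewrite m1E m2E.
  have [f1 f2] := fin D B gD mB (ex_intro _ K (And3 cK KO BK)).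
  have [f3 f4] := fin D' B gD' mB (ex_intro _ K (And3 cK KO BK)).
  rewrite -(fineK f1) -(fineK f2) -(fineK f3) -(fineK f4) -!EFinD => -[] h.
  by rewrite /=; lra.
apply: (@measure_eq_cover _ _ _ m1 m2 (qcover Omega)) => //.
- exact: measurable_qcover.
- move=> k; rewrite /qcover; case: unpickle => [p|]; last by move=> X mX; rewrite setI0 !measure0.
  case: asboolP => pO; last by move=> X mX; rewrite setI0 !measure0.
  move=> X mX.
  have mp : measurable (@qbox R _ p) by exact: measurable_hbox.
  have := @rV_measure_unique _ _ [the measure _ _ of mrestr m1 mp] [the measure _ _ of mrestr m2 mp].
  rewrite /= /mrestr; apply => // q; rewrite /qbox hboxI.
    set a := \row_i _; set b := \row_i _.
    have [ab|] := pselect (forall i, a ord0 i <= b ord0 i); last first.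
      by move=> /existsNP[i /negP]; rewrite -ltNge => /ltW /hbox_empty ->; rewrite !measure0.
    have abO : cbox a b `<=` Omega.
      move=> x xab; apply: pO => i; have := xab i; rewrite !mxE ge_max le_min.
      by move=> /andP[/andP[_ ->] /andP[_ ->]].
    have := gradient_box j oO mA gD gD' ab abO.
    rewrite m1E m2E.
    have rc : exists K, [/\ compact K, K `<=` Omega & hbox a b `<=` K].
      exists (cbox a b); split => //; first exact: compact_cbox.
      by move=> x h i; have /andP[/ltW -> ->] := h i.
    have [f1 f2] := fin D _ gD (measurable_hbox a b) rc.
    have [f3 f4] := fin D' _ gD' (measurable_hbox a b) rc.
    by rewrite -(fineK f1) -(fineK f2) -(fineK f3) -(fineK f4) -!EFinD /= => h; congr (_%:E); lra.
  set a := \row_i _; set b := \row_i _.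
  have rc : exists K, [/\ compact K, K `<=` Omega & hbox a b `<=` K].
    exists (cbox (map_mx ratr p.1) (map_mx ratr p.2)); split => //; first exact: compact_cbox.
    move=> x h i; have := h i; rewrite !mxE gt_max le_min.
    by move=> /andP[/andP[_ /ltW ->] /andP[_ ->]].
  have [f1 f2] := fin D _ gD (measurable_hbox a b) rc.
  have [f3 f4] := fin D' _ gD' (measurable_hbox a b) rc.
  by rewrite m1E -ge0_fin_numE ?adde_ge0// fin_numD f1 f4.
- by rewrite -qcoverP//; apply: subset_trans KO.
Qed.

End gradient_unique.

Section slabs.
Variables (R : realType) (m : nat).
Local Notation E := 'rV[R]_m.+1.
Implicit Types (A : set E) (C : set 'rV[R]_m) (j : 'I_m.+1).

Definition slice j A (t : R) : set 'rV[R]_m := [set w | A (insert j (t, w))].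

Lemma measurable_sl j A t : measurable A -> measurable (slice j A t).
Proof.
move=> mA; rewrite -[X in measurable X]setTI.
apply: (measurableT_comp (measurable_ins j) (measurable_pair1 t)) => //.
Qed.

Lemma measurable_leb_sl j A C : measurable A -> measurable C ->
  measurable_fun setT (fun t => leb R m (C `&` slice j A t)).
Proof.
move=> mA mC.
have mS : measurable (@insert R m j @^-1` A `&` (setT `*` C)).
  apply: measurableI; last exact: measurableX.
  by rewrite -[X in measurable X]setTI; exact: measurable_ins.
have := measurable_fun_xsection (leb R m) mS; congr measurable_fun.
apply/funext => t /=; congr (leb R m _); apply/seteqP; split => w.
  by rewrite /xsection /= inE /= => -[h1 [_ h2]].
by rewrite /xsection /= inE /= => -[h1 h2].
Qed.

(* Almost every height is such for a given [A]; at these heights the cut formula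
   has no error term. *)
Definition lebesgue_slice j A (s : R) := forall q : 'rV[rat]_m * 'rV[rat]_m,
  right_lebesgue_pt (fun t => fine (leb R m (@qbox R m q `&` slice j A t))) s.

(** The segment of length [k.+1%:R^-1] lies in the ball of radius twice that, whose length is four
    times that: passing to one side costs a factor 4. *)
Lemma lebesgue_pt_right (H : R -> R) (C p : R) : measurable_fun setT H -> (forall t, `|H t| <= C) ->
  lebesgue_pt H p -> right_lebesgue_pt H p.
Proof.
move=> mH HC lp.
have mc : measurable_fun setT (fun t => `|H t - H p|).
  by apply: measurableT_comp => //; exact: measurable_funB.
have C2 t : `|H t - H p| <= C + C by apply: le_trans (ler_normB _ _) _; rewrite lerD.
have e0 k : 0 < 2 * k.+1%:R^-1 :> R by rewrite mulr_gt0// invr_gt0.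
have c0 : (fun k : nat => 2 * k.+1%:R^-1 : R) @ \oo --> (0 : R).
  by rewrite -(mulr0 2); apply: cvgM; [exact: cvg_cst|exact: cvg_harmonic].
have dc : (fun k : nat => fine (davg H p (2 * k.+1%:R^-1))) @ \oo --> (0 : R).
  have c0' : (fun k : nat => 2 * k.+1%:R^-1 : R) @ \oo --> (0 : R)^'+.
    move=> P [e /= e0' He].
    have /cvgrPdist_lt /(_ _ e0') := c0; apply: filterS => k hk.
    exact: He.
  by apply: fine_cvg; apply: (cvg_comp _ _ c0' lp).
have dc4 : (fun k : nat => 4 * fine (davg H p (2 * k.+1%:R^-1))) @ \oo --> (0 : R).
  by rewrite -(mulr0 4); apply: cvgM; [exact: cvg_cst|exact: dc].
apply: (squeeze_cvgr _ (cvg_cst 0) dc4); near=> k; apply/andP; split.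
  by rewrite mulr_ge0//; apply: Rintegral_ge0.
pose B := ball p (2 * k.+1%:R^-1).
have mB : measurable (B : set (measurableTypeR R)) by exact: measurable_ball.
have muB : lebesgue_measure (B : set (measurableTypeR R)) = (4 * k.+1%:R^-1)%:E.
  rewrite /B lebesgue_measure_ball ?ltW// -mulr_natr; congr (_%:E); ring.
have Boo : (lebesgue_measure (B : set (measurableTypeR R)) < +oo)%E by rewrite muB ltry.
have iB : lebesgue_measure.-integrable (B : set (measurableTypeR R)) (EFin \o (fun t => `|H t - H p|)).
  apply: (measurable_bounded_integrable mB Boo); first exact: measurable_funTS.
  by exists (C + C); split; [exact: num_real|move=> M CM x _; rewrite /= normr_id; apply: le_trans (C2 x) (ltW CM)].
have -> : davg H p (2 * k.+1%:R^-1) = ((4 * k.+1%:R^-1)^-1 * \int[lebesgue_measure]_(t in B) `|H t - H p|)%:E.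
  rewrite /davg /iavg -/B muB inver.
  have -> : (4 * k.+1%:R^-1 == 0 :> R) = false by apply/negbTE; rewrite mulf_neq0// invr_neq0.
  by rewrite EFinM; congr (_ * _)%E; rewrite /Rintegral fineK//; apply: integrable_fin_num.
rewrite /= invfM invrK mulrA mulrA divff// mul1r ler_wpM2l//.
rewrite /Rintegral fine_le//.
- apply: integrable_fin_num => //; apply: (integrableS mB) iB => //.
  move=> t /=; rewrite in_itv /= => /andP[h1 h2]; rewrite /B /ball /= ltr_distlC.
  have k0 : 0 < k.+1%:R^-1 :> R by rewrite invr_gt0.
  by move: (k.+1%:R^-1) k0 h2 => z z0 h2; apply/andP; split; lra.
- exact: integrable_fin_num.
- apply: ge0_subset_integral => //.
  + by apply/measurable_EFinP; exact: measurable_funTS.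
  + move=> t /=; rewrite in_itv /= => /andP[h1 h2]; rewrite /B /ball /= ltr_distlC.
    have k0 : 0 < k.+1%:R^-1 :> R by rewrite invr_gt0.
    by move: (k.+1%:R^-1) k0 h2 => z z0 h2; apply/andP; split; lra.
Unshelve. all: by end_near. Qed.

(** The differentiation theorem is applied for each of the countably many rational boxes; [pickle]
    turns the quantifier over boxes into one over integers. *)
Lemma good_ae j A : measurable A -> {ae lebesgue_measure, forall s, lebesgue_slice j A s}.
Proof.
move=> mA.
have H (k : nat) : {ae lebesgue_measure, forall s, forall q, unpickle k = Some q ->
    right_lebesgue_pt (fun t => fine (leb R m (@qbox R m q `&` slice j A t))) s}.
  case: unpickle => [q|]; last by apply: aeW.
  have mH : measurable_fun setT (fun t => fine (leb R m (@qbox R m q `&` slice j A t))).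
    by apply: measurableT_comp => //; apply: measurable_leb_sl => //; exact: measurable_hbox.
  have bH t : `|fine (leb R m (@qbox R m q `&` slice j A t))| <= fine (leb R m (@qbox R m q)).
    rewrite ger0_norm ?fine_ge0//; apply: fine_le.
    - rewrite ge0_fin_numE//; apply: le_lt_trans (leb_hbox_lty (map_mx ratr q.1) (map_mx ratr q.2)).
      by apply: measureIl; [exact: measurable_hbox|exact: measurable_sl].
    - by rewrite ge0_fin_numE//; exact: leb_hbox_lty.
    - by apply: measureIl; [exact: measurable_hbox|exact: measurable_sl].
  have li : locally_integrable setT (fun t => fine (leb R m (@qbox R m q `&` slice j A t))).
    split => //; first exact: openT.
    move=> K _ cK.
    have mK : measurable (K : set (measurableTypeR R)).
      by apply: closed_measurable; apply: compact_closed => //; exact: Rhausdorff.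
    apply: (@le_lt_trans _ _ (\int[lebesgue_measure]_(x in K) (fine (leb R m (@qbox R m q)))%:E)%E).
      apply: ge0_le_integral => //.
      - by apply/measurable_EFinP; apply: measurableT_comp => //; exact: measurable_funTS.
      - by move=> x _; rewrite lee_fin.
    by rewrite integral_cst// lte_mul_pinfty ?lee_fin ?fine_ge0//; exact: compact_finite_measure.
  have := lebesgue_differentiation li; apply: (@filterS _ _ (ae_filter_ringOfSetsType _)) => s hs q' [<-].
  exact: (lebesgue_pt_right mH bH hs).
have := ae_foralln H; apply: (@filterS _ _ (ae_filter_ringOfSetsType _)) => s hs q.
exact: (hs (pickle q) q (pickleK q)).
Qed.

Definition slab j (s t : R) C : set E := [set x : E | s < x ord0 j <= t /\ C (delete j x)].

Lemma measurable_slab j s t C : measurable C -> measurable (slab j s t C).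
Proof.
move=> mC.
rewrite (_ : slab _ _ _ _ = ((fun x : E => x ord0 j : measurableTypeR R) @^-1` `]s, t]%classic) `&` (@delete R m j @^-1` C)).
  by apply: measurableI; rewrite -[X in measurable X]setTI;
    [apply: measurable_coord_rV|apply: measurable_del].
by apply/seteqP; split => x; rewrite /slab /= in_itv.
Qed.

Lemma slab_hbox j s t (a b : 'rV[R]_m) : slab j s t (hbox a b) = hbox (insert j (s, a)) (insert j (t, b)).
Proof.
apply/seteqP; split => x.
  by move=> [h1 h2]; rewrite -(ins_del j x); apply/in_hbox_ins; rewrite !ins_id !del_ins.
by rewrite -{1}(ins_del j x) => /in_hbox_ins; rewrite !ins_id !del_ins.
Qed.

Lemma slice_int1 j (a b : E) A t : measurable A ->
  slice_int j a b (fun=> 1) A t = fine (leb R m (hbox (delete j a) (delete j b) `&` slice j A t)).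
Proof.
move=> mA; rewrite /slice_int.
rewrite -[RHS]mul1r -Rintegral_cst; last first.
  by apply: measurableI; [exact: measurable_hbox|exact: measurable_sl].
by rewrite -Rintegral_indic; apply: eq_Rintegral => w _; congr (_ * _).
Qed.

End slabs.

Section good_slices_prelim.
Variable R : realType.

Lemma delE n (j : 'I_n.+1) (v : 'rV[R]_n.+1) l : delete j v ord0 l = v ord0 (lift j l).
Proof. by rewrite mxE. Qed.

Lemma qboxIE n (p q : 'rV[rat]_n * 'rV[rat]_n) : @qbox R n p `&` qbox q =
  qbox (\row_i Num.max (p.1 ord0 i) (q.1 ord0 i), \row_i Num.min (p.2 ord0 i) (q.2 ord0 i)).
Proof.
rewrite /qbox hboxI; congr hbox; apply/rowP => i; rewrite !mxE.
  by rewrite !maxEle ler_rat; case: ifP.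
by rewrite !minEle ler_rat; case: ifP.
Qed.

Lemma balance_swap (x1 x2 y1 y2 : R) : 0 = - (x1 - x2) + (y1 - y2) -> x1 + y2 = x2 + y1.
Proof. lra. Qed.

Lemma balance_sub (x1 x2 y1 y2 : R) : x1 + y2 = x2 + y1 -> x1 - x2 = y1 - y2.
Proof. lra. Qed.

Lemma balance_le (c1 c2 a1 b1 a2 b2 d1 d2 : R) : a1 - b1 = c1 - 0 -> a2 - b2 = 0 - c2 ->
  a1 <= d1 -> b2 <= d2 -> 0 <= b1 -> 0 <= a2 -> c1 + c2 <= d1 + d2.
Proof. lra. Qed.

End good_slices_prelim.

Section good_slices.
Variables (R : realType) (m : nat).
Local Notation E := 'rV[R]_m.+1.
Variables (Omega A : set E) (D : vmeasure R m.+1).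
Hypotheses (oO : open Omega) (mA : measurable A) (gD : is_gradient Omega A D).
Variables (j : 'I_m.+1) (p0 : 'rV[rat]_m.+1 * 'rV[rat]_m.+1).
Let pa : E := map_mx ratr p0.1.
Let pb : E := map_mx ratr p0.2.
Hypothesis (pO : cbox pa pb `<=` Omega).
Let P' := hbox (delete j pa) (delete j pb).

Let mP' : measurable P'. Proof. exact: measurable_hbox. Qed.

(** The ambient box is rational so that its cross-section [P'] meets rational boxes in rational
    boxes, about which [lebesgue_slice] gives information. *)
Let P'E : P' = qbox (\row_l p0.1 ord0 (lift j l), \row_l p0.2 ord0 (lift j l)).
Proof. by rewrite /qbox; congr hbox; apply/rowP => l; rewrite !mxE. Qed.

Let slabO s t C : pa ord0 j <= s -> t <= pb ord0 j -> C `<=` P' -> slab j s t C `<=` cbox pa pb.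
Proof.
move=> as_ tb CP x [/andP[h1 h2] /CP h] i.
have [l ->|->] := unliftP j i; first by have := h l; rewrite !delE => /andP[/ltW -> ->].
by rewrite (le_trans h2 tb) andbT ltW// (le_lt_trans as_).
Qed.

Let Dfin s t C : measurable C -> pa ord0 j <= s -> t <= pb ord0 j -> C `<=` P' ->
  (D j).1 (slab j s t C) \is a fin_num /\ (D j).2 (slab j s t C) \is a fin_num.
Proof.
move=> mC h1 h2 h3; have [lf _] := gD.
have [K1 K2] := lf j _ (@compact_cbox R m.+1 pa pb) pO.
have sb := slabO h1 h2 h3.
have mc : measurable (cbox pa pb) by apply: compact_measurable; exact: compact_cbox.
have ms : measurable (slab j s t C) by exact: measurable_slab.
split.
  by rewrite ge0_fin_numE//; apply: le_lt_trans K1; apply: le_measure; rewrite ?inE.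
by rewrite ge0_fin_numE//; apply: le_lt_trans K2; apply: le_measure; rewrite ?inE.
Qed.

Let lfin (C S : set 'rV[R]_m) : measurable C -> measurable S -> C `<=` P' -> leb R m (C `&` S) \is a fin_num.
Proof.
move=> mC mS CP; rewrite ge0_fin_numE//; apply: le_lt_trans (leb_hbox_lty (delete j pa) (delete j pb)).
apply: le_measure; rewrite ?inE//; first exact: measurableI.
by move=> x [/CP].
Qed.

(* The cut formula for the constant test function. *)
Lemma slabE s t C : lebesgue_slice j A s -> lebesgue_slice j A t -> pa ord0 j <= s -> s <= t -> t <= pb ord0 j ->
  measurable C -> C `<=` P' ->
  fine ((D j).1 (slab j s t C)) - fine ((D j).2 (slab j s t C)) =
  fine (leb R m (C `&` slice j A t)) - fine (leb R m (C `&` slice j A s)).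
Proof.
move=> gs gt as_ st tb mC CP.
have mss := measurable_sl j s mA; have mst := measurable_sl j t mA.
have mS : measurable (slab j s t P') by exact: measurable_slab.
have mPs : measurable (P' `&` slice j A s) by exact: measurableI.
have mPt : measurable (P' `&` slice j A t) by exact: measurableI.
(* With the negative terms moved to the other side, both sides are finite measures in [C], so that
   rational boxes suffice. *)
pose m1 := [the {measure set 'rV[R]_m -> \bar R} of measure_add
  (push_measure [the measure _ _ of mrestr (D j).1 mS] (measurable_del j))
  [the measure _ _ of mrestr (leb R m) mPs]].
pose m2 := [the {measure set 'rV[R]_m -> \bar R} of measure_add
  (push_measure [the measure _ _ of mrestr (D j).2 mS] (measurable_del j))
  [the measure _ _ of mrestr (leb R m) mPt]].
have slI X : delete j @^-1` X `&` slab j s t P' = slab j s t (X `&` P').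
  by apply/seteqP; split => x; [move=> [h1 [h2 h3]]|move=> [h1 [h2 h3]]].
have m1E X : m1 X = ((D j).1 (slab j s t (X `&` P')) + leb R m ((X `&` P') `&` slice j A s))%E.
  by rewrite -slI -setIA; exact: measure_addE.
have m2E X : m2 X = ((D j).2 (slab j s t (X `&` P')) + leb R m ((X `&` P') `&` slice j A t))%E.
  by rewrite -slI -setIA; exact: measure_addE.
have fin X : measurable X -> [/\ (D j).1 (slab j s t (X `&` P')) \is a fin_num,
   (D j).2 (slab j s t (X `&` P')) \is a fin_num,
   leb R m ((X `&` P') `&` slice j A s) \is a fin_num & leb R m ((X `&` P') `&` slice j A t) \is a fin_num].
  move=> mX; have mXP : measurable (X `&` P') by exact: measurableI.
  have XP : X `&` P' `<=` P' by exact: subIsetr.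
  by have [? ?] := Dfin mXP as_ tb XP; split => //; exact: lfin.
have key : m1 C = m2 C.
  apply: rV_measure_unique => // q; last first.
    have [f1 f2 f3 f4] := fin _ (measurable_hbox (map_mx ratr q.1) (map_mx ratr q.2)).
    by rewrite m1E -ge0_fin_numE ?adde_ge0// fin_numD; apply/andP.
  have [f1 f2 f3 f4] := fin _ (measurable_hbox (map_mx ratr q.1) (map_mx ratr q.2)).
  rewrite m1E m2E -(fineK f1) -(fineK f2) -(fineK f3) -(fineK f4) -!EFinD; congr (_%:E).
  move: f1 f2 f3 f4; rewrite -/(qbox q).
  pose q0 := (\row_l p0.1 ord0 (lift j l), \row_l p0.2 ord0 (lift j l)).
  pose q' := (\row_i Num.max (q.1 ord0 i) (q0.1 ord0 i), \row_i Num.min (q.2 ord0 i) (q0.2 ord0 i)).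
  have q'E : qbox q' = qbox q `&` P' by rewrite P'E qboxIE.
  rewrite -q'E => f1 f2 f3 f4.
  set a' : 'rV[R]_m := map_mx ratr q'.1; set b' : 'rV[R]_m := map_mx ratr q'.2.
  have q'h : qbox q' = hbox a' b' by [].
  have [ab|] := pselect (forall i, a' ord0 i <= b' ord0 i); last first.
    move=> /existsNP[i /negP]; rewrite -ltNge => /ltW /hbox_empty h.
    rewrite q'h h !set0I (_ : slab j s t set0 = set0); last by apply/seteqP; split => x // [].
    by rewrite !measure0.
  pose a := insert j (s, a'); pose b := insert j (t, b').
  have aib i : a ord0 i <= b ord0 i.
    by have [l ->|->] := unliftP j i; rewrite ?ins_lift ?ins_id.
  have q'P : hbox a' b' `<=` P' by rewrite -q'h q'E; exact: subIsetr.
  have abO : cbox a b `<=` Omega.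
    apply: subset_trans pO => x xab i.
    have [l li|->] := unliftP j i; last first.
      by have := xab j; rewrite !ins_id => /andP[h1 h2]; rewrite (le_trans as_ h1) (le_trans h2 tb).
    rewrite li; have := xab (lift j l); rewrite !ins_lift => /andP[h1 h2].
    apply/andP; split.
      by apply: le_trans h1; rewrite /pa !mxE ler_rat le_max lexx orbT.
    by apply: le_trans h2 _; rewrite /pb !mxE ler_rat ge_min lexx orbT.
  have [N0 HN] := cbox_enlarge oO aib abO.
  have sf : smooth (fun _ : E => 1 : R) by exact: smooth_cst.
  have c1 (x : E) : `|(fun=> 1) x : R| <= 1 by rewrite normr1.
  have c2 (x : E) : `|partial j (fun=> 1) x : R| <= 0 by rewrite partial_cst normr0.
  have sE u : slice_int j a b (fun=> 1) A u = fine (leb R m (qbox q' `&` slice j A u)).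
    by rewrite slice_int1// !del_ins.
  have rl u : lebesgue_slice j A u -> right_lebesgue_pt (slice_int j a b (fun=> 1) A) u.
    by move=> gu; rewrite (funext sE); exact: gu.
  have := cut_formula oO mA gD sf c1 c2 aib HN.
  rewrite !ins_id => /(_ (rl _ gs) (rl _ gt)).
  rewrite !sE partial_cst Rintegral_cst; last by apply: measurableI => //; exact: measurable_hbox.
  rewrite mul0r !Rintegral_cst; try exact: measurable_hbox.
  rewrite /a /b -slab_hbox -q'h !mul1r /=.
  exact: balance_swap.
have [f1 f2 f3 f4] := fin _ mC.
move: key; rewrite m1E m2E -(fineK f1) -(fineK f2) -(fineK f3) -(fineK f4) -!EFinD => -[].
rewrite (_ : C `&` P' = C); last exact/setIidl.
exact: balance_sub.
Qed.

(** On the columns where [A] appears between the two heights the flux of [D] in direction [j] equals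
    the area, on those where it disappears it is minus the area; the first is charged to [(D j).1],
    the second to [(D j).2]. *)
Lemma slab_symdiff s t q : lebesgue_slice j A s -> lebesgue_slice j A t -> pa ord0 j <= s -> s <= t -> t <= pb ord0 j ->
  measurable q -> q `<=` P' ->
  fine (leb R m (q `&` (slice j A t `\` slice j A s))) + fine (leb R m (q `&` (slice j A s `\` slice j A t))) <=
  fine ((D j).1 (slab j s t q)) + fine ((D j).2 (slab j s t q)).
Proof.
move=> gs gt as_ st tb mq qP.
have mss := measurable_sl j s mA; have mst := measurable_sl j t mA.
pose C1 := q `&` (slice j A t `\` slice j A s); pose C2 := q `&` (slice j A s `\` slice j A t).
have mC1 : measurable C1 by apply: measurableI => //; exact: measurableD.
have mC2 : measurable C2 by apply: measurableI => //; exact: measurableD.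
have C1P : C1 `<=` P' by move=> x [/qP].
have C2P : C2 `<=` P' by move=> x [/qP].
have h1 := slabE gs gt as_ st tb mC1 C1P.
have h2 := slabE gs gt as_ st tb mC2 C2P.
have e1 : C1 `&` slice j A t = C1 by apply/setIidl => x [_ []].
have e2 : C1 `&` slice j A s = set0 by apply/seteqP; split => x // [[_ [_ h]]].
have e3 : C2 `&` slice j A t = set0 by apply/seteqP; split => x // [[_ [_ h]]].
have e4 : C2 `&` slice j A s = C2 by apply/setIidl => x [_ []].
rewrite e1 e2 measure0 in h1.
rewrite e3 e4 measure0 in h2.
rewrite -/C1 -/C2.
have [a1 a2] := Dfin mC1 as_ tb C1P; have [b1 b2] := Dfin mC2 as_ tb C2P.
have [q1 q2] := Dfin mq as_ tb qP.
have l1 : fine ((D j).1 (slab j s t C1)) <= fine ((D j).1 (slab j s t q)).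
  apply: fine_le => //; apply: le_measure; rewrite ?inE; try exact: measurable_slab.
  by move=> x [h [? _]]; split.
have l2 : fine ((D j).2 (slab j s t C2)) <= fine ((D j).2 (slab j s t q)).
  apply: fine_le => //; apply: le_measure; rewrite ?inE; try exact: measurable_slab.
  by move=> x [h [? _]]; split.
have p1 : 0 <= fine ((D j).2 (slab j s t C1)) by rewrite fine_ge0.
have p2 : 0 <= fine ((D j).1 (slab j s t C2)) by rewrite fine_ge0.
exact: (balance_le h1 h2).
Qed.

(** The slabs are open below, hence decrease to the empty set. *)
Lemma slab_cvg0 p (q : set 'rV[R]_m) e : pa ord0 j <= p -> p < pb ord0 j -> measurable q -> q `<=` P' -> 0 < e ->
  \forall k \near \oo, p + k.+1%:R^-1 <= pb ord0 j /\
    fine ((D j).1 (slab j p (p + k.+1%:R^-1) q)) + fine ((D j).2 (slab j p (p + k.+1%:R^-1) q)) <= e.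
Proof.
move=> ap pb' mq qP e0.
have pp : 0 < pb ord0 j - p by rewrite subr_gt0.
have [N _ HN] := near_infty_natSinv_lt (PosNum pp).
have kb k : (N <= k)%N -> p + k.+1%:R^-1 <= pb ord0 j.
  by move=> /(HN k) /= /ltW h; rewrite -lerBrDl.
have cv (mu : {measure set E -> \bar R}) : (forall t, t <= pb ord0 j -> mu (slab j p t q) \is a fin_num) ->
    fine (mu (slab j p (p + (k + N).+1%:R^-1) q)) @[k --> \oo] --> (0 : R).
  move=> fmu; apply: fine_cvg.
  rewrite (_ : 0%:E = mu (\bigcap_k slab j p (p + (k + N).+1%:R^-1) q)).
    apply: nonincreasing_cvg_mu.
    - by rewrite -ge0_fin_numE//; apply: fmu; apply: kb; exact: leq_addl.
    - by move=> k; exact: measurable_slab.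
    - by apply: bigcapT_measurable => k; exact: measurable_slab.
    - move=> k l kl; apply/subsetPset => x [/andP[h1 h2] h3]; split=> //; rewrite h1 /=.
      by apply: le_trans h2 _; rewrite lerD2l lef_pV2 ?posrE// ler_nat ltnS leq_add2r.
  rewrite (_ : \bigcap_k _ = set0) ?measure0//; apply/seteqP; split => // x h.
  have [/andP[px _] _] := h 0%N I.
  have xp : 0 < x ord0 j - p by rewrite subr_gt0.
  have [M _ HM] := near_infty_natSinv_lt (PosNum xp).
  have [/andP[_ h2] _] := h M I.
  have /= := HM (M + N)%N (leq_addr _ _); rewrite ltrBrDl => h3.
  by have := le_lt_trans h2 h3; rewrite ltxx.
have c1 := cv (D j).1 (fun t tb => (Dfin mq ap tb qP).1).
have c2 := cv (D j).2 (fun t tb => (Dfin mq ap tb qP).2).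
have cc : (fun k => fine ((D j).1 (slab j p (p + (k + N).+1%:R^-1) q)) +
    fine ((D j).2 (slab j p (p + (k + N).+1%:R^-1) q))) @ \oo --> (0 : R).
  by rewrite -[0 : R]addr0; apply: cvgD; [exact: c1|exact: c2].
have /cvgrPdist_le /(_ _ e0) [M _ HM] := cc.
exists (M + N)%N => // k /= Mk; split; first by apply: kb; apply: leq_trans Mk; exact: leq_addl.
have := HM (k - N)%N; rewrite /= subnK; last by apply: leq_trans Mk; exact: leq_addl.
rewrite sub0r normrN => h; apply: le_trans (ler_norm _) (h _).
by rewrite leq_subRL ?(addnC N)//; apply: leq_trans Mk; exact: leq_addl.
Qed.

Variables (a b : E) (f : E -> R) (C1 C2 : R).
Hypotheses (sf : smooth f) (fC1 : forall x, `|f x| <= C1)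
  (fC2 : forall x, `|partial j f x| <= C2).
Hypotheses (paa : forall i, pa ord0 i <= a ord0 i) (bpb : forall i, b ord0 i <= pb ord0 i).
Let q := hbox (delete j a) (delete j b).
Let L := fine (leb R m q).

Let mq : measurable q. Proof. exact: measurable_hbox. Qed.
Let qP : q `<=` P'.
Proof.
move=> w qw i; have := qw i; rewrite !delE => /andP[h1 h2].
by rewrite (le_lt_trans (paa _) h1) (le_trans h2 (bpb _)).
Qed.
Let C10 : 0 <= C1. Proof. exact: le_trans (normr_ge0 _) (fC1 0). Qed.
Let C20 : 0 <= C2. Proof. exact: le_trans (normr_ge0 _) (fC2 0). Qed.
Let L0 : 0 <= L. Proof. exact: fine_ge0. Qed.

Let g t (w : 'rV[R]_m) := f (insert j (t, w)) * \1_A (insert j (t, w)).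

Let mg t : measurable_fun setT (g t).
Proof.
have mi : measurable_fun setT (fun w : 'rV[R]_m => @insert R m j (t, w)).
  exact: (measurableT_comp (measurable_ins j) (measurable_pair1 t)).
apply: measurable_funM.
  exact: (measurableT_comp (continuous_measurable_rV (smooth_continuous sf)) mi).
have m1 : measurable_fun setT (\1_A : E -> R) by exact: measurable_indic.
exact: (measurableT_comp m1 mi).
Qed.

Let gC1 t w : `|g t w| <= C1.
Proof. by rewrite normrM -[leRHS]mulr1 ler_pM// indic_le1. Qed.

Let bounded_int (h : 'rV[R]_m -> R) C : measurable_fun setT h -> (forall w, `|h w| <= C) ->
  (leb R m).-integrable q (EFin \o h).
Proof.
move=> mh hC; apply: (measurable_bounded_integrable mq (leb_hbox_lty _ _)).
  exact: measurable_funTS.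
exists C; split; first exact: num_real.
by move=> M CM x _; apply: le_trans (hC x) (ltW CM).
Qed.

Let ig t : (leb R m).-integrable q (EFin \o g t).
Proof. exact: (bounded_int (mg t) (gC1 t)). Qed.

Lemma measurable_slice : measurable_fun setT (slice_int j a b f A).
Proof.
pose a1 (k : nat) : E := insert j (- k%:R, delete j a).
pose b1 (k : nat) : E := insert j (k%:R, delete j b).
pose G k x : R := f x * \1_A x * \1_(hbox (a1 k) (b1 k)) x.
pose H k t := \int[leb R m]_w G k (insert j (t, w)).
have bG k : bsupp (cbox (a1 k) (b1 k)) C1 (G k).
  split=> //.
  - apply: measurable_funM; last by apply: measurable_indic; exact: measurable_hbox.
    apply: measurable_funM; last exact: measurable_indic.
    by apply: continuous_measurable_rV; exact: smooth_continuous.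
  - move=> x; rewrite normrM -[leRHS]mulr1 ler_pM ?indic_le1//.
    by rewrite normrM -[leRHS]mulr1 ler_pM ?indic_le1.
  - move=> x xK; rewrite /G [X in _ * X]indic0 ?mulr0// => h; apply: xK => i.
    by have /andP[/ltW -> ->] := h i.
have cK k := @compact_cbox R m.+1 (a1 k) (b1 k).
have mH k : measurable_fun setT (H k).
  have [ih _] := leb_int_ins j (compact_measurable (cK k)) (leb_compact_lty (cK k)) (bG k).
  by apply: measurableT_comp => //; exact: (measurable_fubini_F ih).
apply: (measurable_fun_cvg (h := H)) => // t _.
apply: cvg_near_cst; near=> k.
rewrite /H /slice_int [RHS]Rintegral_mkcond; apply: eq_Rintegral => w _.
rewrite patchE /G; have := in_hbox_ins j (a1 k) (b1 k) t w.
rewrite !ins_id !del_ins /= => h.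
case: ifPn => [/set_mem wq|/negP wq].
  rewrite [X in _ * X]indic1 ?mulr1//; apply/h; split => //.
  have tk : `|t| < k%:R by near: k; exact: nbhs_infty_gtr.
  by move: tk; rewrite ltr_norml => /andP[-> /ltW ->].
by rewrite [X in _ * X]indic0 ?mulr0// => /h [_ /mem_set].
Unshelve. all: by end_near. Qed.

Let lip p t w : p <= t -> `|f (insert j (t, w)) - f (insert j (p, w))| <= C2 * (t - p).
Proof.
rewrite le_eqVlt => /predU1P[->|pt]; first by rewrite !subrr normr0 mulr0.
have hd s : s \in `]p, t[ -> is_derive s (1 : R) (fun s => f (insert j (s, w))) (partial j f (insert j (s, w))).
  by move=> _; apply: is_derive_ins; exact: smooth_differentiable.
have hc : {within `[p, t], continuous (fun s : R => f (insert j (s, w)))}.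
  apply: continuous_subspaceT => s; apply: differentiable_continuous; apply/derivable1_diffP.
  by case: (is_derive_ins (smooth_differentiable (insert j (s, w)) sf)).
have [c _ ->] := MVT pt hd hc.
by rewrite normrM ler_pM// ger0_norm// subr_ge0 ltW.
Qed.

(** Between the two heights [f] changes by at most [C2 * (t - p)], and the slice of [A] by a set
    whose area [slab_symdiff] bounds. *)
Lemma slice_diff p t : lebesgue_slice j A p -> lebesgue_slice j A t -> pa ord0 j <= p -> p <= t -> t <= pb ord0 j ->
  `|slice_int j a b f A t - slice_int j a b f A p| <= C2 * (t - p) * L +
   C1 * (fine ((D j).1 (slab j p t q)) + fine ((D j).2 (slab j p t q))).
Proof.
move=> gp gt ap pt tb.
have sd := slab_symdiff gp gt ap pt tb mq qP.
have mss := measurable_sl j p mA; have mst := measurable_sl j t mA.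
have mD1 : measurable (slice j A t `\` slice j A p) by exact: measurableD.
have mD2 : measurable (slice j A p `\` slice j A t) by exact: measurableD.
pose u (w : 'rV[R]_m) := \1_(slice j A t `\` slice j A p) w + \1_(slice j A p `\` slice j A t) w : R.
have mu : measurable_fun setT u by apply: measurable_funD; exact: measurable_indic.
have u2 w : `|u w| <= 2.
  by apply: le_trans (ler_normD _ _) _; rewrite (_ : 2 = 1 + 1)// lerD// indic_le1.
have iu := bounded_int mu u2.
rewrite /slice_int -/q -(RintegralB mq (ig t) (ig p)).
have igg : (leb R m).-integrable q (EFin \o (fun w => g t w - g p w)).
  apply: (bounded_int (C := C1 + C1)); first exact: measurable_funB.
  by move=> w; apply: le_trans (ler_normB _ _) _; rewrite lerD.
apply: le_trans (le_normr_Rintegral mq igg) _.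
apply: (@le_trans _ _ (\int[leb R m]_(w in q) (C2 * (t - p) + C1 * u w))).
  apply: le_Rintegral => //.
  - exact: (integrable_norm igg).
  - apply: (bounded_int (C := `|C2 * (t - p)| + C1 * 2)).
      by apply: measurable_funD => //; apply: measurable_funM.
    move=> w; apply: le_trans (ler_normD _ _) _; rewrite lerD2l normrM ger0_norm//.
    by rewrite ler_wpM2l.
  - move=> w _; rewrite /g /u.
    have -> : f (insert j (t, w)) * \1_A (insert j (t, w)) - f (insert j (p, w)) * \1_A (insert j (p, w)) =
      (f (insert j (t, w)) - f (insert j (p, w))) * \1_A (insert j (t, w)) +
      f (insert j (p, w)) * (\1_A (insert j (t, w)) - \1_A (insert j (p, w))) by ring.
    apply: le_trans (ler_normD _ _) _; apply: lerD.
      rewrite normrM -[leRHS]mulr1 ler_pM ?indic_le1//; exact: lip.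
    rewrite normrM ler_pM//.
    have [At|At] := pselect (A (insert j (t, w))); have [Ap|Ap] := pselect (A (insert j (p, w))).
    + by rewrite !(@indic1 R _ A _ At) (@indic1 R _ A _ Ap) subrr normr0 addr_ge0// indicE.
    + rewrite (@indic1 R _ A _ At) (@indic0 R _ A _ Ap) subr0 normr1 [X in _ <= X + _]indic1; last by split.
      by rewrite lerDl indicE.
    + rewrite (@indic0 R _ A _ At) (@indic1 R _ A _ Ap) sub0r normrN normr1 [X in _ <= _ + X]indic1; last by split.
      by rewrite lerDr indicE.
    + by rewrite !(@indic0 R _ A _ At) (@indic0 R _ A _ Ap) subrr normr0 addr_ge0// indicE.
have icst : (leb R m).-integrable q (EFin \o (fun w : 'rV[R]_m => C2 * (t - p))).
  exact: (bounded_int (C := `|C2 * (t - p)|)).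
have iC1u : (leb R m).-integrable q (EFin \o (fun w : 'rV[R]_m => C1 * u w)).
  apply: (bounded_int (C := C1 * 2)); first exact: measurable_funM.
  by move=> w; rewrite normrM ger0_norm// ler_wpM2l.
rewrite RintegralD// Rintegral_cst// lerD2l RintegralZl// ler_wpM2l//.
apply: le_trans sd.
have i1 : (leb R m).-integrable q (EFin \o (\1_(slice j A t `\` slice j A p) : 'rV[R]_m -> R)).
  by apply: (bounded_int (C := 1)) => // w; exact: indic_le1.
have i2 : (leb R m).-integrable q (EFin \o (\1_(slice j A p `\` slice j A t) : 'rV[R]_m -> R)).
  by apply: (bounded_int (C := 1)) => // w; exact: indic_le1.
have E S : measurable S -> \int[leb R m]_(w in q) (\1_S w : R) = fine (leb R m (q `&` S)).
  move=> mS; rewrite -[RHS]mul1r -Rintegral_cst; last exact: measurableI.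
  by rewrite -Rintegral_indic; apply: eq_Rintegral => w _; rewrite mul1r.
by rewrite RintegralD// !E.
Qed.

(** [lebesgue_slice] speaks of rational boxes with weight 1 only. For an arbitrary box and smooth
    weight, [slice_diff] compares the height [p] with almost every height nearby, and its right-hand
    side tends to 0 because the mass of the slab above [p] does. *)
Lemma good_right_lebesgue p : lebesgue_slice j A p -> pa ord0 j <= p -> p < pb ord0 j ->
  right_lebesgue_pt (slice_int j a b f A) p.
Proof.
move=> gp ap pb'; apply/cvgrPdist_le => e e0.
have e1 : 0 < e / 2 / (C1 + 1) by rewrite !divr_gt0// ltr_wpDl.
have s0 := slab_cvg0 ap pb' mq qP e1.
have e2 : 0 < e / 2 / (C2 * L + 1) by rewrite !divr_gt0// ltr_wpDl// mulr_ge0.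
have s1 := near_infty_natSinv_lt (PosNum e2).
near=> k.
have [kb Dk] : p + k.+1%:R^-1 <= pb ord0 j /\
    fine ((D j).1 (slab j p (p + k.+1%:R^-1) q)) + fine ((D j).2 (slab j p (p + k.+1%:R^-1) q)) <= e / 2 / (C1 + 1).
  by near: k.
have /= k1 : k.+1%:R^-1 < (PosNum e2)%:num by near: k.
have k0 : 0 < k.+1%:R^-1 :> R by rewrite invr_gt0.
rewrite sub0r normrN ger0_norm; last by rewrite mulr_ge0//; apply: Rintegral_ge0.
rewrite mulrC -ler_pdivlMr//.
set Ik := `[p, p + k.+1%:R^-1]%classic.
have muI : lebesgue_measure Ik = (k.+1%:R^-1)%:E.
  rewrite lebesgue_measure_itv /= lte_fin ltrDl k0 -EFinD; congr (_%:E).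
  by rewrite addrAC subrr add0r.
have HE t : lebesgue_slice j A t -> p <= t -> t <= p + k.+1%:R^-1 ->
    `|slice_int j a b f A t - slice_int j a b f A p| <= e.
  move=> gt pt tk; have tb := le_trans tk kb.
  apply: le_trans (slice_diff gp gt ap pt tb) _.
  have tp : t - p <= k.+1%:R^-1 by rewrite lerBlDl.
  rewrite [leRHS]splitr; apply: lerD.
    rewrite mulrAC; apply: (@le_trans _ _ (C2 * L * (e / 2 / (C2 * L + 1)))).
      by apply: ler_wpM2l; [exact: mulr_ge0|exact: le_trans tp (ltW k1)].
    rewrite mulrCA ger_pMr ?divr_gt0// ler_pdivrMr; last by rewrite ltr_wpDl// mulr_ge0.
    by rewrite mul1r lerDl.
  apply: (@le_trans _ _ (C1 * (e / 2 / (C1 + 1)))); last first.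
    by rewrite mulrCA ger_pMr ?divr_gt0// ler_pdivrMr ?ltr_wpDl// mul1r lerDl.
  apply: ler_wpM2l => //; apply: le_trans Dk.
  have sub : slab j p t q `<=` slab j p (p + k.+1%:R^-1) q.
    by move=> x [/andP[h1 h2] h3]; split=> //; rewrite h1 (le_trans h2 tk).
  have [a1 a2] := Dfin mq ap tb qP; have [b1 b2] := Dfin mq ap kb qP.
  by apply: lerD; apply: fine_le => //; apply: le_measure; rewrite ?inE//; exact: measurable_slab.
have mI : measurable (Ik : set (measurableTypeR R)) by exact: measurable_itv.
have mh : measurable_fun setT (fun t => `|slice_int j a b f A t - slice_int j a b f A p|).
  apply: measurableT_comp => //; apply: measurable_funB => //; exact: measurable_slice.
have le : (\int[lebesgue_measure]_(t in Ik) (`|slice_int j a b f A t - slice_int j a b f A p|)%:E <=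
   \int[lebesgue_measure]_(t in Ik) e%:E)%E.
  (* The comparison asks that [t] be a Lebesgue height as well, so it is available almost
     everywhere. *)
  apply: ae_ge0_le_integral => //.
  - by apply/measurable_EFinP; exact: measurable_funTS.
  - by move=> t _; rewrite lee_fin ltW.
  have := good_ae j mA; apply: (@filterS _ _ (ae_filter_ringOfSetsType _)) => t gt.
  by rewrite /Ik /= in_itv /= => /andP[h1 h2]; rewrite lee_fin; exact: HE.
have leI : (\int[lebesgue_measure]_(t in Ik) e%:E = (e * k.+1%:R^-1)%:E)%E.
  by rewrite integral_cst// EFinM; congr (_ * _)%E; exact: muI.
rewrite leI in le.
rewrite -lee_fin; apply: (le_trans _ le); rewrite /Rintegral fineK//.
rewrite ge0_fin_numE; last by apply: integral_ge0 => t _; rewrite lee_fin.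
by apply: (le_lt_trans le); rewrite ltry.
Unshelve. all: by end_near. Qed.

Lemma cut_good : (forall i, a ord0 i <= b ord0 i) -> b ord0 j < pb ord0 j ->
  lebesgue_slice j A (a ord0 j) -> lebesgue_slice j A (b ord0 j) ->
  \int[leb R m.+1]_(x in A `&` hbox a b) partial j f x =
  - (\int[(D j).1]_(x in hbox a b) f x - \int[(D j).2]_(x in hbox a b) f x) +
  (slice_int j a b f A (b ord0 j) - slice_int j a b f A (a ord0 j)).
Proof.
move=> ab bp ga gb.
have abO : cbox a b `<=` Omega.
  apply: subset_trans pO => x xab i; have /andP[h1 h2] := xab i.
  by rewrite (le_trans (paa i) h1) (le_trans h2 (bpb i)).
have [N0 HN] := cbox_enlarge oO ab abO.
apply: (cut_formula oO mA gD sf fC1 fC2 ab HN); apply: good_right_lebesgue => //.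
- exact: le_lt_trans (ab j) bp.
- exact: le_trans (paa j) (ab j).
Qed.

End good_slices.

(** * A Poincare inequality on boxes *)

Section swap.
Context d1 d2 d3 (T1 : measurableType d1) (T2 : measurableType d2) (T3 : measurableType d3) (R : realType).
Variables (m1 : {sigma_finite_measure set T1 -> \bar R})
  (m2 : {sigma_finite_measure set T2 -> \bar R})
  (m3 : {sigma_finite_measure set T3 -> \bar R}).
Local Open Scope ereal_scope.

Lemma product_measure_swap (Z : set ((T1 * T2) * T3)) : measurable Z ->
  \int[m1]_x1 (m2 \x m3) [set p | Z ((x1, p.1), p.2)] =
  \int[m2]_x2 (m1 \x m3) [set p | Z ((p.1, x2), p.2)].
Proof.
move=> mZ.
have mf := measurable_fun_xsection m3 mZ.
have := @fubini_tonelli _ _ _ _ _ m1 m2 (m3 \o xsection Z) mf (fun x => measure_ge0 _ _).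
rewrite /fubini_F /fubini_G => h.
transitivity (\int[m1]_x \int[m2]_y (m3 \o xsection Z) (x, y)).
  apply: eq_integral => x _; rewrite /product_measure1; apply: eq_integral => y _.
  by congr (m3 _); apply/seteqP; split => z; rewrite /xsection /= !inE.
rewrite h; apply: eq_integral => y _; rewrite /product_measure1; apply: eq_integral => x _.
by congr (m3 _); apply/seteqP; split => z; rewrite /xsection /= !inE.
Qed.

End swap.

Section sigma_finite_product.
Context d1 d2 (T1 : measurableType d1) (T2 : measurableType d2) (R : realType).
Variables (m1 : {sigma_finite_measure set T1 -> \bar R})
  (m2 : {sigma_finite_measure set T2 -> \bar R}).

Definition sigma_finite_product : set (T1 * T2) -> \bar R := (m1 \x m2)%E.

HB.instance Definition _ := Measure.on sigma_finite_product.

Let sigma_finite_productT : sigma_finite setT sigma_finite_product.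
Proof.
have /sigma_finiteP[F [TF ndF Foo]] := sigma_finiteT m1.
have /sigma_finiteP[G [TG ndG Goo]] := sigma_finiteT m2.
exists (fun n => F n `*` G n) => [|k].
  rewrite predeqE => -[x y]; split => // _.
  have [i _ Fi] : (\bigcup_i F i) x by rewrite -TF.
  have [j _ Gj] : (\bigcup_i G i) y by rewrite -TG.
  exists (maxn i j) => //; split.
  - by move: Fi; exact/subsetPset/ndF/leq_maxl.
  - by move: Gj; exact/subsetPset/ndG/leq_maxr.
have [mF Fk] := Foo k; have [mG Gk] := Goo k; split; first exact: measurableX.
by rewrite /sigma_finite_product product_measure1E// lte_mul_pinfty// ge0_fin_numE.
Qed.

HB.instance Definition _ := Measure_isSigmaFinite.Build _ _ _ sigma_finite_product
  sigma_finite_productT.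

End sigma_finite_product.

Section poincare.
Variable R : realType.
Local Notation lam := (@lebesgue_measure R).
Local Open Scope ereal_scope.

Definition leb_plane : {sigma_finite_measure set (measurableTypeR R * measurableTypeR R)%type -> \bar R} :=
  sigma_finite_product (@lebesgue_measure R) (@lebesgue_measure R).

(* The pairs of points of the box that differ in the [j]-th coordinate only, the
   first one in [A] and the second one outside. *)
Definition jump n (j : 'I_n.+1) (a b : 'rV[R]_n.+1) (A : set 'rV[R]_n.+1) :
    set ((measurableTypeR R * measurableTypeR R) * 'rV[R]_n) :=
  [set p | [/\ (a ord0 j < p.1.1 <= b ord0 j)%R, (a ord0 j < p.1.2 <= b ord0 j)%R,
    hbox (delete j a) (delete j b) p.2, A (insert j (p.1.1, p.2)) & ~ A (insert j (p.1.2, p.2))]].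

Definition jump_mass n (j : 'I_n.+1) a b A : \bar R := (leb_plane \x leb R n) (jump j a b A).

Let measurable_oc d (T : measurableType d) (f : T -> measurableTypeR R) (u v : R) :
  measurable_fun setT f -> measurable [set x | (u < f x <= v)%R].
Proof.
move=> mf; rewrite (_ : [set _ | _] = f @^-1` `]u, v]%classic); last first.
  by apply/seteqP; split => x; rewrite /= in_itv.
by rewrite -[X in measurable X]setTI; exact: mf.
Qed.

Lemma measurable_jump n (j : 'I_n.+1) a b A : measurable A -> measurable (jump j a b A).
Proof.
move=> mA.
have m11 : measurable_fun setT (fun p : (measurableTypeR R * measurableTypeR R) * 'rV[R]_n => p.1.1).
  exact: (measurableT_comp measurable_fst measurable_fst).
have m12 : measurable_fun setT (fun p : (measurableTypeR R * measurableTypeR R) * 'rV[R]_n => p.1.2).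
  exact: (measurableT_comp measurable_snd measurable_fst).
have mi1 : measurable_fun setT (fun p : (measurableTypeR R * measurableTypeR R) * 'rV[R]_n => @insert R n j (p.1.1, p.2)).
  by apply: (measurableT_comp (measurable_ins j)); apply: measurable_fun_pair => //; exact: measurable_snd.
have mi2 : measurable_fun setT (fun p : (measurableTypeR R * measurableTypeR R) * 'rV[R]_n => @insert R n j (p.1.2, p.2)).
  by apply: (measurableT_comp (measurable_ins j)); apply: measurable_fun_pair => //; exact: measurable_snd.
rewrite (_ : jump _ _ _ _ = [set p | (a ord0 j < p.1.1 <= b ord0 j)%R] `&`
  [set p | (a ord0 j < p.1.2 <= b ord0 j)%R] `&` (snd @^-1` hbox (delete j a) (delete j b)) `&`
  ((fun p => insert j (p.1.1, p.2)) @^-1` A) `&` ((fun p => insert j (p.1.2, p.2)) @^-1` (~` A))); last first.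
  by apply/seteqP; split => p; [move=> [? ? ? ? ?]|move=> [[[[? ?] ?] ?] ?]].
apply: measurableI; [apply: measurableI; [apply: measurableI; [apply: measurableI|]|]|].
- exact: measurable_oc.
- exact: measurable_oc.
- by rewrite -[X in measurable X]setTI; apply: measurable_snd => //; exact: measurable_hbox.
- by rewrite -[X in measurable X]setTI; apply: mi1.
- by rewrite -[X in measurable X]setTI; apply: mi2 => //; exact: measurableC.
Qed.

Lemma ins_swap n (j : 'I_n.+1) (s t : R) (w : 'rV[R]_n) :
  insert (lift ord0 j) (s, insert ord0 (t, w)) = insert ord0 (t, insert j (s, w)).
Proof.
apply/rowP => k; rewrite (_ : 0%R = ord0 :> 'I_1)//.
have [k' ->|->] := unliftP ord0 k.
  rewrite [RHS]ins_lift /=; have [l ->|->] := unliftP j k'.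
    have -> : lift ord0 (lift j l) = lift (lift ord0 j) (lift ord0 l).
      by apply: val_inj; rewrite /= /bump /= !add1n ltnS addnS.
    rewrite (@ins_lift R n.+1 (lift ord0 j) (s, _) (lift ord0 l : 'I_n.+1)) /=.
    by rewrite (@ins_lift R n ord0 (t, w) l) (@ins_lift R n j (s, w) l).
  by rewrite !ins_id.
have e : ord0 = lift (lift ord0 j) ord0 by apply: val_inj; rewrite /= /bump.
by rewrite [in LHS]e (@ins_lift R n.+1 (lift ord0 j) (s, _) ord0) /= !ins_id.
Qed.

Lemma del_ord0 n (j : 'I_n.+1) (v : 'rV[R]_n.+2) : delete (lift ord0 j) v ord0 ord0 = v ord0 ord0.
Proof. by rewrite delE; congr (v _ _); apply: val_inj; rewrite /= /bump. Qed.

Lemma del_del n (j : 'I_n.+1) (v : 'rV[R]_n.+2) :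
  delete ord0 (delete (lift ord0 j) v) = delete j (delete ord0 v).
Proof.
apply/rowP => l; rewrite !mxE; congr (v _ _); apply: val_inj.
by rewrite /= /bump /= !add1n ltnS addnS.
Qed.

(** Coordinate 0 is kept apart from the others, so that the integral over it and the one over the
    pair of heights can be exchanged. *)
Let Z n (j : 'I_n.+1) (a b : 'rV[R]_n.+2) A :
    set ((measurableTypeR R * (measurableTypeR R * measurableTypeR R)) * 'rV[R]_n) :=
  [set p | (a ord0 ord0 < p.1.1 <= b ord0 ord0)%R /\
     jump (lift ord0 j) a b A (p.1.2, insert ord0 (p.1.1, p.2))].

Let mZ n (j : 'I_n.+1) (a b : 'rV[R]_n.+2) A : measurable A -> measurable (Z j a b A).
Proof.
move=> mA; rewrite (_ : Z j a b A = [set p | (a ord0 ord0 < p.1.1 <= b ord0 ord0)%R] `&`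
   ((fun p => (p.1.2, insert ord0 (p.1.1, p.2))) @^-1` jump (lift ord0 j) a b A)) //.
apply: measurableI.
  by apply: measurable_oc; exact: (measurableT_comp measurable_fst measurable_fst).
rewrite -[X in measurable X]setTI.
have : measurable_fun setT (fun p : (measurableTypeR R * (measurableTypeR R * measurableTypeR R)) * 'rV[R]_n =>
    (p.1.2, @insert R n ord0 (p.1.1, p.2))).
  apply: measurable_fun_pair; first exact: (measurableT_comp measurable_snd measurable_fst).
  apply: (measurableT_comp (measurable_ins _)); apply: measurable_fun_pair; last exact: measurable_snd.
  exact: (measurableT_comp measurable_fst measurable_fst).
by apply => //; exact: measurable_jump.
Qed.

Let ZE n (j : 'I_n.+1) (a b : 'rV[R]_n.+2) A s : (a ord0 ord0 < s <= b ord0 ord0)%R ->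
  jump_mass j (delete ord0 a) (delete ord0 b) (slice ord0 A s) =
  (leb_plane \x leb R n) [set p | Z j a b A ((s, p.1), p.2)].
Proof.
move=> sI; congr (leb_plane \x leb R n); apply/seteqP; split => -[[u v] w] /=.
  move=> [/= h1 h2 h3 h4 h5]; split => //; split => //=.
  - by rewrite !delE in h1.
  - by rewrite !delE in h2.
  - by apply/in_hbox_ins; split; [rewrite !del_ord0|rewrite !del_del].
  - by rewrite ins_swap.
  - by rewrite ins_swap.
move=> [_ [/= h1 h2 h3 h4 h5]]; split => //=.
- by rewrite !delE.
- by rewrite !delE.
- by move: h3 => /in_hbox_ins [_]; rewrite !del_del.
- by rewrite /slice /= -ins_swap.
- by rewrite /slice /= -ins_swap.
Qed.

Let memI (u v s : R) : (s \in `]u, v]%classic) = (u < s <= v)%R.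
Proof. by apply/idP/idP => [/set_mem|h]; [|apply/mem_set]; rewrite /= in_itv. Qed.

Let measurable_jump_mass n (j : 'I_n.+1) (a b : 'rV[R]_n.+2) A : measurable A ->
  measurable_fun `]a ord0 ord0, b ord0 ord0]%classic
    (fun s => jump_mass j (delete ord0 a) (delete ord0 b) (slice ord0 A s)).
Proof.
move=> mA.
have mf := measurable_fun_xsection (leb R n) (mZ j a b mA).
have h := @measurable_fun_fubini_tonelli_F _ _ _ _ _ leb_plane
  (leb R n \o xsection (Z j a b A)) mf (fun x => measure_ge0 _ _).
apply: (eq_measurable_fun (fubini_F leb_plane (leb R n \o xsection (Z j a b A)))); last exact: measurable_funTS.
move=> s; rewrite memI => sI; rewrite (ZE j A sI) /fubini_F /product_measure1.
apply: eq_integral => y _; rewrite /=.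
by congr (leb R n _); apply/seteqP; split => z; rewrite /xsection /= !inE.
Qed.

(** A jump in another direction leaves coordinate 0 fixed, so these jumps may be counted slice by
    slice; this is Tonelli, with coordinate 0 exchanged with the two heights of the jump. *)
Lemma jump_mass_slice n (j : 'I_n.+1) (a b : 'rV[R]_n.+2) A : measurable A ->
  \int[lam]_(s in `]a ord0 ord0, b ord0 ord0]%classic)
     jump_mass j (delete ord0 a) (delete ord0 b) (slice ord0 A s) =
  jump_mass (lift ord0 j) a b A.
Proof.
move=> mA.
transitivity (\int[lam]_s (leb_plane \x leb R n) [set p | Z j a b A ((s, p.1), p.2)]).
  rewrite integral_mkcond; apply: eq_integral => s _; rewrite patchE memI.
  case: ifPn => [sI|/negP sI]; first exact: ZE.
  by rewrite (_ : [set _ | _] = set0) ?measure0//; apply/seteqP; split => // p [h _].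
rewrite (@product_measure_swap _ _ _ _ _ _ _ lam leb_plane (leb R n) _ (mZ j a b mA)).
rewrite [RHS]/jump_mass [in RHS]/product_measure1; apply: eq_integral => -[u v] _.
have mx : measurable (xsection (jump (lift ord0 j) a b A) (u, v)).
  by apply: measurable_xsection; exact: measurable_jump.
rewrite /= (leb_ins ord0 mx); congr ((lam \x leb R n) _).
apply/seteqP; split => -[x w].
  by rewrite /Z /xsection /= inE => -[].
rewrite /Z /xsection /= inE => h; split => //.
by case: h => _ _ /= /in_hbox_ins [+ _] _ _; rewrite !del_ord0.
Qed.

Lemma leb_split n (a b : 'rV[R]_n.+1) A : measurable A ->
  leb R n.+1 (A `&` hbox a b) = \int[lam]_(s in `]a ord0 ord0, b ord0 ord0]%classic)
    leb R n (hbox (delete ord0 a) (delete ord0 b) `&` slice ord0 A s).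
Proof.
move=> mA.
have mAq : measurable (A `&` hbox a b) by apply: measurableI => //; exact: measurable_hbox.
rewrite (leb_ins ord0 mAq) /product_measure1 [RHS]integral_mkcond; apply: eq_integral => s _.
rewrite patchE.
rewrite memI /=; case: ifPn => [sI|/negP sI].
  congr (leb R n _); apply/seteqP; split => w; rewrite /xsection /= inE /=.
    by move=> [h1 /in_hbox_ins [_ h2]].
  by move=> [h1 h2]; split => //; apply/in_hbox_ins.
rewrite (_ : xsection _ _ = set0) ?measure0//; apply/seteqP; split => // w.
by rewrite /xsection /= inE /= => -[_ /in_hbox_ins [h _]].
Qed.

(** Of the $2n$ coordinates of a pair of points, a jump involves $n+1$; each of the remaining $n-1$
    ranges over a length at most [l], whence the power. In dimension 0 the product in
    [poincare_jump] is 0. *)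
Definition jump_sum n : 'rV[R]_n -> 'rV[R]_n -> set 'rV[R]_n -> R -> \bar R :=
  match n with
  | 0 => fun _ _ _ _ => 0
  | k.+1 => fun a b A l => (l ^+ k)%:E * \sum_(j < k.+1) jump_mass j a b A
  end.

Lemma jump_mass_ge0 n (j : 'I_n.+1) a b A : 0 <= jump_mass j a b A.
Proof. exact: measure_ge0. Qed.

Lemma leb_hbox_le n (a b : 'rV[R]_n) l : (0 <= l)%R ->
  (forall i, (a ord0 i <= b ord0 i)%R /\ (b ord0 i - a ord0 i <= l)%R) ->
  leb R n (hbox a b) <= (l ^+ n)%:E.
Proof.
move=> l0 ab; rewrite leb_hbox => [|i]; last by case: (ab i).
rewrite lee_fin; apply: (@le_trans _ _ (\prod_(i < n) l)%R); last by rewrite prodr_const card_ord.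
apply: ler_prod => i _.
by case: (ab i) => h1 h2; rewrite h2 andbT subr_ge0.
Qed.

Let measurable_jump_sum n (a b : 'rV[R]_n.+1) A l : measurable A ->
  measurable_fun `]a ord0 ord0, b ord0 ord0]%classic
    (fun s => jump_sum (delete ord0 a) (delete ord0 b) (slice ord0 A s) l).
Proof.
case: n a b A => [|n] a b A mA; rewrite /jump_sum; first exact: measurable_cst.
apply: emeasurable_funM => //.
by apply: emeasurable_sum => j; exact: measurable_jump_mass.
Qed.

Lemma jump_sum_ge0 n (a b : 'rV[R]_n) A l : (0 <= l)%R -> 0 <= jump_sum a b A l.
Proof.
case: n a b A => //= n a b A l0; apply: mule_ge0; first by rewrite lee_fin exprn_ge0.
by apply: sume_ge0 => j _; exact: jump_mass_ge0.
Qed.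

Lemma jump_sum_slice n (a b : 'rV[R]_n.+1) A l : measurable A -> (0 <= l)%R ->
  l%:E * \int[lam]_(s in `]a ord0 ord0, b ord0 ord0]%classic)
    jump_sum (delete ord0 a) (delete ord0 b) (slice ord0 A s) l =
  (l ^+ n)%:E * \sum_(j < n) jump_mass (lift ord0 j) a b A.
Proof.
case: n a b A => [|n] a b A mA l0.
  by rewrite big_ord0 mule0 /jump_sum integral0 mule0.
rewrite /jump_sum ge0_integralZl//; last 3 first.
- by apply: emeasurable_sum => j; exact: measurable_jump_mass.
- by move=> s _; apply: sume_ge0 => j _; exact: jump_mass_ge0.
- by rewrite lee_fin exprn_ge0.
rewrite ge0_integral_sum//; last by move=> j; exact: measurable_jump_mass.
rewrite muleA -EFinM -exprS; congr (_ * _); apply: eq_bigr => j _.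
exact: jump_mass_slice.
Qed.

(* A point of [A] is joined to a point outside by changing one coordinate at a
   time. *)
Lemma poincare_jump n (a b : 'rV[R]_n) A l : measurable A -> (0 <= l)%R ->
  (forall i, (a ord0 i <= b ord0 i)%R /\ (b ord0 i - a ord0 i <= l)%R) ->
  leb R n (A `&` hbox a b) * leb R n (hbox a b `\` A) <= jump_sum a b A l.
Proof.
elim: n a b A => [|n IH] a b A mA l0 ab.
  have [h|h] := pselect (A 0%R).
    have -> : hbox a b `\` A = set0.
      by apply/seteqP; split => // x [_]; rewrite (_ : x = 0%R)//; apply/rowP; case.
    by rewrite measure0 mule0.
  have -> : A `&` hbox a b = set0.
    by apply/seteqP; split => // x [+ _]; rewrite (_ : x = 0%R)//; apply/rowP; case.
  by rewrite measure0 mul0e.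
set I := `]a ord0 ord0, b ord0 ord0]%classic.
set a' := delete ord0 a; set b' := delete ord0 b; set q' := hbox a' b'.
have mq' : measurable q' by exact: measurable_hbox.
have ms s : measurable (slice ord0 A s) by exact: measurable_sl.
pose al s := leb R n (q' `&` slice ord0 A s).
pose be s := leb R n (q' `\` slice ord0 A s).
pose J p := leb R n (xsection (jump ord0 a b A) p).
have mJ : measurable_fun setT J by apply: measurable_fun_xsection; exact: measurable_jump.
have J0 p : 0 <= J p by exact: measure_ge0.
pose F := fubini_F (@lebesgue_measure R) J.
have mF : measurable_fun setT F by exact: measurable_fun_fubini_tonelli_F.
have F0 s : 0 <= F s by exact: integral_ge0.
have mal : measurable_fun setT al by exact: measurable_leb_sl.
have mAC : measurable (~` A) by exact: measurableC.
have mbe : measurable_fun setT be.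
  by exact: (@measurable_leb_sl R n ord0 _ _ mAC mq').
have mI : measurable (I : set (measurableTypeR R)) by exact: measurable_itv.
have muI : lam I <= l%:E.
  by rewrite /I lebesgue_measure_oc ?lee_fin; case: (ab ord0).
have E1 : leb R n.+1 (A `&` hbox a b) = \int[lam]_(s in I) al s by exact: leb_split.
have E2 : leb R n.+1 (hbox a b `\` A) = \int[lam]_(s in I) be s.
  by rewrite setDE setIC (leb_split _ _ mAC).
have a'b' i : (a' ord0 i <= b' ord0 i)%R /\ (b' ord0 i - a' ord0 i <= l)%R by rewrite !delE.
have qle : leb R n q' <= (l ^+ n)%:E by exact: leb_hbox_le.
have ale s : al s <= (l ^+ n)%:E.
  by apply: le_trans qle; apply: measureIl.
(* A column outside [A] at height [t] either is outside at height [s] too, which leaves a pair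
   inside one slice, or jumps in direction 0. *)
have key s t : I s -> I t -> al s * be t <= al s * be s + (l ^+ n)%:E * J (s, t).
  move=> Is It.
  apply: (@le_trans _ _ (al s * (be s + J (s, t)))).
    apply: lee_wpmul2l; first exact: measure_ge0.
    have sub : q' `\` slice ord0 A t `<=` (q' `\` slice ord0 A s) `|` xsection (jump ord0 a b A) (s, t).
      move=> w [h1 h2]; have [h|h] := pselect (slice ord0 A s w); [right|by left].
      by rewrite /xsection /= inE; split.
    have mx : measurable (xsection (jump ord0 a b A) (s, t)).
      by apply: measurable_xsection; exact: measurable_jump.
    have mD u : measurable (q' `\` slice ord0 A u) by exact: measurableD.
    have mU : measurable ((q' `\` slice ord0 A s) `|` xsection (jump ord0 a b A) (s, t)) by exact: measurableU.
    apply: (@le_trans _ _ (leb R n ((q' `\` slice ord0 A s) `|` xsection (jump ord0 a b A) (s, t)))).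
      by apply: le_measure; rewrite ?inE.
    exact: measureU2.
  rewrite ge0_muleDr//; apply: leeD => //.
  by apply: lee_wpmul2r.
have ln0 : 0 <= (l ^+ n)%:E by rewrite lee_fin exprn_ge0.
have al0 s : 0 <= al s by exact: measure_ge0.
have be0 s : 0 <= be s by exact: measure_ge0.
have mI' := mI.
rewrite E1 E2.
have ibe0 : 0 <= \int[lam]_(t in I) be t by apply: integral_ge0.
have mall : measurable_fun I al by exact: measurable_funTS.
have mbel : measurable_fun I be by exact: measurable_funTS.
have mJs s : measurable_fun setT (fun t => J (s, t)) by exact: (measurableT_comp mJ (measurable_pair1 s)).
have mJsI s : measurable_fun I (fun t => J (s, t)) by apply: measurable_funS (mJs s) => //; exact: subsetT.
have mFI : measurable_fun I F by exact: measurable_funTS.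
rewrite -ge0_integralZr//.
have msum : measurable_fun I (fun s => jump_sum a' b' (slice ord0 A s) l) by exact: measurable_jump_sum.
have jg0 s : 0 <= jump_sum a' b' (slice ord0 A s) l by exact: jump_sum_ge0.
have l0' : 0 <= l%:E by rewrite lee_fin.
apply: (@le_trans _ _ (\int[lam]_(s in I) (l%:E * jump_sum a' b' (slice ord0 A s) l + (l ^+ n)%:E * F s))).
  apply: ge0_le_integral => //.
  - by move=> s _; apply: mule_ge0.
  - by apply: emeasurable_funM.
  - by apply: emeasurable_funD; apply: emeasurable_funM.
  - move=> s Is; rewrite -ge0_integralZl//.
    apply: (@le_trans _ _ (\int[lam]_(t in I) (al s * be s + (l ^+ n)%:E * J (s, t)))).
      apply: ge0_le_integral => //.
      + by move=> t _; apply: mule_ge0.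
      + by apply: emeasurable_funM.
      + apply: emeasurable_funD; first exact: measurable_cst.
        by apply: emeasurable_funM; [exact: measurable_cst|exact: mJsI].
      + by move=> t It; exact: key.
    rewrite ge0_integralD//; last 3 first.
    + by move=> t _; apply: mule_ge0.
    + by move=> t _; apply: mule_ge0.
    + by apply: emeasurable_funM; [exact: measurable_cst|exact: mJsI].
    rewrite integral_cst// muleC; apply: leeD.
      apply: (@le_trans _ _ (l%:E * (al s * be s))).
        by apply: lee_wpmul2r => //; apply: mule_ge0.
      apply: lee_wpmul2l => //; rewrite /al setIC; apply: IH => //.
    rewrite ge0_integralZl//; last exact: mJsI.
    apply: lee_wpmul2l => //.
    rewrite /F /fubini_F; apply: ge0_subset_integral => //.
rewrite ge0_integralD//; last 4 first.
- by move=> s _; apply: mule_ge0.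
- by apply: emeasurable_funM.
- by move=> s _; apply: mule_ge0.
- by apply: emeasurable_funM.
rewrite ge0_integralZl// jump_sum_slice// /jump_sum big_ord_recl ge0_muleDr; last 2 first.
- exact: jump_mass_ge0.
- by apply: sume_ge0 => j _; exact: jump_mass_ge0.
rewrite addeC; apply: leeD => //.
rewrite ge0_integralZl//; apply: lee_wpmul2l => //.
apply: (@le_trans _ _ (\int[lam]_s F s)); first exact: ge0_subset_integral.
by rewrite /F -fubini_tonelli1.
Qed.

End poincare.

(** * Total variation as an integral *)

Section euclidean_norm.
Variables (R : realType) (n : nat).
Local Notation E := 'rV[R]_n.
Implicit Types u v : E.

Definition dotv u v : R := \sum_i u ord0 i * v ord0 i.

Lemma sqr_enorm u : enorm u ^+ 2 = dotv u u.
Proof.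
by rewrite sqr_sqrtr; [apply: eq_bigr => i _; rewrite expr2|apply: sumr_ge0 => i _; exact: sqr_ge0].
Qed.

Lemma enorm_ge0 u : 0 <= enorm u. Proof. exact: sqrtr_ge0. Qed.

Lemma enorm0 : enorm (0 : E) = 0.
Proof. by rewrite /enorm big1 ?sqrtr0// => i _; rewrite mxE expr0n. Qed.

Lemma enorm_eq0 u : enorm u = 0 -> u = 0.
Proof.
move=> u0; have := sqr_enorm u; rewrite u0 expr0n /= => /esym/eqP.
rewrite psumr_eq0; last by move=> i _; rewrite -expr2 sqr_ge0.
move=> /allP h; apply/rowP => i; rewrite mxE.
by have := h i (mem_index_enum _); rewrite /= mulf_eq0 orbb => /eqP.
Qed.

Lemma enorm_gt0 u : u != 0 -> 0 < enorm u.
Proof. by move=> u0; rewrite lt_neqAle enorm_ge0 andbT eq_sym; apply: contra u0 => /eqP/enorm_eq0/eqP. Qed.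

Lemma dotvDl u v w : dotv (u + v) w = dotv u w + dotv v w.
Proof. by rewrite -big_split; apply: eq_bigr => i _; rewrite mxE mulrDl. Qed.

Lemma dotvC u v : dotv u v = dotv v u.
Proof. by apply: eq_bigr => i _; rewrite mulrC. Qed.

Lemma dotvZl c u v : dotv (c *: u) v = c * dotv u v.
Proof. by rewrite mulr_sumr; apply: eq_bigr => i _; rewrite mxE mulrA. Qed.

Lemma dotvN u v : dotv (- u) v = - dotv u v.
Proof. by rewrite -scaleN1r dotvZl mulN1r. Qed.

Lemma dotvDr u v w : dotv w (u + v) = dotv w u + dotv w v.
Proof. by rewrite dotvC dotvDl !(dotvC w). Qed.

Lemma dotvZr c u v : dotv v (c *: u) = c * dotv v u.
Proof. by rewrite dotvC dotvZl (dotvC v). Qed.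

Lemma dotvNr u v : dotv v (- u) = - dotv v u.
Proof. by rewrite dotvC dotvN (dotvC v). Qed.

Lemma enormZ c u : enorm (c *: u) = `|c| * enorm u.
Proof.
rewrite -[LHS]ger0_norm ?enorm_ge0// -[enorm u]ger0_norm ?enorm_ge0// -normrM.
apply/eqP; rewrite -(@eqrXn2 _ 2)// !real_normK ?num_real//; apply/eqP.
by rewrite exprMn !sqr_enorm dotvZl dotvC dotvZl mulrA expr2.
Qed.

Lemma enormN u : enorm (- u) = enorm u.
Proof. by rewrite -scaleN1r enormZ normrN1 mul1r. Qed.

Lemma cauchy_schwarz u v : dotv u v <= enorm u * enorm v.
Proof.
have [->|u0] := eqVneq u 0.
  by rewrite enorm0 mul0r /dotv big1// => i _; rewrite mxE mul0r.
have [->|v0] := eqVneq v 0.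
  by rewrite enorm0 mulr0 /dotv big1// => i _; rewrite mxE mulr0.
have := sqr_ge0 (enorm (enorm v *: u - enorm u *: v)).
rewrite sqr_enorm !(dotvDl, dotvDr, dotvN, dotvNr, dotvZl, dotvZr) (dotvC v u) -!sqr_enorm.
have := enorm_gt0 u0; have := enorm_gt0 v0.
move: (enorm u) (enorm v) (dotv u v) => a b d b0 a0 h.
have : 0 <= (a * b) * (a * b - d) by nra.
by rewrite pmulr_rge0 ?mulr_gt0// subr_ge0.
Qed.

Lemma enormD u v : enorm (u + v) <= enorm u + enorm v.
Proof.
rewrite -(@ler_pXn2r _ 2)// ?nnegrE ?addr_ge0 ?enorm_ge0//.
rewrite sqr_enorm !(dotvDl, dotvDr) (dotvC v u) -!sqr_enorm.
by have := cauchy_schwarz u v; move: (enorm u) (enorm v) (dotv u v) => a b d h; nra.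
Qed.

Lemma enorm_dist u v : enorm u - enorm v <= enorm (u - v).
Proof. by rewrite lerBlDr; apply: le_trans (enormD _ _); rewrite subrK. Qed.

Lemma le_coord_enorm u i : `|u ord0 i| <= enorm u.
Proof.
rewrite -(@ler_pXn2r _ 2)// ?nnegrE ?enorm_ge0// real_normK ?num_real// sqr_enorm /dotv (bigD1 i)//= expr2.
by rewrite lerDl; apply: sumr_ge0 => k _; rewrite -expr2 sqr_ge0.
Qed.

Lemma enorm_le_sum u : enorm u <= \sum_i `|u ord0 i|.
Proof.
have [->|u0] := eqVneq u 0; first by rewrite enorm0; exact: sumr_ge0.
rewrite -(ler_pM2l (enorm_gt0 u0)) -expr2 sqr_enorm mulr_sumr; apply: ler_sum => i _.
apply: le_trans (ler_norm _) _; rewrite normrM.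
by rewrite ler_wpM2r// le_coord_enorm.
Qed.

Lemma enorm_le_max u c : 0 <= c -> (forall i, `|u ord0 i| <= c) -> enorm u <= n%:R * c.
Proof.
move=> c0 h; apply: le_trans (enorm_le_sum u) _.
apply: (@le_trans _ _ (\sum_(i < n) c)); first by apply: ler_sum => i _; exact: h.
by rewrite sumr_const card_ord mulr_natl.
Qed.

Lemma measurable_enorm d (T : measurableType d) (g : T -> E) (S : set T) :
  (forall j, measurable_fun S (fun x => g x ord0 j)) -> measurable_fun S (fun x => enorm (g x)).
Proof.
move=> mg; apply: (measurableT_comp (continuous_measurable_fun (@sqrt_continuous R))).
by apply: measurable_sum => j; apply: measurable_funX; exact: mg.
Qed.

Lemma measurable_dotv d (T : measurableType d) (g h : T -> E) (S : set T) :
  (forall j, measurable_fun S (fun x => g x ord0 j)) -> (forall j, measurable_fun S (fun x => h x ord0 j)) ->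
  measurable_fun S (fun x => dotv (g x) (h x)).
Proof. by move=> mg mh; apply: measurable_sum => j; apply: measurable_funM. Qed.

End euclidean_norm.

Section ring_cover.
Variables (R : realType) (n : nat).
Local Notation E := 'rV[R]_n.
Variable Omega : set E.

Definition cell k : set E := seqDU (qcover Omega) k.

Lemma measurable_cell k : measurable (cell k).
Proof. by apply: seqDU_measurable => i; exact: measurable_qcover. Qed.

Lemma cell_cover : open Omega -> Omega = \bigcup_k cell k.
Proof. by move=> oO; rewrite -seqDU_bigcup_eq; exact: qcoverP. Qed.

Lemma qcover_rc k : relatively_compact Omega (qcover Omega k).
Proof.
rewrite /qcover; case: unpickle => [p|]; last by exists set0; split => //; exact: compact0.
case: asboolP => pO; last by exists set0; split => //; exact: compact0.
exists (cbox (map_mx ratr p.1) (map_mx ratr p.2)); split => //; first exact: compact_cbox.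
by move=> x h i; have /andP[/ltW -> ->] := h i.
Qed.

Lemma sub_relatively_compact (A B : set E) : A `<=` B -> relatively_compact Omega B -> relatively_compact Omega A.
Proof. by move=> AB [K [cK KO BK]]; exists K; split => //; exact: subset_trans BK. Qed.

Lemma cell_rc k : relatively_compact Omega (cell k).
Proof. by apply: sub_relatively_compact (qcover_rc k); exact: subset_seqDU. Qed.

Lemma rc_measure_lty (Lam : {measure set E -> \bar R}) B :
  (forall K, compact K -> K `<=` Omega -> (Lam K < +oo)%E) -> measurable B ->
  relatively_compact Omega B -> (Lam B < +oo)%E.
Proof.
move=> fL mB [K [cK KO BK]]; apply: le_lt_trans (fL K cK KO).
by apply: le_measure; rewrite ?inE//; exact: compact_measurable.
Qed.

(** Radon-Nikodym is applied on each relatively compact cell, where both measures are finite, and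
    the densities are glued along the index of the cell containing the point. *)
Lemma dominated_density (Lam nu : {measure set E -> \bar R}) : open Omega ->
  (forall K, compact K -> K `<=` Omega -> (Lam K < +oo)%E) ->
  (forall B, measurable B -> (nu B <= Lam B)%E) ->
  exists f : E -> R, [/\ measurable_fun setT f, forall x, 0 <= f x &
    forall B, measurable B -> B `<=` Omega -> nu B = (\int[Lam]_(x in B) (f x)%:E)%E].
Proof.
move=> oO fL nuL.
have Lc k : (Lam (cell k) < +oo)%E.
  by apply: rc_measure_lty => //; [exact: measurable_cell|exact: cell_rc].
have nc k : (nu (cell k) < +oo)%E.
  by apply: le_lt_trans (Lc k); apply: nuL; exact: measurable_cell.
have /choice[f fP] : forall k, exists f : E -> R, [/\ measurable_fun setT f, forall x, 0 <= f x &
    forall B, measurable B -> nu (B `&` cell k) = (\int[Lam]_(x in B `&` cell k) (f x)%:E)%E].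
  move=> k; have mc := measurable_cell k.
  pose Lk : {finite_measure set E -> \bar R} := mfrestr mc (Lc k).
  pose nk : {finite_measure set E -> \bar R} := mfrestr mc (nc k).
  have dom : nk `<< Lk.
    apply/null_content_dominatesP => A mA h; apply/eqP; rewrite -measure_le0 -[leRHS]h.
    by apply: nuL; exact: measurableI.
  have [h [h0 hf hi hE]] := radon_nikodym_sigma_finite dom.
  exists (fine \o h); split.
  - apply/measurable_EFinP; apply: (eq_measurable_fun h); first by move=> x _; rewrite /= fineK.
    exact: measurable_int hi.
  - by move=> x; rewrite fine_ge0.
  move=> B mB; have mBc : measurable (B `&` cell k) by exact: measurableI.
  transitivity (nk (B `&` cell k)); first by rewrite /nk /= /mfrestr /mrestr -setIA setIid.
  rewrite hE// (@eq_measure_integral _ _ _ (B `&` cell k) Lam).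
    by apply: eq_integral => x _; rewrite /= fineK.
  by move=> A mA Ac; rewrite /Lk /= /mfrestr /mrestr setIidl// => x /Ac[].
pose idx x := xget 0%N [set k | cell k x].
have idxP k x : cell k x -> idx x = k.
  move=> ckx; have : cell (idx x) x by exact: (@xgetI _ 0%N [set k | cell k x] k).
  move=> cix; have /trivIsetP tC := @trivIset_seqDU _ (qcover Omega).
  apply/eqP; apply: contrapT => /negP h.
  by have := tC _ _ I I h; rewrite -[_ = _]/(cell _ `&` cell k = set0) => /seteqP[/(_ x) + _]; apply.
pose g x := if x \in Omega then f (idx x) x else 0.
have gc k x : cell k x -> g x = f k x.
  move=> ckx; rewrite /g (idxP _ _ ckx) ifT// inE cell_cover//; by exists k.
have mg : measurable_fun setT g.
  rewrite (_ : g = (fun x => f (idx x) x) \_ Omega); last first.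
    by apply/funext => x; rewrite patchE.
  apply/(measurable_restrictT _ (open_measurable_rV oO)).
  rewrite {1}cell_cover//; apply/measurable_fun_bigcup; first exact: measurable_cell.
  move=> k; apply: (eq_measurable_fun (f k)).
    by move=> x /set_mem ckx; rewrite (idxP _ _ ckx).
  by apply: measurable_funTS; have [] := fP k.
have g0 x : 0 <= g x by rewrite /g; case: ifP => // _; have [_ + _] := fP (idx x).
exists g; split => // B mB BO.
have BE : B = \bigcup_k (B `&` cell k).
  by rewrite -setI_bigcupr -cell_cover// setIidl.
have mBc k : measurable (B `&` cell k) by apply: measurableI => //; exact: measurable_cell.
have tB : trivIset setT (fun k => B `&` cell k).
  by apply: trivIset_setIl; exact: trivIset_seqDU.
rewrite [in LHS]BE [in RHS]BE measure_bigcup//.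
rewrite ge0_integral_bigcup//; last 2 first.
- by apply: measurable_funTS; apply/measurable_EFinP.
- by move=> x _; rewrite lee_fin.
rewrite (@eq_eseriesl _ _ xpredT); last by move=> k; rewrite in_setT.
apply: eq_eseriesr => k _; have [_ _ ->//] := fP k.
by apply: eq_integral => x /set_mem[_ cx]; rewrite (gc k).
Qed.

Lemma sum_measure N (m_ : 'I_N -> {measure set E -> \bar R}) : exists L : {measure set E -> \bar R},
  (forall A, L A = \sum_i m_ i A)%E.
Proof.
elim: N m_ => [|N IH] m_; first by exists mzero => A; rewrite big_ord0.
have [L LE] := IH (fun i => m_ (lift ord0 i)).
by exists (measure_add (m_ ord0) L) => A; rewrite big_ord_recl -LE; exact: measure_addE.
Qed.

(* Densities with respect to a common measure turn inequalities between total
   variations into pointwise ones. *)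
Definition density (Lam : {measure set E -> \bar R}) (D : vmeasure R n) (g : E -> E) :=
  [/\ forall j, measurable_fun setT (fun x => g x ord0 j),
      forall j B, measurable B -> relatively_compact Omega B ->
        Lam.-integrable B (fun x => (g x ord0 j)%:E) &
      forall B, measurable B -> relatively_compact Omega B ->
        vvalue D B = \row_j \int[Lam]_(x in B) g x ord0 j].

(** The sum of both components of all the [D k] in all directions is locally finite and dominates
    each of them. *)
Lemma density_family N (D : 'I_N -> vmeasure R n) : open Omega ->
  (forall k, locally_finite Omega (D k)) ->
  exists (Lam : {measure set E -> \bar R}) (g : 'I_N -> E -> E),
    (forall K, compact K -> K `<=` Omega -> (Lam K < +oo)%E) /\
    forall k, density Lam (D k) (g k).
Proof.
move=> oO lf.
have /choice[L1 L1E] : forall k, exists L : {measure set E -> \bar R},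
    (forall A, L A = \sum_j ((D k j).1 A + (D k j).2 A))%E.
  move=> k; have [L LE] := sum_measure (fun j => measure_add (D k j).1 (D k j).2).
  by exists L => A; rewrite LE; apply: eq_bigr => j _; exact: measure_addE.
have [Lam LE] := sum_measure L1.
have fL K : compact K -> K `<=` Omega -> (Lam K < +oo)%E.
  move=> cK KO; rewrite LE; apply: lte_sum_pinfty => k _; rewrite L1E; apply: lte_sum_pinfty => j _.
  by have [h1 h2] := lf k j K cK KO; exact: lte_add_pinfty.
have dom k j A : ((D k j).1 A <= Lam A)%E /\ ((D k j).2 A <= Lam A)%E.
  have h : ((D k j).1 A + (D k j).2 A <= Lam A)%E.
    rewrite LE (bigD1 k)//=; apply: (@le_trans _ _ (L1 k A)); last by rewrite leeDl// sume_ge0.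
    by rewrite L1E (bigD1 j)//= leeDl// sume_ge0// => i _; rewrite adde_ge0.
  by split; apply: le_trans h; [rewrite leeDl|rewrite leeDr].
have /choice[f1 f1P] : forall kj : 'I_N * 'I_n, exists f : E -> R, [/\ measurable_fun setT f, forall x, 0 <= f x &
    forall B, measurable B -> B `<=` Omega -> (D kj.1 kj.2).1 B = (\int[Lam]_(x in B) (f x)%:E)%E].
  by move=> [k j]; apply: dominated_density => // B _; case: (dom k j B).
have /choice[f2 f2P] : forall kj : 'I_N * 'I_n, exists f : E -> R, [/\ measurable_fun setT f, forall x, 0 <= f x &
    forall B, measurable B -> B `<=` Omega -> (D kj.1 kj.2).2 B = (\int[Lam]_(x in B) (f x)%:E)%E].
  by move=> [k j]; apply: dominated_density => // B _; case: (dom k j B).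
have BO B : relatively_compact Omega B -> B `<=` Omega.
  by move=> [K [_ KO BK]]; exact: subset_trans KO.
have i1 k j B : measurable B -> relatively_compact Omega B -> Lam.-integrable B (fun x => (f1 (k, j) x)%:E).
  move=> mB rB; have [mf f0 fE] := f1P (k, j); apply/integrableP; split.
    by apply: measurable_funTS; apply/measurable_EFinP.
  under eq_integral do rewrite gee0_abs ?lee_fin//.
  rewrite -fE//; last exact: BO.
  by have [h _] := dom k j B; apply: le_lt_trans h _; exact: rc_measure_lty.
have i2 k j B : measurable B -> relatively_compact Omega B -> Lam.-integrable B (fun x => (f2 (k, j) x)%:E).
  move=> mB rB; have [mf f0 fE] := f2P (k, j); apply/integrableP; split.
    by apply: measurable_funTS; apply/measurable_EFinP.
  under eq_integral do rewrite gee0_abs ?lee_fin//.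
  rewrite -fE//; last exact: BO.
  by have [_ h] := dom k j B; apply: le_lt_trans h _; exact: rc_measure_lty.
exists Lam, (fun k x => \row_j (f1 (k, j) x - f2 (k, j) x)); split => // k; split.
- move=> j; apply: (eq_measurable_fun (fun x => f1 (k, j) x - f2 (k, j) x)); first by move=> x _; rewrite mxE.
  by apply: measurable_funB; [have [] := f1P (k, j)|have [] := f2P (k, j)].
- move=> j B mB rB; apply: (eq_integrable mB (fun x => (f1 (k, j) x)%:E - (f2 (k, j) x)%:E)%E).
    by move=> x _; rewrite mxE EFinB.
  by apply: integrableB => //; [exact: i1|exact: i2].
move=> B mB rB; apply/rowP => j; rewrite !mxE.
transitivity (\int[Lam]_(x in B) (f1 (k, j) x - f2 (k, j) x)); last first.
  by apply: eq_Rintegral => x _; rewrite mxE.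
rewrite RintegralB//; [|exact: i1|exact: i2].
have [_ _ h1] := f1P (k, j); have [_ _ h2] := f2P (k, j).
by rewrite /Rintegral -h1//=; [rewrite -h2//=; exact: BO|exact: BO].
Qed.

End ring_cover.

Section total_variation_density.
Variables (R : realType) (n : nat).
Local Notation E := 'rV[R]_n.
Variables (Omega : set E) (Lam : {measure set E -> \bar R}).
Hypotheses (oO : open Omega) (fL : forall K, compact K -> K `<=` Omega -> (Lam K < +oo)%E).
Variables (D : vmeasure R n) (g : E -> E).
Hypothesis dg : density Omega Lam D g.

Lemma integrable_dotv B p : measurable B -> relatively_compact Omega B ->
  Lam.-integrable B (fun x => (dotv (g x) p)%:E).
Proof.
move=> mB rB; have [mg ig _] := dg.
apply: (eq_integrable mB (fun x => \sum_j ((p ord0 j)%:E * (g x ord0 j)%:E))%E).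
  by move=> x _; rewrite sumEFin; congr EFin; apply: eq_bigr => j _; rewrite mulrC.
by apply: integrable_sum => // j _; apply: integrableZl => //; exact: ig.
Qed.

Lemma integrable_enorm B : measurable B -> relatively_compact Omega B ->
  Lam.-integrable B (fun x => (enorm (g x))%:E).
Proof.
move=> mB rB; have [mg ig _] := dg.
apply: (@le_integrable _ _ _ _ _ mB _ (fun x => \sum_j `|(g x ord0 j)%:E|))%E.
- by apply/measurable_EFinP; apply: measurable_enorm => j; exact: measurable_funTS.
- move=> x _; rewrite gee0_abs ?lee_fin ?enorm_ge0// gee0_abs; last by apply: sume_ge0.
  by rewrite sumEFin lee_fin; exact: enorm_le_sum.
by apply: integrable_sum => // j _; apply: integrable_abse; exact: ig.
Qed.

Lemma dotv_vvalue B p : measurable B -> relatively_compact Omega B ->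
  dotv (vvalue D B) p = \int[Lam]_(x in B) dotv (g x) p.
Proof.
move=> mB rB; have [mg ig ->//] := dg.
have Zi j : Lam.-integrable B (fun x => (g x ord0 j * p ord0 j)%:E).
  apply: (eq_integrable mB (fun x => (p ord0 j)%:E * (g x ord0 j)%:E)%E).
    by move=> x _; rewrite -EFinM mulrC.
  by apply: integrableZl => //; exact: ig.
rewrite /Rintegral; under eq_integral do rewrite /dotv -sumEFin.
rewrite integral_sum// -sum_fine; last by move=> j _; exact: integrable_fin_num.
apply: eq_bigr => j _; rewrite mxE mulrC -[in LHS]RintegralZl//; last exact: ig.
by apply: eq_Rintegral => x _; rewrite mulrC.
Qed.

(** The scalar product with the vector value itself reduces $|\int g|\le\int|g|$ to
    Cauchy-Schwarz. *)
Lemma enorm_vvalue B : measurable B -> relatively_compact Omega B ->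
  enorm (vvalue D B) <= \int[Lam]_(x in B) enorm (g x).
Proof.
move=> mB rB; have [v0|v0] := eqVneq (vvalue D B) 0.
  by rewrite v0 enorm0; apply: Rintegral_ge0 => x _; exact: enorm_ge0.
rewrite -(ler_pM2l (enorm_gt0 v0)) -expr2 sqr_enorm dotv_vvalue// -RintegralZl//; last exact: integrable_enorm.
apply: le_Rintegral => //; first exact: integrable_dotv.
  by apply: (eq_integrable mB (fun x => (enorm (vvalue D B))%:E * (enorm (g x))%:E)%E) => //;
    apply: integrableZl => //; exact: integrable_enorm.
by move=> x _; rewrite mulrC; exact: cauchy_schwarz.
Qed.

(** Any rational vector within [tau * enorm v] of [v] will do: [tau <= 1 / 2] keeps it away from 0
    and [tau <= eta / 2] bounds the angle. Rational directions are countable, which is what a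
    partition needs. *)
Lemma rat_direction (eta : R) (v : E) : 0 < eta -> v != 0 ->
  exists p : 'rV[rat]_n, let q := map_mx ratr p : E in
    q != 0 /\ (1 - eta) * enorm v * enorm q <= dotv v q.
Proof.
move=> eta0 v0; have v0' := enorm_gt0 v0.
pose tau := Num.min (eta / 2) (1 / 2).
have tau0 : 0 < tau by rewrite lt_min !divr_gt0.
pose c := tau * enorm v / n.+1%:R.
have c0 : 0 < c by rewrite divr_gt0// mulr_gt0.
have /choice[f fP] := fun j => dense_rat_ball (v ord0 j) c0.
exists (\row_j f j) => q.
have qv : enorm (q - v) <= tau * enorm v.
  apply: (@le_trans _ _ (n%:R * c)).
    apply: enorm_le_max; first exact: ltW.
    by move=> i; rewrite !mxE distrC; exact: ltW (fP i).
  rewrite /c mulrCA ler_piMr ?mulr_ge0 ?(ltW tau0) ?enorm_ge0//.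
    by rewrite ler_pdivrMr ?ltr0n// mul1r ler_nat.
have t2 : tau <= 1 / 2 by rewrite /tau ge_min lexx orbT.
have te : tau <= eta / 2 by rewrite /tau ge_min lexx.
have q1 : enorm q <= enorm v + tau * enorm v.
  by have := enorm_dist q v; lra.
split.
  apply/eqP => q0; move: qv; rewrite q0 sub0r enormN => h.
  have := ler_wpM2r (ltW v0') t2; lra.
have -> : dotv v q = enorm v ^+ 2 - dotv v (v - q).
  by rewrite (dotvC v (v - q)) dotvDl dotvN -sqr_enorm (dotvC q v); ring.
have := cauchy_schwarz v (v - q); rewrite -(enormN (v - q)) opprB.
move: (dotv v (v - q)) (enorm (q - v)) (enorm q) (enorm_ge0 q) (enorm v) v0' qv q1 => d x y y0 a a0 h1 h2 h3.
have [e1|e1] := leP 1 eta.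
  have : (1 - eta) * a * y <= 0 by rewrite -mulrA mulr_le0_ge0// ?subr_le0// mulr_ge0// ltW.
  have : a * x <= a * (1 / 2 * a) by rewrite ler_pM2l//; apply: le_trans h1 _; rewrite ler_pM2r.
  nra.
have : (1 - eta) * a * y <= (1 - eta) * a * (a + tau * a).
  by rewrite ler_wpM2l// mulr_ge0 ?subr_ge0 ?ltW.
have : a * x <= a * (tau * a) by rewrite ler_pM2l.
have : 0 <= a * a * (eta / 2 - tau) by rewrite !mulr_ge0 ?subr_ge0// ltW.
have : 0 <= a * a * (tau * eta) by rewrite !mulr_ge0 ?ltW.
nra.
Qed.

Lemma vvalue0 : vvalue D set0 = 0.
Proof. by apply/rowP => j; rewrite !mxE !measure0 subrr. Qed.

(** For the upper bound, $|\int g|\le\int|g|$ on each set. For the lower bound, cut the space into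
    sets where the direction of [g] is nearly a given rational one: there almost nothing is lost in
    $|\int g|$. *)
Lemma total_variationE A : measurable A ->
  Defs.total_variation Omega D A = (\int[Lam]_(x in A `&` Omega) (enorm (g x))%:E)%E.
Proof.
move=> mA; have [mg ig gE] := dg.
have mO : measurable Omega by exact: open_measurable_rV.
have me : measurable_fun setT (fun x => (enorm (g x))%:E).
  by apply/measurable_EFinP; exact: measurable_enorm.
have e0 x : (0 <= (enorm (g x))%:E)%E by rewrite lee_fin enorm_ge0.
have fine_e B : measurable B -> relatively_compact Omega B ->
    (\int[Lam]_(x in B) (enorm (g x))%:E = (\int[Lam]_(x in B) enorm (g x))%:E)%E.
  move=> mB rB; rewrite /Rintegral fineK//; exact: (integrable_fin_num mB (integrable_enorm mB rB)).
apply/eqP; rewrite eq_le; apply/andP; split.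
  apply: ge_ereal_sup => _ [B [mB rB tB BA] <-].
  apply: (@le_trans _ _ (\sum_(k <oo) \int[Lam]_(x in B k) (enorm (g x))%:E)%E).
    apply: lee_nneseries => k _; first by rewrite lee_fin enorm_ge0.
    by rewrite fine_e// lee_fin; exact: enorm_vvalue.
  rewrite -ge0_integral_bigcup//; last exact: measurable_funTS.
  apply: ge0_subset_integral => //; [exact: bigcup_measurable|exact: measurableI|exact: measurable_funTS|].
  move=> x [k _ Bkx]; split; first by apply: BA; exists k.
  by have [K [_ KO BK]] := rB k; apply: KO; apply: BK.
have key eta : 0 < eta -> eta < 1 ->
    ((1 - eta)%:E * \int[Lam]_(x in A `&` Omega) (enorm (g x))%:E <= Defs.total_variation Omega D A)%E.
  move=> eta0 eta1.
  pose P (p : 'rV[rat]_n) := [set x : E | (1 - eta) * enorm (g x) * enorm (map_mx ratr p : E) <= dotv (g x) (map_mx ratr p)].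
  have mP p : measurable (P p).
    rewrite -[X in measurable X]setTI; apply: measurable_fun_le => //.
      by apply: measurable_funM => //; apply: measurable_funM => //; exact: measurable_enorm.
    by apply: measurable_dotv.
  pose F k : set E := if unpickle k is Some (p, i) then
    (if map_mx ratr p != 0 :> E then P p `&` qcover Omega i `&` A else set0) else set0.
  have mF k : measurable (F k).
    rewrite /F; case: unpickle => [[p i]|]//; case: ifP => // _.
    by apply: measurableI => //; apply: measurableI => //; exact: measurable_qcover.
  have mS k : measurable (seqDU F k) by apply: seqDU_measurable.
  have rS k : relatively_compact Omega (seqDU F k).
    apply: (@sub_relatively_compact _ _ Omega _ (F k)); first exact: subset_seqDU.
    rewrite /F; case: unpickle => [[p i]|]; last by exists set0; split => //; exact: compact0.
    case: ifP => _; last by exists set0; split => //; exact: compact0.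
    by apply: sub_relatively_compact (qcover_rc _ i) => x [[]].
  have FA : \bigcup_k seqDU F k `<=` A.
    move=> x [k _ sx]; have := subset_seqDU sx; rewrite /F; case: unpickle => [[p i]|]//; case: ifP => // _; by case.
  have cov : A `&` Omega `<=` \bigcup_k seqDU F k `|` [set x | g x = 0].
    move=> x [Ax Ox]; have [gx|gx] := eqVneq (g x) 0; [by right|left].
    have [p [p0 hp]] := rat_direction eta0 gx.
    move: Ox; rewrite {1}(qcoverP oO) => -[i _ qi].
    by rewrite -seqDU_bigcup_eq; exists (pickle (p, i)) => //; rewrite /F pickleK p0.
  have cellb k : ((1 - eta)%:E * \int[Lam]_(x in seqDU F k) (enorm (g x))%:E <= (enorm (vvalue D (seqDU F k)))%:E)%E.
    rewrite fine_e// -EFinM lee_fin.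
    have [FE|[p p0 sub]] : seqDU F k = set0 \/ exists2 p : 'rV[rat]_n, map_mx ratr p != 0 :> E & seqDU F k `<=` P p.
      have := @subset_seqDU _ F k; rewrite {2}/F; case: unpickle => [[p i]|] h; last first.
        by left; apply/seteqP; split.
      move: h; case: ifPn => [p0 h|_ h]; last by left; apply/seteqP; split.
      by right; exists p => // x /h[[]].
    - by rewrite FE Rintegral_set0 mulr0 enorm_ge0.
    rewrite -(ler_pM2r (enorm_gt0 p0)); apply: le_trans (cauchy_schwarz _ _).
    rewrite dotv_vvalue// mulrAC -RintegralZl//; last exact: integrable_enorm.
    apply: le_Rintegral => //.
    - by apply: (eq_integrable (mS k) (fun x => ((1 - eta) * enorm (map_mx ratr p : E))%:E * (enorm (g x))%:E)%E) => //;
        apply: integrableZl => //; exact: integrable_enorm.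
    - exact: integrable_dotv.
    by move=> x /sub h; rewrite mulrAC.
  apply: (@le_trans _ _ (\sum_(k <oo) (enorm (vvalue D (seqDU F k)))%:E)%E); last first.
    by apply: ereal_sup_ubound; exists (seqDU F) => //; split => //; exact: trivIset_seqDU.
  apply: (@le_trans _ _ ((1 - eta)%:E * \int[Lam]_(x in \bigcup_k seqDU F k) (enorm (g x))%:E)%E).
    apply: lee_wpmul2l; first by rewrite lee_fin subr_ge0 ltW.
    have mZ : measurable [set x | g x = 0].
      rewrite (_ : [set _ | _] = (fun x => enorm (g x)) @^-1` [set 0]); last first.
        by apply/seteqP; split => x /=; [move=> ->; rewrite enorm0|exact: enorm_eq0].
      by rewrite -[X in measurable X]setTI; exact: measurable_enorm.
    have mU : measurable (\bigcup_k seqDU F k) by exact: bigcup_measurable.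
    pose UZ : set E := (\bigcup_k seqDU F k) `|` ([set x | g x = 0] `\` (\bigcup_k seqDU F k)).
    have mUZ : measurable UZ.
      by apply: measurableU => //; exact: measurableD.
    have -> : (\int[Lam]_(x in \bigcup_k seqDU F k) (enorm (g x))%:E =
        \int[Lam]_(x in UZ) (enorm (g x))%:E)%E; last first.
      apply: ge0_subset_integral => //; [exact: measurableI|exact: measurable_funTS|].
      move=> x /cov[h|h]; first by left.
      by have [h'|h'] := pselect ((\bigcup_k seqDU F k) x); [left|right].
    rewrite [RHS]ge0_integral_setU//; last 3 first.
    - exact: measurableD.
    - exact: measurable_funTS.
    - by apply/disj_set2P; rewrite setDE setICA setICr setI0.
    rewrite [X in (_ + X)%E](_ : _ = 0%E) ?adde0//.
    by rewrite integral0_eq// => x [h _]; rewrite h enorm0.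
  rewrite ge0_integral_bigcup//; last exact: measurable_funTS.
  rewrite -nneseriesZl; last by move=> k _; apply: integral_ge0.
  apply: lee_nneseries => k _; last exact: cellb.
  rewrite mule_ge0//; [by rewrite lee_fin subr_ge0 ltW|exact: integral_ge0].
have tv0 : (0 <= Defs.total_variation Omega D A)%E.
  apply: ereal_sup_ubound; exists (fun=> set0).
    split => //; first by move=> _; exists set0; split => //; exact: compact0.
      by apply/trivIsetP => i j _ _ _; rewrite setI0.
    by move=> x [].
  by rewrite eseries0// => k _ _; rewrite vvalue0 enorm0.
case: (Defs.total_variation Omega D A) tv0 key => [r r0 key|_ _|//]; last exact: leey.
have I0 : (0 <= \int[Lam]_(x in A `&` Omega) (enorm (g x))%:E)%E by exact: integral_ge0.
move: (\int[Lam]_(x in A `&` Omega) (enorm (g x))%:E)%E I0 key => [i i0 key|_ key|//]; last first.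
  by have := key (1/2) ltac:(lra) ltac:(lra); rewrite gt0_muley ?leye_eq// lte_fin; lra.
rewrite lee_fin in i0; rewrite lee_fin; apply/ler_addgt0Pr => e epos.
(* From $(1-\eta)i\le r$ and $\eta(1+i)\le e$ follows $i\le r+e$. *)
pose eta := Num.min (1/2) (e / (1 + i)).
have eta0 : 0 < eta by rewrite lt_min divr_gt0//= divr_gt0//; lra.
have eta1 : eta <= 1/2 by rewrite ge_min lexx.
have etae : eta <= e / (1 + i) by rewrite ge_min lexx orbT.
have := key eta eta0; rewrite -EFinM lee_fin => /(_ ltac:(lra)) h.
have : eta * (1 + i) <= e by rewrite -ler_pdivlMr//; lra.
have : 0 <= eta by exact: ltW.
nra.
Qed.

End total_variation_density.

Section density_measure.
Import HBNNSimple.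
Context d (T : measurableType d) (R : realType).
Variables (Lam : {measure set T -> \bar R}) (h : T -> R).
Hypotheses (mh : measurable_fun setT h) (h0 : forall x, 0 <= h x).
Local Open Scope ereal_scope.

Let dens A := \int[Lam]_(x in A) (h x)%:E.

Let mhE D : measurable_fun D (fun x => (h x)%:E).
Proof. by apply: measurable_funTS; apply/measurable_EFinP. Qed.

Let dens0 : dens set0 = 0. Proof. exact: integral_set0. Qed.

Let dens_ge0 A : 0 <= dens A.
Proof. by apply: integral_ge0 => x _; rewrite lee_fin. Qed.

Let dens_add : semi_sigma_additive dens.
Proof.
move=> F mF tF mUF; rewrite /dens ge0_integral_bigcup//; last by move=> x _; rewrite lee_fin.
by apply: is_cvg_ereal_nneg_natsum => k _; exact: dens_ge0.
Qed.

Definition dens_measure : {measure set T -> \bar R} := measure_of dens0 dens_ge0 dens_add.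

Lemma dens_measureE A : dens_measure A = \int[Lam]_(x in A) (h x)%:E.
Proof. by []. Qed.

Let integral_dens_nnsfun (phi : {nnsfun T >-> R}) :
  \int[dens_measure]_x (phi x)%:E = \int[Lam]_x ((phi x)%:E * (h x)%:E).
Proof.
rewrite integralT_nnsfun sintegralE fsbig_finite//=.
have ge r x : (0 <= r * \1_(phi @^-1` [set r]) x)%R.
  rewrite indicE; have [/set_mem <-|_] := boolP (x \in _); last by rewrite mulr0.
  by rewrite mulr1.
have mA r : measurable (phi @^-1` [set r]).
  by rewrite -[X in measurable X]setTI; exact: measurable_funP.
transitivity (\int[Lam]_x \sum_(r <- finmap.enum_fset (fset_set (range phi))) (r * \1_(phi @^-1` [set r]) x * h x)%:E); last first.
  by apply: eq_integral => x _; rewrite -EFinM fimfunE fsbig_finite//= mulr_suml sumEFin.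
rewrite ge0_integral_sum//; last 2 first.
- move=> r; apply/measurable_EFinP; apply: measurable_funM => //.
  by apply: measurable_funM.
- by move=> r x _; rewrite lee_fin mulr_ge0.
apply: eq_bigr => r _.
have [r0|r0] := leP 0%R r; last first.
  have A0 : phi @^-1` [set r] = set0.
    by apply/seteqP; split => // x /= e; move: r0; rewrite -e ltNge fun_ge0.
  rewrite A0 measure0 mule0 integral0_eq// => x _.
  by rewrite indicE memNset// mulr0 mul0r.
rewrite dens_measureE [X in _ * X]integral_mkcond -ge0_integralZl//.
- apply: eq_integral => x _; rewrite patchE indicE; case: ifP => _; last by rewrite mulr0 mul0r mule0.
  by rewrite mulr1.
- by apply/(measurable_restrictT _ (mA r)).
- by move=> x _; apply: erestrict_ge0 => y _; rewrite lee_fin.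
Qed.

Lemma integral_dens (f : T -> \bar R) : measurable_fun setT f -> (forall x, 0 <= f x) ->
  \int[dens_measure]_x f x = \int[Lam]_x (f x * (h x)%:E).
Proof.
move=> mf f0.
pose f_ := nnsfun_approx measurableT mf.
have fE x : f x = limn (fun k => (f_ k x)%:E).
  by apply/esym/cvg_lim => //; exact: cvg_nnsfun_approx.
have nd x : {homo (fun k => (f_ k x)%:E) : p q / (p <= q)%N >-> p <= q}.
  by move=> p q pq; rewrite lee_fin; exact/lefP/nd_nnsfun_approx.
have mf_ k : measurable_fun setT (fun x => (f_ k x)%:E) by apply/measurable_EFinP.
transitivity (limn (fun k => \int[dens_measure]_x (f_ k x)%:E)).
  under eq_integral do rewrite fE.
  rewrite monotone_convergence// => k x _; by rewrite lee_fin.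
transitivity (limn (fun k => \int[Lam]_x ((f_ k x)%:E * (h x)%:E))).
  by congr (limn _); apply/funext => k; exact: integral_dens_nnsfun.
rewrite -monotone_convergence//.
- apply: eq_integral => x _; apply/cvg_lim => //.
  rewrite fE; apply: cvgeZr => //.
  by apply: ereal_nondecreasing_is_cvgn; exact: nd.
- by move=> k; apply: emeasurable_funM.
- by move=> k x _; rewrite mule_ge0// lee_fin.
- by move=> x _ p q pq; rewrite lee_wpmul2r ?lee_fin//; exact/lefP/nd_nnsfun_approx.
Qed.

Lemma integral_densS D (f : T -> \bar R) : measurable D -> measurable_fun D f ->
  (forall x, D x -> 0 <= f x) ->
  \int[dens_measure]_(x in D) f x = \int[Lam]_(x in D) (f x * (h x)%:E).
Proof.
move=> mD mf f0; rewrite integral_mkcond integral_dens.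
- rewrite [RHS]integral_mkcond; apply: eq_integral => x _; rewrite !patchE.
  by case: ifP => // _; rewrite mul0e.
- by apply/(measurable_restrictT _ mD).
- by move=> x; apply: erestrict_ge0.
Qed.

End density_measure.

Section total_variation_basics.
Variables (R : realType) (n : nat).
Local Notation E := 'rV[R]_n.
Variables (Omega : set E) (D : vmeasure R n).
Local Notation tv := (Defs.total_variation Omega D).

Lemma total_variation_ge A B : measurable B -> relatively_compact Omega B -> B `<=` A ->
  ((enorm (vvalue D B))%:E <= tv A)%E.
Proof.
move=> mB rB BA; pose F k : set E := if k is 0 then B else set0.
apply: ereal_sup_ubound; exists F.
  split.
  - by case => [|k]; rewrite /F.
  - by case => [|k]; rewrite /F //; exists set0; split => //; exact: compact0.
  -
apply/trivIsetP => -[|i] [|j] _ _ //= _; by rewrite ?setI0 ?set0I.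
  - by move=> x [[|k]]//= _ /BA.
rewrite (nneseries_split 0 1)//; last by move=> k _; rewrite lee_fin enorm_ge0.
rewrite add0n big_nat1 eseries0 ?adde0// => -[|k] //= _ _; by rewrite vvalue0 enorm0.
Qed.

Lemma total_variation_le (m : {measure set E -> \bar R}) A : measurable A ->
  (forall B, measurable B -> relatively_compact Omega B -> B `<=` A -> ((enorm (vvalue D B))%:E <= m B)%E) ->
  (tv A <= m A)%E.
Proof.
move=> mA h; apply: ge_ereal_sup => _ [B [mB rB tB BA] <-].
apply: (@le_trans _ _ (\sum_(k <oo) m (B k))%E).
  apply: lee_nneseries => k _; first by rewrite lee_fin enorm_ge0.
  by apply: h => // x Bx; apply: BA; exists k.
rewrite (_ : (\sum_(k <oo) m (B k))%E = m (\bigcup_k B k)).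
  by apply: le_measure; rewrite ?inE//; exact: bigcup_measurable.
rewrite measure_bigcup//.
by apply: eq_eseriesl => k; rewrite in_setT.
Qed.

Lemma total_variation_mono A B : A `<=` B -> (tv A <= tv B)%E.
Proof.
move=> AB; apply: ge_ereal_sup => _ [F [mF rF tF FA] <-].
by apply: ereal_sup_ubound; exists F => //; split => //; exact: subset_trans AB.
Qed.

Lemma total_variation_eq0 A : (forall B, measurable B -> relatively_compact Omega B -> B `<=` A -> vvalue D B = 0) ->
  tv A = 0%E.
Proof.
move=> h; apply/eqP; rewrite eq_le; apply/andP; split.
  apply: ge_ereal_sup => _ [F [mF rF tF FA] <-].
  rewrite eseries0// => k _ _; rewrite h ?enorm0// => x Fx; apply: FA; by exists k.
apply: ereal_sup_ubound; exists (fun=> set0).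
  split => //; first by move=> _; exists set0; split => //; exact: compact0.
    by apply/trivIsetP => i j _ _ _; rewrite setI0.
  by move=> x [].
by rewrite eseries0// => k _ _; rewrite vvalue0 enorm0.
Qed.

End total_variation_basics.

Section poincare.
Variables (R : realType) (m : nat).
Local Notation E := 'rV[R]_m.+1.
Local Notation lam := (@lebesgue_measure R).

(** By Tonelli a bound on the sections at almost all pairs of heights is enough; the two heights
    contribute a factor [l] each. *)
Lemma jump_mass_le (j : 'I_m.+1) (a b : E) A l r : measurable A -> 0 <= r -> 0 <= l ->
  a ord0 j <= b ord0 j -> b ord0 j - a ord0 j <= l ->
  (forall s t, lebesgue_slice j A s -> lebesgue_slice j A t -> a ord0 j < s <= b ord0 j -> a ord0 j < t <= b ord0 j ->
     (leb R m (xsection (jump j a b A) (s, t)) <= r%:E)%E) ->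
  (jump_mass j a b A <= (l ^+ 2 * r)%:E)%E.
Proof.
move=> mA r0 l0 ab abl H.
have mj := measurable_jump j a b mA.
pose J p := leb R m (xsection (jump j a b A) p).
have mJ : measurable_fun setT J by exact: measurable_fun_xsection.
have J0 p : (0 <= J p)%E by exact: measure_ge0.
have -> : jump_mass j a b A = (\int[lam]_s \int[lam]_t J (s, t))%E.
  exact: (@fubini_tonelli1 _ _ _ _ R lam lam J mJ J0).
pose I := `]a ord0 j, b ord0 j]%classic.
have mI : measurable (I : set (measurableTypeR R)) by exact: measurable_itv.
have memI s : (s \in I) = (a ord0 j < s <= b ord0 j).
  by apply/idP/idP => [/set_mem|h]; [|apply/mem_set]; rewrite /I /= in_itv.
have JI s t : ~ (a ord0 j < s <= b ord0 j /\ a ord0 j < t <= b ord0 j) -> J (s, t) = 0%E.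
  move=> h; rewrite /J (_ : xsection _ _ = set0) ?measure0//; apply/seteqP; split => // w.
  by rewrite /xsection /= inE => -[/= h1 h2 _ _ _]; apply: h.
have muI : (lam I <= l%:E)%E by rewrite /I lebesgue_measure_oc// lee_fin.
have gA := good_ae j mA.
have mF : measurable_fun setT (fun s => \int[lam]_t J (s, t))%E.
  exact: (@measurable_fun_fubini_tonelli_F _ _ _ _ R lam J mJ J0).
have rI : (\int[lam]_t (r%:E * (\1_I t)%:E) <= (l * r)%:E)%E.
  rewrite ge0_integralZl//; last by apply/measurable_EFinP.
  by rewrite integral_indic// setIT muleC EFinM; apply: lee_wpmul2r; rewrite ?lee_fin.
have inner s : lebesgue_slice j A s -> (\int[lam]_t J (s, t) <= (l * r)%:E * (\1_I s)%:E)%E.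
  move=> gs; rewrite indicE memI; have [sI|/negP sI] := boolP (_ < s <= _); last first.
    rewrite mule0 integral0_eq// => t _; apply: JI; by case.
  rewrite mule1; apply: le_trans rI; apply: ae_ge0_le_integral => //.
  - exact: (measurableT_comp mJ (measurable_pair1 s)).
  - by move=> t _; rewrite mule_ge0// lee_fin.
  - by apply: emeasurable_funM; [exact: measurable_cst|apply/measurable_EFinP].
  apply: (@filterS _ _ (ae_filter_ringOfSetsType _)) gA => t gt _.
  rewrite indicE memI; have [tI|/negP tI] := boolP (_ < t <= _); last by rewrite JI ?mule0//; case.
  by rewrite mule1; exact: H.
apply: (@le_trans _ _ (\int[lam]_s ((l * r)%:E * (\1_I s)%:E))%E).
  apply: ae_ge0_le_integral => //.
  - by move=> s _; apply: integral_ge0.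
  - by move=> s _; rewrite mule_ge0// lee_fin mulr_ge0.
  - by apply: emeasurable_funM; [exact: measurable_cst|apply/measurable_EFinP].
  by apply: (@filterS _ _ (ae_filter_ringOfSetsType _)) gA => s gs _; exact: inner.
rewrite ge0_integralZl//; [|by apply/measurable_EFinP|by rewrite lee_fin mulr_ge0].
rewrite integral_indic// setIT; apply: (@le_trans _ _ ((l * r)%:E * l%:E)%E).
  by apply: lee_wpmul2l => //; rewrite lee_fin mulr_ge0.
by rewrite -EFinM lee_fin expr2 mulrAC.
Qed.

Variables (Omega A : set E) (D : vmeasure R m.+1).
Hypotheses (oO : open Omega) (mA : measurable A) (gD : is_gradient Omega A D).
Variables (p0 : 'rV[rat]_m.+1 * 'rV[rat]_m.+1).
Let pa : E := map_mx ratr p0.1.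
Let pb : E := map_mx ratr p0.2.
Hypothesis (pO : cbox pa pb `<=` Omega).
Local Notation tv := (Defs.total_variation Omega D).

Lemma box_rc (B : set E) : B `<=` cbox pa pb -> relatively_compact Omega B.
Proof. by move=> BP; exists (cbox pa pb); split => //; exact: compact_cbox. Qed.

(** The columns jumping between the two heights have an area equal to the absolute flux of [D]
    through their slab, whichever height is the lower one, and this slab lies in the box. *)
Lemma jump_slice_le (j : 'I_m.+1) (a b : E) s t :
  (forall i, pa ord0 i <= a ord0 i) -> (forall i, b ord0 i <= pb ord0 i) ->
  lebesgue_slice j A s -> lebesgue_slice j A t -> a ord0 j < s <= b ord0 j -> a ord0 j < t <= b ord0 j ->
  (leb R m (xsection (jump j a b A) (s, t)) <= tv (hbox a b))%E.
Proof.
move=> paa bpb gs gt /andP[as_ sb] /andP[at_ tb].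
set C := xsection (jump j a b A) (s, t).
have mC : measurable C by apply: measurable_xsection; exact: measurable_jump.
have CE w : C w -> [/\ hbox (delete j a) (delete j b) w, slice j A s w & ~ slice j A t w].
  by rewrite /C /xsection /= inE => -[].
have CP : C `<=` hbox (delete j pa) (delete j pb).
  move=> w /CE[h _ _] l; have := h l; rewrite !delE => /andP[h1 h2].
  by rewrite (le_lt_trans (paa _) h1) (le_trans h2 (bpb _)).
have Cs : C `&` slice j A s = C by apply/seteqP; split => w [] // /[dup] /CE[].
have Ct : C `&` slice j A t = set0 by apply/seteqP; split => w // [/CE[]].
have Cf : leb R m C \is a fin_num.
  rewrite ge0_fin_numE//; apply: le_lt_trans (leb_hbox_lty (delete j pa) (delete j pb)).
  by apply: le_measure; rewrite ?inE//; exact: measurable_hbox.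
have slq u v : a ord0 j <= u -> v <= b ord0 j -> slab j u v C `<=` hbox a b.
  move=> au vb x [/andP[h1 h2] /CE[h3 _ _]] i; have [l ->|->] := unliftP j i.
    by have := h3 l; rewrite !delE.
  by rewrite (le_lt_trans au h1) (le_trans h2 vb).
have key u v : a ord0 j <= u -> v <= b ord0 j ->
    `|fine ((D j).1 (slab j u v C)) - fine ((D j).2 (slab j u v C))| = fine (leb R m C) ->
    (leb R m C <= tv (hbox a b))%E.
  move=> au vb e; rewrite -(fineK Cf) -e.
  apply: (@le_trans _ _ (enorm (vvalue D (slab j u v C)))%:E).
    by rewrite lee_fin; have := le_coord_enorm (vvalue D (slab j u v C)) j; rewrite mxE.
  apply: total_variation_ge; [exact: measurable_slab| |exact: slq].
  apply: box_rc => x /(slq _ _ au vb) h i; have /andP[h1 h2] := h i.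
  by rewrite (le_trans (paa _) (ltW h1)) (le_trans h2 (bpb _)).
have [st|ts] := leP s t.
  apply: (key s t); [exact: ltW|by []|].
  rewrite (slabE oO mA gD pO gs gt) ?(le_trans (paa j) (ltW as_)) ?(le_trans tb (bpb j))// Cs Ct measure0 sub0r normrN ger0_norm//.
  exact: fine_ge0.
apply: (key t s); [exact: ltW|by []|].
rewrite (slabE oO mA gD pO gt gs) ?(le_trans (paa j) (ltW at_)) ?(le_trans sb (bpb j)) ?ltW// Cs Ct measure0 subr0 ger0_norm//.
exact: fine_ge0.
Qed.

(** In [l ^+ m.+2], the coordinates that do not jump account for [l ^+ m] and the two heights of the
    jump for [l ^+ 2]. *)
Lemma poincare (a b : E) l :
  (forall i, pa ord0 i <= a ord0 i) -> (forall i, b ord0 i <= pb ord0 i) ->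
  0 < l -> (forall i, a ord0 i <= b ord0 i /\ b ord0 i - a ord0 i <= l) ->
  (leb R m.+1 (A `&` hbox a b) * leb R m.+1 (hbox a b `\` A) <=
   (m.+1%:R * l ^+ m.+2)%:E * tv (hbox a b))%E.
Proof.
move=> paa bpb lpos ab; have l0 := ltW lpos; apply: le_trans (poincare_jump mA l0 ab) _.
have tv0 : (0 <= tv (hbox a b))%E.
  by apply: le_trans (total_variation_ge D (@measurable0 _ E) _ (@sub0set _ _)) => //;
    [rewrite lee_fin enorm_ge0|exists set0; split => //; exact: compact0].
have H (j : 'I_m.+1) s t := @jump_slice_le j a b s t paa bpb.
case: (tv (hbox a b)) tv0 H => [r r0 H|_ _|//]; last first.
  by rewrite gt0_muley ?leey// lte_fin mulr_gt0 ?ltr0n// exprn_gt0.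
rewrite /jump_sum.
have jm j : (jump_mass j a b A <= (l ^+ 2 * r)%:E)%E.
  apply: jump_mass_le => //; [by case: (ab j)|by case: (ab j)|].
  by move=> s t gs gt sI tI; exact: H.
apply: (@le_trans _ _ ((l ^+ m)%:E * \sum_(j < m.+1) (l ^+ 2 * r)%:E)%E).
  by apply: lee_wpmul2l; [rewrite lee_fin exprn_ge0|exact: lee_sum].
rewrite sumEFin -!EFinM lee_fin sumr_const card_ord -[m.+2]addn2 exprD -[_ *+ m.+1]mulr_natl.
by rewrite mulrCA !mulrA.
Qed.

End poincare.

Definition madd d (T : measurableType d) (R : realType) (m1 m2 : {measure set T -> \bar R}) :
  {measure set T -> \bar R} := measure_add m1 m2.

Lemma maddE d (T : measurableType d) (R : realType) (m1 m2 : {measure set T -> \bar R}) A :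
  madd m1 m2 A = (m1 A + m2 A)%E.
Proof. exact: measure_addE. Qed.

Lemma integral_mrestr d (T : measurableType d) (R : realType) (mu : {measure set T -> \bar R})
    (D S : set T) (mD : measurable D) (f : T -> \bar R) : measurable S -> D `<=` S ->
  (mrestr mu mD).-integrable S f ->
  (\int[mrestr mu mD]_(x in S) f x = \int[mu]_(x in D) f x)%E.
Proof.
move=> mS DS intf.
have mN : measurable (S `\` D) by exact: measurableD.
rewrite (negligible_integral mN mS intf); last first.
  transitivity (mu ((S `\` D) `&` D)) => //.
  by rewrite setDE -setIA setICl setI0 measure0.
rewrite setDD setIidr//; apply: eq_measure_integral => B mB BD.
by rewrite -[RHS](_ : mu (B `&` D) = _)// setIidl.
Qed.

(** * Gradients of unions, differences and restrictions *)

Section gradient_algebra.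
Variables (R : realType) (n : nat).
Local Notation E := 'rV[R]_n.
Variable Omega : set E.
Hypothesis oO : open Omega.
Implicit Types (A B C : set E) (D : vmeasure R n).

Lemma locally_finite_fin D j B : locally_finite Omega D -> measurable B -> relatively_compact Omega B ->
  (D j).1 B \is a fin_num /\ (D j).2 B \is a fin_num.
Proof.
move=> lf mB [K [cK KO BK]]; have [h1 h2] := lf j K cK KO.
have mK := compact_measurable cK.
by rewrite !ge0_fin_numE//; split; [apply: le_lt_trans h1|apply: le_lt_trans h2];
  apply: le_measure; rewrite ?inE.
Qed.

Lemma is_gradient_intro A D : measurable A -> locally_finite Omega D ->
  (forall i phi, test_function Omega phi -> \int[leb R n]_(x in A) partial i phi x =
    - (\int[(D i).1]_(x in Omega) phi x - \int[(D i).2]_(x in Omega) phi x)) ->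
  is_gradient Omega A D.
Proof.
move=> mA lf gr; split => // i phi tphi; have := gr i phi tphi.
case: tphi => sphi [K [cK KO phi0]].
have mO : measurable Omega by exact: open_measurable_rV.
have mK := compact_measurable cK.
have [D1 D2] := lf i K cK KO.
have [C bC] := cpt_supp_bsupp (conj cK phi0) (smooth_continuous sphi).
have [C' bC'] := cpt_supp_bsupp (cpt_supp_partial i (conj cK phi0))
  (smooth_continuous (smooth_partial i sphi)).
rewrite /vintegral (Rint_fin mK (leb_compact_lty cK) mA bC').
by rewrite (Rint_fin mK D1 mO bC) (Rint_fin mK D2 mO bC) -EFinB -EFinN => ->.
Qed.

Definition vadd D D' : vmeasure R n := fun j =>
  (madd (D j).1 (D' j).1, madd (D j).2 (D' j).2).

Definition vopp D : vmeasure R n := fun j => ((D j).2, (D j).1).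

Lemma locally_finite_vadd D D' : locally_finite Omega D -> locally_finite Omega D' ->
  locally_finite Omega (vadd D D').
Proof.
move=> h h' i K cK KO; have [h1 h2] := h i K cK KO; have [h3 h4] := h' i K cK KO.
by rewrite !maddE; split; exact: lte_add_pinfty.
Qed.

Lemma locally_finite_vopp D : locally_finite Omega D -> locally_finite Omega (vopp D).
Proof. by move=> h i K cK KO; have [] := h i K cK KO. Qed.

Lemma vvalue_add D D' B : locally_finite Omega D -> locally_finite Omega D' ->
  measurable B -> relatively_compact Omega B -> vvalue (vadd D D') B = vvalue D B + vvalue D' B.
Proof.
move=> h h' mB rB; apply/rowP => j; rewrite !mxE.
have [h1 h2] := locally_finite_fin j h mB rB; have [h3 h4] := locally_finite_fin j h' mB rB.
have -> : (vadd D D' j).1 B = ((D j).1 B + (D' j).1 B)%E by exact: maddE.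
have -> : (vadd D D' j).2 B = ((D j).2 B + (D' j).2 B)%E by exact: maddE.
by rewrite !fineD//; ring.
Qed.

Lemma vvalue_opp D B : vvalue (vopp D) B = - vvalue D B.
Proof. by apply/rowP => j; rewrite !mxE opprB. Qed.

Lemma Rintegral_ae_add A B C K M (f : E -> R) : measurable A -> measurable B -> measurable C ->
  measurable K -> (leb R n K < +oo)%E -> bsupp K M f ->
  {ae leb R n, forall x, \1_B x + \1_C x = \1_A x :> R} ->
  \int[leb R n]_(x in A) f x = \int[leb R n]_(x in B) f x + \int[leb R n]_(x in C) f x.
Proof.
move=> mA mB mC mK Koo bf ae.
have indE S : \int[leb R n]_(x in S) f x = \int[leb R n]_x (f x * \1_S x).
  rewrite Rintegral_mkcond; apply: eq_Rintegral => x _; rewrite patchE indicE.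
  by case: ifP => _; rewrite ?mulr1 ?mulr0.
have bS S : measurable S -> bsupp K M (fun x => f x * \1_S x).
  move=> mS; case: bf => M0 mf fM f0; split => //.
  - by apply: measurable_funM.
  - by move=> x; rewrite normrM; apply: le_trans (fM x); rewrite ler_piMr// indic_le1.
  - by move=> x Kx; rewrite f0// mul0r.
rewrite !indE -RintegralD//; [|exact: bsupp_integrable (bS _ mB)|exact: bsupp_integrable (bS _ mC)].
rewrite /Rintegral; congr fine; apply: ae_eq_integral => //.
- by apply/measurable_EFinP; case: (bS A mA).
- by apply/measurable_EFinP; apply: measurable_funD; [case: (bS B mB)|case: (bS C mC)].
by apply: (@filterS _ _ (ae_filter_ringOfSetsType _)) ae => x h _; rewrite -mulrDr h.
Qed.

Let split_gradient A B C i phi : measurable A -> measurable B -> measurable C ->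
  {ae leb R n, forall x, \1_B x + \1_C x = \1_A x :> R} -> test_function Omega phi ->
  \int[leb R n]_(x in A) partial i phi x =
  \int[leb R n]_(x in B) partial i phi x + \int[leb R n]_(x in C) partial i phi x.
Proof.
move=> mA mB mC ae [sphi [K [cK KO phi0]]].
have [C' bC'] := cpt_supp_bsupp (cpt_supp_partial i (conj cK phi0))
  (smooth_continuous (smooth_partial i sphi)).
exact: (Rintegral_ae_add mA mB mC (compact_measurable cK) (leb_compact_lty cK) bC').
Qed.

Let int_vadd D D' i phi : locally_finite Omega D -> locally_finite Omega D' -> test_function Omega phi ->
  \int[(vadd D D' i).1]_(x in Omega) phi x =
    \int[(D i).1]_(x in Omega) phi x + \int[(D' i).1]_(x in Omega) phi x /\
  \int[(vadd D D' i).2]_(x in Omega) phi x =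
    \int[(D i).2]_(x in Omega) phi x + \int[(D' i).2]_(x in Omega) phi x.
Proof.
move=> h h' [sphi [K [cK KO phi0]]].
have mO : measurable Omega by exact: open_measurable_rV.
have mK := compact_measurable cK.
have [D1 D2] := h i K cK KO; have [D1' D2'] := h' i K cK KO.
have [C bC] := cpt_supp_bsupp (conj cK phi0) (smooth_continuous sphi).
have ib (mu : {measure set E -> \bar R}) (oo : (mu K < +oo)%E) := bsupp_integrable mK oo mO bC.
have mp : measurable_fun Omega (EFin \o phi) by apply: measurable_funTS; apply/measurable_EFinP; case: bC.
split; rewrite /Rintegral -fineD ?integrable_fin_num//; try exact: ib; congr fine.
  by apply: integral_measure_add => //; exact: ib.
by apply: integral_measure_add => //; exact: ib.
Qed.

Lemma gradient_add A B C D D' : measurable A -> measurable B -> measurable C ->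
  {ae leb R n, forall x, \1_B x + \1_C x = \1_A x :> R} ->
  is_gradient Omega B D -> is_gradient Omega C D' -> is_gradient Omega A (vadd D D').
Proof.
move=> mA mB mC ae gB gC; apply: is_gradient_intro => //.
  by apply: locally_finite_vadd; [case: gB|case: gC].
move=> i phi tphi; rewrite (split_gradient _ mA mB mC ae tphi).
rewrite (is_gradient_test _ oO mB gB tphi) (is_gradient_test _ oO mC gC tphi).
have [-> ->] := int_vadd i gB.1 gC.1 tphi; ring.
Qed.

Lemma gradient_sub A B C D D' : measurable A -> measurable B -> measurable C ->
  {ae leb R n, forall x, \1_B x + \1_C x = \1_A x :> R} ->
  is_gradient Omega A D -> is_gradient Omega C D' -> is_gradient Omega B (vadd D (vopp D')).
Proof.
move=> mA mB mC ae gA gC; have lf := locally_finite_vopp gC.1.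
apply: is_gradient_intro => //; first by apply: locally_finite_vadd => //; case: gA.
move=> i phi tphi; have := split_gradient i mA mB mC ae tphi.
rewrite (is_gradient_test _ oO mA gA tphi) (is_gradient_test _ oO mC gC tphi).
have [-> ->] := int_vadd i gA.1 lf tphi; rewrite /vopp /=.
by move=> h; lra.
Qed.

Lemma gradientP A : locally_finite_perimeter Omega A -> is_gradient Omega A (gradient Omega A).
Proof. by move=> h; rewrite /gradient; case: pselect => // h'; exact: projT2 (cid h'). Qed.

End gradient_algebra.

Section gradient_box.
Variables (R : realType) (m : nat).
Local Notation E := 'rV[R]_m.+1.
Variables (Omega : set E).
Hypothesis oO : open Omega.

Lemma vvalue_gradient (A : set E) D D' B : measurable A -> is_gradient Omega A D -> is_gradient Omega A D' ->
  measurable B -> relatively_compact Omega B -> vvalue D B = vvalue D' B.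
Proof. by move=> mA gD gD' mB rB; apply/rowP => j; rewrite !mxE; exact: gradient_unique gD gD' mB rB. Qed.

(** The perimeter refers to a gradient picked by choice; by uniqueness its values on relatively
    compact sets can be read off any gradient. *)
Lemma perimeter_le (A : set E) D (mu : {measure set E -> \bar R}) S : measurable A -> is_gradient Omega A D ->
  (forall B, measurable B -> relatively_compact Omega B -> ((enorm (vvalue D B))%:E <= mu B)%E) ->
  measurable S -> (perimeter Omega A S <= mu S)%E.
Proof.
move=> mA gD h mS; apply: total_variation_le => // B mB rB _.
have gG : is_gradient Omega A (gradient Omega A) by apply: gradientP; exists D.
by rewrite (vvalue_gradient mA gG gD mB rB); exact: h.
Qed.

(** Partial derivatives of test functions have integral 0, so nothing is charged on the boundary of
    [Omega]; hence the complement of a set in [Omega] has the opposite gradient. *)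
Lemma gradient_full : is_gradient Omega Omega (fun=> ((mzero : {measure set E -> \bar R}), (mzero : {measure set E -> \bar R}))).
Proof.
have mO : measurable Omega by exact: open_measurable_rV.
apply: is_gradient_intro => //; first by move=> i K _ _; split; rewrite /= /mzero.
move=> i phi [sphi [K [cK KO phi0]]].
have p0 x : ~ Omega x -> partial i phi x = 0.
  by move=> Ox; have [_ ->//] := cpt_supp_partial i (conj cK phi0); move=> /KO.
transitivity (\int[leb R m.+1]_x partial i phi x).
  rewrite Rintegral_mkcond; apply: eq_Rintegral => x _; rewrite patchE; case: ifPn => // /negP xO.
  by rewrite p0// => Ox; apply: xO; rewrite inE.
rewrite (int_partial0 i sphi (conj cK phi0)) /=.
by rewrite subrr oppr0.
Qed.

Variables (A : set E) (D : vmeasure R m.+1).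
Hypotheses (mA : measurable A) (gD : is_gradient Omega A D).
Variables (p0 : 'rV[rat]_m.+1 * 'rV[rat]_m.+1).
Let pa : E := map_mx ratr p0.1.
Let pb : E := map_mx ratr p0.2.
Hypothesis (pO : cbox pa pb `<=` Omega).
Variables (a b : E).
Hypotheses (paa : forall i, pa ord0 i <= a ord0 i) (bpb : forall i, b ord0 i < pb ord0 i).
Hypothesis ab : forall i, a ord0 i <= b ord0 i.
Hypotheses (ga : forall j, lebesgue_slice j A (a ord0 j)) (gb : forall j, lebesgue_slice j A (b ord0 j)).
Let q := hbox a b.
Let q' j := hbox (delete j a) (delete j b).

Let mq : measurable q. Proof. exact: measurable_hbox. Qed.

Let abO : cbox a b `<=` Omega.
Proof.
apply: subset_trans pO => x xab i; have /andP[h1 h2] := xab i.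
by rewrite (le_trans (paa i) h1) (le_trans h2 (ltW (bpb i))).
Qed.

Let qab : q `<=` cbox a b.
Proof. by move=> x h i; have /andP[/ltW -> ->] := h i. Qed.

Let mC j t : measurable (q' j `&` slice j A t).
Proof. by apply: measurableI; [exact: measurable_hbox|exact: measurable_sl]. Qed.

Let mins j t : measurable_fun setT (fun w : 'rV[R]_m => @insert R m j (t, w)).
Proof. exact: (measurableT_comp (measurable_ins j) (measurable_pair1 t)). Qed.

(** The area of [A] on the face at height [t], as a measure on the whole space. *)
Definition slice_measure j t : {measure set E -> \bar R} :=
  push_measure (mrestr (leb R m) (mC j t)) (mins j t).

Let sliceE j t B : slice_measure j t B = leb R m ((fun w => insert j (t, w)) @^-1` B `&` (q' j `&` slice j A t)).
Proof. by []. Qed.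

Let slice_lty j t B : measurable B -> (slice_measure j t B < +oo)%E.
Proof.
move=> mB; rewrite sliceE; apply: le_lt_trans (leb_hbox_lty (delete j a) (delete j b)).
apply: le_measure; rewrite ?inE//; [|exact: measurable_hbox|by move=> x [_ []]].
apply: measurableI; last exact: mC.
by rewrite -[X in measurable X]setTI; exact: mins.
Qed.

(** In direction [j] the indicator of [A] cut by the box rises on the lower face and drops on the
    upper one, hence the component that each face joins. *)
Definition cut_gradient : vmeasure R m.+1 := fun j =>
  (madd (mrestr (D j).1 mq) (slice_measure j (a ord0 j)),
   madd (mrestr (D j).2 mq) (slice_measure j (b ord0 j))).

Let cut1E j B : (cut_gradient j).1 B = ((D j).1 (B `&` q) + slice_measure j (a ord0 j) B)%E.
Proof. exact: maddE. Qed.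

Let cut2E j B : (cut_gradient j).2 B = ((D j).2 (B `&` q) + slice_measure j (b ord0 j) B)%E.
Proof. exact: maddE. Qed.

Let cut_lf : locally_finite Omega cut_gradient.
Proof.
move=> j K cK KO; have mK := compact_measurable cK; have [h1 h2] := gD.1 j K cK KO.
rewrite cut1E cut2E; split; apply: lte_add_pinfty; try exact: slice_lty.
  by apply: le_lt_trans h1; apply: le_measure; rewrite ?inE//; exact: measurableI.
by apply: le_lt_trans h2; apply: le_measure; rewrite ?inE//; exact: measurableI.
Qed.

Let slice_integral j t phi : a ord0 j <= t <= b ord0 j -> test_function Omega phi ->
  \int[slice_measure j t]_(x in Omega) phi x = slice_int j a b phi A t.
Proof.
move=> tab [sphi [K [cK KO phi0]]].
have mO : measurable Omega by exact: open_measurable_rV.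
have mK := compact_measurable cK.
have [C bC] := cpt_supp_bsupp (conj cK phi0) (smooth_continuous sphi).
have mphi : measurable_fun setT phi by case: bC.
have bi := bsupp_comp (mins j t) bC.
have mpre S : measurable S -> measurable ((fun w : 'rV[R]_m => insert j (t, w)) @^-1` S).
  by move=> mS; rewrite -[X in measurable X]setTI; exact: mins.
have Kl : (mrestr (leb R m) (mC j t) ((fun w : 'rV[R]_m => insert j (t, w)) @^-1` K) < +oo)%E.
  exact: (slice_lty j t mK).
rewrite /slice_int /Rintegral.
have -> : (\int[slice_measure j t]_(x in Omega) (phi x)%:E =
    \int[mrestr (leb R m) (mC j t)]_(w in (fun w => insert j (t, w)) @^-1` Omega) (phi (insert j (t, w)))%:E)%E.
  rewrite (integral_pushforward (mins j t))//; first by apply/measurable_EFinP.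
  exact: (bsupp_integrable (mpre _ mK) Kl (mpre _ mO) bi).
rewrite integral_mrestr; last 3 first.
- exact: mpre.
- move=> w [hw _]; apply: abO => i /=; have [l ->|->] := unliftP j i; last by rewrite ins_id.
  by rewrite ins_lift /=; have := hw l; rewrite !delE => /andP[/ltW -> ->].
- exact: (bsupp_integrable (mpre _ mK) Kl (mpre _ mO) bi).
rewrite integral_mkcondr; congr fine; apply: eq_integral => w _; rewrite patchE indicE.
rewrite (_ : (w \in slice j A t) = (insert j (t, w) \in A)); last by apply/idP/idP => /set_mem h; apply/mem_set.
by case: ifP => _; rewrite ?mulr1 ?mulr0.
Qed.

Lemma gradient_cut : is_gradient Omega (A `&` q) cut_gradient.
Proof.
have mO : measurable Omega by exact: open_measurable_rV.
apply: is_gradient_intro => //; first exact: measurableI.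
move=> j phi tphi; have [sphi [K [cK KO phi0]]] := tphi.
have mK := compact_measurable cK.
have cs := conj cK phi0.
have [C bC] := cpt_supp_bsupp cs (smooth_continuous sphi).
have [C' bC'] := cpt_supp_bsupp (cpt_supp_partial j cs) (smooth_continuous (smooth_partial j sphi)).
have fC1 x : `|phi x| <= C by case: bC.
have fC2 x : `|partial j phi x| <= C' by case: bC'.
have bpb' i : b ord0 i <= pb ord0 i by exact: ltW.
rewrite (cut_good oO mA gD pO sphi fC1 fC2 paa bpb' ab (bpb j) (ga j) (gb j)).
have qO : q `<=` Omega by exact: subset_trans abO.
have [lf1 lf2] := gD.1 j K cK KO.
have step (mu : {measure set E -> \bar R}) t : (mu K < +oo)%E -> a ord0 j <= t <= b ord0 j ->
    \int[madd (mrestr mu mq) (slice_measure j t)]_(x in Omega) phi x =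
    \int[mu]_(x in q) phi x + slice_int j a b phi A t.
  move=> muK tab; rewrite -(slice_integral tab tphi).
  have rK : (mrestr mu mq K < +oo)%E.
    by apply: le_lt_trans muK; apply: le_measure; rewrite ?inE//; exact: measurableI.
  have i1 := bsupp_integrable mK rK mO bC.
  have i2 := bsupp_integrable mK (slice_lty j t mK) mO bC.
  have mp : measurable_fun Omega (EFin \o phi) by apply: measurable_funTS; apply/measurable_EFinP; case: bC.
  rewrite /Rintegral integral_measure_add// integral_mrestr// fineD//.
    by rewrite integrable_fin_num//; exact: bsupp_integrable bC.
  exact: integrable_fin_num.
have -> : \int[(cut_gradient j).1]_(x in Omega) phi x =
    \int[(D j).1]_(x in q) phi x + slice_int j a b phi A (a ord0 j).
  by apply: step => //; rewrite lexx ab.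
have -> : \int[(cut_gradient j).2]_(x in Omega) phi x =
    \int[(D j).2]_(x in q) phi x + slice_int j a b phi A (b ord0 j).
  by apply: step => //; rewrite lexx ab.
ring.
Qed.

(** Later estimates ask for the size and the place of the face part, not for its direction; [S]
    records these two. *)
Lemma cut_exists : exists (D' : vmeasure R m.+1) (S : {measure set E -> \bar R}), [/\
  is_gradient Omega (A `&` q) D',
  forall B, measurable B -> relatively_compact Omega B ->
    ((enorm (vvalue D' B - vvalue D (B `&` q)))%:E <= S B)%E,
  S setT = (\sum_j (leb R m (q' j `&` slice j A (a ord0 j)) + leb R m (q' j `&` slice j A (b ord0 j))))%E &
  S (~` cbox a b) = 0%E].
Proof.
have [S SE] := sum_measure (fun j => madd (slice_measure j (a ord0 j)) (slice_measure j (b ord0 j))).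
have SE' B : S B = (\sum_j (slice_measure j (a ord0 j) B + slice_measure j (b ord0 j) B))%E.
  by rewrite SE; apply: eq_bigr => j _; exact: maddE.
exists cut_gradient, S; split; first exact: gradient_cut.
- move=> B mB rB; rewrite SE'.
  have fs j t : slice_measure j t B = (fine (slice_measure j t B))%:E.
    by rewrite fineK// ge0_fin_numE//; exact: slice_lty.
  under eq_bigr do rewrite fs [X in (_ + X)%E]fs -EFinD.
  rewrite sumEFin lee_fin; apply: le_trans (enorm_le_sum _) _; apply: ler_sum => j _.
  have rBq : relatively_compact Omega (B `&` q) by apply: sub_relatively_compact rB => x [].
  have [h1 h2] := locally_finite_fin j gD.1 (measurableI _ _ mB mq) rBq.
  have ff t : slice_measure j t B \is a fin_num by rewrite ge0_fin_numE//; exact: slice_lty.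
  have e1 : fine ((cut_gradient j).1 B) = fine ((D j).1 (B `&` q)) + fine (slice_measure j (a ord0 j) B).
    by apply: etrans (congr1 fine (cut1E j B)) _; exact: fineD h1 (ff _).
  have e2 : fine ((cut_gradient j).2 B) = fine ((D j).2 (B `&` q)) + fine (slice_measure j (b ord0 j) B).
    by apply: etrans (congr1 fine (cut2E j B)) _; exact: fineD h2 (ff _).
  have vE D0 X : (vvalue D0 X : E) ord0 j = fine ((D0 j).1 X) - fine ((D0 j).2 X) by rewrite mxE.
  have -> : (vvalue cut_gradient B - vvalue D (B `&` q)) ord0 j =
      fine (slice_measure j (a ord0 j) B) - fine (slice_measure j (b ord0 j) B).
    rewrite [LHS]mxE [X in _ + X]mxE !vE e1 e2.
    by move: (fine ((D j).1 _)) (fine ((D j).2 _)) (fine (slice_measure _ _ _)) (fine (slice_measure _ _ _)) => x1 x2 x3 x4; ring.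
  have n0 t : 0 <= fine (slice_measure j t B) by apply: fine_ge0.
  apply: le_trans (ler_normB _ _) _.
  by rewrite !ger0_norm.
- by rewrite SE'; apply: eq_bigr => j _; rewrite !sliceE preimage_setT !setTI.
rewrite SE' big1// => j _.
have z t : a ord0 j <= t <= b ord0 j -> slice_measure j t (~` cbox a b) = 0%E.
  move=> tab; rewrite sliceE (_ : _ `&` _ = set0) ?measure0//.
  apply/seteqP; split => // w [h [hw _]]; apply: h => i; have [l ->|->] := unliftP j i; last by rewrite ins_id.
  by rewrite ins_lift /=; have := hw l; rewrite !delE => /andP[/ltW -> ->].
by rewrite !z ?adde0 ?lexx ?ab.
Qed.

End gradient_box.

(** * Competitors *)

Section perimeter_measure.
Variables (R : realType) (n : nat).
Local Notation E := 'rV[R]_n.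
Variables (Omega : set E) (D : vmeasure R n).
Hypotheses (oO : open Omega) (lf : locally_finite Omega D).

Let tv := Defs.total_variation Omega D.

(** Countable additivity of the total variation, a supremum defined on all sets, is inherited from
    its integral form on measurable sets. *)
Let tv_dens : exists mu : {measure set E -> \bar R}, forall A, measurable A -> tv A = mu A.
Proof.
have [Lam [g [fL dg]]] := density_family oO (fun _ : 'I_1 => lf).
have mO : measurable Omega by exact: open_measurable_rV.
have mg : measurable_fun setT (fun x => enorm (g ord0 x)).
  by apply: measurable_enorm; case: (dg ord0).
exists (dens_measure (mrestr Lam mO) mg (fun x => enorm_ge0 _)) => A mA.
rewrite /tv (total_variationE oO (dg ord0) mA) dens_measureE.
have mI : measurable (A `&` Omega) by exact: measurableI.
have mDf : measurable (A `\` Omega) by exact: measurableD.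
have me S : measurable_fun S (fun x => (enorm (g ord0 x))%:E).
  by apply: measurable_funTS; apply/measurable_EFinP.
rewrite -[in RHS](setUIDK A Omega) (@ge0_integral_setU _ _ _ (mrestr Lam mO))//; last 2 first.
- by move=> x _; rewrite lee_fin enorm_ge0.
- by apply/disj_set2P; rewrite setDE setIACA setICr setI0.
rewrite [X in (_ + X)%E]null_set_integral//.
  rewrite adde0; apply: eq_measure_integral => B mB BO.
  rewrite -[in LHS](_ : B `&` Omega = B) //; by apply: setIidl => x /BO[].
transitivity (Lam ((A `\` Omega) `&` Omega)) => //.
by rewrite setDE -setIA setICl setI0 measure0.
Qed.

Let tv0 : tv set0 = 0%E.
Proof. by have [mu muE] := tv_dens; rewrite muE// measure0. Qed.

Let tv_ge0 A : (0 <= tv A)%E.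
Proof.
apply: le_trans (@total_variation_ge _ _ Omega D A set0 measurable0 _ _) => //.
  by rewrite lee_fin enorm_ge0.
by exists set0; split => //; exact: compact0.
Qed.

Let tv_add : semi_sigma_additive tv.
Proof.
have [mu muE] := tv_dens => F mF tF mUF; rewrite muE//.
rewrite (_ : (fun k => _) = (fun k => \sum_(0 <= i < k) mu (F i))%E); last first.
  by apply/funext => k; apply: eq_bigr => i _; rewrite muE.
exact: measure_semi_sigma_additive.
Qed.

Definition tv_measure : {measure set E -> \bar R} := measure_of tv0 tv_ge0 tv_add.

Lemma tv_measureE : tv_measure = Defs.total_variation Omega D :> (set E -> \bar R).
Proof. by []. Qed.

End perimeter_measure.

Section energy_bound.
Variables (R : realType) (m : nat).
Local Notation E := 'rV[R]_m.+1.
Variables (Omega : set E) (a : E -> R) (Lam : {measure set E -> \bar R}) (c d : E).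
Hypotheses (oO : open Omega) (ma : measurable_fun Omega a) (a0 : forall x, Omega x -> 0 < a x)
  (cO : cbox c d `<=` Omega) (a1 : forall x, cbox c d x -> a x <= 1).

(** Bounding the vector values set by set bounds the total variation by the measure of density [h]
    plus [S]; the latter lives on the closed box, where [a <= 1]. *)
Lemma energy_le (A : set E) D (h : E -> R) (S : {measure set E -> \bar R}) : measurable A ->
  is_gradient Omega A D -> measurable_fun setT h -> (forall x, 0 <= h x) -> S (~` cbox c d) = 0%E ->
  (forall B, measurable B -> relatively_compact Omega B ->
     ((enorm (vvalue D B))%:E <= \int[Lam]_(x in B) (h x)%:E + S B)%E) ->
  (\int[perimeter Omega A]_(x in Omega) (a x)%:E <= \int[Lam]_(x in Omega) (a x * h x)%:E + S setT)%E.
Proof.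
move=> mA gD mh h0 S0 hD.
have mO : measurable Omega by exact: open_measurable_rV.
have mc : measurable (cbox c d) by apply: compact_measurable; exact: compact_cbox.
have gG : is_gradient Omega A (gradient Omega A) by apply: gradientP; exists D.
have maE : measurable_fun Omega (fun x => (a x)%:E) by apply/measurable_EFinP.
have a0E x : Omega x -> (0 <= (a x)%:E)%E by move=> Ox; rewrite lee_fin ltW// a0.
pose mu := madd (dens_measure Lam mh h0) S.
have -> : (\int[perimeter Omega A]_(x in Omega) (a x)%:E = \int[tv_measure oO gG.1]_(x in Omega) (a x)%:E)%E by [].
apply: (@le_trans _ _ (\int[mu]_(x in Omega) (a x)%:E)%E).
  rewrite [leLHS]integral_mkcond [leRHS]integral_mkcond.
  apply: (@ge0_le_measure_integral _ _ _ (tv_measure oO gG.1) mu) => //.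
  - move=> B mB; rewrite tv_measureE; apply: (perimeter_le oO mA gD) => // B' mB' rB'.
    by rewrite maddE dens_measureE; exact: hD.
  - by move=> x; apply: erestrict_ge0.
  - by apply/(measurable_restrictT _ mO).
rewrite /mu /madd ge0_integral_measure_add//; apply: leeD.
  by rewrite integral_densS.
have UO : Omega = cbox c d `|` (Omega `\` cbox c d) by rewrite setDUK.
have mD : measurable (Omega `\` cbox c d) by exact: measurableD.
rewrite {1}UO ge0_integral_setU//; last 3 first.
- by rewrite -UO.
- by rewrite -UO.
- by apply/disj_set2P; rewrite setDE setICA setICr setI0.
have -> : (\int[S]_(x in Omega `\` cbox c d) (a x)%:E = 0)%E.
  apply: null_set_integral; [exact: mD|by apply: measurable_funS maE|].
  apply/eqP; rewrite -measure_le0 -[leRHS]S0; apply: le_measure; rewrite ?inE//; exact: measurableC.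
rewrite adde0; apply: (@le_trans _ _ (\int[S]_(x in cbox c d) (cst 1%E) x)%E).
  apply: ge0_le_integral => //.
  - by move=> x /cO; exact: a0E.
  - by apply: measurable_funS maE.
by rewrite integral_cst// mul1e; apply: le_measure; rewrite ?inE.
Qed.

End energy_bound.

Lemma sum_leb (R : realType) n N (W : 'I_N -> set 'rV[R]_n) (S : pred 'I_N) (V B : set 'rV[R]_n) :
  (forall k, measurable (W k)) -> measurable V -> measurable B ->
  {ae leb R n, forall x, \sum_(k | S k) \1_(W k) x = \1_V x :> R} ->
  (\sum_(k | S k) leb R n (W k `&` B) = leb R n (V `&` B))%E.
Proof.
move=> mW mV mB ae.
pose W' k := if S k then W k else set0.
have mW' k : measurable (W' k) by rewrite /W'; case: ifP.
rewrite big_mkcond /= (eq_bigr (fun k => leb R n (W' k `&` B))); last first.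
  by move=> k _; rewrite /W'; case: ifP => // _; rewrite set0I measure0.
under eq_bigr do rewrite -(integral_indic _ mB (mW' _)).
rewrite -(integral_indic _ mB mV) -ge0_integral_sum//; last first.
- by move=> k; apply/measurable_EFinP; apply: measurable_funTS.
apply: ae_eq_integral => //.
- by apply: emeasurable_sum => k; apply/measurable_EFinP; apply: measurable_funTS.
- by apply/measurable_EFinP; apply: measurable_funTS.
apply: (@filterS _ _ (ae_filter_ringOfSetsType _)) ae => x h _; rewrite sumEFin -h [in RHS]big_mkcond /=; congr EFin.
by apply: eq_bigr => k _; rewrite /W'; case: ifP => // _; rewrite indic0.
Qed.

Lemma density_add (R : realType) n (Omega : set 'rV[R]_n) (Lam : {measure set 'rV[R]_n -> \bar R})
    (D1 D2 : vmeasure R n) g1 g2 : locally_finite Omega D1 -> locally_finite Omega D2 ->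
  density Omega Lam D1 g1 -> density Omega Lam D2 g2 ->
  density Omega Lam (vadd D1 D2) (fun x => g1 x + g2 x).
Proof.
move=> l1 l2 [m1 i1 e1] [m2 i2 e2]; split.
- move=> j; apply: (eq_measurable_fun (fun x => g1 x ord0 j + g2 x ord0 j)); first by move=> x _; rewrite mxE.
  by apply: measurable_funD; [exact: m1|exact: m2].
- move=> j B mB rB; apply: (eq_integrable mB (fun x => (g1 x ord0 j)%:E + (g2 x ord0 j)%:E)%E).
    by move=> x _; rewrite mxE EFinD.
  by apply: integrableD => //; [exact: i1|exact: i2].
move=> B mB rB; rewrite (vvalue_add l1 l2 mB rB) e1// e2//; apply/rowP => j; rewrite !mxE.
rewrite -RintegralD//; [|exact: i1|exact: i2].
by apply: eq_Rintegral => x _; rewrite mxE.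
Qed.

Section transfer.
Variables (R : realType) (m N : nat) (alpha Calpha : R).
Local Notation E := 'rV[R]_m.+1.
Variables (Omega : set E) (a : E -> R) (G : ('I_N -> set E) -> R) (W : 'I_N -> set E).
Hypotheses (oO : open Omega) (lO : (leb R m.+1 Omega < +oo)%E)
  (ma : measurable_fun Omega a) (a0 : forall x, Omega x -> 0 < a x)
  (alpha0 : 0 <= alpha) (C0 : 0 <= Calpha)
  (hG : forall W1 W2 : 'I_N -> set E, Fw Omega W1 -> Fw Omega W2 ->
      `|G W1 - G W2| <= Calpha * (fine (distw W1 W2)) `^ alpha)
  (minW : minimizes_Jw Omega a G W).
Variables (Lam : {measure set E -> \bar R}) (g : 'I_N -> E -> E).
Hypotheses (fL : forall K, compact K -> K `<=` Omega -> (Lam K < +oo)%E)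
  (dg : forall k, density Omega Lam (gradient Omega (W k)) (g k)).

Let D k := gradient Omega (W k).
Let mO : measurable Omega. Proof. exact: open_measurable_rV. Qed.
Let mW k : measurable (W k). Proof. by case: minW => -[/(_ k)[]]. Qed.
Let WO k : W k `<=` Omega. Proof. by case: minW => -[/(_ k)[]]. Qed.
Let gW k : is_gradient Omega (W k) (D k).
Proof. by apply: gradientP; case: minW => -[/(_ k)[]]. Qed.

Let mge k : measurable_fun setT (fun x => enorm (g k x)).
Proof. by apply: measurable_enorm; case: (dg k). Qed.

Lemma gradient_set0 : is_gradient Omega set0 (fun=> ((mzero : {measure set E -> \bar R}), (mzero : {measure set E -> \bar R}))).
Proof.
apply: is_gradient_intro => //; first by move=> i K _ _; split; rewrite /= /mzero.
by move=> i phi _; rewrite !Rintegral_set0 /Rintegral !integral_measure_zero subrr oppr0.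
Qed.

Definition wenergy k (S : set E) : \bar R := (\int[Lam]_(x in S) (a x * enorm (g k x))%:E)%E.

Lemma energy_wenergy : (0 < N)%N ->
  (energy Omega a W = \sum_k wenergy k Omega)%E.
Proof.
move=> _; apply: eq_bigr => k _.
have -> : (\int[perimeter Omega (W k)]_(x in Omega) (a x)%:E = \int[tv_measure oO (gW k).1]_(x in Omega) (a x)%:E)%E by [].
rewrite (@eq_measure_integral _ _ _ Omega (dens_measure Lam (mge k) (fun x => enorm_ge0 _))).
  rewrite integral_densS//; first by apply/measurable_EFinP.
  by move=> x Ox; rewrite lee_fin ltW// a0.
move=> A mA AO; rewrite tv_measureE (total_variationE oO (dg k))// dens_measureE setIidl//.
Qed.

Lemma wenergy_ge0 k S : S `<=` Omega -> (0 <= wenergy k S)%E.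
Proof. by move=> SO; apply: integral_ge0 => x /SO Sx; rewrite lee_fin mulr_ge0 ?enorm_ge0// ltW// a0. Qed.

(** Giving all of [Omega] to one phase costs no energy, as nothing on the boundary of [Omega] is
    counted; minimality then bounds the energy of [W]. Finiteness is what allows the energy outside
    the cube to be cancelled. *)
Lemma energy_lty : (0 < N)%N -> (energy Omega a W < +oo)%E.
Proof.
move=> N0; pose i0 := Ordinal N0.
pose W0 (k : 'I_N) : set E := if k == i0 then Omega else set0.
have z B : vvalue (fun=> ((mzero : {measure set E -> \bar R}), (mzero : {measure set E -> \bar R}))) B = 0 :> E.
  by apply/rowP => j; rewrite !mxE /mzero /= subrr.
have gW0 k : is_gradient Omega (W0 k) (fun=> ((mzero : {measure set E -> \bar R}), (mzero : {measure set E -> \bar R}))).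
  by rewrite /W0; case: ifP => _; [exact: gradient_full|exact: gradient_set0].
have mW0 k : measurable (W0 k) by rewrite /W0; case: ifP.
have FW0 : Fw Omega W0.
  split => [k|]; first by split => //; [rewrite /W0; case: ifP => _ x|eexists; exact: gW0].
  apply: aeW => x; rewrite (bigD1 i0)//= /W0 eqxx big1 ?addr0// => k /negbTE ->.
  by rewrite indic0.
have [_ /(_ _ FW0)] := minW; rewrite /Jw => h.
have e0 : energy Omega a W0 = 0%E.
  rewrite /energy big1// => k _.
  have gG : is_gradient Omega (W0 k) (gradient Omega (W0 k)) by apply: gradientP; eexists; exact: gW0.
  have -> : (\int[perimeter Omega (W0 k)]_(x in Omega) (a x)%:E = \int[tv_measure oO gG.1]_(x in Omega) (a x)%:E)%E by [].
  rewrite (@eq_measure_integral _ _ _ Omega mzero) ?integral_measure_zero// => A mA AO.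
  rewrite tv_measureE total_variation_eq0// => B mB rB _.
  by rewrite (vvalue_gradient oO (mW0 k) gG (gW0 k)).
move: h; rewrite e0 add0e => h.
have : (energy Omega a W + (G W)%:E < +oo)%E by apply: le_lt_trans h _; rewrite ltry.
case: (energy Omega a W) => [r _||//]; first by rewrite ltry.
by rewrite addye// ltxx.
Qed.

Variables (Omega' : set E) (O'O : Omega' `<=` Omega) (a1 : forall x, Omega' x -> a x <= 1).
Variables (p0 : 'rV[rat]_m.+1 * 'rV[rat]_m.+1).
Let pa : E := map_mx ratr p0.1.
Let pb : E := map_mx ratr p0.2.
Hypothesis (pO : cbox pa pb `<=` Omega').
Variables (c d : E).
Hypotheses (pc : forall i, pa ord0 i <= c ord0 i) (dp : forall i, d ord0 i < pb ord0 i).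
Hypothesis cd : forall i, c ord0 i <= d ord0 i.
Let q := hbox c d.

Definition face_area (A : set E) : \bar R :=
  (\sum_j (leb R m (hbox (delete j c) (delete j d) `&` slice j A (c ord0 j)) +
           leb R m (hbox (delete j c) (delete j d) `&` slice j A (d ord0 j))))%E.

Variables (V : set E) (DV : vmeasure R m.+1) (gV : E -> E) (S : pred 'I_N) (j0 : 'I_N).
Hypotheses (mV : measurable V) (VO : V `<=` Omega) (GV : is_gradient Omega V DV) (dV : density Omega Lam DV gV)
  (jS : ~~ S j0) (WV : {ae leb R m.+1, forall x, \sum_(k | S k) \1_(W k) x = \1_V x :> R}).
Hypotheses (gdV : forall j, lebesgue_slice j V (c ord0 j) /\ lebesgue_slice j V (d ord0 j))
  (gdW : forall k j, S k -> lebesgue_slice j (W k) (c ord0 j) /\ lebesgue_slice j (W k) (d ord0 j)).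

Let cO' : cbox c d `<=` Omega'.
Proof.
apply: subset_trans pO => x xab i; have /andP[h1 h2] := xab i.
by rewrite (le_trans (pc i) h1) (le_trans h2 (ltW (dp i))).
Qed.

Let cO : cbox c d `<=` Omega. Proof. exact: subset_trans O'O. Qed.
Let mq : measurable q. Proof. exact: measurable_hbox. Qed.
Let qO : q `<=` Omega.
Proof. by apply: subset_trans cO => x h i; have /andP[/ltW -> ->] := h i. Qed.

Let pOO : cbox pa pb `<=` Omega. Proof. exact: subset_trans O'O. Qed.

Let a1c x : cbox c d x -> a x <= 1. Proof. by move=> /cO'; exact: a1. Qed.

(* The phase [j0] annexes [V] inside [q], where [V] is the union of the phases in [S]. *)
Definition transferred (k : 'I_N) : set E :=
  if k == j0 then W j0 `|` (V `&` q) else if S k then W k `\` q else W k.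

Let mT k : measurable (transferred k).
Proof.
rewrite /transferred; case: ifP => _; first by apply: measurableU => //; exact: measurableI.
by case: ifP => // _; exact: measurableD.
Qed.

Let aeW : {ae leb R m.+1, forall x, \sum_i \1_(W i) x = \1_Omega x :> R}.
Proof. by case: minW => -[]. Qed.

(** [V] is made of phases other than [j0]: a point of both sets would make the sum of the indicators
    exceed 1, which happens on a null set only. *)
Let j0V : {ae leb R m.+1, forall x, \1_(W j0) x + \1_(V `&` q) x = \1_(W j0 `|` (V `&` q)) x :> R}.
Proof.
apply: (@filterS2 _ _ (ae_filter_ringOfSetsType _)) aeW WV => x h1 h2.
rewrite [RHS]indicE in_setU.
have : \1_(W j0) x + \1_V x <= 1 :> R.
  rewrite -h2; apply: (@le_trans _ _ (\sum_i \1_(W i) x)); last by rewrite h1 indicE; case: (_ \in _).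
  rewrite [leRHS](bigID S) /= [leRHS]addrC lerD2r (bigD1 j0)//= lerDl.
  by apply: sumr_ge0.
rewrite !indicE in_setI; case: (x \in W j0); case: (x \in V) => //=; rewrite ?addr0 ?add0r//; case: (x \in q) => //=; rewrite ?addr0//; lra.
Qed.

Let gcut : exists (D' : vmeasure R m.+1) (SV : {measure set E -> \bar R}), [/\
  is_gradient Omega (V `&` q) D',
  forall B, measurable B -> relatively_compact Omega B ->
    ((enorm (vvalue D' B - vvalue DV (B `&` q)))%:E <= SV B)%E,
  SV setT = face_area V & SV (~` cbox c d) = 0%E].
Proof.
exact: (cut_exists oO mV GV pOO pc dp cd (fun j => (gdV j).1) (fun j => (gdV j).2)).
Qed.

Let gcutW k : S k -> exists (D' : vmeasure R m.+1) (SV : {measure set E -> \bar R}), [/\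
  is_gradient Omega (W k `&` q) D',
  forall B, measurable B -> relatively_compact Omega B ->
    ((enorm (vvalue D' B - vvalue (D k) (B `&` q)))%:E <= SV B)%E,
  SV setT = face_area (W k) & SV (~` cbox c d) = 0%E].
Proof.
move=> Sk.
exact: (cut_exists oO (mW k) (gW k) pOO pc dp cd (fun j => (gdW j Sk).1) (fun j => (gdW j Sk).2)).
Qed.

Let splitW k : {ae leb R m.+1, forall x, \1_(W k `\` q) x + \1_(W k `&` q) x = \1_(W k) x :> R}.
Proof.
apply: measure_negligible.aeW => x; rewrite !indicE in_setD in_setI.
by case: (x \in W k) => //=; case: (x \in q) => //=; rewrite ?addr0 ?add0r.
Qed.

Let lfpT k : locally_finite_perimeter Omega (transferred k).
Proof.
rewrite /transferred; case: ifP => _.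
  have [D' [SV [gD' _ _ _]]] := gcut; exists (vadd (D j0) D').
  by apply: (gradient_add oO _ _ _ j0V) => //; [apply: measurableU => //|]; exact: measurableI.
case: ifP => // Sk; last by exists (D k).
have [D' [SV [gD' _ _ _]]] := gcutW Sk; exists (vadd (D k) (vopp D')).
by apply: (gradient_sub oO _ _ _ (splitW k)) => //; [exact: measurableD|exact: measurableI].
Qed.

Let FT : Fw Omega transferred.
Proof.
split => [k|].
  split => //; rewrite /transferred; case: ifP => _; first by move=> x [/WO//|[/VO]].
  by case: ifP => _ x; [move=> [/WO]|move=> /WO].
apply: (@filterS3 _ _ (ae_filter_ringOfSetsType _)) aeW WV j0V => x h1 h2 h3.
rewrite -h1 (bigD1 j0)//= [RHS](bigD1 j0)//= /transferred eqxx -h3 -addrA; congr (_ + _).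
rewrite (bigID S) [RHS](bigID S) /= addrA; congr (_ + _); last first.
  by apply: eq_bigr => k /andP[/negbTE -> /negbTE ->].
have e : \1_(V `&` q) x = \sum_(k | (k != j0) && S k) (\1_(W k) x * \1_q x) :> R.
  rewrite -mulr_suml; have -> : \sum_(k | (k != j0) && S k) \1_(W k) x = \1_V x :> R.
    rewrite -h2; apply: eq_bigl => k; have [->|//] := eqVneq k j0; by rewrite (negbTE jS).
  by rewrite !indicE in_setI; case: (_ \in _); case: (_ \in _); rewrite ?mulr0 ?mul0r ?mulr1.
rewrite e -big_split /=; apply: eq_bigr => k /andP[/negbTE -> ->].
by rewrite !indicE in_setD; case: (x \in W k); case: (x \in q); rewrite /= ?mulr0 ?mul0r ?mulr1 ?addr0 ?add0r.
Qed.

(** Where [W j0] and [V] meet, their gradients are opposite and cancel in the sum: this is the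
    perimeter saved by the transfer. *)
Let I' : \bar R := (\int[Lam]_(x in q) (a x * enorm (g j0 x + gV x))%:E)%E.

Let split_int (h : E -> R) (h1 h2 : E -> R) : (forall x, 0 <= h1 x) -> (forall x, 0 <= h2 x) ->
  measurable_fun setT h1 -> measurable_fun setT h2 ->
  (forall x, ~ q x -> h x = h1 x) -> (forall x, q x -> h x = h2 x) ->
  [/\ measurable_fun setT h, forall x, 0 <= h x, 
   (\int[Lam]_(x in Omega) (a x * h x)%:E =
    \int[Lam]_(x in Omega `\` q) (a x * h1 x)%:E + \int[Lam]_(x in q) (a x * h2 x)%:E)%E &
   forall B, measurable B -> (\int[Lam]_(x in B) (h x)%:E =
     \int[Lam]_(x in B `\` q) (h1 x)%:E + \int[Lam]_(x in B `&` q) (h2 x)%:E)%E].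
Proof.
move=> h10 h20 mh1 mh2 e1 e2.
have hE : h = (fun x => if x \in q then h2 x else h1 x).
  by apply/funext => x; case: ifPn => [/set_mem/e2//|/negP xq]; apply: e1 => qx; apply: xq; rewrite inE.
have mh : measurable_fun setT h.
  rewrite hE; apply: measurable_fun_ifT => //.
  by apply: (measurable_fun_bool true) => /=; rewrite setTI preimage_mem_true.
have h0 x : 0 <= h x by rewrite hE; case: ifP.
have gen B (w : E -> R) : measurable B -> measurable_fun B w -> (forall x, B x -> 0 <= w x) ->
   (\int[Lam]_(x in B) (w x * h x)%:E =
     \int[Lam]_(x in B `\` q) (w x * h1 x)%:E + \int[Lam]_(x in B `&` q) (w x * h2 x)%:E)%E.
  move=> mB mw w0.
  have mBq : measurable (B `&` q) by exact: measurableI.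
  have mBD : measurable (B `\` q) by exact: measurableD.
  have mwh : measurable_fun B (fun x => (w x * h x)%:E).
    by apply/measurable_EFinP; apply: measurable_funM => //; exact: measurable_funTS.
  rewrite -{1}(setUIDK B q) ge0_integral_setU//; last 3 first.
  - by rewrite setUIDK.
  - by rewrite setUIDK => x Bx; rewrite lee_fin mulr_ge0// w0.
  - by apply/disj_set2P; rewrite setDE setIACA setICr setI0.
  rewrite addeC; congr (_ + _)%E; apply: eq_integral => x /set_mem[_ xq].
    by rewrite e1.
  by rewrite e2.
split => //.
  rewrite gen//; first by rewrite [X in (_ + X)%E](_ : _ = \int[Lam]_(x in q) (a x * h2 x)%:E)%E// setIidr.
  by move=> x Ox; rewrite ltW// a0.
move=> B mB; have := gen B (fun=> 1) mB; rewrite /= => hh.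
under eq_integral do rewrite -[h _]mul1r.
rewrite hh//; congr (_ + _)%E; by under eq_integral do rewrite mul1r.
Qed.

Let enorm_bound (DD : vmeasure R m.+1) (gg : E -> E) B : density Omega Lam DD gg -> measurable B -> relatively_compact Omega B ->
  ((enorm (vvalue DD B))%:E <= \int[Lam]_(x in B) (enorm (gg x))%:E)%E.
Proof.
move=> dd mB rB; have := enorm_vvalue dd mB rB; rewrite -lee_fin => /le_trans; apply.
by rewrite /Rintegral fineK//; exact: (integrable_fin_num mB (integrable_enorm dd mB rB)).
Qed.

(** Each new gradient is the old one off [q], plus what is left inside [q], plus a face part;
    [energy_le] converts this decomposition into energies. *)
Let energy_transferred k : (\int[perimeter Omega (transferred k)]_(x in Omega) (a x)%:E <=
  wenergy k (Omega `\` q) +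
  (if k == j0 then I' + face_area V else if S k then face_area (W k) else wenergy k q))%E.
Proof.
have subD B : relatively_compact Omega B -> relatively_compact Omega (B `\` q).
  by apply: sub_relatively_compact => x [].
have subI B : relatively_compact Omega B -> relatively_compact Omega (B `&` q).
  by apply: sub_relatively_compact => x [].
have vsplit (DD : vmeasure R m.+1) B : locally_finite Omega DD -> measurable B -> relatively_compact Omega B ->
    vvalue DD B = vvalue DD (B `\` q) + vvalue DD (B `&` q).
  move=> lf mB rB; have mBD : measurable (B `\` q) by exact: measurableD.
  have mBI : measurable (B `&` q) by exact: measurableI.
  have dj : [disjoint B `&` q & B `\` q].
    by apply/disj_set2P; rewrite setDE setIACA setICr setI0.
  apply/rowP => j; rewrite !mxE.
  have [h1 h2] := locally_finite_fin j lf mBD (subD _ rB).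
  have [h3 h4] := locally_finite_fin j lf mBI (subI _ rB).
  rewrite -{1 2}(setUIDK B q) !measureU//; try by apply/disj_set2P.
  by rewrite !fineD//; ring.
rewrite /transferred; case: ifP => [/eqP ->|_].
  have [D' [SV [gD' D'E SVT SV0]]] := gcut.
  have mVq : measurable (V `&` q) by exact: measurableI.
  have mU : measurable (W j0 `|` (V `&` q)) by exact: measurableU.
  have gU := gradient_add oO mU (mW j0) mVq j0V (gW j0) gD'.
  pose h x := if x \in q then enorm (g j0 x + gV x) else enorm (g j0 x).
  have dsum : density Omega Lam (vadd (D j0) DV) (fun x => g j0 x + gV x).
    exact: density_add (gW j0).1 GV.1 (dg j0) dV.
  have [mh h0 hO hB] := @split_int h (fun x => enorm (g j0 x)) (fun x => enorm (g j0 x + gV x))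
    (fun x => enorm_ge0 _) (fun x => enorm_ge0 _) (mge j0)
    (measurable_enorm (let: And3 z _ _ := dsum in z))
    (fun x xq => ltac:(by rewrite /h memNset)) (fun x xq => ltac:(by rewrite /h mem_set)).
  apply: le_trans (energy_le (Lam := Lam) oO ma a0 cO a1c mU gU mh h0 SV0 _) _; last first.
    rewrite hO SVT -addeA; apply: leeD; first exact: lexx.
  by apply: leeD; exact: lexx.
  move=> B mB rB; have mBD : measurable (B `\` q) by exact: measurableD.
  have mBI : measurable (B `&` q) by exact: measurableI.
  rewrite hB// (vvalue_add (gW j0).1 gD'.1 mB rB) (vsplit _ _ (gW j0).1 mB rB).
  have -> : vvalue (D j0) (B `\` q) + vvalue (D j0) (B `&` q) + vvalue D' B =
      vvalue (D j0) (B `\` q) + vvalue (vadd (D j0) DV) (B `&` q) + (vvalue D' B - vvalue DV (B `&` q)).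
    rewrite (vvalue_add (gW j0).1 GV.1 mBI (subI _ rB)).
    by apply/rowP => i; rewrite !mxE; ring.
  apply: (@le_trans _ _ ((enorm (vvalue (D j0) (B `\` q)))%:E + (enorm (vvalue (vadd (D j0) DV) (B `&` q)))%:E + (enorm (vvalue D' B - vvalue DV (B `&` q)))%:E)%E).
    rewrite -!EFinD lee_fin; apply: le_trans (enormD _ _) _; rewrite lerD2r; exact: enormD.
  apply: leeD; last exact: D'E.
  by apply: leeD; [apply: (enorm_bound (dg j0) mBD); exact: subD|apply: (enorm_bound dsum mBI); exact: subI].
case: ifPn => [Sk|_]; last first.
  have [mh h0 hO hB] := @split_int (fun x => enorm (g k x)) (fun x => enorm (g k x)) (fun x => enorm (g k x))
    (fun x => enorm_ge0 _) (fun x => enorm_ge0 _) (mge k) (mge k) (fun x _ => erefl) (fun x _ => erefl).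
  apply: le_trans (energy_le (Lam := Lam) oO ma a0 cO a1c (mW k) (gW k) mh h0 (_ : (mzero : {measure set E -> \bar R}) _ = 0%E) _) _ => //.
    by move=> B mB rB; rewrite [X in (_ + X)%E](_ : _ = 0%E)// adde0; exact: (enorm_bound (dg k) mB rB).
  by rewrite hO [X in (_ + X <= _)%E](_ : _ = 0%E)// adde0.
have [D' [SV [gD' D'E SVT SV0]]] := gcutW Sk.
have mWq : measurable (W k `&` q) by exact: measurableI.
have mU : measurable (W k `\` q) by exact: measurableD.
have gU := gradient_sub oO (mW k) mU mWq (splitW k) (gW k) gD'.
pose h x := if x \in q then 0 else enorm (g k x).
have [mh h0 hO hB] := @split_int h (fun x => enorm (g k x)) (fun=> 0)
    (fun x => enorm_ge0 _) (fun x => lexx _) (mge k) (@measurable_cst _ _ _ _ _ _)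
    (fun x xq => ltac:(by rewrite /h memNset)) (fun x xq => ltac:(by rewrite /h mem_set)).
apply: le_trans (energy_le (Lam := Lam) oO ma a0 cO a1c mU gU mh h0 SV0 _) _; last first.
  by rewrite hO SVT [X in (_ + X + _)%E]integral0_eq ?adde0// => x _; rewrite mulr0.
move=> B mB rB; have mBD : measurable (B `\` q) by exact: measurableD.
rewrite hB// (vvalue_add (gW k).1 (locally_finite_vopp gD'.1) mB rB) (vsplit _ _ (gW k).1 mB rB) vvalue_opp.
have -> : vvalue (D k) (B `\` q) + vvalue (D k) (B `&` q) - vvalue D' B =
      vvalue (D k) (B `\` q) + - (vvalue D' B - vvalue (D k) (B `&` q)).
  by apply/rowP => i; rewrite !mxE; ring.
rewrite [X in (_ + X + _)%E]integral0_eq// adde0.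
apply: (@le_trans _ _ ((enorm (vvalue (D k) (B `\` q)))%:E + (enorm (vvalue D' B - vvalue (D k) (B `&` q)))%:E)%E).
  by rewrite -!EFinD lee_fin -(enormN (vvalue D' B - _)); exact: enormD.
by apply: leeD; [apply: (enorm_bound (dg k) mBD); exact: subD|exact: D'E].
Qed.

Let Mq := fine (leb R m.+1 (V `&` q)).

Let leb_fin B : measurable B -> B `<=` Omega -> leb R m.+1 B \is a fin_num.
Proof.
move=> mB BO; rewrite ge0_fin_numE//; apply: le_lt_trans lO.
by apply: le_measure; rewrite ?inE.
Qed.

(** The transferred volume counts twice, once as gained by [j0] and once as lost by the phases in
    [S]. *)
Let dist_transferred : (distw W transferred <= (2 * Mq)%:E)%E.
Proof.
have mVq : measurable (V `&` q) by exact: measurableI.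
have VqO : V `&` q `<=` Omega by move=> x [/VO].
rewrite /distw (bigD1 j0)//=.
have -> : (2 * Mq)%:E = (leb R m.+1 (V `&` q) + leb R m.+1 (V `&` q))%E.
  by rewrite /Mq mulr_natl mulr2n EFinD fineK//; exact: leb_fin.
apply: leeD.
  apply: le_measure; rewrite ?inE//.
    by rewrite /transferred eqxx; apply: measurableU; apply: measurableD => //; exact: measurableU.
  by rewrite /transferred eqxx => x [[h1 h2]|[[//|//]]]; exfalso; apply: h2; left.
rewrite -(sum_leb mW mV mq WV) (bigID S) /= [X in (_ + X)%E]big1 ?adde0; last first.
  move=> k /andP[/negbTE kj /negbTE Sk]; rewrite /transferred kj Sk (_ : _ `+` _ = set0) ?measure0//.
  by apply/seteqP; split => // x [[]|[]].
rewrite (eq_bigl S); last first.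
  by move=> k; have [->|//] := eqVneq k j0; rewrite (negbTE jS).
apply: lee_sum => k Sk; apply: le_measure; rewrite ?inE//.
- by apply: measurableU; apply: measurableD.
- exact: measurableI.
have kj : k == j0 = false by apply/negP => /eqP e; move: Sk; rewrite e (negbTE jS).
rewrite /transferred kj Sk => x [[h1 h2]|[[]//]]; split => //.
by apply: contrapT => h3; apply: h2.
Qed.

(** Minimality against [transferred]; the energy off [q] appears on both sides and is finite, hence
    cancels. *)
Lemma transfer_ineq : (0 < N)%N ->
  (\sum_k wenergy k q <= \sum_k
    (if k == j0 then I' + face_area V else if S k then face_area (W k) else wenergy k q) +
    (Calpha * (2 * Mq) `^ alpha)%:E)%E.
Proof.
move=> N0; have elty := energy_lty N0.
pose X k : \bar R := if k == j0 then (I' + face_area V)%E else if S k then face_area (W k) else wenergy k q.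
rewrite -/X.
have [FW /(_ _ FT)] := minW; rewrite /Jw => hJ.
have mqD : measurable (Omega `\` q) by exact: measurableD.
have sp k : wenergy k Omega = (wenergy k (Omega `\` q) + wenergy k q)%E.
  by rewrite /wenergy; have [_ _ -> _] := @split_int (fun x => enorm (g k x)) (fun x => enorm (g k x)) (fun x => enorm (g k x))
    (fun x => enorm_ge0 _) (fun x => enorm_ge0 _) (mge k) (mge k) (fun x _ => erefl) (fun x _ => erefl).
have eW : energy Omega a W = (\sum_k wenergy k (Omega `\` q) + \sum_k wenergy k q)%E.
  by rewrite (energy_wenergy N0) -big_split; apply: eq_bigr => k _; exact: sp.
have eT : (energy Omega a transferred <= \sum_k wenergy k (Omega `\` q) + \sum_k X k)%E.
  by rewrite -big_split; apply: lee_sum => k _; exact: energy_transferred.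
have P1 : (0 <= \sum_k wenergy k (Omega `\` q))%E by apply: sume_ge0 => k _; apply: wenergy_ge0 => x [].
have P2 : (0 <= \sum_k wenergy k q)%E by apply: sume_ge0 => k _; exact: wenergy_ge0.
have dfin : distw W transferred \is a fin_num.
  rewrite ge0_fin_numE; first by apply: le_lt_trans dist_transferred _; rewrite ltry.
  by apply: sume_ge0.
have GG : G transferred - G W <= Calpha * (2 * Mq) `^ alpha.
  apply: le_trans (ler_norm _) _; rewrite distrC; apply: le_trans (hG FW FT) _.
  apply: ler_wpM2l => //; apply: ge0_ler_powR => //.
  - by rewrite nnegrE fine_ge0// sume_ge0.
  - by rewrite nnegrE mulr_ge0// fine_ge0.
  by rewrite -lee_fin fineK.
move: elty hJ; rewrite eW => elty hJ.
have := le_trans hJ (leeD eT (lexx (G transferred)%:E)).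
have X0 k : (0 <= X k)%E.
  rewrite /X; case: ifP => _.
    apply: adde_ge0; first by apply: integral_ge0 => x /qO Ox; rewrite lee_fin mulr_ge0 ?enorm_ge0// ltW// a0.
    by apply: sume_ge0 => j _; exact: adde_ge0.
  by case: ifP => _; [apply: sume_ge0 => j _; exact: adde_ge0|exact: wenergy_ge0].
have P3 : (0 <= \sum_k X k)%E by exact: sume_ge0.
have ufin : (\sum_k wenergy k (Omega `\` q))%E \is a fin_num.
  by rewrite ge0_fin_numE//; apply: le_lt_trans elty; rewrite leeDl.
have vfin : (\sum_k wenergy k q)%E \is a fin_num.
  by rewrite ge0_fin_numE//; apply: le_lt_trans elty; rewrite leeDr.
rewrite -(fineK ufin) -(fineK vfin); case: (\sum_k X k)%E P3 => [w|_|//] _; last by rewrite addye// leey.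
rewrite -!EFinD !lee_fin => h; lra.
Qed.

End transfer.

(** * Vectors of sum zero *)

Section phase_vectors.
Variables (R : realType) (n : nat).
Local Notation E := 'rV[R]_n.

(** The hypothesis makes the scalar product nonpositive and gives $|u|\le N|v|$, that is
    $c|u|\le(1-c)|v|$ for $c=1/(N+1)$. Expanding the square,
    $(|u|+|v|-c|u|)^2\ge|u|^2+|v|^2\ge|u+v|^2$. *)
Lemma phase_pair (N : R) (u v : E) : 0 < N -> u != 0 -> dotv v u <= - (enorm u ^+ 2 / N) ->
  enorm u / (N + 1) <= enorm u + enorm v - enorm (u + v).
Proof.
move=> N0 u0 h; have up := enorm_gt0 u0.
have cs : enorm u ^+ 2 / N <= enorm v * enorm u.
  apply: (@le_trans _ _ (dotv (- v) u)); first by rewrite dotvN lerNr.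
  by apply: le_trans (cauchy_schwarz _ _) _; rewrite enormN.
have w2 : enorm (u + v) ^+ 2 = enorm u ^+ 2 + dotv v u *+ 2 + enorm v ^+ 2.
  by rewrite sqr_enorm dotvDl !dotvDr (dotvC u v) -!sqr_enorm; ring.
have s0 : dotv v u <= 0 by apply: le_trans h _; rewrite oppr_le0 divr_ge0 ?sqr_ge0// ltW.
move: (enorm u) (enorm v) (enorm (u + v)) (dotv v u) up (enorm_ge0 v) (enorm_ge0 (u + v)) cs w2 s0 => a b w s a0 b0 w0 cs w2 s0.
have N1 : 0 < N + 1 by rewrite addr_gt0.
pose c := (N + 1)^-1.
have c0 : 0 < c by rewrite invr_gt0.
have cN : c * N = 1 - c by rewrite /c; field; rewrite gt_eqF.
have c1 : c <= 1 by rewrite invf_le1// lerDr ltW.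
have ab : a <= N * b.
  move: cs; rewrite ler_pdivrMr// expr2 (mulrC b) -mulrA ler_pM2l// => /le_trans; apply.
  by rewrite mulrC.
rewrite -/c lerBrDr -lerBrDl.
have z0 : 0 <= a + b - a * c.
  have : a * c <= a * 1 by rewrite ler_pM2l.
  by rewrite mulr1; lra.
rewrite -[a / _]/(a * c).
rewrite -(@ler_pXn2r _ 2)// w2 -mulr_natl.
have h1 : c * a <= (1 - c) * b by rewrite -cN -mulrA ler_pM2l.
have h2 : a * (c * a) <= a * ((1 - c) * b) by rewrite ler_pM2l.
have h3 : 0 <= (c * a) ^+ 2 by exact: sqr_ge0.
nra.
Qed.

(* One of the other vectors has a component of length at least |v i| / N opposite
   to [v i]. *)
Lemma phase_sum N (v : 'I_N -> E) i : \sum_k v k = 0 ->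
  enorm (v i) / (N%:R + 1) + \sum_(j | j != i) enorm (v i + v j) <=
  \sum_(j | j != i) (enorm (v i) + enorm (v j)).
Proof.
move=> v0.
have N0 : 0 < N%:R :> R by rewrite ltr0n; case: N i v v0 => [[]|].
have tri j : enorm (v i + v j) <= enorm (v i) + enorm (v j) by exact: enormD.
have [->|vi] := eqVneq (v i) 0.
  rewrite enorm0 mul0r add0r; apply: ler_sum => j _.
  by rewrite !add0r.
(* Otherwise the other $N-1$ scalar products would add up to at least
   $-\frac{N-1}{N}|v_i|^2>-|v_i|^2$, whereas with $|v_i|^2$ they add up to 0. *)
have [j ji hj] : exists2 j, j != i & dotv (v j) (v i) <= - (enorm (v i) ^+ 2 / N%:R).
  apply: contrapT => h.
  have hs j : j != i -> - (enorm (v i) ^+ 2 / N%:R) <= dotv (v j) (v i).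
    by move=> ji; rewrite leNgt; apply/negP => hj; apply: h; exists j => //; exact: ltW.
  have sumd : forall s : seq 'I_N, dotv (\sum_(k <- s) v k) (v i) = \sum_(k <- s) dotv (v k) (v i).
    elim=> [|k s IH]; first by rewrite !big_nil /dotv big1// => l _; rewrite mxE mul0r.
    by rewrite !big_cons dotvDl IH.
  have : \sum_k dotv (v k) (v i) = 0.
    by rewrite -sumd v0 /dotv big1// => l _; rewrite mxE mul0r.
  rewrite (bigD1 i)//= -sqr_enorm => e.
  have : \sum_(j < N | j != i) (- (enorm (v i) ^+ 2 / N%:R)) <= \sum_(k | k != i) dotv (v k) (v i).
    by apply: ler_sum => k; exact: hs.
  rewrite sumr_const => le.
  have cN : #|(fun j : 'I_N => j != i)| = N.-1.
    by have := cardC1 i; rewrite card_ord => <-; apply: eq_card.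
  have e2 : \sum_(k | k != i) dotv (v k) (v i) = - enorm (v i) ^+ 2 by apply/eqP; rewrite -addr_eq0 addrC e.
  move: le; rewrite cN e2 => le.
  have p := enorm_gt0 vi.
  have : - (enorm (v i) ^+ 2 / N%:R) *+ N.-1 > - enorm (v i) ^+ 2.
    rewrite mulNrn ltrN2 -[_ *+ N.-1]mulr_natr mulrAC ltr_pdivrMr// ltr_pM2l ?exprn_gt0// ltr_nat prednK//.
    by rewrite -(ltr0n R).
  by rewrite ltNge le.
rewrite (bigD1 j)//= [leRHS](bigD1 j)//= addrA; apply: lerD; last by apply: ler_sum => k _.
by have := phase_pair N0 vi hj; lra.
Qed.

End phase_vectors.

Section density_extra.
Variables (R : realType) (n : nat) (Omega : set 'rV[R]_n) (Lam : {measure set 'rV[R]_n -> \bar R}).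
Local Notation E := 'rV[R]_n.

Definition vzero : vmeasure R n := fun=> ((mzero : {measure set E -> \bar R}), (mzero : {measure set E -> \bar R})).

Lemma vvalue_vzero B : vvalue vzero B = 0.
Proof. by apply/rowP => j; rewrite !mxE /mzero /= subrr. Qed.

Lemma density_vzero : density Omega Lam vzero (fun=> 0).
Proof.
split.
- by move=> j; exact: measurable_cst.
- move=> j B mB _; have -> : (fun _ : E => ((0 : E) ord0 j)%:E) = cst 0%E by apply/funext => x; rewrite mxE.
  exact: integrable0.
move=> B mB _; rewrite vvalue_vzero; apply/rowP => j; rewrite !mxE.
by rewrite /Rintegral integral0.
Qed.

Lemma density_vopp D g : density Omega Lam D g -> density Omega Lam (vopp D) (fun x => - g x).
Proof.
move=> [mg ig e]; split.
- move=> j; apply: (eq_measurable_fun (fun x => - g x ord0 j)); first by move=> x _; rewrite mxE.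
  exact: measurable_funN.
- move=> j B mB rB; apply: (eq_integrable mB (fun x => - (g x ord0 j)%:E)%E); first by move=> x _; rewrite mxE EFinN.
  by apply: integrableN; exact: ig.
move=> B mB rB; rewrite vvalue_opp e//; apply/rowP => j; rewrite !mxE.
rewrite -[LHS]mulN1r -RintegralZl//; last exact: ig.
by apply: eq_Rintegral => x _; rewrite mxE mulN1r.
Qed.

End density_extra.

Section cube_inequality.
Variables (R : realType) (m N : nat) (alpha Calpha : R).
Local Notation E := 'rV[R]_m.+1.
Variables (Omega : set E) (a : E -> R) (G : ('I_N -> set E) -> R) (W : 'I_N -> set E).
Hypotheses (oO : open Omega) (lO : (leb R m.+1 Omega < +oo)%E)
  (ma : measurable_fun Omega a) (a0 : forall x, Omega x -> 0 < a x)
  (alpha0 : 0 <= alpha) (C0 : 0 <= Calpha)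
  (hG : forall W1 W2 : 'I_N -> set E, Fw Omega W1 -> Fw Omega W2 ->
      `|G W1 - G W2| <= Calpha * (fine (distw W1 W2)) `^ alpha)
  (minW : minimizes_Jw Omega a G W).
Variables (Lam : {measure set E -> \bar R}) (g : 'I_N -> E -> E).
Hypotheses (dg : forall k, density Omega Lam (gradient Omega (W k)) (g k)).

Let mO : measurable Omega. Proof. exact: open_measurable_rV. Qed.
Let mW k : measurable (W k). Proof. by case: minW => -[/(_ k)[]]. Qed.
Let WO k : W k `<=` Omega. Proof. by case: minW => -[/(_ k)[]]. Qed.
Let gW k : is_gradient Omega (W k) (gradient Omega (W k)).
Proof. by apply: gradientP; case: minW => -[/(_ k)[]]. Qed.
Let aeW : {ae leb R m.+1, forall x, \sum_i \1_(W i) x = \1_Omega x :> R}.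
Proof. by case: minW => -[]. Qed.
Let mge k : measurable_fun setT (fun x => enorm (g k x)).
Proof. by apply: measurable_enorm; case: (dg k). Qed.

(** The phases being almost disjoint, the indicator of a union of phases is almost everywhere the
    sum of theirs, so gradients and densities add up. *)
Lemma gradient_sum (s : seq 'I_N) : uniq s -> exists A DD, [/\ measurable A,
  {ae leb R m.+1, forall x, \sum_(k <- s) \1_(W k) x = \1_A x :> R},
  is_gradient Omega A DD & density Omega Lam DD (fun x => \sum_(k <- s) g k x)].
Proof.
elim: s => [_|k s IH /= /andP[ks us]].
  exists set0, (@vzero R m.+1); split => //.
  - by apply: measure_negligible.aeW => x; rewrite big_nil indic0.
  - exact: gradient_set0.
  have -> : (fun x : E => \sum_(k <- [::]) g k x) = (fun=> 0) by apply/funext => x; rewrite big_nil.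
  exact: density_vzero.
have [A [DD [mA ae gA dA]]] := IH us.
have mU : measurable (W k `|` A) by exact: measurableU.
have aeU : {ae leb R m.+1, forall x, \1_(W k) x + \1_A x = \1_(W k `|` A) x :> R}.
  apply: (@filterS2 _ _ (ae_filter_ringOfSetsType _)) aeW ae => x h1 h2.
  have : \1_(W k) x + \1_A x <= 1 :> R.
    rewrite -h2 -[leLHS](big_cons _ _ k s xpredT (fun k => \1_(W k) x)).
    apply: (@le_trans _ _ (\sum_i \1_(W i) x)); last by rewrite h1 indicE; case: (_ \in _).
    rewrite big_uniq /= ?ks// [leRHS](bigID (fun i => i \in k :: s)) /= lerDl.
    by apply: sumr_ge0.
  by rewrite !indicE in_setU; case: (x \in W k); case: (x \in A) => //=; rewrite ?addr0 ?add0r//; lra.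
exists (W k `|` A), (vadd (gradient Omega (W k)) DD); split => //.
- apply: (@filterS2 _ _ (ae_filter_ringOfSetsType _)) ae aeU => x h1 h2.
  by rewrite big_cons h1 h2.
- exact: (gradient_add oO mU (mW k) mA aeU (gW k) gA).
have -> : (fun x => \sum_(l <- k :: s) g l x) = (fun x => g k x + \sum_(l <- s) g l x).
  by apply/funext => x; rewrite big_cons.
exact: density_add (gW k).1 gA.1 (dg k) dA.
Qed.

(** All phases together fill [Omega], whose gradient is 0: the total variation of the summed
    gradient vanishes, hence so does its density. *)
Lemma sum_density_zero : {ae Lam, forall x, Omega x -> \sum_k g k x = 0}.
Proof.
have [A [DD [mA ae gA dA]]] := gradient_sum (index_enum_uniq 'I_N).
have ae2 : {ae leb R m.+1, forall x, \1_A x + \1_(set0 : set E) x = \1_Omega x :> R}.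
  apply: (@filterS2 _ _ (ae_filter_ringOfSetsType _)) aeW ae => x h1 h2.
  by rewrite [\1_set0 x]indic0// addr0 -h1 -h2.
have gO := gradient_add oO mO mA measurable0 ae2 gA (gradient_set0 oO).
have z : Defs.total_variation Omega DD Omega = 0%E.
  apply: total_variation_eq0 => B mB rB _.
  have := vvalue_gradient oO mO gO (gradient_full oO) mB rB.
  rewrite (vvalue_add gA.1 (gradient_set0 oO).1 mB rB).
  by rewrite (vvalue_vzero B) addr0.
move: z; rewrite (total_variationE oO dA mO) setIid => z.
have me : measurable_fun Omega (fun x => (enorm (\sum_k g k x))%:E).
  by apply: measurable_funTS; apply/measurable_EFinP; apply: measurable_enorm; case: dA.
have /(ae_eq_integral_abs _ mO me) h : (\int[Lam]_(x in Omega) `|(enorm (\sum_k g k x))%:E| = 0)%E.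
  by rewrite -z; apply: eq_integral => x _; rewrite gee0_abs// lee_fin enorm_ge0.
apply: (@filterS _ _ (ae_filter_ringOfSetsType _)) h => x h Ox.
by have [/enorm_eq0] := h Ox.
Qed.

Variables (Omega' : set E) (O'O : Omega' `<=` Omega) (delta : R) (delta0 : 0 < delta)
  (a1 : forall x, Omega' x -> delta <= a x <= 1).
Variables (p0 : 'rV[rat]_m.+1 * 'rV[rat]_m.+1).
Let pa : E := map_mx ratr p0.1.
Let pb : E := map_mx ratr p0.2.
Hypothesis (pO : cbox pa pb `<=` Omega').
Variables (c d : E).
Hypotheses (pc : forall i, pa ord0 i <= c ord0 i) (dp : forall i, d ord0 i < pb ord0 i).
Hypothesis cd : forall i, c ord0 i <= d ord0 i.
Let q := hbox c d.
Variable i : 'I_N.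
Hypotheses (gdW : forall k j, lebesgue_slice j (W k) (c ord0 j) /\ lebesgue_slice j (W k) (d ord0 j))
  (gdV : forall j, lebesgue_slice j (Omega `\` W i) (c ord0 j) /\ lebesgue_slice j (Omega `\` W i) (d ord0 j)).

Let a1' x : Omega' x -> a x <= 1. Proof. by move=> /a1/andP[]. Qed.
Let N0 : (0 < N)%N. Proof. by apply: leq_ltn_trans (ltn_ord i). Qed.
Let mq : measurable q. Proof. exact: measurable_hbox. Qed.

Let qO' : q `<=` Omega'.
Proof.
move=> x h; apply: pO => k; have /andP[h1 h2] := h k.
by rewrite (le_trans (pc k) (ltW h1)) (le_trans h2 (ltW (dp k))).
Qed.
Let qO : q `<=` Omega. Proof. exact: subset_trans O'O. Qed.

Let rq : relatively_compact Omega q.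
Proof.
apply: (@box_rc _ _ Omega p0); first exact: subset_trans O'O.
by move=> x h k; have /andP[h1 h2] := h k; rewrite (le_trans (pc k) (ltW h1)) (le_trans h2 (ltW (dp k))).
Qed.

Let maq : measurable_fun q a. Proof. by apply: measurable_funS ma. Qed.

Let face_fin A : measurable A -> face_area c d A \is a fin_num.
Proof.
move=> mA; rewrite ge0_fin_numE; last by apply: sume_ge0 => j _; exact: adde_ge0.
apply: lte_sum_pinfty => j _; apply: lte_add_pinfty.
  apply: le_lt_trans (leb_hbox_lty (delete j c) (delete j d)); apply: le_measure; rewrite ?inE//; [|exact: measurable_hbox].
  by apply: measurableI; [exact: measurable_hbox|exact: measurable_sl].
apply: le_lt_trans (leb_hbox_lty (delete j c) (delete j d)); apply: le_measure; rewrite ?inE//; [|exact: measurable_hbox].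
by apply: measurableI; [exact: measurable_hbox|exact: measurable_sl].
Qed.

Let wfin D0 (h : E -> E) : density Omega Lam D0 h ->
  (0 <= \int[Lam]_(x in q) (a x * enorm (h x))%:E)%E /\ (\int[Lam]_(x in q) (a x * enorm (h x))%:E)%E \is a fin_num.
Proof.
move=> dh.
have p : (0 <= \int[Lam]_(x in q) (a x * enorm (h x))%:E)%E.
  by apply: integral_ge0 => x qx; rewrite lee_fin mulr_ge0 ?enorm_ge0// ltW// a0//; exact: qO.
split=> //; rewrite ge0_fin_numE//.
have ie := integrable_enorm dh mq rq.
apply: (@le_lt_trans _ _ (\int[Lam]_(x in q) (enorm (h x))%:E)%E).
  apply: ge0_le_integral => //.
  - by move=> x qx; rewrite lee_fin mulr_ge0 ?enorm_ge0// ltW// a0//; exact: qO.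
  - apply/measurable_EFinP; apply: measurable_funM => //.
    by apply: measurable_funTS; apply: measurable_enorm; case: dh.
  - by apply/measurable_EFinP; apply: measurable_funTS; apply: measurable_enorm; case: dh.
  - by move=> x qx; rewrite lee_fin ler_piMl ?enorm_ge0// a1'//; exact: qO'.
have := integrable_fin_num mq ie; rewrite ge0_fin_numE//.
by apply: integral_ge0 => x _; rewrite lee_fin enorm_ge0.
Qed.

Let e k := fine (wenergy a Lam g k q).
Let eE k : wenergy a Lam g k q = (e k)%:E.
Proof. by rewrite /e fineK//; case: (wfin (dg k)). Qed.
Let e0 k : 0 <= e k.
Proof. by apply: fine_ge0; case: (wfin (dg k)). Qed.
Let f A := fine (face_area c d A).

(** Phase [j] annexes [W i] inside [q]. The faces of [W i] count twice, as added to [j] and as left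
    on [i]; the energies of the other phases cancel. *)
Lemma transfer_one j : j != i ->
  e i + e j <= fine (\int[Lam]_(x in q) (a x * enorm (g j x + g i x))%:E)%E + 2 * f (W i) +
    Calpha * (2 * fine (leb R m.+1 (W i `&` q))) `^ alpha.
Proof.
move=> ji.
have ae1 : {ae leb R m.+1, forall x, \sum_(k | pred1 i k) \1_(W k) x = \1_(W i) x :> R}.
  by apply: measure_negligible.aeW => x; rewrite big_pred1_eq.
have gd1 k j' : pred1 i k -> lebesgue_slice j' (W k) (c ord0 j') /\ lebesgue_slice j' (W k) (d ord0 j') by [].
have := @transfer_ineq R m N alpha Calpha Omega a G W oO lO ma a0 alpha0 C0 hG minW Lam g dg Omega' O'O a1' p0 pO c d pc dp cd
  (W i) _ _ (pred1 i) j (mW i) (@WO i) (gW i) (dg i) ji ae1 (gdW i) gd1 N0.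
have dsum := density_add (gW j).1 (gW i).1 (dg j) (dg i).
have [_ h2] := wfin dsum.
set I' := (\int[Lam]_(x in q) _)%E; have I'E : I' = (fine I')%:E by rewrite fineK.
have fE : face_area c d (W i) = (f (W i))%:E by rewrite /f fineK// face_fin.
rewrite (eq_bigr (fun k => (e k)%:E)); last by move=> k _; exact: eE.
rewrite [X in (_ <= X + _)%E -> _](eq_bigr (fun k => (if k == j then fine I' + f (W i) else if k == i then f (W i) else e k)%:E)); last first.
  move=> k _; rewrite fE I'E eE /=; case: ifP => _; first by rewrite EFinD.
  by case: eqVneq => [->|_]; rewrite ?fE.
rewrite !sumEFin -EFinD lee_fin (bigD1 j)//= [X in _ <= X + _ -> _](bigD1 j)//= eqxx.
rewrite (bigD1 i)/=; last by rewrite eq_sym.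
rewrite [X in _ <= _ + X + _ -> _](bigD1 i)/=; last by rewrite eq_sym.
rewrite eqxx eq_sym (negbTE ji).
rewrite [X in _ <= _ + (_ + X) + _ -> _](eq_bigr e); last first.
  by move=> k /andP[/negbTE -> /negbTE ->].
by move=> h; lra.
Qed.

Let fineI (D0 : vmeasure R m.+1) (h : E -> E) : density Omega Lam D0 h ->
  (\int[Lam]_(x in q) (a x * enorm (h x))%:E = (fine (\int[Lam]_(x in q) (a x * enorm (h x))%:E))%:E)%E.
Proof. by move=> dh; rewrite fineK//; case: (wfin dh). Qed.

(** Merging phase [i] into phase [j] saves [e i + e j] minus the energy of the sum of the two
    densities; by [transfer_one] this is at most [r]. By [phase_sum], integrated with the weight
    [a], these savings add up over [j] to at least [e i / (N%:R + 1)]. *)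
Lemma phase_energy : e i / (N%:R + 1) <=
  N%:R * (2 * f (W i) + Calpha * (2 * fine (leb R m.+1 (W i `&` q))) `^ alpha).
Proof.
set r := 2 * f (W i) + _.
have r0 : 0 <= r.
  apply: addr_ge0; last by rewrite mulr_ge0// powR_ge0.
  by rewrite mulr_ge0// fine_ge0//; apply: sume_ge0 => j _; exact: adde_ge0.
pose ee j := fine (\int[Lam]_(x in q) (a x * enorm (g j x + g i x))%:E)%E.
have dsum j := density_add (gW j).1 (gW i).1 (dg j) (dg i).
have mgs j : measurable_fun q (fun x => a x * enorm (g j x + g i x)).
  by apply: measurable_funM => //; apply: measurable_funTS; apply: measurable_enorm; case: (dsum j).
have mgk k : measurable_fun q (fun x => a x * enorm (g k x)).
  by apply: measurable_funM => //; exact: measurable_funTS.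
have msum (F : 'I_N -> E -> \bar R) : (forall j, measurable_fun q (F j)) ->
    measurable_fun q (fun x => \sum_(j | j != i) F j x)%E.
  move=> mF; under eq_fun do rewrite -big_filter.
  exact: emeasurable_sum.
have N1 : 0 <= (N%:R + 1)^-1 :> R by rewrite invr_ge0 addr_ge0.
have key : e i / (N%:R + 1) + \sum_(j | j != i) ee j <= \sum_(j | j != i) (e i + e j).
  rewrite -lee_fin EFinD -!sumEFin EFinM.
  have -> : (\sum_(j | j != i) (ee j)%:E = \int[Lam]_(x in q) \sum_(j | j != i) (a x * enorm (g j x + g i x))%:E)%E.
    under [RHS]eq_integral do rewrite -big_filter.
    rewrite ge0_integral_sum//; last 2 first.
    - by move=> j; apply/measurable_EFinP.
    - by move=> j x qx; rewrite lee_fin mulr_ge0 ?enorm_ge0// ltW// a0//; exact: qO.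
    rewrite big_filter; apply: eq_bigr => j _; rewrite [RHS](fineI (dsum j)) //.
  have -> : (\sum_(j | j != i) (e i + e j)%:E = \int[Lam]_(x in q) \sum_(j | j != i) (a x * (enorm (g i x) + enorm (g j x)))%:E)%E.
    under [RHS]eq_integral do rewrite -big_filter.
    rewrite ge0_integral_sum//; last 2 first.
    - by move=> j; apply/measurable_EFinP; apply: measurable_funM => //; apply: measurable_funD; exact: measurable_funTS.
    - by move=> j x qx; rewrite lee_fin mulr_ge0 ?addr_ge0 ?enorm_ge0// ltW// a0//; exact: qO.
    rewrite big_filter; apply: eq_bigr => j _; rewrite EFinD -!eE /wenergy -ge0_integralD//; try (by apply/measurable_EFinP);
      try (by move=> x qx; rewrite lee_fin mulr_ge0 ?enorm_ge0// ltW// a0//; exact: qO).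
    by apply: eq_integral => x _; rewrite mulrDr EFinD.
  have -> : ((e i)%:E * ((N%:R + 1)^-1)%:E = \int[Lam]_(x in q) (a x * enorm (g i x) / (N%:R + 1))%:E)%E.
    rewrite -eE /wenergy -ge0_integralZr//; first by apply/measurable_EFinP.
    by move=> x qx; rewrite lee_fin mulr_ge0 ?enorm_ge0// ltW// a0//; exact: qO.
  have aq x : q x -> 0 <= a x by move=> qx; rewrite ltW// a0//; exact: qO.
  rewrite -ge0_integralD//; last 4 first.
  - by move=> x qx; rewrite lee_fin !mulr_ge0 ?enorm_ge0// aq.
  - by apply/measurable_EFinP; apply: measurable_funM.
  - by move=> x qx; apply: sume_ge0 => j _; rewrite lee_fin mulr_ge0 ?enorm_ge0// aq.
  - by apply: msum => j; apply/measurable_EFinP.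
  apply: ae_ge0_le_integral => //.
  - move=> x qx; apply: adde_ge0; first by rewrite lee_fin !mulr_ge0 ?enorm_ge0// aq.
    by apply: sume_ge0 => j _; rewrite lee_fin mulr_ge0 ?enorm_ge0// aq.
  - apply: emeasurable_funD; first by apply/measurable_EFinP; apply: measurable_funM.
    by apply: msum => j; apply/measurable_EFinP.
  - by move=> x qx; apply: sume_ge0 => j _; rewrite lee_fin mulr_ge0 ?addr_ge0 ?enorm_ge0// aq.
  - apply: msum => j; apply/measurable_EFinP; apply: measurable_funM => //.
    by apply: measurable_funD; exact: measurable_funTS.
  apply: (@filterS _ _ (ae_filter_ringOfSetsType _)) sum_density_zero => x h qx.
  have := phase_sum i (h (qO qx)) => hp.
  rewrite !sumEFin -EFinD lee_fin -!mulr_sumr -mulrA -mulrDr ler_wpM2l ?aq//.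
  by apply: le_trans hp; rewrite lerD2l; apply: ler_sum => j _; rewrite addrC.
have := @ler_sum _ _ (index_enum 'I_N) (fun j => j != i) _ _ (fun j ji => transfer_one ji).
rewrite [X in _ <= X -> _](eq_bigr (fun j => ee j + r)); last by move=> j _; rewrite /r /ee addrA.
rewrite [X in _ <= X -> _]big_split /= => h.
apply: le_trans (_ : \sum_(j < N | j != i) r <= _); first by lra.
rewrite [leRHS](_ : _ = \sum_(j < N) r); last by rewrite sumr_const card_ord mulr_natl.
by rewrite [leRHS](bigID (fun j => j != i)) /= lerDl; apply: sumr_ge0.
Qed.

(** The competitor gives the whole cube to phase [i]: as the complement has density [- g i], the
    density left inside [q] is 0, and only faces and volume are paid. *)
Lemma complement_energy : \sum_k e k <=
  f (Omega `\` W i) + \sum_(k | k != i) f (W k) +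
  Calpha * (2 * fine (leb R m.+1 ((Omega `\` W i) `&` q))) `^ alpha.
Proof.
set V := Omega `\` W i.
have mV : measurable V by exact: measurableD.
have VO : V `<=` Omega by move=> x [].
have aeV : {ae leb R m.+1, forall x, \1_V x + \1_(W i) x = \1_Omega x :> R}.
  apply: measure_negligible.aeW => x; rewrite !indicE in_setD.
  have [/set_mem xi|xi] /= := boolP (x \in W i); last by rewrite andbT addr0.
  by rewrite andbF add0r mem_set//; exact: WO xi.
have GV := gradient_sub oO mO mV (mW i) aeV (gradient_full oO) (gW i).
have dV := density_add (gradient_full oO).1 (locally_finite_vopp (gW i).1) (density_vzero Omega Lam) (density_vopp (dg i)).
have ni : ~~ (i != i) by rewrite eqxx.
have aeS : {ae leb R m.+1, forall x, \sum_(k | k != i) \1_(W k) x = \1_V x :> R}.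
  apply: (@filterS2 _ _ (ae_filter_ringOfSetsType _)) aeW aeV => x h1 h2.
  by apply: (addIr (\1_(W i) x)); rewrite h2 -h1 [RHS](bigD1 i)//= addrC.
have := @transfer_ineq R m N alpha Calpha Omega a G W oO lO ma a0 alpha0 C0 hG minW Lam g dg Omega' O'O a1' p0 pO c d pc dp cd
  V _ _ (fun k => k != i) i mV VO GV dV ni aeS gdV (fun k j _ => gdW k j) N0.
rewrite (eq_bigr (fun k => (e k)%:E)); last by move=> k _; exact: eE.
have -> : (\int[Lam]_(x in hbox c d) (a x * enorm (g i x + (0 - g i x)))%:E = 0)%E.
  by apply: integral0_eq => x _; rewrite sub0r subrr enorm0 mulr0.
have fE A : measurable A -> face_area c d A = (f A)%:E by move=> mA; rewrite /f fineK// face_fin.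
rewrite [X in (_ <= X + _)%E -> _](eq_bigr (fun k => (if k == i then f V else f (W k))%:E)); last first.
  by move=> k _; case: eqVneq => _ /=; rewrite ?add0e fE.
rewrite !sumEFin -EFinD lee_fin => /le_trans; apply; rewrite lerD2r (bigD1 i)//= eqxx lerD2l.
by apply: ler_sum => k /negbTE ->.
Qed.

Lemma tv_energy k : (delta%:E * perimeter Omega (W k) q <= (e k)%:E)%E.
Proof.
rewrite -eE /perimeter (total_variationE oO (dg k) mq) setIidl// -ge0_integralZl//; last 3 first.
- by apply: measurable_funTS; apply/measurable_EFinP.
- by move=> x _; rewrite lee_fin enorm_ge0.
- by rewrite lee_fin ltW.
apply: ge0_le_integral => //.
- by move=> x _; apply: mule_ge0; rewrite lee_fin ?enorm_ge0 ?ltW.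
- by apply: emeasurable_funM => //; apply: measurable_funTS; apply/measurable_EFinP.
- by apply/measurable_EFinP; apply: measurable_funM => //; exact: measurable_funTS.
by move=> x qx; rewrite -EFinM lee_fin ler_wpM2r ?enorm_ge0//; have /andP[] := a1 (qO' qx).
Qed.

End cube_inequality.

(** * Density estimates on cubes *)

Section affine_null.
Variable R : realType.
Local Notation lam := (@lebesgue_measure R).

(** Null sets of the line are carried to ['rV_1], where [leb_affins] provides the invariance. *)
Lemma ae_affine (s : bool) (c : R) (P : R -> Prop) : {ae lam, forall t, P t} -> {ae lam, forall t, P (affine s c t)}.
Proof.
move=> [S [mS S0 PS]]; exists (affine s c @^-1` S); split.
- by rewrite -[X in measurable X]setTI; exact: measurable_affine.
- pose X : set 'rV[R]_1 := [set v | S (v ord0 ord0)].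
  have mX : measurable X by rewrite /X -[X in measurable X]setTI; exact: measurable_coord_rV.
  have l0 : leb R 0 setT = 1%E by rewrite /= diracE mem_set.
  have e1 : leb R 1 X = 0%E.
    rewrite (leb_ins ord0 mX) (_ : _ @^-1` _ = S `*` setT); last first.
      by apply/seteqP; split => -[t w]; rewrite /X /= ins_id; [move=> ?; split|case].
    by rewrite product_measure1E// [X in (X * _)%E](_ : _ = 0%E) ?mul0e.
  move: e1; rewrite (leb_affins ord0 s c mX) (_ : _ @^-1` _ = (affine s c @^-1` S) `*` setT); last first.
    by apply/seteqP; split => -[t w]; rewrite /X /affins /= ins_id; [move=> ?; split|case].
  rewrite product_measure1E//; last by rewrite -[X in measurable X]setTI; exact: measurable_affine.
  by move=> h; rewrite -[LHS]mule1 -[X in (_ * X)%E]l0.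
by move=> t /= h; apply: PS => /= h'; apply: h.
Qed.

Lemma ae_forall_fin (I : finType) (P : I -> R -> Prop) : (forall i, {ae lam, forall t, P i t}) ->
  {ae lam, forall t, forall i, P i t}.
Proof.
move=> h.
have : forall s : seq I, {ae lam, forall t, forall i, i \in s -> P i t}.
  elim=> [|i s IH]; first exact: measure_negligible.aeW.
  apply: (@filterS2 _ _ (ae_filter_ringOfSetsType _)) (h i) IH => t h1 h2 k.
  by rewrite inE => /orP[/eqP->|]//; exact: h2.
move=> /(_ (index_enum I)); apply: (@filterS _ _ (ae_filter_ringOfSetsType _)) => t ht i.
by apply: ht; rewrite mem_index_enum.
Qed.

(** Otherwise [T] would exceed [L] at almost every point and its integral would reach [L] times the
    length of the interval. *)
Lemma ae_select (P : R -> Prop) (T : R -> \bar R) (s1 s2 L : R) : s1 < s2 -> 0 <= L ->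
  {ae lam, forall s, P s} -> measurable_fun (`]s1, s2[%classic : set R) T -> (forall s, 0 <= T s)%E ->
  (\int[lam]_(s in `]s1, s2[%classic) T s < (L * (s2 - s1))%:E)%E ->
  exists s, [/\ s1 < s, s < s2, P s & (T s <= L%:E)%E].
Proof.
move=> s12 L0 aeP mT T0 lt; apply: contrapT => h.
have mI : measurable (`]s1, s2[%classic : set (measurableTypeR R)) by exact: measurable_itv.
suff : ((L * (s2 - s1))%:E <= \int[lam]_(s in `]s1, s2[%classic) T s)%E by rewrite leNgt lt.
have <- : (\int[lam]_(s in `]s1, s2[%classic) L%:E = (L * (s2 - s1))%:E)%E.
  have muI : (lam (`]s1, s2[%classic) = (s2 - s1)%:E)%E.
    by rewrite [LHS]lebesgue_measure_itv /= lte_fin s12.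
  by rewrite integral_cst// EFinM; congr (_ * _)%E; exact: muI.
apply: ae_ge0_le_integral => //.
apply: (@filterS _ _ (ae_filter_ringOfSetsType _)) aeP => s Ps /=; rewrite in_itv /= => /andP[h1 h2].
by rewrite leNgt; apply/negP => /ltW h3; apply: h; exists s.
Qed.

End affine_null.

Section cubes.
Variables (R : realType) (m : nat).
Local Notation E := 'rV[R]_m.+1.
Implicit Types (y : E) (s : R).

Definition lo y s : E := \row_i (y ord0 i - s).
Definition hi y s : E := \row_i (y ord0 i + s).
Definition cube y s : set E := hbox (lo y s) (hi y s).
Definition ccube y s : set E := cbox (lo y s) (hi y s).

Lemma cubeP y s v : cube y s v <-> forall i, y ord0 i - s < v ord0 i <= y ord0 i + s.
Proof. by split => h i; have := h i; rewrite !mxE. Qed.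

Lemma ccubeP y s v : ccube y s v <-> forall i, `|v ord0 i - y ord0 i| <= s.
Proof.
split => h i; have := h i; rewrite !mxE ler_norml; first by move=> /andP[h1 h2]; apply/andP; split; lra.
by move=> /andP[h1 h2]; apply/andP; split; lra.
Qed.

Lemma measurable_cube y s : measurable (cube y s). Proof. exact: measurable_hbox. Qed.

Lemma cube_sub y s t : s <= t -> cube y s `<=` cube y t.
Proof. by move=> st v /cubeP h; apply/cubeP => i; have /andP[h1 h2] := h i; apply/andP; split; lra. Qed.

Lemma lohi_le y s i : 0 <= s -> lo y s ord0 i <= hi y s ord0 i.
Proof. by move=> s0; rewrite !mxE; lra. Qed.

Lemma lohi_side y s i : hi y s ord0 i - lo y s ord0 i = 2 * s.
Proof. by rewrite !mxE; lra. Qed.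

Lemma leb_cube y s : 0 <= s -> leb R m.+1 (cube y s) = ((2 * s) ^+ m.+1)%:E.
Proof.
move=> s0; rewrite leb_hbox => [|i]; last exact: lohi_le.
by under eq_bigr do rewrite lohi_side; rewrite prodr_const card_ord.
Qed.

(** Between half sides [r] and [r'] there is room for rational corners, and for the strict margin on
    the upper side that right Lebesgue points require. *)
Lemma ambient_box (Omega : set E) y r r' : 0 <= r -> r < r' -> ccube y r' `<=` Omega ->
  exists p : 'rV[rat]_m.+1 * 'rV[rat]_m.+1, let pa : E := map_mx ratr p.1 in let pb : E := map_mx ratr p.2 in
    [/\ cbox pa pb `<=` Omega, forall i, pa ord0 i <= lo y r ord0 i & forall i, hi y r ord0 i < pb ord0 i].
Proof.
move=> r0 rr' sub.
have /choice[fa faP] : forall i : 'I_m.+1, exists q : rat, (ratr q : R) \in `]y ord0 i - r', y ord0 i - r[.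
  by move=> i; have [|q] := @rat_in_itvoo R (y ord0 i - r') (y ord0 i - r); [lra|exists q].
have /choice[fb fbP] : forall i : 'I_m.+1, exists q : rat, (ratr q : R) \in `]y ord0 i + r, y ord0 i + r'[.
  by move=> i; have [|q] := @rat_in_itvoo R (y ord0 i + r) (y ord0 i + r'); [lra|exists q].
exists (\row_i fa i, \row_i fb i) => pa pb; split => [v h|i|i].
- apply: sub; apply/ccubeP => i; have := h i; rewrite !mxE => /andP[h1 h2].
  have := faP i; have := fbP i; rewrite !in_itv /= => /andP[h3 h4] /andP[h5 h6].
  by rewrite ler_norml; apply/andP; split; lra.
- by rewrite !mxE; have := faP i; rewrite in_itv /= => /andP[_ /ltW].
- by rewrite !mxE; have := fbP i; rewrite in_itv /= => /andP[].
Qed.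

Let sgn (b : bool) j y (s : R) := affine b (y ord0 j) s.

Lemma sgn_lo j y s : affine true (y ord0 j) s = lo y s ord0 j.
Proof. by rewrite /affine expr1 mulN1r mxE. Qed.

Lemma sgn_hi j y s : affine false (y ord0 j) s = hi y s ord0 j.
Proof. by rewrite /affine expr0 mul1r mxE. Qed.

Let face b j y A s := leb R m (hbox (delete j (lo y s)) (delete j (hi y s)) `&` slice j A (sgn b j y s)).

Let Z b j y A : set (measurableTypeR R * 'rV[R]_m) :=
  [set p | hbox (delete j (lo y p.1)) (delete j (hi y p.1)) p.2 /\ A (affins j b (y ord0 j) p)].

Let mZ b j y A : measurable A -> measurable (Z b j y A).
Proof.
move=> mA; apply: measurableI; last first.
  by rewrite -[X in measurable X]setTI; apply: measurable_affins.
rewrite (_ : (fun x : measurableTypeR R * 'rV[R]_m => _) = \bigcap_(l in [set: 'I_m])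
    [set p : measurableTypeR R * 'rV[R]_m | y ord0 (lift j l) - p.1 < p.2 ord0 l <= y ord0 (lift j l) + p.1]); last first.
  apply/seteqP; split => p h l.
    by move=> _; have := h l; rewrite !delE !mxE.
  by rewrite !delE !mxE; exact: h.
apply: fin_bigcap_measurable => // l _.
have mc : measurable_fun setT (fun p : measurableTypeR R * 'rV[R]_m => p.2 ord0 l).
  exact: (measurableT_comp (measurable_coord_rV l) measurable_snd).
have m1 : measurable_fun setT (fun p : measurableTypeR R * 'rV[R]_m => p.1 : R) by exact: measurable_fst.
rewrite (_ : [set _ | _] = [set p : measurableTypeR R * 'rV[R]_m | y ord0 (lift j l) - p.1 < p.2 ord0 l] `&`
   [set p : measurableTypeR R * 'rV[R]_m | p.2 ord0 l <= y ord0 (lift j l) + p.1]); last first.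
  by apply/seteqP; split => p /=; [move=> /andP[]|move=> [-> ->]].
apply: measurableI.
  rewrite (_ : [set _ | _] = ~` [set p : measurableTypeR R * 'rV[R]_m | p.2 ord0 l <= y ord0 (lift j l) - p.1]); last first.
    by apply/seteqP; split => p /=; rewrite ltNge => /negP.
  apply: measurableC; rewrite -[X in measurable X]setTI.
  by apply: measurable_fun_le => //; apply: measurable_funB => //; exact: measurable_cst.
rewrite -[X in measurable X]setTI; by apply: measurable_fun_le => //; apply: measurable_funD => //; exact: measurable_cst.
Qed.

Let faceE b j y A s : face b j y A s = leb R m (xsection (Z b j y A) s).
Proof.
congr (leb R m _); apply/seteqP; split => w; rewrite /xsection /= inE /Z /affins /=.
  by [].
by [].
Qed.

Let mface b j y A : measurable A -> measurable_fun setT (face b j y A).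
Proof.
move=> mA; apply: (eq_measurable_fun (fun s => leb R m (xsection (Z b j y A) s))).
  by move=> s _; rewrite faceE.
by apply: measurable_fun_xsection; exact: mZ.
Qed.

(** As the half side grows, each face sweeps a pyramid with apex [y] at unit speed; the areas of the
    slices of [A] therefore integrate to the volume of [A] in a part of this pyramid. *)
Let int_face b j y A s1 s2 : measurable A -> 0 <= s1 ->
  (\int[lebesgue_measure]_(s in `]s1, s2[%classic) face b j y A s <= leb R m.+1 (A `&` cube y s2))%E.
Proof.
move=> mA s10.
have mX : measurable (A `&` cube y s2) by apply: measurableI => //; exact: measurable_cube.
rewrite (leb_affins j b (y ord0 j) mX) /product_measure1 integral_mkcond.
have mP : measurable (@affins R m j b (y ord0 j) @^-1` (A `&` cube y s2)).
  by rewrite -[X in measurable X]setTI; exact: measurable_affins.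
have mI : measurable (`]s1, s2[%classic : set (measurableTypeR R)) by exact: measurable_itv.
apply: ge0_le_integral => //.
- by move=> s _; apply: erestrict_ge0 => t _; exact: measure_ge0.
- by apply/(measurable_restrictT _ mI); apply: measurable_funTS; exact: mface.
- exact: measurable_fun_xsection.
move=> s _; rewrite patchE; case: ifPn => [/set_mem|_]; last exact: measure_ge0.
rewrite /= in_itv /= => /andP[h1 h2]; rewrite faceE; apply: le_measure.
- by rewrite inE; apply: measurable_xsection; exact: mZ.
- by rewrite inE; exact: measurable_xsection.
move=> w; rewrite /xsection /= !inE => -[/= hw Aw]; split => //; apply/cubeP => l.
rewrite /affins; have [l' ->|->] := unliftP j l.
  rewrite ins_lift /=; have := hw l'; rewrite !delE !mxE => /andP[h3 h4]; apply/andP; split; lra.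
rewrite ins_id /= /affine; case: b {Aw hw mP}; rewrite ?expr1 ?expr0 ?mulN1r ?mul1r; apply/andP; split; lra.
Qed.

Lemma measurable_face_area y A : measurable A -> measurable_fun setT (fun s => face_area (lo y s) (hi y s) A).
Proof.
move=> mA; apply: emeasurable_sum => j; apply: emeasurable_funD.
  apply: (eq_measurable_fun (face true j y A)); last exact: mface.
  by move=> s _; rewrite /face /sgn sgn_lo.
apply: (eq_measurable_fun (face false j y A)); last exact: mface.
by move=> s _; rewrite /face /sgn sgn_hi.
Qed.

Lemma face_area_ge0 (c d : E) A : (0 <= face_area c d A)%E.
Proof. by apply: sume_ge0 => j _; exact: adde_ge0. Qed.

Lemma int_face_area y A s1 s2 : measurable A -> 0 <= s1 ->
  (\int[lebesgue_measure]_(s in `]s1, s2[%classic) face_area (lo y s) (hi y s) A <=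
   (2 * m.+1%:R)%:E * leb R m.+1 (A `&` cube y s2))%E.
Proof.
move=> mA s10.
have mI : measurable (`]s1, s2[%classic : set (measurableTypeR R)) by exact: measurable_itv.
have fE s : face_area (lo y s) (hi y s) A = (\sum_j (face true j y A s + face false j y A s))%E.
  by apply: eq_bigr => j _; rewrite /face /sgn sgn_lo sgn_hi.
under eq_integral do rewrite fE.
rewrite ge0_integral_sum//; last 2 first.
- by move=> j; apply: emeasurable_funD; apply: measurable_funTS; exact: mface.
- by move=> j s _; apply: adde_ge0; exact: measure_ge0.
apply: (@le_trans _ _ (\sum_(j < m.+1) ((2%:R)%:E * leb R m.+1 (A `&` cube y s2)))%E).
  apply: lee_sum => j _; rewrite ge0_integralD//; try (by apply: measurable_funTS; exact: mface).
  rewrite -[2%:R]/(1 + 1) EFinD ge0_muleDl// !mul1e.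
  by apply: leeD; exact: int_face.
rewrite -ge0_sume_distrl; last by move=> j _; rewrite lee_fin.
by rewrite sumEFin sumr_const card_ord -[_ *+ m.+1]mulr_natr.
Qed.

Lemma face_area_le y s A : 0 <= s -> measurable A ->
  (face_area (lo y s) (hi y s) A <= (2 * m.+1%:R * (2 * s) ^+ m)%:E)%E.
Proof.
move=> s0 mA.
have h j t : (leb R m (hbox (delete j (lo y s)) (delete j (hi y s)) `&` slice j A t) <= ((2 * s) ^+ m)%:E)%E.
  apply: (@le_trans _ _ (leb R m (hbox (delete j (lo y s)) (delete j (hi y s))))).
    by apply: measureIl; [exact: measurable_hbox|exact: measurable_sl].
  apply: leb_hbox_le; first by rewrite mulr_ge0.
  by move=> i; rewrite !delE lohi_side; split => //; exact: lohi_le.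
apply: (@le_trans _ _ (\sum_(j < m.+1) ((2 * s) ^+ m + (2 * s) ^+ m)%:E)%E).
  by apply: lee_sum => j _; rewrite EFinD; apply: leeD.
rewrite sumEFin lee_fin sumr_const card_ord -[_ *+ m.+1]mulr_natl.
by rewrite le_eqVlt; apply/orP; left; apply/eqP; ring.
Qed.

End cubes.

Lemma measure_setD_setI d (T : measurableType d) (R : realType) (mu : {measure set T -> \bar R}) (Q A : set T) :
  measurable Q -> measurable A -> (mu (Q `\` A) + mu (A `&` Q) = mu Q)%E.
Proof.
move=> mQ mA; rewrite -measureU//.
- congr (mu _); apply/seteqP; split => [x [[]|[]]//|x Qx].
  by have [Ax|Ax] := pselect (A x); [right|left].
- exact: measurableD.
- exact: measurableI.
by apply/seteqP; split => // x [[_ h] [/h]].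
Qed.

Section tiling.
Variables (R : realType) (m : nat).
Local Notation E := 'rV[R]_m.+1.
Variables (a : E) (l : R) (K : nat).
Hypotheses (l0 : 0 < l).

Let clo (c : {ffun 'I_m.+1 -> 'I_K}) : E := \row_i (a ord0 i + l * (c i)%:R).
Let chi (c : {ffun 'I_m.+1 -> 'I_K}) : E := \row_i (a ord0 i + l * (c i).+1%:R).
Let b : E := \row_i (a ord0 i + l * K%:R).

Lemma tile_cover : hbox a b = \bigcup_(c in [set: {ffun 'I_m.+1 -> 'I_K}]) hbox (clo c) (chi c).
Proof.
apply/seteqP; split => [v h|v [c _ h] i]; last first.
  have := h i; rewrite !mxE => /andP[h1 h2]; apply/andP; split.
    by apply: le_lt_trans h1; rewrite lerDl mulr_ge0// ltW.
  by apply: le_trans h2 _; rewrite lerD2l ler_pM2l// ler_nat.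
have /choice[f fP] : forall i : 'I_m.+1, exists k : 'I_K, a ord0 i + l * k%:R < v ord0 i <= a ord0 i + l * k.+1%:R.
  move=> i; have := h i; rewrite !mxE => /andP[h1 h2].
  have K0 : (0 < K)%N.
    by rewrite lt0n; apply/eqP => K0; move: h2; rewrite K0 mulr0 addr0 leNgt h1.
  have ex : exists k : nat, v ord0 i <= a ord0 i + l * k.+1%:R by exists K.-1; rewrite prednK.
  have kK : (ex_minn ex < K)%N.
    by case: ex_minnP => k _ /(_ K.-1); rewrite prednK// => /(_ h2) kk; rewrite -ltnS prednK in kk *.
  exists (Ordinal kK) => /=; case: ex_minnP => k hk kmin; rewrite hk andbT.
  case: k hk kmin => [|k] hk kmin; first by rewrite mulr0 addr0.
  by rewrite ltNge; apply/negP => hh; have := kmin k hh; rewrite ltnn.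
exists [ffun i => f i] => // i; rewrite !mxE !ffunE; exact: fP.
Qed.

Lemma tile_sum (mu : {measure set E -> \bar R}) B : measurable B ->
  (mu (B `&` hbox a b) = \sum_(c : {ffun 'I_m.+1 -> 'I_K}) mu (B `&` hbox (clo c) (chi c)))%E.
Proof.
move=> mB; rewrite tile_cover setI_bigcupr measure_fin_bigcup//; last 3 first.
- exact: finite_finset.
- apply/trivIsetP => c c' _ _ cc'; apply/seteqP; split => // v [[_ h] [_ h']].
  move: cc' => /eqP; apply; apply/ffunP => i; apply: val_inj; apply/eqP => /=.
  have := h i; have := h' i; rewrite !mxE => /andP[h1 h2] /andP[h3 h4].
  have p (x y : nat) : a ord0 i + l * x%:R < v ord0 i -> v ord0 i <= a ord0 i + l * y.+1%:R -> (x <= y)%N.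
    by move=> hx hy; have := lt_le_trans hx hy; rewrite ltrD2l ltr_pM2l// ltr_nat ltnS.
  by rewrite eqn_leq (p _ _ h3 h2) (p _ _ h1 h4).
- by move=> c _; apply: measurableI => //; exact: measurable_hbox.
rewrite (_ : [set: {ffun 'I_m.+1 -> 'I_K}] = [set` index_enum {ffun 'I_m.+1 -> 'I_K}]).
  by rewrite -fsbig_seq//; exact: index_enum_uniq.
by apply/seteqP; split => c //= _; rewrite mem_index_enum.
Qed.

Lemma clo_ge c i : a ord0 i <= clo c ord0 i.
Proof. by rewrite mxE lerDl mulr_ge0// ltW. Qed.

Lemma chi_le c i : chi c ord0 i <= b ord0 i.
Proof. by rewrite !mxE lerD2l ler_pM2l// ler_nat. Qed.

Variables (Omega A : set E) (D : vmeasure R m.+1).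
Hypotheses (oO : open Omega) (mA : measurable A) (gD : is_gradient Omega A D).
Variables (p0 : 'rV[rat]_m.+1 * 'rV[rat]_m.+1).
Let pa : E := map_mx ratr p0.1.
Let pb : E := map_mx ratr p0.2.
Hypothesis (pO : cbox pa pb `<=` Omega).
Hypotheses (paa : forall i, pa ord0 i <= a ord0 i) (bpb : forall i, b ord0 i <= pb ord0 i).

(* On each tile [A] fills at most half of the volume. *)
Lemma poincare_tiled : (leb R m.+1 (A `&` hbox a b) <= (l ^+ m.+1 / 2)%:E)%E ->
  (leb R m.+1 (A `&` hbox a b) <= (2 * m.+1%:R * l)%:E * Defs.total_variation Omega D (hbox a b))%E.
Proof.
move=> small.
rewrite -(tv_measureE oO gD.1) -[X in (_ <= _ * tv_measure _ _ X)%E]setTI.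
rewrite !tile_sum// ge0_sume_distrr; last by move=> c _; exact: measure_ge0.
apply: lee_sum => c _; rewrite setTI tv_measureE.
have mc : measurable (hbox (clo c) (chi c)) by exact: measurable_hbox.
have side i : clo c ord0 i <= chi c ord0 i /\ chi c ord0 i - clo c ord0 i <= l.
  rewrite !mxE -natr1 mulrDr mulr1; split; first by rewrite lerD2l lerDl ltW.
  by rewrite addrA [X in X - _]addrC addrK.
have lc : leb R m.+1 (hbox (clo c) (chi c)) = (l ^+ m.+1)%:E.
  rewrite leb_hbox => [|i]; last by case: (side i).
  rewrite (eq_bigr (fun=> l)) ?prodr_const ?card_ord// => i _.
  by rewrite !mxE -natr1 mulrDr mulr1 addrA [X in X - _]addrC addrK.
have paa' i : pa ord0 i <= clo c ord0 i by apply: le_trans (clo_ge c i).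
have bpb' i : chi c ord0 i <= pb ord0 i by apply: le_trans (chi_le c i) _.
have := poincare oO mA gD pO paa' bpb' l0 side.
have mAc : measurable (A `&` hbox (clo c) (chi c)) by exact: measurableI.
have al : (leb R m.+1 (A `&` hbox (clo c) (chi c)) <= (l ^+ m.+1 / 2)%:E)%E.
  apply: le_trans small; apply: le_measure; rewrite ?inE//.
    by apply: measurableI => //; exact: measurable_hbox.
  by apply: setIS; rewrite tile_cover => x h; exists c.
have split : (leb R m.+1 (hbox (clo c) (chi c) `\` A) + leb R m.+1 (A `&` hbox (clo c) (chi c)) = (l ^+ m.+1)%:E)%E.
  by rewrite -lc; exact: measure_setD_setI.
have tv0 : (0 <= Defs.total_variation Omega D (hbox (clo c) (chi c)))%E.
  by rewrite -(tv_measureE oO gD.1).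
have f1 : leb R m.+1 (A `&` hbox (clo c) (chi c)) \is a fin_num.
  by rewrite ge0_fin_numE//; apply: le_lt_trans al _; rewrite ltry.
have f2 : leb R m.+1 (hbox (clo c) (chi c) `\` A) \is a fin_num.
  rewrite ge0_fin_numE//; apply: (@le_lt_trans _ _ (l ^+ m.+1)%:E); last by rewrite ltry.
  by rewrite -split leeDl.
have x0 : 0 <= fine (leb R m.+1 (A `&` hbox (clo c) (chi c))) by exact: fine_ge0.
move: al split x0 tv0; rewrite -(fineK f1) -(fineK f2).
set x := fine (leb R m.+1 (A `&` hbox (clo c) (chi c))); set z := fine (leb R m.+1 (hbox (clo c) (chi c) `\` A)).
rewrite lee_fin -EFinD => xl [zx] x0.
case: (Defs.total_variation Omega D (hbox (clo c) (chi c))) => [t t0|_ _|//]; last first.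
  by rewrite gt0_muley ?leey// lte_fin !mulr_gt0 ?ltr0n.
rewrite -!EFinM !lee_fin => h.
have lp : 0 < l ^+ m.+1 by exact: exprn_gt0.
(* The complement fills at least half of the tile, so its volume can be divided out of the Poincare
   inequality. *)
have hz : l ^+ m.+1 / 2 <= z by lra.
have : x * (l ^+ m.+1 / 2) <= m.+1%:R * l ^+ m.+2 * t by apply: le_trans h; rewrite ler_wpM2l.
rewrite [l ^+ m.+2]exprS => h2.
rewrite -[X in (X <= _)%E](fineK f1) -/x lee_fin -(ler_pM2r (_ : 0 < l ^+ m.+1 / 2)) ?divr_gt0//.
apply: le_trans h2 _; rewrite le_eqVlt; apply/orP; left; apply/eqP.
by move: (l ^+ m.+1) (m.+1%:R : R) => u v; field.
Qed.

End tiling.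

(** * Decay of the volume along shrinking cubes *)

Section iteration.
Variables (R : realType) (n : nat) (alpha c1 C : R).
Hypotheses (n0 : (0 < n)%N) (alpha_gt : n.-1%:R / n%:R < alpha) (c10 : 0 <= c1) (C0 : 0 <= C).

(** A volume $z^n$ raised to the power $\alpha$ is $z^{n-1}z^\beta$: this is the gain over the
    scaling of the perimeter. *)
Let beta := n%:R * alpha - n.-1%:R.

Lemma exponent_gap_gt0 : 0 < beta.
Proof. by rewrite /beta subr_gt0 mulrC -ltr_pdivrMr ?ltr0n. Qed.

Lemma powR_volume (z : R) : 0 < z -> (z ^+ n) `^ alpha = z ^+ n.-1 * z `^ beta.
Proof.
move=> z0; rewrite -powR_mulrn ?ltW// -powRrM -powR_mulrn ?ltW// -powRD; last by apply/implyP => _; rewrite gt_eqF.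
by congr (_ `^ _); rewrite /beta; ring.
Qed.

Lemma powR_volume_le (z : R) : 0 < z -> z <= 1 -> (z ^+ n) `^ alpha <= z ^+ n.-1.
Proof.
move=> z0 z1; rewrite powR_volume//; apply: ler_piMr; first by rewrite exprn_ge0 ?ltW.
have -> : 1 = 1 `^ beta :> R by rewrite powR1.
apply: ge0_ler_powR => //; [exact: ltW exponent_gap_gt0|by rewrite nnegrE ltW|by rewrite nnegrE].
Qed.

(** The number [K] of tiles per side has to make small both the cost [c1 / K%:R] of the cut faces
    and the cost $Cz^\beta$ of the penalty at all scales up to [K%:R^-1]. *)
Lemma exists_scale (eta : R) : 0 < eta -> exists2 K : nat, (0 < K)%N &
  forall z : R, 0 < z -> z <= K%:R^-1 -> c1 / K%:R <= eta /\ C * z `^ beta <= eta.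
Proof.
move=> eta0; pose b := beta; have b0 : 0 < b by exact: exponent_gap_gt0.
pose t := (eta / (C + 1)) `^ b^-1.
have C1 : 0 < C + 1 by rewrite ltr_wpDl.
have t0 : 0 < t by apply: powR_gt0; exact: divr_gt0.
have [K1 hK1] : exists K1 : nat, c1 / eta < K1%:R.
  by exists (Num.truncn (c1 / eta)).+1; exact: truncnS_gt.
have [K2 hK2] : exists K2 : nat, t^-1 < K2%:R.
  by exists (Num.truncn t^-1).+1; exact: truncnS_gt.
exists (K1 + K2).+1 => // z z0 zK.
have K1' : K1%:R <= (K1 + K2).+1%:R :> R by rewrite ler_nat leqW// leq_addr.
have K2' : K2%:R <= (K1 + K2).+1%:R :> R by rewrite ler_nat leqW// leq_addl.
have Kp : 0 < (K1 + K2).+1%:R :> R by [].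
split.
  rewrite ler_pdivrMr// mulrC -ler_pdivrMr//; exact: le_trans (ltW hK1) K1'.
have zt : z <= t.
  apply: le_trans zK _; rewrite -[t]invrK lef_pV2 ?posrE ?invr_gt0//.
  exact: le_trans (ltW hK2) K2'.
have : z `^ b <= eta / (C + 1).
  apply: (@le_trans _ _ (t `^ b)).
    by apply: ge0_ler_powR => //; [exact: ltW|rewrite nnegrE ltW|rewrite nnegrE ltW].
  by rewrite /t -powRrM mulVf ?gt_eqF// powRr1 ?lexx// divr_ge0 ?(ltW eta0) ?(ltW C1).
rewrite ler_pdivlMr// => h.
apply: le_trans h; rewrite mulrC ler_wpM2l ?powR_ge0// lerDl ler01//.
Qed.

(* Here [m s] is the volume and [mu s] the perimeter inside the cube of half side
   [s]; the volume is followed along the half sides rho (1 + 2^-k) / 2, with tiles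
   of size proportional to 2^-k. *)
Lemma dyadic_decay : alpha <= 1 -> exists2 e0 : R, 0 < e0 &
  forall (m mu : R -> R) (rho : R), 0 < rho -> rho <= 1 ->
  (forall s, 0 <= m s) -> (forall s, 0 <= mu s) ->
  (forall s t, s <= t -> m s <= m t) -> (forall s t, 0 < s -> s <= t -> t <= rho -> mu s <= mu t) ->
  (forall s (K : nat), 0 < s -> s <= rho -> (0 < K)%N -> m s <= (2 * s / K%:R) ^+ n / 2 ->
     m s <= 2 * n%:R * (2 * s / K%:R) * mu s) ->
  (forall s1 s2 M, 0 < s1 -> s1 < s2 -> s2 <= rho -> 0 < M -> m s2 <= M ->
     exists s, [/\ s1 < s, s < s2 & mu s <= c1 * (M / (s2 - s1)) + C * (2 * m s) `^ alpha]) ->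
  m rho <= e0 * rho ^+ n -> mu (rho / 4) = 0.
Proof.
move=> alpha1.
have a0 : 0 < alpha.
  by apply: le_lt_trans alpha_gt; rewrite divr_ge0.
(* One step of the iteration must divide the volume bound by [2 ^+ n]; the two summands are the
   contributions computed in [t1] and [t2]. *)
have [eta eta0 etaE] : exists2 eta : R, 0 < eta & 16 * n%:R * eta + 8 * n%:R * eta <= 2^-1 ^+ n.
  exists (2^-1 ^+ n / (24 * n%:R)); first by rewrite divr_gt0 ?mulr_gt0 ?ltr0n// exprn_gt0 ?invr_gt0.
  rewrite -mulrDl le_eqVlt; apply/orP; left; apply/eqP.
  by move: (2^-1 ^+ n : R) => u; field; rewrite pnatr_eq0 -lt0n.
have [K K0 hK] := exists_scale eta0.
have Kp : 0 < K%:R :> R by rewrite ltr0n.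
(* Smallness at this level is exactly [m rho <= Mk 0], half the volume of a cube of side
   [rho / K%:R]. *)
exists (2 * K%:R ^+ n)^-1; first by rewrite invr_gt0 mulr_gt0// exprn_gt0.
move=> m mu rho rho0 rho1 m0 mu0 mM muM H1 H2 small.
pose h k : R := rho / 2 * (1 + 2^-1 ^+ k).
pose Mk k : R := (rho / (K%:R * 2 ^+ k)) ^+ n / 2.
have hk2 k : rho / 2 <= h k.
  by rewrite /h ler_pMr ?divr_gt0// lerDl exprn_ge0 ?invr_ge0.
have hkr k : h k <= rho.
  rewrite /h -[leRHS](divfK (_ : (2 : R) != 0))// ler_pM2l ?divr_gt0// -[leRHS]/(1 + 1) lerD2l exprn_ile1 ?invr_ge0//.
  by rewrite invf_le1// ler1n.
have step k : m (h k) <= Mk k.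
  elim: k => [|k IH].
    rewrite /h expr0 -[1 + 1]/(2%:R) divfK// /Mk expr0 mulr1; apply: le_trans small _.
    rewrite expr_div_n le_eqVlt; apply/orP; left; apply/eqP.
    by field; rewrite expf_neq0// gt_eqF.
  have tk : 0 < 2 ^+ k :> R by exact: exprn_gt0.
  have Kk : 0 < K%:R * 2 ^+ k :> R by exact: mulr_gt0.
  have Mp : 0 < Mk k by rewrite /Mk divr_gt0// exprn_gt0// divr_gt0.
  have gap : h k - h k.+1 = rho / (4 * 2 ^+ k).
    by rewrite /h exprS exprVn; field; rewrite gt_eqF.
  have hlt : h k.+1 < h k by rewrite -subr_gt0 gap divr_gt0// mulr_gt0.
  have hp : 0 < h k.+1 by apply: lt_le_trans (hk2 _); rewrite divr_gt0.
  have [s [s1 s2 hs]] := H2 _ _ _ hp hlt (hkr k) Mp IH.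
  have sp : 0 < s by exact: lt_trans s1.
  have srho : s <= rho by apply: le_trans (ltW s2) (hkr k).
  (* As [s] is at least [rho / 2], tiles obtained by dividing the side [2 * s] into [K * 2 ^ k]
     parts have volume at least twice [Mk k], so the Poincare bound applies. *)
  have srho2 : rho <= 2 * s by have := hk2 k.+1; lra.
  have ms : m s <= Mk k by apply: le_trans IH; apply: mM; exact: ltW.
  have KkE : (K * 2 ^ k)%:R = K%:R * 2 ^+ k :> R by rewrite natrM natrX.
  have Kn : (0 < K * 2 ^ k)%N by rewrite muln_gt0 K0 expn_gt0.
  have := H1 s (K * 2 ^ k)%N sp srho Kn; rewrite KkE => H1'.
  have {}H1' : m s <= 2 * n%:R * (2 * s / (K%:R * 2 ^+ k)) * mu s.
    apply: H1'; apply: le_trans ms _; rewrite /Mk ler_pM2r ?invr_gt0//.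
    apply: lerXn2r.
    - by rewrite nnegrE divr_ge0 ?(ltW rho0) ?(ltW Kk).
    - by rewrite nnegrE divr_ge0 ?mulr_ge0 ?(ltW sp) ?(ltW Kk).
    by rewrite ler_pM2r ?invr_gt0.
  apply: le_trans (mM _ _ (ltW s1)) _; apply: le_trans H1' _.
  pose z := rho / (K%:R * 2 ^+ k).
  have z0 : 0 < z by rewrite divr_gt0.
  have zK : z <= K%:R^-1.
    rewrite /z ler_pdivrMr// mulrA mulVf ?gt_eqF// mul1r; apply: le_trans rho1 _.
    by rewrite exprn_ege1// ler1n.
  have [e1 e2] := hK z z0 zK.
  have pw : (2 * m s) `^ alpha <= z ^+ n.-1 * z `^ beta.
    rewrite -powR_volume//; apply: ge0_ler_powR; first exact: ltW.
    - by rewrite nnegrE mulr_ge0.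
    - by rewrite nnegrE exprn_ge0// ltW.
    apply: (@le_trans _ _ (2 * Mk k)); first by rewrite ler_pM2l.
    by rewrite /Mk -/z mulrCA mulfV// mulr1.
  have zn : z ^+ n = z * z ^+ n.-1 by rewrite -exprS prednK.
  have zE : z * (K%:R * 2 ^+ k) = rho by rewrite /z divfK// gt_eqF.
  have MkE : Mk k = z ^+ n / 2 by [].
  have MkS : Mk k.+1 = z ^+ n / 2 * 2^-1 ^+ n.
    have -> : Mk k.+1 = (z / 2) ^+ n / 2.
      by rewrite /Mk /z exprS; congr (_ ^+ n / 2); field; rewrite !gt_eqF.
    by rewrite exprMn mulrAC.
  have b1 : mu s <= c1 * (z ^+ n / 2 * (4 * 2 ^+ k) / rho) + C * (z ^+ n.-1 * z `^ beta).
    apply: le_trans hs _; apply: lerD; last by rewrite ler_wpM2l.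
    rewrite gap MkE ler_wpM2l// le_eqVlt; apply/orP; left; apply/eqP.
    by move: (z ^+ n) => u; field; rewrite !gt_eqF.
  apply: (@le_trans _ _ (2 * n%:R * (2 * z) * (c1 * (z ^+ n / 2 * (4 * 2 ^+ k) / rho) + C * (z ^+ n.-1 * z `^ beta)))).
    apply: ler_pM; [by rewrite !mulr_ge0 ?invr_ge0 ?(ltW sp) ?(ltW Kk)|exact: mu0| |exact: b1].
    rewrite ler_pM2l ?mulr_gt0 ?ltr0n//.
    by rewrite /z -mulrA ler_pM2l// ler_pM2r ?invr_gt0.
  rewrite mulrDr MkS.
  have t1 : 2 * n%:R * (2 * z) * (c1 * (z ^+ n / 2 * (4 * 2 ^+ k) / rho)) = 16 * n%:R * (c1 / K%:R) * (z ^+ n / 2).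
    rewrite -zE; move: (z ^+ n) (n%:R : R) => u v; field.
    by rewrite !gt_eqF.
  have t2 : 2 * n%:R * (2 * z) * (C * (z ^+ n.-1 * z `^ beta)) = 8 * n%:R * (C * z `^ beta) * (z ^+ n / 2).
    by rewrite zn; move: (z ^+ n.-1) (n%:R : R) (z `^ beta) => u v w; field.
  rewrite t1 t2 -mulrDl mulrC ler_pM2l ?divr_gt0 ?exprn_gt0//.
  apply: le_trans etaE; apply: lerD; rewrite ler_pM2l ?mulr_gt0 ?ltr0n//.
have z0 : m (rho / 2) = 0.
  apply/eqP; rewrite eq_le m0 andbT; apply/ler_addgt0Pr => e e0; rewrite add0r.
  have [k hk] : exists k : nat, e^-1 < k%:R by exists (Num.truncn e^-1).+1; exact: truncnS_gt.
  apply: le_trans (mM _ _ (hk2 k)) _; apply: le_trans (step k) _.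
  have tk : 0 < 2 ^+ k :> R by exact: exprn_gt0.
  have k2 : k%:R <= 2 ^+ k :> R by rewrite -natrX ler_nat ltnW// ltn_expl.
  have w0 : 0 <= rho / (K%:R * 2 ^+ k) by rewrite divr_ge0 ?mulr_ge0 ?ltW.
  have w : rho / (K%:R * 2 ^+ k) <= e.
    rewrite ler_pdivrMr ?mulr_gt0//; apply: le_trans rho1 _.
    have : 1 <= e * 2 ^+ k.
      by rewrite mulrC -ler_pdivrMr// div1r; apply: le_trans (ltW hk) k2.
    move=> h1; apply: le_trans h1 _; rewrite mulrCA ler_peMl ?mulr_ge0 ?(ltW e0) ?(ltW tk)//.
    by rewrite (ler_nat _ 1).
  have w1 : rho / (K%:R * 2 ^+ k) <= 1.
    rewrite ler_pdivrMr ?mulr_gt0// mul1r; apply: le_trans rho1 _.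
    by rewrite -[leLHS]mulr1 ler_pM// ?(ler_nat _ 1)// exprn_ege1// ler1n.
  rewrite /Mk -(prednK n0) exprS.
  have : (rho / (K%:R * 2 ^+ k)) ^+ n.-1 <= 1 by exact: exprn_ile1.
  move: (rho / (K%:R * 2 ^+ k)) w0 w w1 => x x0 xe x1 h1.
  have : x * x ^+ n.-1 <= e * 1 by apply: ler_pM => //; exact: exprn_ge0.
  lra.
apply/eqP; rewrite eq_le mu0 andbT; apply/ler_addgt0Pr => e e0; rewrite add0r.
(* The volume vanishes at [rho / 2], so any positive [M] bounds it; this one makes the perimeter at
   most [e]. *)
pose M := e * (rho / 4) / (c1 + 1).
have c11 : 0 < c1 + 1 by rewrite ltr_wpDl.
have M0 : 0 < M by rewrite divr_gt0// mulr_gt0// divr_gt0.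
have r4 : rho / 4 < rho / 2 by lra.
have r4p : 0 < rho / 4 by lra.
have r2 : rho / 2 <= rho by lra.
have mz : m (rho / 2) <= M by rewrite z0 ltW.
have [s [s1 s2 hs]] := H2 _ _ _ r4p r4 r2 M0 mz.
apply: le_trans (muM _ s r4p (ltW s1) _) _; first by lra.
have ms : m s = 0 by apply/eqP; rewrite eq_le m0 andbT -z0; apply: mM; exact: ltW.
apply: le_trans hs _; rewrite ms mulr0 powR0 ?gt_eqF// mulr0 addr0.
have -> : c1 * (M / (rho / 2 - rho / 4)) = e * (c1 / (c1 + 1)).
  have -> : rho / 2 - rho / 4 = rho / 4 by field.
  by rewrite /M; field; rewrite !gt_eqF.
by rewrite ler_piMr ?ltW// ltr_pdivrMr// mul1r ltrDl.
Qed.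

End iteration.

Lemma total_variation_eq (R : realType) n (Omega : set 'rV[R]_n) (D D' : vmeasure R n) A :
  (forall B, measurable B -> relatively_compact Omega B -> enorm (vvalue D B) = enorm (vvalue D' B)) ->
  Defs.total_variation Omega D A = Defs.total_variation Omega D' A.
Proof.
move=> h; congr ereal_sup; apply/seteqP; split => _ [B [mB rB tB BA] <-]; exists B => //.
  by apply: eq_eseriesr => k _; rewrite h.
by apply: eq_eseriesr => k _; rewrite h.
Qed.

Section real_facts.
Variable R : realFieldType.
Implicit Types x y z u v w : R.

Lemma half_lt x : 0 < x -> x / 2 < x. Proof. by move=> ?; lra. Qed.

Lemma quarter_le x : 0 < x -> x / 4 <= x. Proof. by move=> ?; lra. Qed.

Lemma quarter_gt0 x : 0 < x -> 0 < x / 4. Proof. by move=> ?; lra. Qed.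

Lemma half_gap x : 0 < x -> 0 < 1 * (x - x / 2). Proof. by move=> ?; lra. Qed.

Lemma box_side u s : u - s + 2 * s = u + s. Proof. lra. Qed.

Lemma le_half_sum x z w : x <= z -> x + z = w -> w / 2 <= z.
Proof. by move=> ? ?; lra. Qed.

Lemma le_double u v K : 0 <= u -> 1 * (2 * u + v) <= K -> u + v <= K.
Proof. by move=> ? ?; lra. Qed.

End real_facts.

(** * Volume and perimeter densities of a minimizer *)

Section density_estimates.
Variables (R : realType) (m N : nat) (alpha Calpha delta : R).
Local Notation E := 'rV[R]_m.+1.
Hypotheses (alpha_gt : m%:R / m.+1%:R < alpha) (alpha1 : alpha <= 1) (C0 : 0 <= Calpha) (delta0 : 0 < delta).

Let n1 : R := m.+1%:R.
(** [N * (N + 1)] comes from [phase_energy] and $1/\delta$ from [a >= delta]. In [c1], the factor 2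
    is the one in front of the face area, [4 * n1] bounds the integral of the face areas over the
    half side by the volume, and [+ 1] makes the inequality of [ae_select] strict. *)
Let NN : R := N%:R * (N%:R + 1).
Let c1 : R := NN / delta * (2 * (4 * n1 + 1)).
Let C1 : R := NN / delta * Calpha.

Let NN0 : 0 <= NN. Proof. by rewrite mulr_ge0// addr_ge0. Qed.
Let c10 : 0 <= c1.
Proof. by rewrite !mulr_ge0 ?invr_ge0 ?(ltW delta0)// addr_ge0// mulr_ge0. Qed.
Let C10 : 0 <= C1.
Proof. by rewrite !mulr_ge0 ?invr_ge0 ?(ltW delta0). Qed.
Let alpha0 : 0 < alpha.
Proof. by apply: le_lt_trans alpha_gt; rewrite divr_ge0. Qed.

(** Chosen before [Omega], [a], [G] and [W], so that it depends on the parameters alone. *)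
Definition decay_constant : R := s2val (cid2 (@dyadic_decay R m.+1 alpha c1 C1 (ltn0Sn m) alpha_gt c10 C10 alpha1)).

Lemma decay_constant_gt0 : 0 < decay_constant.
Proof. by rewrite /decay_constant; case: cid2. Qed.

(** The face areas, at most $N+1$ of them, are bounded by $2n(2\rho)^m$ each, with $n=m+1$;
    $2^{m+2}\rho^{m+1}$ is twice the volume of the cube of half side $\rho$. *)
Definition upper_constant : R := ((N%:R + 1) * (2 * n1 * 2 ^+ m) + Calpha * 2 ^+ m.+2) / delta.

Lemma upper_constant_ge0 : 0 <= upper_constant.
Proof.
rewrite /upper_constant mulr_ge0 ?invr_ge0 ?(ltW delta0)//; apply: addr_ge0.
  by apply: mulr_ge0; [exact: addr_ge0|rewrite !mulr_ge0 ?exprn_ge0].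
by rewrite mulr_ge0 ?exprn_ge0.
Qed.

Variables (Omega : set E) (a : E -> R) (G : ('I_N -> set E) -> R) (W : 'I_N -> set E).
Hypotheses (oO : open Omega) (lO : (leb R m.+1 Omega < +oo)%E)
  (ma : measurable_fun Omega a) (a0 : forall x, Omega x -> 0 < a x)
  (hG : forall W1 W2 : 'I_N -> set E, Fw Omega W1 -> Fw Omega W2 ->
      `|G W1 - G W2| <= Calpha * (fine (distw W1 W2)) `^ alpha)
  (minW : minimizes_Jw Omega a G W).
Variables (Omega' : set E) (O'O : Omega' `<=` Omega)
  (a1 : forall x, Omega' x -> delta <= a x <= 1).
Variables (i : 'I_N) (y : E) (rho rho' : R).
Hypotheses (rho0 : 0 < rho) (rho1 : rho <= 1) (rr' : rho < rho') (yO' : ccube y rho' `<=` Omega').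

Let D k := gradient Omega (W k).
Let V := Omega `\` W i.
Let mO : measurable Omega. Proof. exact: open_measurable_rV. Qed.
Let mW k : measurable (W k). Proof. by case: minW => -[/(_ k)[]]. Qed.
Let WO k : W k `<=` Omega. Proof. by case: minW => -[/(_ k)[]]. Qed.
Let gW k : is_gradient Omega (W k) (D k).
Proof. by apply: gradientP; case: minW => -[/(_ k)[]]. Qed.
Let aeW : {ae leb R m.+1, forall x, \sum_i \1_(W i) x = \1_Omega x :> R}.
Proof. by case: minW => -[]. Qed.
Let mV : measurable V. Proof. exact: measurableD. Qed.

Let aeV : {ae leb R m.+1, forall x, \1_V x + \1_(W i) x = \1_Omega x :> R}.
Proof.
apply: measure_negligible.aeW => x; rewrite !indicE in_setD.
have [/set_mem xi|xi] /= := boolP (x \in W i); last by rewrite andbT addr0.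
by rewrite andbF add0r mem_set//; exact: WO xi.
Qed.

Let aeS : {ae leb R m.+1, forall x, \sum_(k | k != i) \1_(W k) x = \1_V x :> R}.
Proof.
apply: (@filterS2 _ _ (ae_filter_ringOfSetsType _)) aeW aeV => x h1 h2.
by apply: (addIr (\1_(W i) x)); rewrite h2 -h1 [RHS](bigD1 i)//= addrC.
Qed.

Let DV := vadd (@vzero R m.+1) (vopp (D i)).
Let GV : is_gradient Omega V DV.
Proof. exact: (gradient_sub oO mO mV (mW i) aeV (gradient_full oO) (gW i)). Qed.

Let tvV A : Defs.total_variation Omega DV A = perimeter Omega (W i) A.
Proof.
apply: total_variation_eq => B mB rB.
rewrite (vvalue_add (gradient_full oO).1 (locally_finite_vopp (gW i).1) mB rB) vvalue_opp.
by rewrite (vvalue_vzero B) add0r enormN.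
Qed.

Let good_radius s := (forall k j, lebesgue_slice j (W k) (lo y s ord0 j) /\ lebesgue_slice j (W k) (hi y s ord0 j)) /\
  (forall j, lebesgue_slice j V (lo y s ord0 j) /\ lebesgue_slice j V (hi y s ord0 j)).

(** The faces of the cube sit at heights affine in [s], and finitely many sets and directions are
    involved. *)
Let ae_good : {ae @lebesgue_measure R, forall s, good_radius s}.
Proof.
have one A : measurable A -> {ae @lebesgue_measure R, forall s, forall j, lebesgue_slice j A (lo y s ord0 j) /\ lebesgue_slice j A (hi y s ord0 j)}.
  move=> mA; apply: ae_forall_fin => j.
  have h1 := ae_affine true (y ord0 j) (good_ae j mA).
  have h2 := ae_affine false (y ord0 j) (good_ae j mA).
  apply: (@filterS2 _ _ (ae_filter_ringOfSetsType _)) h1 h2 => s.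
  by rewrite sgn_lo sgn_hi.
have hW := ae_forall_fin (fun k => one _ (mW k)).
by apply: (@filterS2 _ _ (ae_filter_ringOfSetsType _)) hW (one _ mV) => s h1 h2; split.
Qed.

(** One rational box serves all half sides up to [rho]. *)
Let amb : exists p : 'rV[rat]_m.+1 * 'rV[rat]_m.+1, let pa : E := map_mx ratr p.1 in let pb : E := map_mx ratr p.2 in
    [/\ cbox pa pb `<=` Omega', forall s, s <= rho -> forall i, pa ord0 i <= lo y s ord0 i &
        forall s, s <= rho -> forall i, hi y s ord0 i < pb ord0 i].
Proof.
have [p [h1 h2 h3]] := ambient_box (ltW rho0) rr' yO'; exists p; split => // s sr j.
  by apply: le_trans (h2 j) _; rewrite !mxE; lra.
by apply: le_lt_trans (h3 j); rewrite !mxE; lra.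
Qed.

Let rc s : s <= rho -> relatively_compact Omega (cube y s).
Proof.
move=> sr; have [p [h1 h2 h3]] := amb.
apply: (@box_rc _ _ Omega p); first exact: subset_trans O'O.
by move=> x h k; have /andP[e1 e2] := h k;
  rewrite (le_trans (h2 s sr k) (ltW e1)) (le_trans e2 (ltW (h3 s sr k))).
Qed.

Let leb_fin A s : measurable A -> leb R m.+1 (A `&` cube y s) \is a fin_num.
Proof.
move=> mA; rewrite ge0_fin_numE//; apply: le_lt_trans (leb_hbox_lty (lo y s) (hi y s)).
by apply: le_measure; rewrite ?inE//; [apply: measurableI => //|]; exact: measurable_cube.
Qed.

Let per_ge0 A : (0 <= perimeter Omega (W i) A)%E.
Proof. by rewrite /perimeter -(tv_measureE oO (gW i).1). Qed.

Lemma perimeter_fin s : s <= rho -> perimeter Omega (W i) (cube y s) \is a fin_num.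
Proof.
move=> sr; rewrite ge0_fin_numE//.
have [Lam [g [fL dg]]] := density_family oO (fun k => (gW k).1).
have mc : measurable (cube y s) by exact: measurable_cube.
have rcs := rc sr.
rewrite /perimeter (total_variationE oO (dg i) mc) setIidl; last first.
  by have [K [_ KO cK]] := rcs; exact: subset_trans KO.
have := integrable_fin_num mc (integrable_enorm (dg i) mc rcs); rewrite ge0_fin_numE//.
by apply: integral_ge0 => x _; rewrite lee_fin enorm_ge0.
Qed.

(** The faces paid by the second competitor: those of the complement are added to phase [i], the
    others remain on the phases that lose the cube. *)
Let TV s : \bar R := (face_area (lo y s) (hi y s) V + \sum_(k | k != i) face_area (lo y s) (hi y s) (W k))%E.

Let face_fin s A : 0 <= s -> measurable A -> face_area (lo y s) (hi y s) A \is a fin_num.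
Proof.
move=> s0 mA; rewrite ge0_fin_numE ?face_area_ge0//; apply: le_lt_trans (face_area_le y s0 mA) _.
by rewrite ltry.
Qed.

Let TV_fine s : 0 <= s -> TV s = (fine (face_area (lo y s) (hi y s) V) + \sum_(k | k != i) fine (face_area (lo y s) (hi y s) (W k)))%:E.
Proof.
move=> s0; rewrite EFinD -sumEFin fineK ?face_fin//; congr (_ + _)%E.
by apply: eq_bigr => k _; rewrite fineK// face_fin.
Qed.

(** The same perimeter is bounded once through the volume of [W i], by merging it into each other
    phase, and once through the volume of its complement. *)
Let energies s : 0 < s -> s <= rho -> good_radius s ->
  (delta * fine (perimeter Omega (W i) (cube y s)) <=
    NN * (2 * fine (face_area (lo y s) (hi y s) (W i)) + Calpha * (2 * fine (leb R m.+1 (W i `&` cube y s))) `^ alpha)) /\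
  (delta * fine (perimeter Omega (W i) (cube y s)) <=
    fine (TV s) + Calpha * (2 * fine (leb R m.+1 (V `&` cube y s))) `^ alpha).
Proof.
move=> s0 sr [gd1 gd2].
have [Lam [g [fL dg]]] := density_family oO (fun k => (gW k).1).
have [p [h1 h2 h3]] := amb.
have cd j : lo y s ord0 j <= hi y s ord0 j by apply: lohi_le; exact: ltW.
have te := tv_energy oO ma a0 dg O'O delta0 a1 h1 (h2 s sr) (h3 s sr) i.
have ph := phase_energy oO lO ma a0 (ltW alpha0) C0 hG minW dg O'O a1 h1 (h2 s sr) (h3 s sr) cd i gd1.
have ce := complement_energy oO lO ma a0 (ltW alpha0) C0 hG minW dg O'O a1 h1 (h2 s sr) (h3 s sr) cd gd1 gd2.
set e := fine (wenergy a Lam g i (hbox (lo y s) (hi y s))) in ph.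
have dle : delta * fine (perimeter Omega (W i) (cube y s)) <= e.
  rewrite -lee_fin EFinM fineK ?perimeter_fin//; exact: te.
split.
  apply: le_trans dle _; move: ph; rewrite ler_pdivrMr; last by rewrite ltr_wpDl.
  by move=> /le_trans; apply; rewrite /NN mulrAC.
apply: le_trans dle _; rewrite (TV_fine (ltW s0)) /=; apply: (le_trans _ ce).
rewrite (bigD1 i)//= lerDl; apply: sumr_ge0 => k _; apply: fine_ge0.
have [K [_ KO cK]] := rc sr; apply: (wenergy_ge0 a0 Lam g k).
exact: subset_trans cK KO.
Qed.

(** Serves for [W i] and for its complement, which have the same perimeter. The Poincare hypothesis
    of [dyadic_decay] is [poincare_tiled]; for the other one, [ae_select] finds between any two half
    sides a good one at which [T] is bounded by the volume over the gap, up to a constant. *)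
Let half_density A DA T : measurable A -> is_gradient Omega A DA ->
  (forall B, Defs.total_variation Omega DA B = perimeter Omega (W i) B) ->
  measurable_fun setT T -> (forall s, 0 <= T s)%E ->
  (forall s1 s2, 0 <= s1 -> (\int[lebesgue_measure]_(s in `]s1, s2[%classic) T s <= (4 * n1)%:E * leb R m.+1 (A `&` cube y s2))%E) ->
  (forall s, 0 < s -> s <= rho -> good_radius s -> T s \is a fin_num /\
     delta * fine (perimeter Omega (W i) (cube y s)) <= NN * (2 * fine (T s) + Calpha * (2 * fine (leb R m.+1 (A `&` cube y s))) `^ alpha)) ->
  fine (leb R m.+1 (A `&` cube y rho)) <= decay_constant * rho ^+ m.+1 ->
  perimeter Omega (W i) (cube y (rho / 4)) = 0%E.
Proof.
move=> mA gA tvA mT T0 iT eT small.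
have mc s : measurable (cube y s) by exact: measurable_cube.
have mAc s : measurable (A `&` cube y s) by exact: measurableI.
have pf s : s <= rho -> perimeter Omega (W i) (cube y s) = (fine (perimeter Omega (W i) (cube y s)))%:E.
  by move=> sr; rewrite fineK// perimeter_fin.
have key : fine (perimeter Omega (W i) (cube y (rho / 4))) = 0; last by rewrite pf ?key//; exact: quarter_le.
have [_ hd2] : 0 < decay_constant /\ forall (m0 mu : R -> R) (r : R), 0 < r -> r <= 1 ->
  (forall s, 0 <= m0 s) -> (forall s, 0 <= mu s) ->
  (forall s t, s <= t -> m0 s <= m0 t) -> (forall s t, 0 < s -> s <= t -> t <= r -> mu s <= mu t) ->
  (forall s (K : nat), 0 < s -> s <= r -> (0 < K)%N -> m0 s <= (2 * s / K%:R) ^+ m.+1 / 2 ->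
     m0 s <= 2 * m.+1%:R * (2 * s / K%:R) * mu s) ->
  (forall s1 s2 M, 0 < s1 -> s1 < s2 -> s2 <= r -> 0 < M -> m0 s2 <= M ->
     exists s, [/\ s1 < s, s < s2 & mu s <= c1 * (M / (s2 - s1)) + C1 * (2 * m0 s) `^ alpha]) ->
  m0 r <= decay_constant * r ^+ m.+1 -> mu (r / 4) = 0.
  by rewrite /decay_constant; case: cid2.
apply: (hd2 (fun s => fine (leb R m.+1 (A `&` cube y s))) (fun s => fine (perimeter Omega (W i) (cube y s)))) => //.
- by move=> s; exact: fine_ge0.
- by move=> s; exact: fine_ge0.
- move=> s t st; apply: fine_le; [exact: leb_fin|exact: leb_fin|].
  by apply: le_measure; rewrite ?inE//; apply: setIS; exact: cube_sub.
- move=> s t s0 st tr; apply: fine_le; [by apply: perimeter_fin; exact: le_trans tr|exact: perimeter_fin|].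
  by apply: total_variation_mono; exact: cube_sub.
- move=> s K s0 sr K0 sm.
  have [p [h1 h2 h3]] := amb.
  have Kp : 0 < K%:R :> R by rewrite ltr0n.
  have l0 : 0 < 2 * s / K%:R by rewrite divr_gt0// mulr_gt0.
  have hiE : \row_i0 (lo y s ord0 i0 + 2 * s / K%:R * K%:R) = hi y s :> E.
    by apply/rowP => k; rewrite !mxE divfK ?gt_eqF//; exact: box_side.
  have pOO := subset_trans h1 O'O.
  have bpb k : (\row_i0 (lo y s ord0 i0 + 2 * s / K%:R * K%:R) : E) ord0 k <= (map_mx ratr p.2 : E) ord0 k.
    by rewrite hiE ltW// h3.
  have := poincare_tiled l0 oO mA gA pOO (h2 s sr) bpb.
  rewrite hiE tvA -/(cube y s) -(fineK (leb_fin s mA)) lee_fin => /(_ sm).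
  by rewrite pf// -EFinM lee_fin.
- move=> s1 s2 M s10 s12 s2r M0 mM.
  have d0 : 0 < s2 - s1 by rewrite subr_gt0.
  pose L := (4 * n1 + 1) * M / (s2 - s1).
  have L0 : 0 <= L by rewrite divr_ge0 ?(ltW d0)// mulr_ge0 ?(ltW M0)// addr_ge0// mulr_ge0.
  have lt : (\int[lebesgue_measure]_(s in `]s1, s2[%classic) T s < (L * (s2 - s1))%:E)%E.
    apply: le_lt_trans (iT _ _ (ltW s10)) _.
    rewrite -(fineK (leb_fin s2 mA)) -EFinM lte_fin /L divfK ?gt_eqF//.
    apply: (@le_lt_trans _ _ (4 * n1 * M)); first by rewrite ler_wpM2l// mulr_ge0.
    by rewrite ltr_pM2r// ltrDl.
  have [s [h1 h2 Ps Ts]] := ae_select s12 L0 ae_good (measurable_funTS mT) T0 lt.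
  have s0 : 0 < s by exact: lt_trans h1.
  have sr : s <= rho by apply: le_trans s2r; exact: ltW.
  have [Tf eTs] := eT s s0 sr Ps.
  exists s; split => //.
  have Tl : fine (T s) <= L by rewrite -lee_fin fineK.
  rewrite -(ler_pM2l delta0); apply: le_trans eTs _.
  have -> : delta * (c1 * (M / (s2 - s1)) + C1 * (2 * fine (leb R m.+1 (A `&` cube y s))) `^ alpha) =
     NN * (2 * L + Calpha * (2 * fine (leb R m.+1 (A `&` cube y s))) `^ alpha).
    rewrite /c1 /C1 /L; move: (_ `^ alpha) => u; field; rewrite !gt_eqF//.
  by rewrite ler_wpM2l// lerD2r ler_pM2l.
Qed.

(** By [half_density] neither [W i] nor its complement is small in the cube, as the perimeter near
    the centre is positive. The larger of the two volumes is at least half of the cube, the smaller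
    exceeds the threshold, and [poincare] on the whole cube gives the constant. *)
Lemma lower_density : (forall s, 0 < s -> (0 < perimeter Omega (W i) (cube y s))%E) ->
  ((decay_constant / (4 * m.+1%:R) * rho ^+ m)%:E <= perimeter Omega (W i) (cube y rho))%E.
Proof.
move=> supp.
have pos : perimeter Omega (W i) (cube y (rho / 4)) <> 0%E.
  by move=> h; have := supp (rho / 4); rewrite h ltxx => /(_ (quarter_gt0 rho0)).
have mc s : measurable (cube y s) by exact: measurable_cube.
have n10 : 0 <= n1 by [].
have A1 : decay_constant * rho ^+ m.+1 < fine (leb R m.+1 (W i `&` cube y rho)).
  rewrite ltNge; apply/negP => small; apply: pos.
  apply: (@half_density (W i) (D i) (fun s => face_area (lo y s) (hi y s) (W i)) (mW i) (gW i) _ _ _ _ _ small) => //.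
  - exact: measurable_face_area.
  - by move=> s; exact: face_area_ge0.
  - move=> s1 s2 s10; apply: le_trans (int_face_area y s2 (mW i) s10) _.
    by apply: lee_wpmul2r => //; rewrite lee_fin ler_wpM2r// ler_nat.
  move=> s s0 sr gs; split; first by apply: face_fin => //; exact: ltW.
  by have [] := energies s0 sr gs.
have mTV : measurable_fun setT TV.
  apply: emeasurable_funD; first exact: measurable_face_area.
  under eq_fun do rewrite -big_filter.
  by apply: emeasurable_sum => k; exact: measurable_face_area.
have TV0 s : (0 <= TV s)%E by apply: adde_ge0; [|apply: sume_ge0 => k _]; exact: face_area_ge0.
have A2 : decay_constant * rho ^+ m.+1 < fine (leb R m.+1 (V `&` cube y rho)).
  rewrite ltNge; apply/negP => small; apply: pos.
  apply: (@half_density V DV TV mV GV _ _ _ _ _ small) => //.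
  - move=> s1 s2 s10.
    have mI : measurable (`]s1, s2[%classic : set (measurableTypeR R)) by exact: measurable_itv.
    rewrite /TV ge0_integralD//; last 4 first.
    + by move=> s _; exact: face_area_ge0.
    + by apply: measurable_funTS; exact: measurable_face_area.
    + by move=> s _; apply: sume_ge0 => k _; exact: face_area_ge0.
    + apply: measurable_funTS; under eq_fun do rewrite -big_filter.
      by apply: emeasurable_sum => k; exact: measurable_face_area.
    have e4 : (4 * n1)%:E = ((2 * n1)%:E + (2 * n1)%:E)%E by rewrite -EFinD; congr EFin; ring.
    rewrite e4 ge0_muleDl ?lee_fin ?mulr_ge0//; apply: leeD; first exact: int_face_area.
    under eq_integral do rewrite -big_filter.
    rewrite ge0_integral_sum//; last 2 first.
    + by move=> k; apply: measurable_funTS; exact: measurable_face_area.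
    + by move=> k s _; exact: face_area_ge0.
    rewrite big_filter -(sum_leb mW mV (mc s2) aeS) ge0_sume_distrr; last by move=> k _; exact: measure_ge0.
    by apply: lee_sum => k _; exact: int_face_area.
  move=> s s0 sr gs; split; first by rewrite TV_fine ?ltW.
  have [_ h] := energies s0 sr gs; apply: le_trans h _.
  have t0 : 0 <= fine (TV s) by exact: fine_ge0.
  have w0 : 0 <= Calpha * (2 * fine (leb R m.+1 (V `&` cube y s))) `^ alpha by rewrite mulr_ge0// powR_ge0.
  (* The second competitor yields a bound without the factor [NN]; it fits the form shared by both
     cases because [NN >= 1]. *)
  have NN1 : 1 <= NN.
    have N1 : 1 <= N%:R :> R by rewrite (ler_nat _ 1) (leq_trans _ (ltn_ord i)).
    rewrite /NN; nra.
  move: (fine (TV s)) (Calpha * _) t0 w0 => u v u0 v0.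
  have : 1 * (2 * u + v) <= NN * (2 * u + v) by rewrite ler_wpM2r// addr_ge0// mulr_ge0.
  exact: le_double.
have [p [h1 h2 h3]] := amb.
have l0 : 0 < 2 * rho by rewrite mulr_gt0.
have pOO := subset_trans h1 O'O.
have := poincare oO (mW i) (gW i) pOO (h2 _ (lexx rho)) (fun k => ltW (h3 _ (lexx rho) k)) l0
  (fun k => conj (lohi_le y k (ltW rho0)) (ltac:(by rewrite lohi_side) : hi y rho ord0 k - lo y rho ord0 k <= 2 * rho)).
rewrite -/(cube y rho) -/(perimeter Omega (W i) (cube y rho)).
have split := measure_setD_setI (leb R m.+1) (mc rho) (mW i).
have cO : cube y rho `<=` Omega by have [K [_ KO cK]] := rc (lexx rho); exact: subset_trans KO.
have VE : V `&` cube y rho = cube y rho `\` W i.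
  by apply/seteqP; split => x [h4 h5]; [case: h4|split => //; split => //; exact: cO].
have split' : (leb R m.+1 (V `&` cube y rho) + leb R m.+1 (W i `&` cube y rho) = ((2 * rho) ^+ m.+1)%:E)%E.
  by rewrite VE; exact: etrans split (leb_cube y (ltW rho0)).
move: split'; rewrite -VE -(fineK (leb_fin rho (mW i))) -(fineK (leb_fin rho mV)) -(fineK (perimeter_fin (lexx rho))).
move: (fine (leb R m.+1 (W i `&` cube y rho))) (fine (leb R m.+1 (V `&` cube y rho))) (fine (perimeter Omega (W i) (cube y rho))) A1 A2 => x z t xl zl.
rewrite -EFinD -!EFinM !lee_fin => -[sum] ineq.
have rn : 0 < rho ^+ m.+1 by exact: exprn_gt0.
have rm : 0 < rho ^+ m by exact: exprn_gt0.
have e0 := decay_constant_gt0.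
have de : 0 < decay_constant * rho ^+ m.+1 by exact: mulr_gt0.
have half : decay_constant * rho ^+ m.+1 * ((2 * rho) ^+ m.+1 / 2) <= x * z.
  have [xz|zx] := leP x z.
    by apply: ler_pM; [exact: ltW|rewrite divr_ge0 ?exprn_ge0 ?(ltW l0)//|exact: ltW|by apply: (le_half_sum xz); rewrite addrC].
  rewrite (mulrC x); apply: ler_pM; [exact: ltW|rewrite divr_ge0 ?exprn_ge0 ?(ltW l0)//|exact: ltW|exact: (le_half_sum (ltW zx))].
have := le_trans half ineq.
have qn : 0 < (2 * rho) ^+ m.+1 by exact: exprn_gt0.
have np : 0 < m.+1%:R :> R by [].
rewrite [(2 * rho) ^+ m.+2]exprS [rho ^+ m.+1]exprS => h.
rewrite -(ler_pM2r (_ : 0 < (2 * rho) ^+ m.+1 * (2 * rho * m.+1%:R))); last by rewrite !mulr_gt0.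
apply: le_trans (le_trans _ h) _; rewrite le_eqVlt; apply/orP; left; apply/eqP.
  by move: (rho ^+ m) ((2 * rho) ^+ m.+1) (m.+1%:R : R) np => u v w w0; field; rewrite gt_eqF.
by move: ((2 * rho) ^+ m.+1) => v; ring.
Qed.

(** Between [rho / 2] and [rho] there is a good half side; there the second competitor costs at most
    the full area of the faces and, through the penalty, the full volume of the cube to the power
    [alpha]. *)
Lemma upper_density : (perimeter Omega (W i) (cube y (rho / 2)) <= (upper_constant * rho ^+ m)%:E)%E.
Proof.
have r2 : rho / 2 < rho by exact: half_lt.
(* Any good half side will do, so [ae_select] is applied to the zero function. *)
have lt0 : (\int[lebesgue_measure]_(s in `](rho / 2)%R, rho[%classic) (cst 0%E : R -> \bar R) s < (1 * (rho - rho / 2))%:E)%E.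
  by rewrite integral0 lte_fin; exact: half_gap.
have [s [s1 s2 Ps _]] := ae_select r2 ler01 ae_good (@measurable_cst _ _ _ _ _ _) (fun _ => lexx _) lt0.
have s0 : 0 < s by apply: lt_trans s1; exact: divr_gt0.
have sr : s <= rho by exact: ltW.
have [_ h] := energies s0 sr Ps.
apply: (@le_trans _ _ (perimeter Omega (W i) (cube y s))).
  by apply: total_variation_mono; apply: cube_sub; exact: ltW.
rewrite -(fineK (perimeter_fin sr)) lee_fin -(ler_pM2l delta0); apply: le_trans h _.
have -> : delta * (upper_constant * rho ^+ m) = (N%:R + 1) * (2 * n1 * 2 ^+ m * rho ^+ m) + Calpha * (2 ^+ m.+2 * rho ^+ m).
  by rewrite /upper_constant; move: (2 ^+ m) (2 ^+ m.+2) (rho ^+ m) => u v w; field; rewrite gt_eqF.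
have fl A : measurable A -> fine (face_area (lo y s) (hi y s) A) <= 2 * n1 * 2 ^+ m * rho ^+ m.
  move=> mA; rewrite -lee_fin fineK; last by apply: face_fin => //; exact: ltW.
  apply: le_trans (face_area_le y (ltW s0) mA) _; rewrite lee_fin -mulrA -[leRHS]mulrA -/n1.
  rewrite [leRHS](_ : _ = 2 * (n1 * (2 * rho) ^+ m)); last by rewrite exprMn; ring.
  rewrite !ler_wpM2l//; apply: lerXn2r; rewrite ?nnegrE ?mulr_ge0 ?(ltW s0) ?(ltW rho0)//.
  by rewrite ler_pM2l.
apply: lerD.
  rewrite (TV_fine (ltW s0)) /= mulrDl mul1r addrC; apply: lerD; last exact: fl.
  apply: (@le_trans _ _ (\sum_(k < N) 2 * n1 * 2 ^+ m * rho ^+ m)); last by rewrite sumr_const card_ord -[leLHS]mulr_natl.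
  rewrite [leRHS](bigID (fun k => k != i)) /=; apply: ler_wpDr.
    by apply: sumr_ge0 => k _; rewrite !mulr_ge0 ?exprn_ge0 ?(ltW rho0).
  by apply: ler_sum => k _; exact: fl.
rewrite ler_wpM2l//.
have vl : 2 * fine (leb R m.+1 (V `&` cube y s)) <= 2 ^+ m.+2 * rho ^+ m.+1.
  rewrite exprS -mulrA ler_pM2l// -exprMn -lee_fin (fineK (leb_fin s mV)).
  apply: (@le_trans _ _ (leb R m.+1 (cube y rho))).
    apply: le_measure; rewrite ?inE; [by apply: measurableI => //; exact: measurable_cube|exact: measurable_cube|].
    by move=> x [_]; apply: cube_sub.
  by rewrite leb_cube// ltW.
apply: (@le_trans _ _ ((2 ^+ m.+2 * rho ^+ m.+1) `^ alpha)).
  apply: ge0_ler_powR; [exact: ltW|by rewrite nnegrE mulr_ge0// fine_ge0|by rewrite nnegrE mulr_ge0 ?exprn_ge0 ?(ltW rho0)|exact: vl].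
(* [alpha <= 1] bounds the power of [2 ^+ m.+2]; that of [rho ^+ m.+1] is bounded by [rho ^+ m]
   because the exponent gap is positive and [rho <= 1]. *)
rewrite powRM ?exprn_ge0 ?(ltW rho0)//; apply: ler_pM; rewrite ?powR_ge0//.
  rewrite -[leRHS]powRr1 ?exprn_ge0//; apply: ler_powR => //.
  by rewrite exprn_ege1// ler1n.
exact: (@powR_volume_le R m.+1 alpha (ltn0Sn m) alpha_gt rho rho0 rho1).
Qed.

End density_estimates.

(** * Differentiation of the gradient *)

Section vitali_covering.
Variables (R : realType) (n : nat) (mu rho : {measure set 'rV[R]_n -> \bar R}) (K : R).
Local Notation E := 'rV[R]_n.

Lemma measurable_ball (y : E) (s : R) : measurable (ball y s).
Proof. by apply: open_measurable_rV; exact: ball_open. Qed.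

Lemma max_radius (s : seq (E * R)) : s != [::] ->
  exists2 b, b \in s & forall b', b' \in s -> b'.2 <= b.2.
Proof.
elim: s => // c [|d s] IH _.
  by exists c; [rewrite inE|move=> b'; rewrite inE => /eqP ->].
have [b bs bm] := IH isT.
have [cb|bc] := leP c.2 b.2.
  by exists b; [rewrite inE bs orbT|move=> b'; rewrite inE => /orP[/eqP ->//|/bm]].
exists c; first by rewrite inE eqxx.
by move=> b'; rewrite inE => /orP[/eqP ->//|/bm h]; rewrite (le_trans h) ?(ltW bc).
Qed.

Definition ball_union (s : seq (E * R)) : set E := \bigcup_(b in [set` s]) ball b.1 b.2.

Lemma measurable_ball_union s : measurable (ball_union s).
Proof. by apply: open_measurable_rV; apply: bigcup_open => b _; exact: ball_open. Qed.

(* The ball of largest radius is removed together with all the balls meeting it,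
   which lie in its threefold enlargement. *)
Lemma covering_bound (s : seq (E * R)) (V : set E) : 0 <= K -> measurable V ->
  (forall b, b \in s -> [/\ 0 < b.2, ball b.1 b.2 `<=` V &
     (mu (ball b.1 (3 * b.2)) <= K%:E * rho (ball b.1 b.2))%E]) ->
  (mu (ball_union s) <= K%:E * rho V)%E.
Proof.
move=> K0; have [k ks] := ubnP (size s); elim: k => // k IH in s ks V *; move=> mV hs.
have [->|s0] := eqVneq s [::].
  rewrite /ball_union (_ : [set` [::]] = set0) ?bigcup_set0 ?measure0 ?mule_ge0//.
  by apply/seteqP; split => x.
have [b bs bm] := max_radius s0.
have [b0 bV bK] := hs _ bs.
pose s' := [seq c <- s | `[< ball c.1 c.2 `&` ball b.1 b.2 = set0 >]].
have ss' : (size s' < k)%N.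
  rewrite ltnS in ks; apply: (@leq_trans (size s)) ks; rewrite /s' size_filter.
  have : (count (predC (fun c : E * R => `[< ball c.1 c.2 `&` ball b.1 b.2 = set0 >])) s > 0)%N.
    rewrite -has_count; apply/hasP; exists b => //=.
    apply/asboolPn; rewrite setIid => h; have := @ballxx _ _ b.1 _ b0; by rewrite h.
  by move=> h; rewrite -[X in (_ < X)%N](count_predC (fun c : E * R => `[< ball c.1 c.2 `&` ball b.1 b.2 = set0 >]) s) -[ltnLHS]addn0 ltn_add2l.
have mb : measurable (ball b.1 b.2) by exact: measurable_ball.
have h1 : (mu (ball_union s') <= K%:E * rho (V `\` ball b.1 b.2))%E.
  apply: IH => //; first exact: measurableD.
  move=> c; rewrite mem_filter => /andP[/asboolP cb cs]; have [c0 cV cK] := hs _ cs.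
  split => // x cx; split; first exact: cV.
  by move=> bx; have : set0 x by rewrite -cb.
have cover : ball_union s `<=` ball b.1 (3 * b.2) `|` ball_union s'.
  move=> x [c /= cs cx].
  have [d|nd] := pselect (ball c.1 c.2 `&` ball b.1 b.2 = set0).
    by right; exists c => //=; rewrite mem_filter cs andbT; apply/asboolP.
  have [z [cz bz]] : ball c.1 c.2 `&` ball b.1 b.2 !=set0 by apply/set0P/eqP.
  left; have -> : 3 * b.2 = b.2 + (b.2 + b.2) by ring.
  apply: (ball_triangle bz); apply: (ball_triangle (y := c.1)).
    by apply: ball_sym; apply: le_ball cz; exact: bm.
  by apply: le_ball cx; exact: bm.
apply: (@le_trans _ _ (mu (ball b.1 (3 * b.2) `|` ball_union s'))).
  apply: le_measure; rewrite ?inE//; first exact: measurable_ball_union.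
  by apply: measurableU; [exact: measurable_ball|exact: measurable_ball_union].
apply: (le_trans (measureU2 _ (measurable_ball _ _) (measurable_ball_union _))).
apply: (le_trans (leeD bK h1)).
rewrite -ge0_muleDr// (_ : (rho _ + rho _)%E = rho V)//.
rewrite -measureU//; last by rewrite setDE setIA setIAC setICr set0I.
  congr (rho _); apply/seteqP; split => x; first by case=> [/bV//|[]].
  by move=> Vx; have [h|h] := pselect (ball b.1 b.2 x); [left|right].
exact: measurableD.
Qed.

End vitali_covering.

(** * Outer regularity and a density theorem *)

Section outer_regularity.
Variables (R : realType) (n : nat) (rho : {measure set 'rV[R]_n -> \bar R}).
Local Notation E := 'rV[R]_n.
Hypothesis rho_fin : (rho setT < +oo)%E.

(** Approximation from both sides at once makes the class stable under complement. *)
Definition regular (A : set E) := forall e : R, 0 < e -> exists F V : set E,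
  [/\ closed F, open V, F `<=` A, A `<=` V & (rho (V `\` F) <= e%:E)%E].

Lemma closed_measurable (F : set E) : closed F -> measurable F.
Proof. by move=> cF; rewrite -(setCK F); apply: measurableC; apply: open_measurable_rV; rewrite openC. Qed.

(** By continuity from above, finitely many [F k] do nearly as well as all of them; this matters
    because a finite union of closed sets is still closed. *)
Lemma exhaust (V : set E) (F : nat -> set E) (e : R) : 0 < e -> measurable V -> (forall k, measurable (F k)) ->
  exists N, (rho (V `\` \big[setU/set0]_(k < N) F k) <= rho (V `\` \bigcup_k F k) + e%:E)%E.
Proof.
move=> e0 mV mF.
pose G k := V `\` \big[setU/set0]_(j < k) F j.
have mG k : measurable (G k) by apply: measurableD => //; apply: bigsetU_measurable => j _.
have Gd : nonincreasing_seq G.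
  apply/nonincreasing_seqP => k; apply/subsetPset => x [Vx nx]; split => // h; apply: nx.
  by rewrite big_ord_recr /=; left.
have GE : \bigcap_k G k = V `\` \bigcup_k F k.
  apply/seteqP; split => [x h|x [Vx nx] k _].
    split; first by case: (h 0%N).
    move=> [k _ Fx]; have [_] := h k.+1 I; apply; rewrite big_ord_recr /=; by right.
  split => //; rewrite -bigcup_mkord => -[j _ Fx]; by apply: nx; exists j.
have G0 : (rho (G 0%N) < +oo)%E.
  by apply: le_lt_trans rho_fin; apply: le_measure; rewrite ?inE.
have mI : measurable (\bigcap_k G k) by exact: bigcapT_measurable.
have cv := nonincreasing_cvg_mu G0 mG mI Gd.
have fI : rho (\bigcap_k G k) \is a fin_num.
  rewrite ge0_fin_numE//; apply: le_lt_trans rho_fin; apply: le_measure; rewrite ?inE//.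
have : \forall k \near \oo, (rho (G k) < rho (\bigcap_k G k) + e%:E)%E.
  have lt : (rho (\bigcap_k G k) < rho (\bigcap_k G k) + e%:E)%E by rewrite lteDl// lte_fin.
  exact: cv _ (open_ereal_lt' lt).
move=> [N _ /(_ N (leqnn N))] /= h; exists N; rewrite -GE; exact: ltW.
Qed.

Lemma regular_open (U : set E) : open U -> regular U.
Proof.
move=> oU e e0.
pose F k : set E := if unpickle k is Some p then
  if `[< cbox (map_mx ratr p.1) (map_mx ratr p.2) `<=` U >] then cbox (map_mx ratr p.1) (map_mx ratr p.2) else set0
  else set0.
have cF k : closed (F k).
  rewrite /F; case: unpickle => [p|]; last exact: closed0.
  case: ifP => _; last exact: closed0.
  by apply: compact_closed; [exact: norm_hausdorff|exact: compact_cbox].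
have FU k : F k `<=` U.
  rewrite /F; case: unpickle => [p|]; last exact: sub0set.
  by case: asboolP => // _; exact: sub0set.
have UF : U = \bigcup_k F k.
  apply/seteqP; split => [x|x [k _]]; last exact: FU.
  rewrite (qcoverP oU) => -[k _ h]; exists k => //; move: h; rewrite /F /qcover.
  case: unpickle => [p|]//; case: ifP => // _ h i; have /andP[/ltW -> ->] := h i; by [].
have mF k : measurable (F k) by exact: closed_measurable.
have [N hN] := exhaust e0 (open_measurable_rV oU) mF.
exists (\big[setU/set0]_(k < N) F k), U; split => //.
- by apply: closed_bigsetU => k _; exact: cF.
- by move=> x; rewrite -bigcup_mkord => -[k _ h]; exact: FU h.
- by move: hN; rewrite -UF setDv measure0 add0e.
Qed.

(** The measurable sets that are [regular] form a sigma-algebra containing the open sets. In a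
    countable union, half of [e] pays for truncating the inner approximation and half for the series
    of the errors. *)
Lemma regular_measurable (A : set E) : measurable A -> regular A.
Proof.
suff : <<s @open E >> `<=` [set A | measurable A /\ regular A] by move=> h mA; case: (h A mA).
apply: smallest_sub; last by move=> U oU; split; [exact: open_measurable_rV|exact: regular_open].
split.
- by split => // e e0; exists set0, set0; split=> //; do ?[exact: closed0|exact: open0]; rewrite setD0 measure0 lee_fin ltW.
- move=> B [mB rB]; rewrite setTD; split; first exact: measurableC.
  move=> e /rB[F [V [cF oV FB BV h]]]; exists (~` V), (~` F); split.
  + by apply: open_closedC.
  + by apply: closed_openC.
  + exact: subsetC.
  + exact: subsetC.
  + by rewrite setDE setCK setIC -setDE.
move=> B hB; split; first by apply: bigcupT_measurable => k; case: (hB k).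
move=> e e0.
have ek k : 0 < e / 2 / (2 ^ k.+1)%:R by rewrite !divr_gt0// ltr0n expn_gt0.
have /choice[F /choice[V hFV]] k : exists F V, [/\ closed F, open V, F `<=` B k, B k `<=` V & (rho (V `\` F) <= (e / 2 / (2 ^ k.+1)%:R)%:E)%E].
  by have [_ /(_ _ (ek k))] := hB k.
have oV : open (\bigcup_k V k) by apply: bigcup_open => k _; case: (hFV k).
have cF k : closed (F k) by case: (hFV k).
have mF k : measurable (F k) by exact: closed_measurable.
have mV k : measurable (V k) by apply: open_measurable_rV; case: (hFV k).
have e2 : 0 < e / 2 by rewrite divr_gt0.
have [N hN] := exhaust e2 (open_measurable_rV oV) mF.
exists (\big[setU/set0]_(k < N) F k), (\bigcup_k V k); split => //.
- by apply: closed_bigsetU => k _; exact: cF.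
- move=> x; rewrite -bigcup_mkord => -[k _ h]; exists k => //.
  by case: (hFV k) => _ _ FB _ _; exact: FB.
- by move=> x [k _ Bx]; exists k => //; case: (hFV k) => _ _ _ BV _; exact: BV.
apply: (le_trans hN); rewrite [e in leRHS]splitr EFinD leeD2r//.
apply: (@le_trans _ _ (rho (\bigcup_k (V k `\` F k)))).
  apply: le_measure; rewrite ?inE.
  - by apply: measurableD; apply: bigcupT_measurable.
  - by apply: bigcupT_measurable => k; exact: measurableD.
  - by move=> x [[k _ Vx] nF]; exists k => //; split => // Fx; apply: nF; exists k.
apply: (le_trans (measure_sigma_subadditive _ _ _ (@subset_refl _ _))).
- by move=> k; exact: measurableD.
- by apply: bigcupT_measurable => k; exact: measurableD.
apply: (@le_trans _ _ (\sum_(k <oo) (0 + (e / 2 / (2 ^ k.+1)%:R)%:E))%E).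
  by apply: lee_nneseries => // k _; rewrite add0e; case: (hFV k).
apply: (le_trans (epsilon_trick _ _ _)) => //; first by exact: ltW.
by rewrite eseries0// add0e.
Qed.

End outer_regularity.

Section density_zero.
Variables (R : realType) (n : nat).
Local Notation E := 'rV[R]_n.
Implicit Types mu rho : {measure set E -> \bar R}.

Lemma negligible_approx mu (B : set E) :
  (forall e : R, 0 < e -> exists Q, [/\ measurable Q, B `<=` Q & (mu Q <= e%:E)%E]) ->
  mu.-negligible B.
Proof.
move=> h; have /choice[Q hQ] k : exists Q, [/\ measurable Q, B `<=` Q & (mu Q <= (k.+1%:R^-1)%:E)%E].
  by apply: h; rewrite invr_gt0.
have mI : measurable (\bigcap_k Q k) by apply: bigcapT_measurable => k; case: (hQ k).
exists (\bigcap_k Q k); split => //; last by move=> x Bx k _; case: (hQ k) => _ BQ _; exact: BQ.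
apply/eqP; rewrite eq_le measure_ge0 andbT; apply/lee_addgt0Pr => e e0; rewrite add0e.
have [k ke] : exists k : nat, (k.+1%:R^-1 : R) <= e.
  exists (Num.truncn e^-1); rewrite -[leRHS]invrK lef_pV2 ?posrE ?invr_gt0//.
  exact: ltW (truncnS_gt _).
apply: (@le_trans _ _ (mu (Q k))).
  by apply: le_measure; rewrite ?inE//; [case: (hQ k)|move=> x; exact].
by case: (hQ k) => _ _ /le_trans; apply; rewrite lee_fin.
Qed.

Lemma measure_bigcup_le mu (F : nat -> set E) (a : \bar R) : (forall k, measurable (F k)) ->
  (forall N, (mu (\big[setU/set0]_(k < N) F k) <= a)%E) -> (mu (\bigcup_k F k) <= a)%E.
Proof.
move=> mF h; rewrite -bigcup_bigsetU_bigcup.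
have mG k : measurable (\big[setU/set0]_(i < k.+1) F i) by apply: bigsetU_measurable.
have nd : nondecreasing_seq (fun k => \big[setU/set0]_(i < k.+1) F i).
  apply/nondecreasing_seqP => k; apply/subsetPset => x h1; rewrite big_ord_recr /=; by left.
have cv := @nondecreasing_cvg_mu _ _ _ mu _ mG (bigcupT_measurable _ mG) nd.
rewrite -(cvg_lim _ cv)//; apply: lime_le; first by apply/cvg_ex; eexists; exact: cv.
by apply: nearW => k; exact: h.
Qed.

(** Where [rho] charges arbitrarily small balls with more than $ts^m$, the upper bound on [mu] gives
    $\mu(B_{3s})\le K\rho(B_s)$. Inside an open set around [A] of small [rho] measure,
    [covering_bound] then makes the [mu] measure of these points small. *)
Lemma density_zero mu rho (U A : set E) (m : nat) (C s0 : R) : (rho setT < +oo)%E -> 0 <= C -> 0 < s0 ->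
  (forall y s, U y -> 0 < s -> s <= s0 -> (mu (ball y s) <= (C * s ^+ m)%:E)%E) ->
  measurable A -> rho A = 0%E ->
  mu.-negligible [set y | [/\ A y, U y & exists2 t : R, 0 < t & forall s1, 0 < s1 ->
    exists s, [/\ 0 < s, s < s1 & ((t * s ^+ m)%:E < rho (ball y s))%E]]].
Proof.
move=> rho_fin C0 s00 up mA rA.
pose bad (t : R) := [set y | [/\ A y, U y & forall s1, 0 < s1 ->
    exists s, [/\ 0 < s, s < s1 & ((t * s ^+ m)%:E < rho (ball y s))%E]]].
have nbad t : 0 < t -> mu.-negligible (bad t).
  move=> t0; apply: negligible_approx => e e0.
  (* From $\mu(B_{3s})\le C3^ms^m$ and $ts^m<\rho(B_s)$. *)
  pose K := C * 3 ^+ m / t.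
  have K0 : 0 <= K by rewrite divr_ge0 ?(ltW t0)// mulr_ge0// exprn_ge0.
  have K1 : 0 < K + 1 by rewrite ltr_wpDl.
  (* The division is by [K + 1] since [K] may be 0. *)
  have [F0 [V [cF oV FA AV hV]]] := regular_measurable rho_fin mA (divr_gt0 e0 K1).
  have mV : measurable V := open_measurable_rV oV.
  have rV : (rho V <= (e / (K + 1))%:E)%E.
    have mF0 : measurable F0 := closed_measurable cF.
    have rF : rho F0 = 0%E.
      by apply/eqP; rewrite eq_le measure_ge0 andbT -rA; apply: le_measure; rewrite ?inE.
    have mD : measurable (V `\` F0) by exact: measurableD.
    have h : (rho (V `\` F0 `|` F0) <= rho (V `\` F0) + rho F0)%E := measureU2 _ mD mF0.
    have VE : V `\` F0 `|` F0 = V by rewrite setUC setDUK// => x /FA /AV.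
    by move: h; rewrite rF adde0 VE => h; exact: le_trans h hV.
  pose admissible (b : E * R) := [/\ 0 < b.2, ball b.1 b.2 `<=` V & (mu (ball b.1 (3 * b.2)) <= K%:E * rho (ball b.1 b.2))%E].
  (* Each bad point lies in a rational box inside an admissible ball. These boxes are countable and
     measurable, and any finite number of them is covered by finitely many balls, which is what
     [covering_bound] handles. *)
  pose F k : set E := if unpickle k is Some p then
     if `[< exists b, admissible b /\ @qbox R n p `<=` ball b.1 b.2 >] then @qbox R n p else set0 else set0.
  have mF k : measurable (F k).
    by rewrite /F; case: unpickle => [p|]//; case: ifP => // _; exact: measurable_hbox.
  exists (\bigcup_k F k); split; first exact: bigcupT_measurable.
    move=> y [Ay Uy hy].
    have /nbhs_ballP[d /= d0 dV] := open_nbhs_nbhs (conj oV (AV _ Ay) : open_nbhs _ _).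
    have [s [sp sd hs]] := hy (Num.min d (s0 / 3)) ltac:(by rewrite lt_min d0 divr_gt0).
    move: sd; rewrite lt_min => /andP[sd s3].
    have [p py pe] := qbox_in_ball y sp.
    exists (pickle p) => //; rewrite /F pickleK asboolT//.
    exists (y, s); split => //; split => //=; first by apply: subset_trans dV; apply: le_ball; exact: ltW.
    have s30 : 3 * s <= s0 by move: s3; rewrite ltr_pdivlMr// mulrC => /ltW.
    apply: (le_trans (up _ _ Uy _ s30)); first by rewrite mulr_gt0.
    apply: (@le_trans _ _ (K%:E * (t * s ^+ m)%:E)%E); last by apply: lee_wpmul2l; [rewrite lee_fin|exact: ltW].
    rewrite -EFinM lee_fin /K exprMn le_eqVlt; apply/orP; left; apply/eqP.
    by move: (3 ^+ m) (s ^+ m) => u v; field; rewrite gt_eqF.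
  apply: (@le_trans _ _ (K%:E * rho V)%E).
    apply: measure_bigcup_le => // N.
    have /choice[f hf] k : exists l : seq (E * R), (forall b, b \in l -> admissible b) /\ F k `<=` ball_union l.
      rewrite /F; case: unpickle => [p|]; last by exists [::]; split => //; exact: sub0set.
      case: asboolP => [[b [gb pb]]|_]; last by exists [::]; split => //; exact: sub0set.
      exists [:: b]; split; first by move=> c; rewrite inE => /eqP ->.
      by move=> x /pb bx; exists b => //=; rewrite inE.
    pose L := flatten [seq f k | k <- iota 0 N].
    apply: (@le_trans _ _ (mu (ball_union L))).
      apply: le_measure; rewrite ?inE; [exact: bigsetU_measurable|exact: measurable_ball_union|].
      move=> x; rewrite -bigcup_mkord => -[k /= kN Fx]; have [b /= bf bx] := (hf k).2 _ Fx.
      exists b => //=; apply/flattenP; exists (f k) => //; apply/mapP; exists k => //.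
      by rewrite mem_iota add0n.
    apply: covering_bound => // b /flattenP[l /mapP[k _ ->]]; exact: (hf k).1.
  apply: (@le_trans _ _ (K%:E * (e / (K + 1))%:E)%E); first by apply: lee_wpmul2l; rewrite ?lee_fin.
  rewrite -EFinM lee_fin mulrCA ler_piMr ?(ltW e0)// ler_pdivrMr// mul1r lerDl//.
apply: (negligibleS _ (negligible_bigcup (fun k : nat => nbad (k.+1%:R^-1) ltac:(by rewrite invr_gt0)))).
move=> y [Ay Uy [t t0 ht]].
exists (Num.truncn t^-1) => //; split => // s1 s10; have [s [sp ss hs]] := ht _ s10.
exists s; split => //; apply: le_lt_trans hs; rewrite lee_fin ler_wpM2r ?exprn_ge0 ?(ltW sp)//.
by rewrite -[leRHS]invrK lef_pV2 ?posrE ?invr_gt0// ltW// truncnS_gt.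
Qed.

(** A point off the support lies in one of countably many rational boxes of measure 0. *)
Lemma support_full mu : mu.-negligible [set y | exists2 s : R, 0 < s & mu (ball y s) = 0%E].
Proof.
pose F k : set E := if unpickle k is Some p then
     if `[< mu (@qbox R n p) = 0%E >] then @qbox R n p else set0 else set0.
have nF k : mu.-negligible (F k).
  rewrite /F; case: unpickle => [p|]; last exact: negligible_set0.
  case: asboolP => h; last exact: negligible_set0.
  by exists (@qbox R n p); split => //; exact: measurable_hbox.
apply: (negligibleS _ (negligible_bigcup nF)) => y [s s0 hs].
have [p py pe] := qbox_in_ball y s0; exists (pickle p) => //; rewrite /F pickleK asboolT//.
apply/eqP; rewrite eq_le measure_ge0 andbT -hs; apply: le_measure; rewrite ?inE//; [exact: measurable_hbox|exact: measurable_ball].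
Qed.

End density_zero.

Section euclidean_balls.
Variables (R : realType) (n : nat).
Local Notation E := 'rV[R]_n.
Implicit Types (y v : E) (r s : R).

Lemma ballP_rV y s v : 0 < s -> ball y s v <-> forall i, `|y ord0 i - v ord0 i| < s.
Proof.
move=> s0; split => [[_ h] i|h]; first exact: h.
by split => // i j; rewrite (ord1 i); exact: h.
Qed.

Lemma eball_sub_ball y r : 0 < r -> eball y r `<=` ball y r.
Proof.
move=> r0 v h; apply/ballP_rV => // i; rewrite distrC.
have := le_coord_enorm (v - y) i; rewrite !mxE => /le_lt_trans; exact.
Qed.

(** The Euclidean norm is at most [n] times the sup norm; dividing by [n.+1] makes the inequality
    strict, also for [n = 0]. *)
Lemma ball_sub_eball y r : 0 < r -> ball y (r / n.+1%:R) `<=` eball y r.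
Proof.
move=> r0 v /ballP_rV h; rewrite /eball /=.
have rn : 0 < r / n.+1%:R by rewrite divr_gt0.
apply: (@le_lt_trans _ _ (n%:R * (r / n.+1%:R))).
  apply: enorm_le_max; first exact: ltW.
  by move=> i; rewrite !mxE distrC ltW// h.
by rewrite mulrCA gtr_pMr// ltr_pdivrMr// mul1r ltr_nat.
Qed.

Lemma measurable_eball y r : measurable (eball y r).
Proof.
have mf : measurable_fun setT (fun v : E => enorm (v - y)).
  apply: measurable_enorm => j.
  rewrite (_ : (fun x : E => _) = (fun x : E => x ord0 j - y ord0 j)); last by apply/funext => x; rewrite !mxE.
  by apply: measurable_funB => //; exact: measurable_coord_rV.
rewrite (_ : eball y r = [set: E] `&` (fun v : E => enorm (v - y)) @^-1` `]-oo, r[%classic); last first.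
  by rewrite setTI; apply/seteqP; split => v /=; rewrite in_itv.
exact: mf.
Qed.

End euclidean_balls.

Section differentiation.
Variables (R : realType) (n : nat).
Local Notation E := 'rV[R]_n.
Variables (Omega : set E) (Lam : {measure set E -> \bar R}).
Hypothesis oO : open Omega.
Variables (D : vmeasure R n) (g : E -> E).
Hypotheses (lf : locally_finite Omega D) (dg : density Omega Lam D g).
Local Notation mu := (tv_measure oO lf).

Let mg j : measurable_fun setT (fun x => g x ord0 j). Proof. by case: dg. Qed.
Let me : measurable_fun setT (fun x => enorm (g x)).
Proof. exact: measurable_enorm. Qed.

(** The distance from the direction of [g] to [p], weighted by the length of [g] so as to be a
    density relative to [Lam]. *)
Definition deviation (p x : E) : R := enorm (g x - enorm (g x) *: p).

(* Vanishes where the direction [g x / |g x|] is within [eta] of [p]. *)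
Definition excess p eta x : R := Num.max 0 (deviation p x - eta * enorm (g x)).

Lemma measurable_deviation p : measurable_fun setT (deviation p).
Proof.
apply: measurable_enorm => j.
rewrite (_ : (fun x : E => _) = (fun x : E => g x ord0 j - enorm (g x) * p ord0 j)); last by apply/funext => x; rewrite !mxE.
by apply: measurable_funB => //; apply: measurable_funM.
Qed.

Lemma measurable_excess p eta : measurable_fun setT (excess p eta).
Proof.
apply: measurable_maxr => //; apply: measurable_funB; first exact: measurable_deviation.
by apply: measurable_funM.
Qed.

Lemma excess_ge0 p eta x : 0 <= excess p eta x.
Proof. by rewrite /excess le_max lexx. Qed.

Lemma tv_rc B : measurable B -> relatively_compact Omega B -> mu B = (\int[Lam]_(x in B) enorm (g x))%:E.
Proof.
move=> mB rB; rewrite tv_measureE (total_variationE oO dg mB) setIidl; last first.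
  by have [K [_ KO BK]] := rB; exact: subset_trans KO.
rewrite /Rintegral fineK//; exact: (integrable_fin_num mB (integrable_enorm dg mB rB)).
Qed.

Lemma integrable_deviation p B : measurable B -> relatively_compact Omega B ->
  Lam.-integrable B (fun x => (deviation p x)%:E).
Proof.
move=> mB rB; have ie := integrable_enorm dg mB rB.
apply: (@le_integrable _ _ _ _ _ mB _ (fun x => (1 + enorm p)%:E * (enorm (g x))%:E)%E).
- by apply: measurable_funTS; apply/measurable_EFinP; exact: measurable_deviation.
- move=> x _; rewrite -EFinM !abse_EFin lee_fin !ger0_norm ?mulr_ge0 ?addr_ge0 ?enorm_ge0// /deviation; apply: (le_trans (enormD _ _)).
  by rewrite enormN enormZ ger0_norm ?enorm_ge0// mulrDl mul1r mulrC (mulrC (enorm p)).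
by apply: integrableZl.
Qed.

Lemma integrable_excess p eta B : 0 <= eta -> measurable B -> relatively_compact Omega B ->
  Lam.-integrable B (fun x => (excess p eta x)%:E).
Proof.
move=> eta0 mB rB; apply: le_integrable (integrable_deviation p mB rB) => //.
  by apply: measurable_funTS; apply/measurable_EFinP; exact: measurable_excess.
move=> x _; rewrite !abse_EFin lee_fin !ger0_norm ?excess_ge0 ?enorm_ge0//.
by rewrite /excess ge_max enorm_ge0 lerBlDr lerDl mulr_ge0 ?enorm_ge0.
Qed.

Lemma vvalue_deviation p B : measurable B -> relatively_compact Omega B ->
  enorm (vvalue D B - (\int[Lam]_(x in B) enorm (g x)) *: p) <= \int[Lam]_(x in B) deviation p x.
Proof.
move=> mB rB; have ie := integrable_enorm dg mB rB; set w := vvalue D B - _.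
have [w0|w0] := eqVneq w 0.
  by rewrite w0 enorm0; apply: Rintegral_ge0 => x _; exact: enorm_ge0.
rewrite -(ler_pM2l (enorm_gt0 w0)) -expr2 sqr_enorm {1}/w dotvDl dotvN dotvZl.
rewrite (dotv_vvalue dg w mB rB) [X in _ - X]mulrC -[X in _ - X]RintegralZl//.
have i1 : Lam.-integrable B (fun x => (dotv (g x) w)%:E) by exact: (integrable_dotv dg w mB rB).
have i2 : Lam.-integrable B (fun x => (dotv p w * enorm (g x))%:E).
  apply: (eq_integrable mB (fun x => (dotv p w)%:E * (enorm (g x))%:E)%E) => //.
  by apply: integrableZl.
rewrite -RintegralB// -RintegralZl//; last exact: integrable_deviation.
apply: le_Rintegral => //.
- by apply: (eq_integrable mB (fun x => (dotv (g x) w)%:E - (dotv p w * enorm (g x))%:E)%E) => //; exact: integrableB.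
- apply: (eq_integrable mB (fun x => (enorm w)%:E * (deviation p x)%:E)%E) => //.
  by apply: integrableZl => //; exact: integrable_deviation.
move=> x _; have -> : dotv (g x) w - dotv p w * enorm (g x) = dotv (g x - enorm (g x) *: p) w.
  by rewrite dotvDl dotvN dotvZl mulrC.
by rewrite mulrC; exact: cauchy_schwarz.
Qed.

(** Pointwise [deviation] is at most [eta] times the length of [g] plus [excess], and the length of
    [g] integrates to [mu]. *)
Lemma vvalue_excess p eta B : 0 <= eta -> measurable B -> relatively_compact Omega B ->
  enorm (vvalue D B - fine (mu B) *: p) <= eta * fine (mu B) + fine (\int[Lam]_(x in B) (excess p eta x)%:E).
Proof.
move=> eta0 mB rB; rewrite tv_rc//=; apply: (le_trans (vvalue_deviation p mB rB)).
have ie := integrable_enorm dg mB rB; have ix := integrable_excess p eta0 mB rB.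
rewrite -RintegralZl// -/(Rintegral _ _ _) -RintegralD//; last first.
  by apply: (eq_integrable mB (fun x => eta%:E * (enorm (g x))%:E)%E) => //; exact: integrableZl.
apply: le_Rintegral => //; first exact: integrable_deviation.
  apply: (eq_integrable mB (fun x => eta%:E * (enorm (g x))%:E + (excess p eta x)%:E)%E) => //.
  by apply: integrableD => //; exact: integrableZl.
move=> x _; rewrite /excess -lerBlDl le_max lexx orbT//.
Qed.

Variables (U : set E) (m : nat) (c C s0 : R).
Hypotheses (oU : open U) (rU : relatively_compact Omega U) (c0 : 0 < c) (C0 : 0 <= C) (s00 : 0 < s0).
Hypothesis up : forall y s, U y -> 0 < s -> s <= s0 -> (mu (ball y s) <= (C * s ^+ m)%:E)%E.
Hypothesis low : forall y, U y -> (forall s, 0 < s -> (0 < mu (ball y s))%E) ->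
  forall s, 0 < s -> s <= s0 -> ((c * s ^+ m)%:E <= mu (ball y s))%E.

(** The excess over a rational [p] defines a measure without mass on the points whose direction is
    within [eta k] of [p]. By [density_zero] it is $o(s^m)$ at almost all of them, hence negligible
    against the lower bound $cs^m$ on [mu], and the mean direction on small balls is close to
    [p]. *)
Lemma ae_direction : mu.-negligible [set y | U y /\ ~ ((forall r, 0 < r -> (0 < mu (eball y r))%E) /\
  exists2 nu : E, enorm nu = 1 &
    (fun r : R => (fine (mu (eball y r)))^-1 *: vvalue D (eball y r)) @ 0^'+ --> nu)].
Proof.
have mU : measurable U by exact: open_measurable_rV.
pose eta (k : nat) : R := k.+1%:R^-1.
have eta0 k : 0 < eta k by rewrite invr_gt0.
pose rho p k := mrestr (dens_measure Lam (measurable_excess p (eta k)) (excess_ge0 p (eta k))) mU.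
have rho_fin p k : (rho p k setT < +oo)%E.
  rewrite /rho /mrestr /= setTI.
  have := integrable_fin_num mU (integrable_excess p (ltW (eta0 k)) mU rU).
  by rewrite ge0_fin_numE//; apply: integral_ge0 => x _; rewrite lee_fin excess_ge0.
pose A p k := [set x : E | excess p (eta k) x = 0].
have mA p k : measurable (A p k).
  rewrite (_ : A p k = [set: E] `&` excess p (eta k) @^-1` [set 0]); last by rewrite setTI.
  by apply: measurable_excess => //; exact: measurable_set1.
have rA p k : rho p k (A p k) = 0%E.
  rewrite /rho /mrestr dens_measureE integral0_eq// => x [Ax _]; by rewrite Ax.
pose Z p k := [set y | [/\ A p k y, U y & exists2 t : R, 0 < t & forall s1, 0 < s1 ->
    exists s, [/\ 0 < s, s < s1 & ((t * s ^+ m)%:E < rho p k (ball y s))%E]]].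
have nZ p k : mu.-negligible (Z p k) := (density_zero (rho_fin p k) C0 s00 up (mA p k) (rA p k)).
pose Y (i : nat) := if unpickle i is Some (p, k) then Z (map_mx ratr (p : 'rV[rat]_n)) k else set0.
have nY i : mu.-negligible (Y i).
  by rewrite /Y; case: unpickle => [[p k]|]; [exact: nZ|exact: negligible_set0].
pose G0 := [set x : E | enorm (g x) = 0].
have mG0 : measurable G0.
  rewrite (_ : G0 = [set: E] `&` (fun x => enorm (g x)) @^-1` [set 0]); last by rewrite setTI.
  by apply: me => //; exact: measurable_set1.
have nG0 : mu.-negligible G0.
  exists G0; split => //; rewrite tv_measureE (total_variationE oO dg mG0).
  by apply: integral0_eq => x [+ _]; rewrite /G0 /= => ->.
apply: (negligibleS _ (negligibleU (negligibleU (support_full mu) nG0) (negligible_bigcup nY))).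
move=> y [Uy bad]; apply: contrapT => ngood; apply: bad.
have supp s : 0 < s -> (0 < mu (ball y s))%E.
  move=> sp; rewrite lt0e measure_ge0 andbT; apply/eqP => h; apply: ngood; left; left; by exists s.
have gy : 0 < enorm (g y).
  rewrite lt_neqAle enorm_ge0 andbT; apply/eqP => h; by apply: ngood; left; right.
have dec p k : A (map_mx ratr (p : 'rV[rat]_n)) k y -> forall t : R, 0 < t -> exists2 s1, 0 < s1 &
    forall s, 0 < s -> s < s1 -> (rho (map_mx ratr p) k (ball y s) <= (t * s ^+ m)%:E)%E.
  move=> Ay t t0; apply: contrapT => h; apply: ngood; right; exists (pickle (p, k)) => //.
  rewrite /Y pickleK; split => //; exists t => // s1 s10; apply: contrapT => h2; apply: h.
  exists s1 => // s sp ss; rewrite leNgt; apply/negP => h3; apply: h2; by exists s.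
have eb r : 0 < r -> (mu (ball y (r / n.+1%:R)) <= mu (eball y r))%E.
  move=> r0; apply: le_measure; rewrite ?inE; [exact: measurable_ball|exact: measurable_eball|exact: ball_sub_eball].
split; first by move=> r r0; apply: lt_le_trans (eb _ r0); apply: supp; rewrite divr_gt0.
have n0 := enorm_ge0 (g y).
exists ((enorm (g y))^-1 *: g y); first by rewrite enormZ ger0_norm ?invr_ge0// mulVf// gt_eqF.
set nu := _ *: g y.
have gnu : g y = enorm (g y) *: nu by rewrite /nu scalerA mulfV ?gt_eqF// scale1r.
apply/cvg_ballP => e e0.
(* One [eta k] separates [nu] from [p], two more separate the mean direction from [p]. *)
have [k hk] : exists k, 3 * eta k < e.
  exists (Num.truncn (3 / e)); rewrite /eta ltr_pdivrMr// mulrC -ltr_pdivrMr//.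
  exact: truncnS_gt.
have [p hp] : exists p : 'rV[rat]_n, enorm (nu - map_mx ratr p) <= eta k.
  have ek : 0 < eta k / n.+1%:R by rewrite divr_gt0.
  have /choice[f fP] := fun j => dense_rat_ball (nu ord0 j) ek.
  exists (\row_j f j); apply: (@le_trans _ _ (n%:R * (eta k / n.+1%:R))).
    by apply: enorm_le_max => [|j]; [exact: ltW|move: (nu) (fP j) => v h; rewrite !mxE; exact: ltW].
  by rewrite mulrCA ger_pMr// ler_pdivrMr// mul1r ler_nat.
have Ay : A (map_mx ratr p) k y.
  rewrite /A /= /excess; apply/max_idPl; rewrite subr_le0 /deviation {1}gnu -scalerBr enormZ ger0_norm//.
  by rewrite mulrC ler_wpM2r.
(* The lower bound is known for sup-norm balls; the Euclidean ball of radius [r] contains the one of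
   radius [r / n.+1%:R]. *)
pose c' := c / n.+1%:R ^+ m.
have c'0 : 0 < c' by rewrite divr_gt0// exprn_gt0.
(* This threshold makes the excess at most [eta k] times [mu] on the Euclidean ball. *)
have [s1 s10 hs1] := dec p k Ay (eta k * c') (mulr_gt0 (eta0 k) c'0).
have /nbhs_ballP[d /= d0 dU] := open_nbhs_nbhs (conj oU Uy : open_nbhs _ _).
near=> r.
have r0 : 0 < r by near: r; exact: nbhs_right_gt.
have rs1 : r < s1 by near: r; exact: nbhs_right_lt.
have rd : r < d by near: r; exact: nbhs_right_lt.
have rs0 : r < s0 by near: r; exact: nbhs_right_lt.
set B := eball y r.
have mB : measurable B by exact: measurable_eball.
have BU : B `<=` U.
  by apply: subset_trans dU; apply: subset_trans (eball_sub_ball r0) _; apply: le_ball; exact: ltW.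
have rB : relatively_compact Omega B by exact: sub_relatively_compact rU.
have lB : c' * r ^+ m <= fine (mu B).
  rewrite -lee_fin (tv_rc mB rB) /= -(tv_rc mB rB); apply: le_trans (eb _ r0).
  have -> : c' * r ^+ m = c * (r / n.+1%:R) ^+ m by rewrite expr_div_n /c'; ring.
  apply: low => //; first by rewrite divr_gt0.
  apply: le_trans (ltW rs0); rewrite ler_pdivrMr// ler_peMr ?(ltW r0)// ler1n//.
have xB : fine (\int[Lam]_(x in B) (excess (map_mx ratr p) (eta k) x)%:E) <= eta k * c' * r ^+ m.
  have := hs1 r r0 rs1.
  have fx : (\int[Lam]_(x in B) (excess (map_mx ratr p) (eta k) x)%:E)%E \is a fin_num.
    have := integrable_fin_num mB (integrable_excess (map_mx ratr p) (ltW (eta0 k)) mB rB); exact.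
  rewrite -lee_fin fineK//; apply: le_trans.
  rewrite /rho /mrestr dens_measureE; apply: ge0_subset_integral => //.
  - by apply: measurableI => //; exact: measurable_ball.
  - by apply: measurable_funTS; apply/measurable_EFinP; exact: measurable_excess.
  - by move=> x _; rewrite lee_fin excess_ge0.
  - by move=> x Bx; split; [exact: eball_sub_ball Bx|exact: BU].
have vB := vvalue_excess (map_mx ratr p) (ltW (eta0 k)) mB rB.
move: (fine (mu B)) lB vB => q lB vB.
have q0 : 0 < q by apply: lt_le_trans lB; rewrite mulr_gt0// exprn_gt0.
apply/ballP_rV => // j; apply: (@le_lt_trans _ _ (3 * eta k)) => //.
have key : enorm (q^-1 *: vvalue D B - map_mx ratr p) <= 2 * eta k.
  rewrite -[map_mx ratr p](scalerK (a := q)) ?gt_eqF// -scalerBr enormZ ger0_norm ?invr_ge0 ?(ltW q0)//.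
  rewrite mulrC ler_pdivrMr//; apply: (le_trans vB).
  have h : eta k * (c' * r ^+ m) <= eta k * q by rewrite ler_wpM2l// ltW.
  by rewrite -[leRHS]mulrA [leRHS]mulr_natl mulr2n lerD2l (le_trans xB)// -mulrA.
have := le_coord_enorm (nu - q^-1 *: vvalue D B) j.
rewrite [X in `|X|]mxE [X in _ + X]mxE => /le_trans; apply.
have -> : nu - q^-1 *: vvalue D B = (nu - map_mx ratr p) - (q^-1 *: vvalue D B - map_mx ratr p).
  by rewrite opprB addrA subrK.
apply: (le_trans (enormD _ _)); rewrite enormN; apply: (le_trans (lerD hp key)).
by rewrite le_eqVlt; apply/orP; left; apply/eqP; ring.
Unshelve. all: by end_near.
Qed.

End differentiation.

(** * Hausdorff measure *)

Section geometry.
Variables (R : realType) (n : nat).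
Local Notation E := 'rV[R]_n.

(** If the ball left [O], the first point at which the segment from [x] to [v] leaves [O] would be a
    boundary point nearer to [x] than [r]. *)
Lemma eball_sub_open (O : set E) (x : E) (r : R) : open O -> O x ->
  (r%:E <= edist_to x (boundary O))%E -> eball x r `<=` O.
Proof.
move=> oO Ox rO v vr; apply: contrapT => nOv.
pose ga (t : R) : E := x + t *: (v - x).
pose S := [set t : R | 0 <= t <= 1 /\ ~ O (ga t)].
have S1 : S 1 by split; [rewrite ler01 lexx|rewrite /ga scale1r addrC subrK].
have lbS : has_lbound S by exists 0 => t [/andP[]].
have hS : has_inf S by split => //; exists 1.
pose T := inf S.
have T0 : 0 <= T by apply: lb_le_inf; [exists 1|move=> t [/andP[]]].
have T1 : T <= 1 by exact: ge_inf.
(* A Lipschitz constant of the segment for the sup norm, with 1 added so that it is positive. *)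
pose M := enorm (v - x) + 1.
have M0 : 0 < M by rewrite ltr_wpDl ?enorm_ge0.
have gaB s t e : 0 < e -> `|s - t| * M < e -> ball (ga s) e (ga t).
  move=> e0 h; apply/ballP_rV => // i; apply: le_lt_trans h.
  rewrite /ga !mxE opprD addrACA subrr add0r -mulrBl normrM ler_wpM2l//.
  have := le_coord_enorm (v - x) i; rewrite !mxE => /le_trans; apply.
  by rewrite lerDl.
have inO t : 0 <= t -> t < T -> O (ga t).
  move=> t0 tT; have t1 := ltW (lt_le_trans tT T1).
  apply: contrapT => h; move: tT; rewrite ltNge => /negP; apply.
  by apply: ge_inf => //; split => //; rewrite t0 t1.
have nOT : ~ O (ga T).
  move=> OT; have /nbhs_ballP[e /= e0 eO] := open_nbhs_nbhs (conj oO OT : open_nbhs _ _).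
  have [t St tT] := inf_adherent (divr_gt0 e0 M0) hS.
  have Tt : T <= t by exact: ge_inf.
  case: (St) => _; apply; apply: eO; apply: gaB => //.
  rewrite -ltr_pdivlMr// ler0_norm ?subr_le0// opprB ltrBlDl; exact: tT.
have Tp : 0 < T.
  rewrite lt_neqAle T0 andbT; apply/eqP => h; apply: nOT.
  by rewrite -h /ga scale0r addr0.
have bT : boundary O (ga T).
  split; last by move=> /interior_subset.
  move=> B /nbhs_ballP[e /= e0 eB].
  pose t := Num.max 0 (T - e / (2 * M)).
  have eM : 0 < e / (2 * M) by rewrite divr_gt0// mulr_gt0.
  have t0 : 0 <= t by rewrite le_max lexx.
  have tT : t < T by rewrite gt_max Tp ltrBlDr ltrDl.
  exists (ga t); split; first exact: inO.
  apply: eB; apply: gaB => //; rewrite -ltr_pdivlMr// gtr0_norm ?subr_gt0//.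
  apply: (@le_lt_trans _ _ (e / (2 * M))).
    by rewrite lerBlDr -lerBlDl le_max lexx orbT.
  by rewrite ltr_pM2l// ltf_pV2 ?posrE ?mulr_gt0// ltr_pMl// ltr1n.
have : (edist_to x (boundary O) <= (enorm (x - ga T))%:E)%E by apply: ereal_inf_lbound; exists (ga T).
move=> /(le_trans rO); rewrite lee_fin leNgt => /negP; apply.
rewrite /ga opprD addrA subrr add0r enormN enormZ ger0_norm//.
apply: le_lt_trans vr; rewrite ler_piMl ?enorm_ge0//.
Qed.

(** The cube of half side $1/(2n+1)$ fits in the unit ball, in dimension 0 as well. *)
Lemma leb_eball_ge : (((2 / (2 * n%:R + 1)) ^+ n : R)%:E <= leb R n (eball 0 1))%E.
Proof.
pose c : R := (2 * n%:R + 1)^-1.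
have d0 : 0 < 2 * n%:R + 1 :> R by rewrite ltr_wpDl// mulr_ge0.
have c0 : 0 < c by rewrite invr_gt0.
have := @leb_box R n (const_mx (- c)) (const_mx c).
have ab (i : 'I_n) : (const_mx (- c) : E) ord0 i <= (const_mx c : E) ord0 i by rewrite !mxE; lra.
move=> /(_ ab) vol.
have -> : ((2 / (2 * n%:R + 1)) ^+ n : R)%:E = leb R n [set v : E | forall i, (const_mx (- c) : E) ord0 i <= v ord0 i <= (const_mx c : E) ord0 i].
  rewrite vol; congr EFin; rewrite (eq_bigr (fun=> 2 * c)); last by move=> i _; rewrite !mxE; lra.
  by rewrite prodr_const card_ord.
apply: le_measure; rewrite ?inE; [|exact: measurable_eball|].
  by apply: compact_measurable; exact: compact_cbox.
move=> v h; rewrite /eball /= subr0; apply: (@le_lt_trans _ _ (n%:R * c)).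
  apply: enorm_le_max; first exact: ltW.
  by move=> i; have := h i; rewrite !mxE ler_norml.
rewrite /c ltr_pdivrMr// mul1r; have : 0 <= n%:R :> R by []. move: (n%:R : R) => u; lra.
Qed.

End geometry.

(** * The mass distribution principle *)

Section mass_distribution.
Variables (R : realType) (m : nat).
Local Notation E := 'rV[R]_m.+1.

(** Closed cubes with [d = 0] are included, since a covering set may be a single point. Then for
    [m > 0] shrinking balls give measure 0, and for [m = 0] all powers are 1. *)
Lemma ccube_upper (mu : {measure set E -> \bar R}) (y : E) (C s0 : R) : 0 <= C -> 0 < s0 ->
  (forall s, 0 < s -> s <= s0 -> (mu (ball y s) <= (C * s ^+ m)%:E)%E) ->
  forall d, 0 <= d -> d <= s0 / 2 -> (mu (ccube y d) <= (C * 2 ^+ m * d ^+ m)%:E)%E.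
Proof.
move=> C0 s00 up.
have mcc d : measurable (ccube y d) by rewrite /ccube; apply: compact_measurable; exact: compact_cbox.
have sub d s : d < s -> 0 < s -> (mu (ccube y d) <= mu (ball y s))%E.
  move=> ds s1; apply: le_measure; rewrite ?inE//; first exact: measurable_ball.
  by move=> v /ccubeP h; apply/ballP_rV => // i; rewrite distrC; apply: le_lt_trans ds.
move=> d; rewrite le_eqVlt => /orP[/eqP <- _|d0 ds]; last first.
  have d2 : 0 < 2 * d by rewrite mulr_gt0.
  apply: (le_trans (sub d (2 * d) _ d2)); first by rewrite ltr_pMl// ltr1n.
  apply: (le_trans (up _ d2 _)); first by rewrite mulrC -ler_pdivlMr.
  by rewrite exprMn mulrA.
have [m0|m0] := posnP m.
  have ex (z : R) : z ^+ m = 1 by rewrite m0.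
  apply: (le_trans (sub 0 s0 s00 s00)); apply: (le_trans (up _ s00 (lexx _))).
  by rewrite !ex !mulr1.
have ex (z : R) : 0 <= z -> z <= 1 -> z ^+ m <= z.
  by move=> z0 z1; case: (m) m0 => // k _; rewrite exprS ler_piMr// exprn_ile1.
rewrite expr0n gtn_eqF// mulr0; apply/lee_addgt0Pr => e e0; rewrite add0e.
pose s := Num.min s0 (Num.min 1 (e / (C + 1))).
have C1 : 0 < C + 1 by rewrite ltr_wpDl.
have s1 : 0 < s by rewrite !lt_min s00 ltr01 divr_gt0.
apply: (le_trans (sub 0 s s1 s1)).
apply: (le_trans (up _ s1 _)); first by rewrite ge_min lexx.
rewrite lee_fin; apply: (@le_trans _ _ ((C + 1) * s)).
  apply: ler_pM => //; [by rewrite exprn_ge0// ltW|by rewrite lerDl|].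
  by apply: ex; [exact: ltW|rewrite !ge_min lexx orbT].
by rewrite mulrC -ler_pdivlMr// !ge_min lexx !orbT.
Qed.

(* The volume of a cube contained in the unit ball. *)
Definition ball_volume : R := (2 / (2 * m%:R + 1)) ^+ m.

Lemma ball_volume_gt0 : 0 < ball_volume.
Proof. by rewrite exprn_gt0// divr_gt0// ltr_wpDl// mulr_ge0. Qed.

Lemma gauge_ge0 (Q : set E) : (0 <= hausdorff_gauge m Q)%E.
Proof.
rewrite /hausdorff_gauge; case: asboolP => // /eqP/set0P[y Qy].
rewrite mule_ge0// expe_ge0// mule_ge0 ?lee_fin//.
apply: (@le_trans _ _ (enorm (y - y))%:E); first by rewrite lee_fin enorm_ge0.
by apply: ereal_sup_ubound; exists (y, y).
Qed.

(** A covering set of diameter [d] that meets [U] is replaced by the closed cube of half side [d]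
    around one of its points in [U], which is measurable and whose [mu] is controlled. The gauge
    carries $(d/2)^m$ times the volume of the unit ball, hence the factor [2 ^+ m / ball_volume]. *)
Lemma gauge_cover (mu : {measure set E -> \bar R}) (U Q : set E) (C s0 : R) : 0 < C -> 
  (forall y d, U y -> 0 <= d -> d <= s0 -> (mu (ccube y d) <= (C * d ^+ m)%:E)%E) ->
  (ediam Q <= s0%:E)%E ->
  exists Q' : set E, [/\ measurable Q', U `&` Q `<=` Q' &
    (mu Q' <= (C * 2 ^+ m / ball_volume)%:E * hausdorff_gauge m Q)%E].
Proof.
move=> C0 up dQ; have v0 := ball_volume_gt0.
have K0 : 0 <= C * 2 ^+ m / ball_volume by rewrite divr_ge0 ?(ltW v0)// mulr_ge0 ?(ltW C0)// exprn_ge0.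
have [h|/eqP/set0P[y [Uy Qy]]] := pselect (U `&` Q = set0).
  exists set0; split => //; first by rewrite h.
  by rewrite measure0 mule_ge0//; exact: gauge_ge0.
have d0 : (0 <= ediam Q)%E.
  apply: (@le_trans _ _ (enorm (y - y))%:E); first by rewrite lee_fin enorm_ge0.
  by apply: ereal_sup_ubound; exists (y, y).
have df : ediam Q \is a fin_num by rewrite ge0_fin_numE//; apply: le_lt_trans dQ _; rewrite ltry.
pose d := fine (ediam Q).
have dE : ediam Q = d%:E by rewrite fineK.
have d0' : 0 <= d by rewrite -lee_fin -dE.
have ds : d <= s0 by rewrite -lee_fin -dE.
exists (ccube y d); split.
- by rewrite /ccube; apply: compact_measurable; exact: compact_cbox.
- move=> v [_ Qv]; apply/ccubeP => i.
  have := le_coord_enorm (v - y) i; rewrite !mxE => /le_trans; apply.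
  by rewrite -lee_fin -dE; apply: ereal_sup_ubound; exists (v, y).
apply: (le_trans (up _ _ Uy d0' ds)).
have Q0 : Q <> set0 by move=> h; move: Qy; rewrite h.
rewrite /hausdorff_gauge asboolF// dE -EFinM -EFin_expe.
apply: (@le_trans _ _ ((C * 2 ^+ m / ball_volume)%:E * (ball_volume%:E * ((d * 2^-1) ^+ m)%:E))%E).
  rewrite -!EFinM lee_fin le_eqVlt; apply/orP; left; apply/eqP.
  rewrite exprMn exprVn; have := exprn_gt0 m (ltr0n R 2 : 0 < 2 :> R).
  move: (2 ^+ m) (d ^+ m) v0 => u w v0 u0; field; rewrite !gt_eqF//.
apply: lee_wpmul2l; first by rewrite lee_fin.
apply: lee_wpmul2r; first by rewrite lee_fin exprn_ge0// mulr_ge0.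
exact: leb_eball_ge.
Qed.

(** Any cover of [A] by sets of diameter at most [s0] yields cubes that cover [U] up to a null set,
    so the sum of its gauges is at least [mu U] over the constant. The single value [s0] of [eps]
    suffices, [hausdorff] being a supremum. *)
Lemma mass_distribution (mu : {measure set E -> \bar R}) (A U : set E) (C s0 : R) : 0 < C -> 0 < s0 ->
  measurable U ->
  (forall y d, U y -> 0 <= d -> d <= s0 -> (mu (ccube y d) <= (C * d ^+ m)%:E)%E) ->
  mu.-negligible (U `\` A) ->
  (((C * 2 ^+ m / ball_volume)^-1)%:E * mu U <= hausdorff m A)%E.
Proof.
move=> C0 s00 mU up [Z [mZ Z0 UZ]]; have v0 := ball_volume_gt0.
set K := C * 2 ^+ m / ball_volume.
have K0 : 0 < K by rewrite divr_gt0// mulr_gt0// exprn_gt0.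
apply: (@le_trans _ _ (hausdorff_size m s0 A)); last by apply: ereal_sup_ubound; exists s0.
apply: le_ereal_inf_tmp => _ [Q [AQ dQ] <-].
have /choice[Q' hQ'] k := gauge_cover C0 up (dQ k).
have mQ' k : measurable (Q' k) by case: (hQ' k).
rewrite lee_pdivrMl//.
apply: (@le_trans _ _ (mu (Z `|` \bigcup_k Q' k))).
  apply: le_measure; rewrite ?inE//; first by apply: measurableU => //; exact: bigcupT_measurable.
  move=> v Uv; have [Av|nAv] := pselect (A v); last by left; exact: UZ.
  by right; have [k _ Qv] := AQ _ Av; exists k => //; case: (hQ' k) => _ h _; exact: h.
have h : (mu (Z `|` \bigcup_k Q' k) <= mu Z + mu (\bigcup_k Q' k))%E := measureU2 _ mZ (bigcupT_measurable _ mQ').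
apply: (le_trans h); have -> : (mu Z + mu (\bigcup_k Q' k) = mu (\bigcup_k Q' k))%E by rewrite Z0 add0e.
 apply: (le_trans (measure_sigma_subadditive _ mQ' (bigcupT_measurable _ mQ') (@subset_refl _ _))).
rewrite -nneseriesZl//; last by move=> k _; exact: gauge_ge0.
by apply: lee_nneseries => // k _; case: (hQ' k).
Qed.

End mass_distribution.

Section scales.
Variable R : realFieldType.
Implicit Types u v w d q s : R.

Lemma lt_half_quarter u v w d q : 0 < q -> d <= q / 4 -> u <= v + w -> v < q / 2 -> w <= d -> u < q.
Proof. by move=> ? ? ? ? ?; lra. Qed.

Lemma half_interval u v s : 0 < s -> u - s / 2 < v <= u + s / 2 -> u - s < v < u + s.
Proof. by move=> ? /andP[? ?]; apply/andP; split; lra. Qed.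

Lemma double_lt_quarter s q : 0 < q -> s <= q / 16 -> 2 * s < q / 4.
Proof. by move=> ? ?; lra. Qed.

Lemma half_lt_quarter s q : 0 < q -> s <= q / 16 -> s / 2 < q / 4.
Proof. by move=> ? ?; lra. Qed.

Lemma lt_quarter_le1 s q : 0 < q -> q <= 1 -> s < q / 4 -> s <= 1.
Proof. by move=> ? ? ?; lra. Qed.

Lemma sixteenth_le_half q : 0 < q -> q / 16 <= q / 2.
Proof. by move=> ?; lra. Qed.

End scales.

(** * The Hausdorff bound at a point of the reduced boundary *)

Section lower_bound.
Variables (R : realType) (m N : nat) (alpha Calpha delta : R).
Local Notation E := 'rV[R]_m.+1.
Hypotheses (alpha_gt : m%:R / m.+1%:R < alpha) (alpha1 : alpha <= 1) (C0 : 0 <= Calpha) (delta0 : 0 < delta).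

(** [mass_distribution] is applied to the perimeter on a small ball [U] around [x], almost all of
    which is in the reduced boundary by [ae_direction]. The point [x] lies in the support of the
    perimeter, so the lower density bound there gives the mass of [U]. *)
Lemma hausdorff_lower_bound : exists2 c : R, 0 < c &
  forall (Omega : set E) (a : E -> R) (G : ('I_N -> set E) -> R) (Omega' : set E) (W : 'I_N -> set E),
  open Omega -> (leb R m.+1 Omega < +oo)%E -> measurable_fun Omega a -> (forall x, Omega x -> 0 < a x) ->
  (forall W1 W2 : 'I_N -> set E, Fw Omega W1 -> Fw Omega W2 ->
      `|G W1 - G W2| <= Calpha * (fine (distw W1 W2)) `^ alpha) ->
  Omega' `<=` Omega -> (forall x, Omega' x -> delta <= a x <= 1) -> minimizes_Jw Omega a G W ->
  forall (i : 'I_N) (x : E) (r : R), reduced_boundary Omega (W i) x -> 0 < r -> r <= 1 ->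
    eball x r `<=` Omega' ->
    ((c * r ^+ m)%:E <= hausdorff m (reduced_boundary Omega (W i) `&` eball x r))%E.
Proof.
(* The Euclidean ball of radius [r] contains the sup-norm ball of radius [r / n1]. *)
pose n1 : R := m.+2%:R.
have n10 : 0 < n1 by [].
have n11 : 1 <= n1 by rewrite ler1n.
(* The sup-norm ball of radius [s] contains the cube of half side [s / 2], whence [2 ^+ m]. *)
pose cl := decay_constant N alpha_gt alpha1 C0 delta0 / (4 * m.+1%:R) / 2 ^+ m.
have cl0 : 0 < cl by rewrite !divr_gt0 ?exprn_gt0 ?mulr_gt0//; exact: decay_constant_gt0.
(* The upper bound at half side [s] comes from cutting at most at half side [2 * s]; adding 1 makes
   the constant positive. *)
pose cu := upper_constant m N Calpha delta * 2 ^+ m + 1.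
have u0 : 0 <= upper_constant m N Calpha delta * 2 ^+ m by rewrite mulr_ge0 ?exprn_ge0//; exact: upper_constant_ge0.
have cu0 : 0 < cu by rewrite ltr_wpDl.
have cu2 : 0 < cu * 2 ^+ m by rewrite mulr_gt0// exprn_gt0.
pose K := cu * 2 ^+ m * 2 ^+ m / ball_volume R m.
have K0 : 0 < K by rewrite divr_gt0 ?ball_volume_gt0// mulr_gt0// exprn_gt0.
(* [16 * n1] is [r / s0] for the scale [s0] below, at which the mass around [x] is bounded from
   below. *)
exists (K^-1 * (cl / (16 * n1) ^+ m)).
  by rewrite mulr_gt0 ?invr_gt0// divr_gt0// exprn_gt0// mulr_gt0.
move=> Omega a G Omega' W oO lO ma a0 hG O'O a1 minW i x r xb r0 r1 xr.
have gW : is_gradient Omega (W i) (gradient Omega (W i)).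
  by apply: gradientP; case: minW => -[/(_ i)[]].
have [Lam [g [fL dg]]] := density_family (N := 1) oO (fun=> gW.1).
pose mu := tv_measure oO gW.1.
have muE A : mu A = perimeter Omega (W i) A by [].
pose q := r / n1.
have q0 : 0 < q by rewrite divr_gt0.
have q1 : q <= 1 by rewrite ler_pdivrMr// mul1r; exact: le_trans n11.
have bq : ball x q `<=` Omega' by apply: subset_trans xr; exact: ball_sub_eball.
pose U : set E := ball x (q / 2).
have q20 : 0 < q / 2 by rewrite divr_gt0.
have oU : open U by exact: ball_open.
have mU : measurable U by exact: open_measurable_rV.
have ccq y d : U y -> d <= q / 4 -> ccube y d `<=` Omega'.
  move=> /(ballP_rV _ _ q20) Uy dq v /ccubeP vy; apply: bq; apply/ballP_rV => // j.
  apply: (lt_half_quarter q0 dq (ler_distD (y ord0 j) _ _) (Uy j)).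
  by rewrite distrC; exact: vy.
have rU : relatively_compact Omega U.
  exists (ccube x (q / 2)); split; first by rewrite /ccube; exact: compact_cbox.
    apply: subset_trans O'O; apply: subset_trans bq => v /ccubeP vx; apply/ballP_rV => // j.
    by rewrite distrC; apply: le_lt_trans (vx j) _; exact: half_lt.
  by move=> v /(ballP_rV _ _ q20) vx; apply/ccubeP => j; rewrite distrC ltW.
(* Small enough for the doubled cubes around points of [U] to stay in the ball of radius [q], hence
   in [Omega']. *)
pose s0 := q / 16.
have s00 : 0 < s0 by rewrite divr_gt0.
have bc (y : E) s : 0 < s -> ball y s `<=` cube y s.
  move=> sp v /(ballP_rV _ _ sp) h; apply/cubeP => j; have := h j.
  by rewrite ltr_distlC => /andP[h1 /ltW h2]; rewrite h1 h2.
have cb (y : E) s : 0 < s -> cube y (s / 2) `<=` ball y s.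
  move=> sp v /cubeP h; apply/ballP_rV => // j; rewrite ltr_distlC; exact: half_interval (h j).
have up y s : U y -> 0 < s -> s <= s0 -> (mu (ball y s) <= (cu * s ^+ m)%:E)%E.
  move=> Uy sp ss; have s2 : 0 < 2 * s by rewrite mulr_gt0.
  have sq : 2 * s < q / 4 by exact: double_lt_quarter.
  have s21 : 2 * s <= 1 by exact: lt_quarter_le1 sq.
  apply: (@le_trans _ _ (perimeter Omega (W i) (cube y (2 * s / 2)))).
    by rewrite muE; apply: total_variation_mono; rewrite mulrAC divff// mul1r; exact: bc.
  apply: (le_trans (upper_density alpha_gt alpha1 C0 delta0 oO lO ma a0 hG minW O'O a1 i s2 s21 sq (ccq _ _ Uy (lexx _)))).
  by rewrite lee_fin exprMn mulrA ler_wpM2r ?exprn_ge0 ?(ltW sp)// lerDl.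
have low y : U y -> (forall s, 0 < s -> (0 < mu (ball y s))%E) ->
    forall s, 0 < s -> s <= s0 -> ((cl * s ^+ m)%:E <= mu (ball y s))%E.
  move=> Uy supp s sp ss; have s2 : 0 < s / 2 by rewrite divr_gt0.
  have sq : s / 2 < q / 4 by exact: half_lt_quarter.
  have s21 : s / 2 <= 1 by exact: lt_quarter_le1 sq.
  apply: (@le_trans _ _ (perimeter Omega (W i) (cube y (s / 2)))); last first.
    by rewrite muE; apply: total_variation_mono; exact: cb.
  have supp' t : 0 < t -> (0 < perimeter Omega (W i) (cube y t))%E.
    by move=> tp; apply: lt_le_trans (supp t tp) _; rewrite muE; apply: total_variation_mono; exact: bc.
  apply: le_trans (lower_density alpha_gt alpha1 C0 delta0 oO lO ma a0 hG minW O'O a1 s2 s21 sq (ccq _ _ Uy (lexx _)) supp').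
  rewrite lee_fin /cl expr_div_n le_eqVlt; apply/orP; left; apply/eqP; rewrite -!mulrA; congr (_ * _).
  by rewrite mulrCA mulrC mulrA mulrAC.
have neg : mu.-negligible (U `\` (reduced_boundary Omega (W i) `&` eball x r)).
  have := ae_direction (dg ord0) oU rU cl0 (ltW cu0) s00 up low.
  apply: negligibleS => y [Uy nb]; split => // -[h1 h2]; apply: nb.
  have yO' : Omega' y by apply: (ccq y 0 Uy) => //; [rewrite divr_ge0// ltW|apply/ccubeP => j; rewrite subrr normr0].
  split; first by split => //; exact: O'O.
  by apply: (ball_sub_eball r0); apply: le_ball Uy; rewrite -/n1 -/q ltW// half_lt.
have cc y d : U y -> 0 <= d -> d <= s0 / 2 -> (mu (ccube y d) <= (cu * 2 ^+ m * d ^+ m)%:E)%E.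
  by move=> Uy; apply: (ccube_upper (ltW cu0) s00) => s; exact: up.
have s20 : 0 < s0 / 2 by rewrite divr_gt0.
apply: le_trans (mass_distribution cu2 s20 mU cc neg).
rewrite -/K -[in leLHS]mulrA EFinM; apply: lee_wpmul2l; first by rewrite lee_fin invr_ge0 ltW.
have Ux : U x by exact: ballxx.
have suppx s : 0 < s -> (0 < mu (ball x s))%E.
  move=> sp; case: xb => _ /(_ s sp) h _; apply: lt_le_trans h _.
  by rewrite muE; apply: total_variation_mono; exact: eball_sub_ball.
apply: le_trans (_ : mu (ball x s0) <= mu U)%E; last first.
  by rewrite !muE; apply: total_variation_mono; apply: le_ball; exact: sixteenth_le_half.
apply: le_trans (low x Ux suppx s0 s00 (lexx _)).
have -> : s0 = r / (16 * n1) by rewrite /s0 /q -mulrA -invfM (mulrC n1).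
by rewrite expr_div_n mulrA mulrAC.
Qed.

End lower_bound.

Lemma bounded_leb_lty (R : realType) m (A : set 'rV[R]_m.+1) : measurable A -> bounded_set A ->
  (leb R m.+1 A < +oo)%E.
Proof.
move=> mA [M [Mr hM]].
have M1 : 0 < `|M| + 1 by rewrite ltr_wpDl.
have AM x : A x -> `|x| <= `|M| + 1 by apply: hM; apply: le_lt_trans (ler_norm _) _; rewrite ltrDl.
apply: le_lt_trans (leb_hbox_lty (lo 0 (`|M| + 2)) (hi 0 (`|M| + 2))).
apply: le_measure; rewrite ?inE//; first exact: measurable_hbox.
move=> x Ax; apply/cubeP => j.
have M2 : 0 < `|M| + 2 by rewrite ltr_wpDl.
have : ball (0 : 'rV[R]_m.+1) (`|M| + 2) x.
  rewrite -ball_normE /= sub0r normrN; apply: le_lt_trans (AM _ Ax) _.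
  by rewrite ltrD2l ltr1n.
by move=> /(ballP_rV _ _ M2)/(_ j); rewrite ltr_distlC => /andP[-> /ltW ->].
Qed.
Theorem theorem4p4 (R : realType) (n N : nat) (alpha Calpha delta : R)
    (hn : (1 <= n)%N) (hN : (1 <= N)%N)
    (halpha : (n.-1%:R / n%:R < alpha) /\ (alpha <= 1))
    (hCalpha : 0 <= Calpha) (hdelta : 0 < delta) :
  exists2 CN : R, 0 < CN &
  forall (Omega : set 'rV[R]_n) (a : 'rV[R]_n -> R)
    (G : ('I_N -> set 'rV[R]_n) -> R)
    (Omega' : set 'rV[R]_n) (W : 'I_N -> set 'rV[R]_n),
    open Omega -> connected Omega -> Omega !=set0 -> bounded_set Omega ->
    measurable_fun Omega a -> (forall x, Omega x -> 0 < a x) ->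
    (forall W1 W2 : 'I_N -> set 'rV[R]_n, Fw Omega W1 -> Fw Omega W2 ->
      `|G W1 - G W2| <= Calpha * (fine (distw W1 W2)) `^ alpha) ->
    open Omega' -> Omega' `<=` Omega ->
    (forall x, Omega' x -> delta <= a x <= 1) ->
    minimizes_Jw Omega a G W ->
    forall (i : 'I_N) (x : 'rV[R]_n) (r : R),
      Omega' x -> reduced_boundary Omega (W i) x ->
      0 < r -> r <= 1 -> (r%:E <= edist_to x (boundary Omega'))%E ->
      ((CN^-1 * r ^+ n.-1)%:E <=
        hausdorff n.-1 (reduced_boundary Omega (W i) `&` eball x r))%E.
Proof.
case: halpha => alpha_gt alpha1; case: n hn alpha_gt => // m _ alpha_gt.
have [c c0 hc] := @hausdorff_lower_bound R m N alpha Calpha delta alpha_gt alpha1 hCalpha hdelta.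
exists c^-1; first by rewrite invr_gt0.
move=> Omega a G Omega' W oO _ _ bO ma a0 hG oO' O'O a1 minW i x r O'x xb r0 r1 rd.
have lO : (leb R m.+1 Omega < +oo)%E by apply: bounded_leb_lty => //; exact: open_measurable_rV.
rewrite invrK; exact: (hc Omega a G Omega' W oO lO ma a0 hG O'O a1 minW i x r xb r0 r1 (eball_sub_open oO' O'x rd)).
Qed.
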